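(* Suppose that $\xi,\eta\in\mathbb{C}$ satisfy $$\Re(\eta+i\xi)>0\quad\text{and}\quad\Re(\xi+i\eta)>0 .$$ Let $\sigma\in\mathbb{C}$ be such that $|\Re\sigma|<\frac14$. Then $$H_0^{(2)}\left(\tfrac12(\xi^2+\eta^2)\right)=\frac{2^{1/2}}{\pi^2}\int_{\sigma-i\infty}^{\sigma+i\infty}\Gamma\left(\tfrac14-s\right)\Gamma\left(\tfrac14+s\right)D_{2s-\frac12}\left((1+i)\xi\right)D_{-2s-\frac12}\left((1+i)\eta\right)ds .$$ Here the hypotheses imply that $i(\xi^2+\eta^2)\in\mathbb{C}\setminus(-\infty,0]$, and $H_0^{(2)}(z)$ on the left-hand side is evaluated in the sector $-\frac32\pi<\arg z<\frac12\pi$.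
   Context: $\Gamma$ is Euler's gamma function. $U(a,b,z)$ is the confluent hypergeometric function of the second kind: the solution of $z w''+(b-z)w'-aw=0$ with $U(a,b,z)\sim z^{-a}$ as $z\to\infty$ in $|\arg z|\le\frac32\pi-\delta$ ($\delta>0$), analytic in $z$ on the Riemann surface of the logarithm. The Hankel function of the second kind is $H_\nu^{(2)}(z)=\frac{2i}{\sqrt\pi}e^{-i(z-\nu\pi)}(2z)^\nu U\left(\frac12+\nu,1+2\nu,2iz\right)$, where $\arg(2iz)=\arg z+\frac{\pi}{2}$. The parabolic cylinder function is $D_\nu(z)=2^{\nu/2}e^{-z^2/4}U\left(-\frac{\nu}{2},\frac12,\frac12z^2\right)$ (with $\arg(z^2)=2\arg z$, extended analytically); it is analytic for all $\nu,z\in\mathbb{C}$. The integral is along the vertical line through $\sigma$. *)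

(* Defs.v *)
From HB Require Import structures.
From mathcomp Require Import all_boot all_order all_algebra.
From mathcomp Require Import complex.
From mathcomp Require Import all_classical all_reals all_analysis.

Set Implicit Arguments.
Unset Strict Implicit.
Unset Printing Implicit Defensive.

Import Order.TTheory GRing.Theory Num.Theory.
Import numFieldNormedType.Exports.
Import complex.

Local Open Scope classical_set_scope.
Local Open Scope ring_scope.
Local Open Scope complex_scope.

(* Packing R[i] as a numFieldType gives it the topology and the (complex)
   derivatives that MathComp-Analysis defines on every numFieldType. *)
Definition Cplx (R : realType) : numFieldType := R[i].

Section Elementary.
Context {R : realType}.
Local Notation C := (Cplx R).

(* Typed in [Cplx R], so that terms built from them use its structures. *)
Definition CofR (x : R) : C := x%:C.
Definition iC : C := 0 +i* 1.

Definition cexp (z : C) : C :=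
  (expR (Re z) * cos (Im z)) +i* (expR (Re z) * sin (Im z)).

Definition cmod (z : C) : R := Num.sqrt (Re z ^+ 2 + Im z ^+ 2).

(* Principal argument, in ]-pi, pi] for z != 0. *)
Definition carg (z : C) : R :=
  let t := acos (Re z / cmod z) in if 0 <= Im z then t else - t.

Definition clog (z : C) : C := ln (cmod z) +i* carg z.

(* a ^ w for a positive real base a *)
Definition rcpow (a : R) (w : C) : C := cexp (w * CofR (ln a)).

Definition cintegrable (D : set R) (f : R -> C) : Prop :=
  (@lebesgue_measure R).-integrable D (EFin \o (fun t => Re (f t))) /\
  (@lebesgue_measure R).-integrable D (EFin \o (fun t => Im (f t))).

Definition cintegral (D : set R) (f : R -> C) : C :=
  (\int[lebesgue_measure]_(t in D) Re (f t)) +i*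
  (\int[lebesgue_measure]_(t in D) Im (f t)).

(* The line s = sigma + i t, ds = i dt *)
Definition vintegrable (sigma : C) (f : C -> C) : Prop :=
  cintegrable setT (fun t => f (sigma + iC * CofR t)).

Definition vintegral (sigma : C) (f : C -> C) : C :=
  iC * cintegral setT (fun t => f (sigma + iC * CofR t)).

End Elementary.

Section SpecialFunctions.
Context {R : realType}.
Local Notation C := (Cplx R).

Definition euler_integral (z : C) : C :=
  cintegral `]0, +oo[ (fun t => rcpow t (z - 1) * CofR (expR (- t))).

(* Euler's integral where it converges, Re z > 0 (there n = 0), continued to
   the left by Gamma (z + n) = z (z + 1) ... (z + n - 1) Gamma z. *)
Definition cGamma (z : C) : C :=
  let n := Num.truncn (1 - Re z) in
  euler_integral (z + n%:R) / \prod_(k < n) (z + k%:R).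

(* A function w on the Riemann surface of the logarithm is represented by
   W zeta = w (e ^ zeta), with zeta = log z ranging over the whole plane, so
   that arg z = Im zeta and |z| = e ^ (Re zeta).  [dlog] is d/dz in this
   coordinate. *)
Definition dlog (W : C -> C) (zeta : C) : C := cexp (- zeta) * derive1 W zeta.

Definition entire (f : C -> C) : Prop := forall z, derivable f z 1.

(* The second conjunct of [is_tricomi] is z w'' + (b - z) w' - a w = 0; the
   third is w ~ z ^ (- a), uniformly in |arg z| <= 3 pi / 2 - delta. *)
Definition is_tricomi (a b : C) (W : C -> C) : Prop :=
  [/\ entire W /\ entire (dlog W),
      forall zeta : C,
        cexp zeta * dlog (dlog W) zeta + (b - cexp zeta) * dlog W zeta
          - a * W zeta = 0
    & forall delta : R, 0 < delta -> forall eps : R, 0 < eps ->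
        \forall r \near +oo, forall theta : R,
          `|theta| <= 3 / 2 * pi - delta ->
          let zeta : C := r +i* theta in
          cmod (W zeta / cexp (- a * zeta) - 1) < eps].

(* U(a, b, e ^ zeta) *)
Definition tricomiU (a b : C) : C -> C :=
  xget (fun=> 0) [set W | is_tricomi a b W].

(* H_nu^(2)(e ^ zeta) *)
Definition hankel2 (nu zeta : C) : C :=
  let z := cexp zeta in
  let log2z := CofR (ln 2) + zeta in
  2 * iC / CofR (Num.sqrt pi) * cexp (- iC * (z - nu * CofR pi))
    * cexp (nu * log2z)
    * tricomiU (1 / 2 + nu) (1 + 2 * nu) (log2z + iC * CofR (pi / 2)).

Definition parcyl_punctured (nu z : C) : C :=
  rcpow 2 (nu / 2) * cexp (- (z ^+ 2 / 4))
    * tricomiU (- (nu / 2)) (1 / 2) (2 * clog z - CofR (ln 2)).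

(* D_nu(z); z = 0 does not lie on the Riemann surface of the logarithm, and
   the value there is the one given by continuity. *)
Definition parcyl (nu z : C) : C :=
  if z == 0 then lim (parcyl_punctured nu w @[w --> (0 : C)^'])
  else parcyl_punctured nu z.

End SpecialFunctions.

(* Main.v *)
Require Import Defs.
From HB Require Import structures.
From mathcomp Require Import all_boot all_order all_algebra.
From mathcomp Require Import complex.
From mathcomp Require Import all_classical all_reals all_analysis.
From mathcomp Require Import measurable_realfun.
From mathcomp Require Import ring lra.

(** Write A = eta + i xi and B = xi + i eta, so that the hypotheses say
    Re A > 0 and Re B > 0 and that A B = i (xi^2 + eta^2). Put z = A B and
    K(z) = e^(z / 2) K_0(z / 2), which is sqrt pi U(1/2, 1, z). Up to constants
    and the factor e^(- z / 2) the left-hand side is K(z), and with a = 1/4 - s,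
    a' = 1/4 + s, p = (1 + i) xi, q = (1 + i) eta the integrand on the right is
    e^(- z / 2) Phi a p Phi a' q, where Phi a p = 2^(- a) Gamma(a)
    U(a, 1/2, p^2 / 2).

    For p and q near the positive axis the Laplace integrals of Tricomi's
    function show y -> Phi a p and y -> Phi a' q, with s = sigma + i y, to be
    Fourier transforms in the variable u - ln (1 + e^u). The Parseval identity
    ([parseval], [Phi_integral]) turns the integral of their product into a
    single Laplace integral with parameters 1/2 and 1 at (p^2 + q^2) / 2 = z,
    and this is K(z).

    The identity then extends by analytic continuation ([product_formula]).
    Replace A and B by the powers A^w and B^w with w from 0 to 1: near w = 0
    the formula is the one just described, and both sides are holomorphic in w.
    On the right-hand side this rests on a bound for the integrand that is
    uniform near the curve, of order e^(- c sqrt |y|) with c proportional to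
    Re B at one end of the line and to Re A at the other ([tilt_arg],
    [Phi_product_le]). It comes from a staircase contour through the saddle
    point of the parabolic integral ([pint_bound_neg]) and from the decay of
    Gamma on vertical lines ([Gam_le], [Gam_inv_le]).

    It remains to connect the integrals with the functions that are defined
    through Tricomi's equation and its asymptotics. A function with these
    properties is unique ([tricomi_unique]): on the real axis it is the
    recessive solution up to a factor, and the rest is the identity theorem.
    The parabolic integral has them for b = 1/2 ([parabolic_is_tricomi]). For
    b = 1 and a = 1/2 they hold for K, written as an entire function of log z
    ([tricomi_half]). In both cases the asymptotics in the sector of opening
    3 pi follow by Watson's lemma on a contour that turns with arg z.

    The complex analysis is developed for this purpose from Cauchy's formula:
    all integrals are taken in logarithmic variables over the real line and
    dominated by e^(- k |u|), so that lines of integration can be moved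
    ([line_shift]) and parameters continued ([param_holo]). *)

Set Implicit Arguments.
Unset Strict Implicit.
Unset Printing Implicit Defensive.

Import Order.TTheory GRing.Theory Num.Theory.
Import numFieldNormedType.Exports.
Import complex.

Local Open Scope classical_set_scope.
Local Open Scope ring_scope.
Local Open Scope complex_scope.

(** * Complex numbers and differentiation *)

Section ComplexAlgebra.
Context {R : realType}.
Local Notation C := (Cplx R).
Implicit Types (z w : C) (x y : R).

Lemma norm_cmod z : `|z| = CofR (cmod z).
Proof. exact: (@normc_def R z). Qed.

Lemma CofR_inj : injective (@CofR R). Proof. by move=> x y [->]. Qed.
Lemma CofRD x y : CofR (x + y) = CofR x + CofR y.
Proof. by rewrite /CofR rmorphD. Qed.
Lemma CofRN x : CofR (- x) = - CofR x.
Proof. by rewrite /CofR rmorphN. Qed.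
Lemma CofRB x y : CofR (x - y) = CofR x - CofR y.
Proof. by rewrite /CofR rmorphB. Qed.
Lemma CofRM x y : CofR (x * y) = CofR x * CofR y.
Proof. by rewrite /CofR rmorphM. Qed.
Lemma CofRX x n : CofR (x ^+ n) = CofR x ^+ n.
Proof. by rewrite /CofR rmorphXn. Qed.
Lemma CofRV x : CofR x^-1 = (CofR x)^-1.
Proof. by rewrite /CofR fmorphV. Qed.
Lemma CofR0 : CofR (0 : R) = 0. Proof. by []. Qed.
Lemma CofR1 : CofR (1 : R) = 1. Proof. by []. Qed.
Lemma CofR_nat n : CofR (n%:R : R) = n%:R.
Proof. by rewrite /CofR rmorph_nat. Qed.

Lemma ReD z w : Re (z + w) = Re z + Re w. Proof. by case: z; case: w. Qed.
Lemma ImD z w : Im (z + w) = Im z + Im w. Proof. by case: z; case: w. Qed.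
Lemma ReN z : Re (- z) = - Re z. Proof. by case: z. Qed.
Lemma ImN z : Im (- z) = - Im z. Proof. by case: z. Qed.
Lemma ReM z w : Re (z * w) = Re z * Re w - Im z * Im w.
Proof. by case: z; case: w. Qed.
Lemma ImM z w : Im (z * w) = Re z * Im w + Im z * Re w.
Proof. by case: z; case: w => a b c d /=; rewrite [LHS]addrC addrC. Qed.
Lemma Re_CofR x : Re (CofR x) = x. Proof. by []. Qed.
Lemma Im_CofR x : Im (CofR x) = 0. Proof. by []. Qed.
Lemma Re_iC : Re (iC : C) = 0. Proof. by []. Qed.
Lemma Im_iC : Im (iC : C) = 1. Proof. by []. Qed.
Lemma Re0 : Re (0 : C) = 0. Proof. by []. Qed.
Lemma Im0 : Im (0 : C) = 0. Proof. by []. Qed.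
Lemma Re1 : Re (1 : C) = 1. Proof. by []. Qed.
Lemma Im1 : Im (1 : C) = 0. Proof. by []. Qed.
Lemma Re_nat n : Re (n%:R : C) = n%:R. Proof. by rewrite -CofR_nat. Qed.
Lemma Im_nat n : Im (n%:R : C) = 0. Proof. by rewrite -CofR_nat. Qed.
Definition ReImE := (ReD, ImD, ReN, ImN, ReM, ImM, Re_CofR, Im_CofR, Re_iC,
  Im_iC, Re0, Im0, Re1, Im1, Re_nat, Im_nat).

Lemma cplx_ext z w : Re z = Re w -> Im z = Im w -> z = w.
Proof. by case: z => a b; case: w => c d /= -> ->. Qed.
Lemma iC2 : (iC : C) * iC = -1.
Proof. by apply: cplx_ext; rewrite !ReImE; ring. Qed.
Lemma CE z : z = CofR (Re z) + iC * CofR (Im z).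
Proof. by apply: cplx_ext; rewrite !ReImE; ring. Qed.

Lemma cmod_ge0 z : 0 <= cmod z. Proof. exact: sqrtr_ge0. Qed.
Lemma cmodM z w : cmod (z * w) = cmod z * cmod w.
Proof. by apply: CofR_inj; rewrite CofRM -!norm_cmod normrM. Qed.
Lemma cmodD z w : cmod (z + w) <= cmod z + cmod w.
Proof.
have := ler_normD z w; rewrite !norm_cmod -CofRD.
by rewrite /CofR (lecR (cmod (z + w)) _).
Qed.
Lemma cmodN z : cmod (- z) = cmod z.
Proof. by apply: CofR_inj; rewrite -!norm_cmod normrN. Qed.
Lemma cmodBC z w : cmod (z - w) = cmod (w - z).
Proof. by rewrite -cmodN opprB. Qed.
Lemma cmodV z : cmod z^-1 = (cmod z)^-1.
Proof. by apply: CofR_inj; rewrite CofRV -!norm_cmod normfV. Qed.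
Lemma cmod_CofR x : cmod (CofR x) = `|x|.
Proof. by rewrite /cmod /= expr0n addr0 sqrtr_sqr. Qed.
Lemma cmod0 : cmod (0 : C) = 0. Proof. by rewrite -CofR0 cmod_CofR normr0. Qed.
Lemma cmod1 : cmod (1 : C) = 1. Proof. by rewrite -CofR1 cmod_CofR normr1. Qed.
Lemma cmod_iC : cmod (iC : C) = 1.
Proof. by rewrite /cmod /= expr0n add0r expr1n sqrtr1. Qed.
Lemma cmod_nat n : cmod (n%:R : C) = n%:R.
Proof. by rewrite -CofR_nat cmod_CofR normr_nat. Qed.
Lemma cmodX z n : cmod (z ^+ n) = cmod z ^+ n.
Proof. by apply: CofR_inj; rewrite CofRX -!norm_cmod normrX. Qed.
Lemma cmod_eq0 z : (cmod z == 0) = (z == 0).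
Proof. by rewrite -(inj_eq CofR_inj) -norm_cmod CofR0 normr_eq0. Qed.
Lemma cmod_gt0 z : (0 < cmod z) = (z != 0).
Proof. by rewrite lt0r cmod_ge0 andbT cmod_eq0. Qed.
Lemma cmodB z w : cmod (z - w) <= cmod z + cmod w.
Proof. by rewrite -(cmodN w) cmodD. Qed.
Lemma cmodBD u z w : cmod (z - w) <= cmod (z - u) + cmod (u - w).
Proof. by have := cmodD (z - u) (u - w); rewrite addrA subrK. Qed.
Lemma cmod_lbD z w : cmod z - cmod w <= cmod (z + w).
Proof. by have := cmodB (z + w) w; rewrite addrK; lra. Qed.
Lemma cmod_sqr z : cmod z ^+ 2 = Re z ^+ 2 + Im z ^+ 2.
Proof. by rewrite sqr_sqrtr // addr_ge0 // sqr_ge0. Qed.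
Lemma Re_le_cmod z : `|Re z| <= cmod z.
Proof.
rewrite -ler_sqr ?nnegrE ?cmod_ge0 // cmod_sqr real_normK ?num_real //.
by rewrite lerDl sqr_ge0.
Qed.
Lemma Im_le_cmod z : `|Im z| <= cmod z.
Proof.
rewrite -ler_sqr ?nnegrE ?cmod_ge0 // cmod_sqr real_normK ?num_real //.
by rewrite lerDr sqr_ge0.
Qed.
Lemma cmod_le_ReIm z : cmod z <= `|Re z| + `|Im z|.
Proof.
rewrite {1}(CE z) (le_trans (cmodD _ _)) // cmodM cmod_iC mul1r.
by rewrite !cmod_CofR.
Qed.
Lemma cmod_le2 z (M : R) : `|Re z| <= M -> `|Im z| <= M -> cmod z <= 2 * M.
Proof. by have := cmod_le_ReIm z; lra. Qed.
Lemma cmod_conj z : cmod (conjc z) = cmod z.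
Proof. by rewrite /cmod; case: z => a b /=; rewrite sqrrN. Qed.
Lemma CofR_eq0 x : (CofR x == 0) = (x == 0).
Proof. by rewrite -CofR0 (inj_eq CofR_inj). Qed.

Lemma Re_cexp z : Re (cexp z) = expR (Re z) * cos (Im z). Proof. by []. Qed.
Lemma Im_cexp z : Im (cexp z) = expR (Re z) * sin (Im z). Proof. by []. Qed.
Lemma cexpD z w : cexp (z + w) = cexp z * cexp w.
Proof.
by apply: cplx_ext; rewrite ?ReM ?ImM !(Re_cexp, Im_cexp) ReD ImD expRD
  ?cosD ?sinD; ring.
Qed.
Lemma cexp0 : cexp (0 : C) = 1.
Proof. by apply: cplx_ext; rewrite /= expR0 ?cos0 ?sin0; ring. Qed.
Lemma cexpN z : cexp (- z) = (cexp z)^-1.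
Proof.
have h : cexp (- z) * cexp z = 1 by rewrite -cexpD addNr cexp0.
have h0 : cexp z != 0 by apply: contraTneq isT => e0; move: h; rewrite e0 mulr0 => /eqP; rewrite eq_sym oner_eq0.
by apply: (mulIf h0); rewrite h mulVf.
Qed.
Lemma cexp_neq0 z : cexp z != 0.
Proof.
apply/eqP => e0; have := cexpD z (- z); rewrite e0 mul0r subrr cexp0.
by move/eqP; rewrite oner_eq0.
Qed.
Lemma cmod_cexp z : cmod (cexp z) = expR (Re z).
Proof.
rewrite /cmod Re_cexp Im_cexp !exprMn -mulrDr cos2Dsin2 mulr1.
by rewrite sqrtr_sqr ger0_norm ?expR_ge0.
Qed.
Lemma cexp_CofR x : cexp (CofR x) = CofR (expR x).
Proof. by apply: cplx_ext; rewrite /= ?cos0 ?sin0; ring. Qed.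
Lemma cexpB z w : cexp (z - w) = cexp z / cexp w.
Proof. by rewrite cexpD cexpN. Qed.

End ComplexAlgebra.

Section Calculus.
Context {R : realType}.
Local Notation C := (Cplx R).

(** Differentiability at x of f : T -> C relative to an embedding j of T in
    the plane.  With j = id it is complex differentiability, with j = CofR it
    is differentiability of a complex-valued function of a real variable; the
    calculus rules and the chain rule are the same for both. *)
Definition rderiv (T : Type) (j f : T -> C) (x : T) (d : C) : Prop :=
  forall e : R, 0 < e -> exists2 r : R, 0 < r &
    forall y, cmod (j y - j x) < r ->
      cmod (f y - f x - d * (j y - j x)) <= e * cmod (j y - j x).

Definition rcont (T : Type) (j f : T -> C) (x : T) : Prop :=
  forall e : R, 0 < e -> exists2 r : R, 0 < r &
    forall y, cmod (j y - j x) < r -> cmod (f y - f x) <= e.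

Section Rules.
Variables (T : Type) (j : T -> C).
Implicit Types (f g : T -> C) (x : T) (d : C).

Lemma rderiv_eq f x d d' : rderiv j f x d -> d = d' -> rderiv j f x d'.
Proof. by move=> h <-. Qed.

Lemma rderiv_ext f g x d : (forall y, f y = g y) ->
  rderiv j f x d -> rderiv j g x d.
Proof. by move=> /funext ->. Qed.

Lemma rderiv_lip f x d : rderiv j f x d -> exists2 r : R, 0 < r &
  forall y, cmod (j y - j x) < r ->
    cmod (f y - f x) <= (cmod d + 1) * cmod (j y - j x).
Proof.
move=> /(_ 1 ltr01)[r r0 h]; exists r => // y /h hy.
have -> : f y - f x = (f y - f x - d * (j y - j x)) + d * (j y - j x) by ring.
by rewrite (le_trans (cmodD _ _)) // cmodM; lra.
Qed.

Lemma rderiv_cont f x d : rderiv j f x d -> rcont j f x.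
Proof.
move=> /rderiv_lip[r r0 h] e e0.
have d0 : 0 < cmod d + 1 by rewrite ltr_wpDl ?cmod_ge0.
exists (Num.min r (e / (cmod d + 1))); first by rewrite lt_min r0 divr_gt0.
move=> y; rewrite lt_min => /andP[/h hy]; rewrite ltr_pdivlMr // => hy2.
by rewrite (le_trans hy) // mulrC ltW.
Qed.

Lemma rcont_cst c x : rcont j (fun=> c) x.
Proof. by move=> e e0; exists 1 => // y _; rewrite subrr cmod0 ltW. Qed.
Lemma rcont_id x : rcont j j x.
Proof. by move=> e e0; exists e => // y /ltW. Qed.
Lemma rcont_add f g x : rcont j f x -> rcont j g x ->
  rcont j (fun y => f y + g y) x.
Proof.
move=> hf hg e e0; have e2 : 0 < e / 2 by rewrite divr_gt0.
have [r r0 h] := hf _ e2; have [s s0 k] := hg _ e2.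
exists (Num.min r s); first by rewrite lt_min r0.
move=> y; rewrite lt_min => /andP[/h hy /k ky].
have -> : f y + g y - (f x + g x) = (f y - f x) + (g y - g x) by ring.
by rewrite (le_trans (cmodD _ _)) //; lra.
Qed.
Lemma rcont_bnd f x : rcont j f x -> exists2 r : R, 0 < r &
  forall y, cmod (j y - j x) < r -> cmod (f y) <= cmod (f x) + 1.
Proof.
move=> /(_ 1 ltr01)[r r0 h]; exists r => // y /h hy.
by have := cmodD (f y - f x) (f x); rewrite subrK; lra.
Qed.
Lemma rcont_mul f g x : rcont j f x -> rcont j g x ->
  rcont j (fun y => f y * g y) x.
Proof.
move=> hf hg e e0.
have [r0 r00 hb] := rcont_bnd hf.
have gx := cmod_ge0 (g x); have fx := cmod_ge0 (f x).
have ea : 0 < e / 2 / (cmod (f x) + 1) by rewrite !divr_gt0 // ltr_wpDl.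
have eb : 0 < e / 2 / (cmod (g x) + 1) by rewrite !divr_gt0 // ltr_wpDl.
have [r1 r10 h1] := hf _ eb; have [r2 r20 h2] := hg _ ea.
exists (Num.min r0 (Num.min r1 r2)); first by rewrite !lt_min r00 r10.
move=> y; rewrite !lt_min => /and3P[/hb by_ /h1 f1 /h2 g1].
have -> : f y * g y - f x * g x = f y * (g y - g x) + (f y - f x) * g x by ring.
rewrite (le_trans (cmodD _ _)) // !cmodM.
have A : cmod (f y) * cmod (g y - g x) <= e / 2.
  rewrite (le_trans (ler_pM (cmod_ge0 _) (cmod_ge0 _) by_ g1)) //.
  by rewrite mulrC divfK // gt_eqF // ltr_wpDl.
have B : cmod (f y - f x) * cmod (g x) <= e / 2.
  have : cmod (f y - f x) * cmod (g x) <=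
      e / 2 / (cmod (g x) + 1) * (cmod (g x) + 1).
    by apply: ler_pM => //; rewrite ?cmod_ge0 // lerDl.
  by rewrite divfK // gt_eqF // ltr_wpDl.
lra.
Qed.

Lemma rderiv_cst c x : rderiv j (fun=> c) x 0.
Proof.
move=> e e0; exists 1 => // y _.
by rewrite subrr mul0r subrr cmod0 mulr_ge0 ?cmod_ge0 // ltW.
Qed.
Lemma rderiv_id x : rderiv j j x 1.
Proof.
move=> e e0; exists 1 => // y _.
by rewrite mul1r subrr cmod0 mulr_ge0 ?cmod_ge0 // ltW.
Qed.
Lemma rderiv_add f g x d d' : rderiv j f x d -> rderiv j g x d' ->
  rderiv j (fun y => f y + g y) x (d + d').
Proof.
move=> hf hg e e0; have e2 : 0 < e / 2 by rewrite divr_gt0.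
have [r r0 h] := hf _ e2; have [s s0 k] := hg _ e2.
exists (Num.min r s); first by rewrite lt_min r0.
move=> y; rewrite lt_min => /andP[/h hy /k ky].
have -> : f y + g y - (f x + g x) - (d + d') * (j y - j x) =
  (f y - f x - d * (j y - j x)) + (g y - g x - d' * (j y - j x)) by ring.
by rewrite (le_trans (cmodD _ _)) //; lra.
Qed.
Lemma rderiv_scale c f x d : rderiv j f x d ->
  rderiv j (fun y => c * f y) x (c * d).
Proof.
move=> hf e e0; have c0 := cmod_ge0 c.
have e2 : 0 < e / (cmod c + 1) by rewrite divr_gt0 // ltr_wpDl.
have [r r0 h] := hf _ e2; exists r => // y /h hy.
have -> : c * f y - c * f x - c * d * (j y - j x) =
  c * (f y - f x - d * (j y - j x)) by ring.
rewrite cmodM.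
have := ler_pM c0 (cmod_ge0 _) (_ : cmod c <= cmod c + 1) hy.
rewrite lerDl ler01 => /(_ isT)/le_trans; apply.
by rewrite mulrA mulrCA divff ?mulr1 // gt_eqF // ltr_wpDl.
Qed.
Lemma rderiv_opp f x d : rderiv j f x d -> rderiv j (fun y => - f y) x (- d).
Proof.
move=> hf; have := rderiv_scale (-1) hf; rewrite mulN1r.
by apply: rderiv_ext => y; rewrite mulN1r.
Qed.
Lemma rderiv_sub f g x d d' : rderiv j f x d -> rderiv j g x d' ->
  rderiv j (fun y => f y - g y) x (d - d').
Proof. by move=> hf hg; exact: rderiv_add hf (rderiv_opp hg). Qed.
Lemma rderiv_mul f g x d d' : rderiv j f x d -> rderiv j g x d' ->
  rderiv j (fun y => f y * g y) x (d * g x + f x * d').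
Proof.
move=> hf hg.
have -> : (fun y => f y * g y) = (fun y => (f y - f x) * (g y - g x) +
  (g x * f y + (f x * g y + - (f x * g x)))) by apply/funext => y; ring.
have -> : d * g x + f x * d' = 0 + (g x * d + (f x * d' + 0)) by ring.
apply: rderiv_add; last first.
  apply: rderiv_add (rderiv_scale _ hf) _.
  by apply: rderiv_add (rderiv_scale _ hg) _; exact: rderiv_cst.
move=> e e0; have [r r0 h] := rderiv_lip hf.
have d0 : 0 < cmod d + 1 by rewrite ltr_wpDl ?cmod_ge0.
have [s s0 k] := rderiv_cont hg (divr_gt0 e0 d0).
exists (Num.min r s); first by rewrite lt_min r0.
move=> y; rewrite lt_min => /andP[/h hy /k ky].
rewrite !subrr !mul0r !subr0 cmodM.
have := ler_pM (cmod_ge0 _) (cmod_ge0 _) hy ky => /le_trans; apply.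
by rewrite mulrC mulrA divfK // gt_eqF.
Qed.
End Rules.

Lemma rderiv_comp (T : Type) (j f : T -> C) (g : C -> C) x d d' :
  rderiv id g (f x) d' -> rderiv j f x d ->
  rderiv j (fun y => g (f y)) x (d' * d).
Proof.
move=> hg hf e e0.
have [r0 r00 h0] := rderiv_lip hf.
have d0 : 0 < cmod d + 1 by rewrite ltr_wpDl ?cmod_ge0.
have d'0 : 0 < cmod d' + 1 by rewrite ltr_wpDl ?cmod_ge0.
have ea : 0 < e / 2 / (cmod d + 1) by rewrite !divr_gt0.
have eb : 0 < e / 2 / (cmod d' + 1) by rewrite !divr_gt0.
have [r1 r10 h1] := hg _ ea; have [r2 r20 h2] := hf _ eb.
have [r3 r30 h3] : exists2 r : R, 0 < r &
    forall y, cmod (j y - j x) < r -> cmod (f y - f x) < r1.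
  have r12 : 0 < r1 / 2 by rewrite divr_gt0.
  have [r h hh] := rderiv_cont hf r12; exists r => // y /hh; lra.
exists (Num.min r0 (Num.min r2 r3)); first by rewrite !lt_min r00 r20.
move=> y; rewrite !lt_min => /and3P[/h0 A /h2 B /h3 /h1 D].
have -> : g (f y) - g (f x) - d' * d * (j y - j x) =
  (g (f y) - g (f x) - d' * (f y - f x)) + d' * (f y - f x - d * (j y - j x)).
  by ring.
rewrite (le_trans (cmodD _ _)) // cmodM.
have X : cmod (g (f y) - g (f x) - d' * (f y - f x)) <=
    e / 2 * cmod (j y - j x).
  rewrite (le_trans D) // (le_trans (ler_wpM2l (ltW ea) A)) //.
  by rewrite mulrA divfK // gt_eqF.
have Y : cmod d' * cmod (f y - f x - d * (j y - j x)) <=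
    e / 2 * cmod (j y - j x).
  have : cmod d' * cmod (f y - f x - d * (j y - j x)) <=
    (cmod d' + 1) * (e / 2 / (cmod d' + 1) * cmod (j y - j x)).
    by apply: ler_pM => //; rewrite ?cmod_ge0 // lerDl.
  by rewrite mulrA mulrCA divff ?mulr1 // gt_eqF.
lra.
Qed.

Lemma rcont_comp (T : Type) (j f : T -> C) (g : C -> C) x :
  rcont id g (f x) -> rcont j f x -> rcont j (fun y => g (f y)) x.
Proof.
move=> hg hf e e0; have [r r0 h] := hg _ e0.
have r2 : 0 < r / 2 by rewrite divr_gt0.
have [s s0 k] := hf _ r2; exists s => // y /k hy; apply: h.
by apply: le_lt_trans hy _; lra.
Qed.

End Calculus.
Section Bridge.
Context {R : realType}.
Local Notation C := (Cplx R).

Lemma ltc0_Im (z : C) : 0 < z -> Im z = 0.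
Proof. by rewrite ltcE => /andP[/eqP]. Qed.

Lemma is_derive_rderiv (g : R -> R) (t d : R) :
  is_derive t 1 g d -> rderiv CofR (fun s => CofR (g s) : C) t (CofR d).
Proof.
move=> [dg gd] e e0.
have /cvgrPdist_le /(_ _ e0) : h^-1 *: (g (h *: 1 + t) - g t) @[h --> 0^'] --> d.
  by rewrite -gd; exact: dg.
move=> /nbhs_ballP[r /= r0 hr]; exists r => // s.
rewrite -!(CofRB, CofRM) !cmod_CofR => st.
have [->|ne] := eqVneq s t; first by rewrite !subrr mulr0 subrr !normr0 mulr0.
have ne' : s - t != 0 by rewrite subr_eq0.
have := hr (s - t); rewrite /ball/= sub0r normrN => /(_ st ne').
rewrite [_%:A]mulr1 subrK => h.
have -> : g s - g t - d * (s - t) = ((s - t)^-1 * (g s - g t) - d) * (s - t).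
  by field.
by rewrite normrM ler_wpM2r // distrC.
Qed.

Lemma rderiv_is_derive (g : R -> R) (t d : R) :
  rderiv CofR (fun s => CofR (g s) : C) t (CofR d) -> is_derive t 1 g d.
Proof.
move=> h.
have c : h^-1 *: (g (h *: 1 + t) - g t) @[h --> 0^'] --> d.
  apply/cvgrPdist_le => e e0; have [r r0 hr] := h _ e0.
  apply/nbhs_ballP; exists r => //= s.
  rewrite /ball/= sub0r normrN => st ne.
  have := hr (s + t); rewrite -!(CofRB, CofRM) !cmod_CofR addrK => /(_ st) k.
  rewrite [_%:A]mulr1 distrC.
  have -> : s^-1 *: (g (s + t) - g t) - d = (g (s + t) - g t - d * s) / s.
    by rewrite /GRing.scale/=; field.
  by rewrite normrM normfV ler_pdivrMr ?normr_gt0.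
by apply: DeriveDef; [apply/cvg_ex; exists d | apply/cvg_lim].
Qed.

Lemma rderiv_Re (f : R -> C) (t : R) (d : C) : rderiv CofR f t d ->
  is_derive t 1 (fun s => Re (f s)) (Re d).
Proof.
move=> h; apply: rderiv_is_derive => e e0; have [r r0 hr] := h _ e0.
exists r => // s /hr; apply: le_trans.
rewrite -!(CofRB, CofRM) cmod_CofR (le_trans _ (Re_le_cmod _)) //.
rewrite le_eqVlt; apply/orP; left; apply/eqP; congr (`|_|); rewrite !ReImE; ring.
Qed.

Lemma rderiv_Im (f : R -> C) (t : R) (d : C) : rderiv CofR f t d ->
  is_derive t 1 (fun s => Im (f s)) (Im d).
Proof.
move=> h; apply: rderiv_is_derive => e e0; have [r r0 hr] := h _ e0.
exists r => // s /hr; apply: le_trans.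
rewrite -!(CofRB, CofRM) cmod_CofR (le_trans _ (Im_le_cmod _)) //.
rewrite le_eqVlt; apply/orP; left; apply/eqP; congr (`|_|); rewrite !ReImE; ring.
Qed.

Lemma rderiv_derive1 (f : C -> C) (z d : C) : rderiv id f z d ->
  derivable f z 1 /\ derive1 f z = d.
Proof.
move=> h.
have c : h^-1 *: (f (h *: 1 + z) - f z) @[h --> 0^'] --> d.
  apply/cvgrPdist_le => e e0.
  have ee : e = CofR (Re e) by rewrite {1}(CE e) (ltc0_Im e0) CofR0 mulr0 addr0.
  have e0' : 0 < Re e by move: e0; rewrite ltcE => /andP[].
  have [r r0 hr] := h _ e0'.
  apply/nbhs_ballP; exists (CofR r); first by rewrite /= ltcR.
  move=> s; rewrite /ball/= sub0r normrN norm_cmod ltcR => st ne.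
  have := hr (s + z); rewrite /= addrK => /(_ st) k.
  rewrite [_%:A]mulr1 distrC.
  have -> : s^-1 *: (f (s + z) - f z) - d = (f (s + z) - f z - d * s) / s.
    by rewrite /GRing.scale/=; field.
  rewrite norm_cmod ee /CofR lecR cmodM cmodV ler_pdivrMr ?cmod_gt0 //.
split; first by apply/cvg_ex; exists d.
by rewrite derive1E; apply/cvg_lim.
Qed.

Lemma derivable_rderiv (f : C -> C) (z : C) : derivable f z 1 ->
  rderiv id f z (derive1 f z).
Proof.
move=> dg e e0.
have e0' : 0 < CofR e by rewrite ltcR.
have /cvgrPdist_le /(_ _ e0') : h^-1 *: (f (h *: 1 + z) - f z) @[h --> 0^'] --> derive1 f z.
  by rewrite derive1E; exact: dg.
move=> /nbhs_ballP[r /= r0 hr].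
have r0' : 0 < Re r by move: r0; rewrite ltcE => /andP[].
have re : r = CofR (Re r) by rewrite {1}(CE r) (ltc0_Im r0) CofR0 mulr0 addr0.
exists (Re r) => // s st.
have [->|ne] := eqVneq s z; first by rewrite !subrr mulr0 subrr cmod0 mulr0.
have ne' : s - z != 0 by rewrite subr_eq0.
have := hr (s - z); rewrite /ball/= sub0r normrN norm_cmod re ltcR => /(_ st ne').
rewrite [_%:A]mulr1 subrK norm_cmod lecR => h.
have -> : f s - f z - derive1 f z * (s - z) = ((s - z)^-1 * (f s - f z) - derive1 f z) * (s - z).
  by field.
by rewrite cmodM ler_wpM2r ?cmod_ge0 // cmodBC.
Qed.
End Bridge.
Section MeanValue.
Context {R : realType}.
Local Notation C := (Cplx R).

Lemma is_derive_ndecr (h h1 : R -> R) (a b : R) : a <= b ->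
  (forall t, a <= t <= b -> is_derive t 1 h (h1 t)) ->
  (forall t, a <= t <= b -> 0 <= h1 t) -> h a <= h b.
Proof.
move=> ab dh h0; rewrite -subr_ge0.
have [||c cab ->] := @MVT_segment R h h1 a b ab.
- by move=> x /subset_itv_oo_cc; rewrite in_itv/= => /dh.
- apply: derivable_within_continuous => x; rewrite in_itv/= => /dh[].
  by [].
- by rewrite mulr_ge0 ?subr_ge0 // h0 // -in_itv.
Qed.

Lemma is_derive_mull (L t : R) : is_derive t 1 (fun s => L * s) L.
Proof.
apply: rderiv_is_derive.
apply: (@rderiv_ext R R CofR (fun s => CofR L * CofR s)); first by move=> y; rewrite CofRM.
by apply: rderiv_eq; [apply: rderiv_scale; exact: rderiv_id | rewrite mulr1].
Qed.

(** The factor 2 comes from bounding real and imaginary parts separately. *)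
Lemma mean_value_ineq (g g1 : R -> C) (m m1 : R -> R) (a b : R) : a <= b ->
  (forall t, a <= t <= b -> rderiv CofR g t (g1 t)) ->
  (forall t, a <= t <= b -> is_derive t 1 m (m1 t)) ->
  (forall t, a <= t <= b -> cmod (g1 t) <= m1 t) ->
  cmod (g b - g a) <= 2 * (m b - m a).
Proof.
move=> ab dg dm gm.
apply: cmod_le2; rewrite ler_norml !ReImE.
- have A : m a - Re (g a) <= m b - Re (g b).
    apply: (@is_derive_ndecr (fun t => m t - Re (g t)) (fun t => m1 t - Re (g1 t))) => // t tab.
      have := dm _ tab; have := rderiv_Re (dg _ tab); move=> *; exact: is_deriveB.
    by have := le_trans (Re_le_cmod _) (gm _ tab); rewrite ler_norml; lra.
  have B : m a + Re (g a) <= m b + Re (g b).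
    apply: (@is_derive_ndecr (fun t => m t + Re (g t)) (fun t => m1 t + Re (g1 t))) => // t tab.
      have := dm _ tab; have := rderiv_Re (dg _ tab); move=> *; exact: is_deriveD.
    by have := le_trans (Re_le_cmod _) (gm _ tab); rewrite ler_norml; lra.
  lra.
- have A : m a - Im (g a) <= m b - Im (g b).
    apply: (@is_derive_ndecr (fun t => m t - Im (g t)) (fun t => m1 t - Im (g1 t))) => // t tab.
      have := dm _ tab; have := rderiv_Im (dg _ tab); move=> *; exact: is_deriveB.
    by have := le_trans (Im_le_cmod _) (gm _ tab); rewrite ler_norml; lra.
  have B : m a + Im (g a) <= m b + Im (g b).
    apply: (@is_derive_ndecr (fun t => m t + Im (g t)) (fun t => m1 t + Im (g1 t))) => // t tab.
      have := dm _ tab; have := rderiv_Im (dg _ tab); move=> *; exact: is_deriveD.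
    by have := le_trans (Im_le_cmod _) (gm _ tab); rewrite ler_norml; lra.
  lra.
Qed.

Lemma mean_value_lip (g g1 : R -> C) (L a b : R) : a <= b ->
  (forall t, a <= t <= b -> rderiv CofR g t (g1 t)) ->
  (forall t, a <= t <= b -> cmod (g1 t) <= L) ->
  cmod (g b - g a) <= 2 * (L * (b - a)).
Proof.
move=> ab dg gL.
have -> : L * (b - a) = L * b - L * a by ring.
apply: (@mean_value_ineq g g1 (fun t => L * t) (fun=> L)) => // t _.
exact: is_derive_mull.
Qed.

Lemma rderiv_line (z v : C) (t : R) : rderiv CofR (fun s => z + CofR s * v) t v.
Proof.
apply: rderiv_eq.
  apply: rderiv_add; first exact: rderiv_cst.
  apply: rderiv_mul; [exact: rderiv_id | exact: rderiv_cst].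
by rewrite /=; ring.
Qed.

Lemma rderiv_along (f : C -> C) (z v : C) (t : R) d :
  rderiv id f (z + CofR t * v) d ->
  rderiv CofR (fun s => f (z + CofR s * v)) t (d * v).
Proof.
move=> h; exact: (@rderiv_comp R R CofR (fun s => z + CofR s * v) f t _ _ h (rderiv_line _ _ _)).
Qed.

Lemma mean_value_segment (f f1 : C -> C) (z w : C) (L : R) :
  (forall t, 0 <= t <= 1 ->
    rderiv id f (z + CofR t * (w - z)) (f1 (z + CofR t * (w - z)))) ->
  (forall t, 0 <= t <= 1 -> cmod (f1 (z + CofR t * (w - z))) <= L) ->
  cmod (f w - f z) <= 2 * (L * cmod (w - z)).
Proof.
move=> df fL.
have := @mean_value_lip (fun t => f (z + CofR t * (w - z)))
  (fun t => f1 (z + CofR t * (w - z)) * (w - z)) (L * cmod (w - z)) 0 1 ler01.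
rewrite subr0 mulr1 CofR0 CofR1 mul0r mul1r addr0 [z + _]addrC subrK; apply=> t t01.
  exact: rderiv_along (df _ t01).
by rewrite cmodM ler_wpM2r ?cmod_ge0 ?fL.
Qed.

Lemma rderiv_CofR (g : R -> R) (t d : R) : is_derive t 1 g d ->
  rderiv CofR (fun s => CofR (g s) : C) t (CofR d).
Proof. exact: is_derive_rderiv. Qed.

Lemma rderiv_cexp_line (h : C) (t : R) :
  rderiv CofR (fun s => cexp (CofR s * h)) t (cexp (CofR t * h) * h).
Proof.
set a := Re h; set b := Im h.
have E s : cexp (CofR s * h) = CofR (expR (s * a) * cos (s * b)) + iC * CofR (expR (s * a) * sin (s * b)).
  apply: cplx_ext; rewrite ?Re_cexp ?Im_cexp !ReImE -/a -/b !mul0r ?subr0 ?addr0; ring.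
apply: (rderiv_ext (fun s => esym (E s))).
have lin (c : R) : is_derive t 1 (fun s => s * c) c.
  by under eq_fun do rewrite mulrC; exact: is_derive_mull.
have e1 : is_derive t 1 (fun s => expR (s * a)) (expR (t * a) * a).
  exact: (@is_derive1_comp R expR (fun s => s * a) t _ _ (is_derive_expR (t * a)) (lin a)).
have e2 : is_derive t 1 (fun s => cos (s * b)) (- sin (t * b) * b).
  exact: (@is_derive1_comp R (@cos R) (fun s => s * b) t _ _ (is_derive_cos (t * b)) (lin b)).
have e3 : is_derive t 1 (fun s => sin (s * b)) (cos (t * b) * b).
  exact: (@is_derive1_comp R (@sin R) (fun s => s * b) t _ _ (is_derive_sin (t * b)) (lin b)).
have h1 := is_deriveM e1 e2; have h2 := is_deriveM e1 e3.
have k1 := rderiv_CofR h1; have k2 := rderiv_CofR h2.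
apply: rderiv_eq; first exact: rderiv_add k1 (rderiv_scale iC k2).
by rewrite E /GRing.scale /=; apply: cplx_ext; rewrite !ReImE -/a -/b; ring.
Qed.

Lemma cexp_sub1_le (h : C) : cmod (cexp h - 1) <= 2 * (expR (cmod h) * cmod h).
Proof.
have := @mean_value_lip (fun t => cexp (CofR t * h)) (fun t => cexp (CofR t * h) * h)
  (expR (cmod h) * cmod h) 0 1 ler01.
rewrite CofR0 CofR1 mul1r mul0r cexp0 subr0 mulr1; apply=> t; first by move=> _; exact: rderiv_cexp_line.
move=> /andP[t0 t1]; rewrite cmodM ler_wpM2r ?cmod_ge0 // cmod_cexp ler_expR.
rewrite !ReImE mul0r subr0 (le_trans (ler_norm _)) // normrM ger0_norm //.
by rewrite (le_trans (ler_wpM2l t0 (Re_le_cmod h))) // ler_piMl ?cmod_ge0.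
Qed.

Lemma cexp_sub2_le (h : C) :
  cmod (cexp h - 1 - h) <= 4 * (expR (cmod h) * cmod h ^+ 2).
Proof.
have := @mean_value_lip (fun t => cexp (CofR t * h) - CofR t * h) (fun t => cexp (CofR t * h) * h - h)
  (2 * (expR (cmod h) * cmod h ^+ 2)) 0 1 ler01.
rewrite CofR0 CofR1 mul1r mul0r cexp0 !subr0 mulr1.
have -> : cexp h - h - 1 = cexp h - 1 - h by ring.
have -> : 2 * (2 * (expR (cmod h) * cmod h ^+ 2)) = 4 * (expR (cmod h) * cmod h ^+ 2) by ring.
apply=> t.
  move=> _; apply: rderiv_sub; first exact: rderiv_cexp_line.
  by apply: rderiv_eq; first apply: rderiv_mul; first exact: rderiv_id; first exact: rderiv_cst; rewrite /=; ring.
move=> /andP[t0 t1].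
have -> : cexp (CofR t * h) * h - h = (cexp (CofR t * h) - 1) * h by ring.
have le : cmod (CofR t * h) <= cmod h.
  by rewrite cmodM cmod_CofR ger0_norm // ler_piMl ?cmod_ge0.
rewrite cmodM expr2 !mulrA ler_wpM2r ?cmod_ge0 // (le_trans (cexp_sub1_le _)) // -mulrA ler_pM2l //.
by rewrite ler_pM ?expR_ge0 ?cmod_ge0 ?ler_expR.
Qed.

Lemma rderiv_cexp (z : C) : rderiv id cexp z (cexp z).
Proof.
move=> e e0.
have p0 : 0 < cmod (cexp z) by rewrite cmod_gt0 cexp_neq0.
have k0 : 0 < cmod (cexp z) * (4 * expR 1) by rewrite !mulr_gt0 ?expR_gt0.
exists (Num.min 1 (e / (cmod (cexp z) * (4 * expR 1)))); first by rewrite lt_min ltr01 divr_gt0.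
move=> w; rewrite lt_min => /andP[w1]; rewrite ltr_pdivlMr // => we.
have -> : cexp w - cexp z - cexp z * (w - z) = cexp z * (cexp (w - z) - 1 - (w - z)).
  by rewrite !mulrBr mulr1 -cexpD (addrC z) subrK; ring.
rewrite cmodM (le_trans (ler_wpM2l (ltW p0) (cexp_sub2_le _))) //.
have : expR (cmod (w - z)) <= expR 1 by rewrite ler_expR ltW.
move=> le; rewrite expr2.
have h := cmod_ge0 (w - z).
apply: (@le_trans _ _ (cmod (cexp z) * (4 * (expR 1 * (cmod (w - z) * cmod (w - z)))))).
  by rewrite ler_pM2l // ler_pM2l // ler_wpM2r // mulr_ge0.
have -> : cmod (cexp z) * (4 * (expR 1 * (cmod (w - z) * cmod (w - z)))) =
  (cmod (w - z) * (cmod (cexp z) * (4 * expR 1))) * cmod (w - z) by ring.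
by rewrite ler_wpM2r // ltW.
Qed.

Lemma rcont_cexp (z : C) : rcont id cexp z.
Proof. exact: rderiv_cont (rderiv_cexp z). Qed.

Lemma rderiv_inv (z : C) : z != 0 -> rderiv id (fun w => w^-1) z (- z ^- 2).
Proof.
move=> z0 e e0; have p0 : 0 < cmod z by rewrite cmod_gt0.
exists (Num.min (cmod z / 2) (e * (cmod z ^+ 3 / 2))).
  by rewrite lt_min divr_gt0 // mulr_gt0 // divr_gt0 // exprn_gt0.
move=> w; rewrite lt_min => /andP[w1 w2].
have wl : cmod z / 2 <= cmod w.
  have := cmodB w (w - z); have -> : w - (w - z) = z by ring.
  rewrite ler_pdivrMr //; move: w1; rewrite /= ltr_pdivlMr //; lra.
have w0 : w != 0 by rewrite -cmod_gt0; lra.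
have -> : w^-1 - z^-1 - - z ^- 2 * (w - z) = (w - z) * (w - z) / (z ^+ 2 * w).
  by field; rewrite ?w0 ?z0.
rewrite cmodM cmodV (cmodM (w - z)) (cmodM (z ^+ 2)) cmodX -mulrA [e * _]mulrC ler_wpM2l ?cmod_ge0 //.
have cw : 0 < cmod w by rewrite cmod_gt0.
rewrite ler_pdivrMr ?mulr_gt0 ?exprn_gt0 //.
apply: (le_trans (ltW w2)); rewrite ler_pM2l // exprSr -mulrA ler_pM2l ?exprn_gt0 //.
Qed.

End MeanValue.

(** * Integrals of complex-valued functions *)

Section ComplexIntegral.
Context {R : realType}.
Local Notation C := (Cplx R).
Local Notation mu := (@lebesgue_measure R).
Implicit Types (D E : set R) (M : R -> R).

Definition cmeas d (T : measurableType d) (D : set T) (f : T -> C) : Prop :=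
  measurable_fun D (fun x => Re (f x)) /\ measurable_fun D (fun x => Im (f x)).

Section Measurability.
Context d (T : measurableType d) (D : set T).
Implicit Types (f g : T -> C).

Lemma cmeas_ext f g : (forall x, f x = g x) -> cmeas D f -> cmeas D g.
Proof. by move=> /funext ->. Qed.

Lemma cmeas_cst c : cmeas D (fun=> c).
Proof. by split; exact: measurable_cst. Qed.

Lemma cmeas_real (h : T -> R) : measurable_fun D h ->
  cmeas D (fun x => CofR (h x)).
Proof. by move=> mh; split => //; exact: measurable_cst. Qed.

Lemma cmeas_add f g : cmeas D f -> cmeas D g -> cmeas D (fun x => f x + g x).
Proof.
move=> [f1 f2] [g1 g2]; split.
  by under eq_fun do rewrite ReD; exact: measurable_funD.
by under eq_fun do rewrite ImD; exact: measurable_funD.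
Qed.

Lemma cmeas_mul f g : cmeas D f -> cmeas D g -> cmeas D (fun x => f x * g x).
Proof.
move=> [f1 f2] [g1 g2]; split.
  under eq_fun do rewrite ReM.
  by apply: measurable_funB; exact: measurable_funM.
under eq_fun do rewrite ImM.
by apply: measurable_funD; exact: measurable_funM.
Qed.

Lemma cmeas_opp f : cmeas D f -> cmeas D (fun x => - f x).
Proof.
move=> mf; apply: (@cmeas_ext (fun x => (-1) * f x)) => [x|].
  by rewrite mulN1r.
exact: cmeas_mul (cmeas_cst _) mf.
Qed.

Lemma cmeas_cexp f : cmeas D f -> cmeas D (fun x => cexp (f x)).
Proof.
have ms : measurable_fun setT (@sin R) by apply: continuous_measurable_fun; exact: continuous_sin.
have mc : measurable_fun setT (@cos R) by apply: continuous_measurable_fun; exact: continuous_cos.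
move=> [f1 f2]; split.
  under eq_fun do rewrite Re_cexp.
  by apply: measurable_funM; apply: measurableT_comp.
under eq_fun do rewrite Im_cexp.
by apply: measurable_funM; apply: measurableT_comp.
Qed.

End Measurability.
Implicit Types f g : R -> C.
Local Notation mR := (measurableTypeR R).
Local Notation mset D := (@measurable _ mR D).
Local Notation cmeasR D f := (@cmeas _ mR D f).

Lemma cmeasS d (T : measurableType d) (D E : set T) (f : T -> C) :
  measurable E -> D `<=` E -> cmeas E f -> cmeas D f.
Proof. by move=> mE DE [a b]; split; apply: measurable_funS mE DE _. Qed.

Lemma rcont_continuous (g : R -> R) :
  (forall t, rcont CofR (fun s => CofR (g s) : C) t) -> continuous g.
Proof.
move=> h t; apply/cvgrPdist_le => e e0; have [r r0 hr] := h t _ e0.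
apply/nbhs_ballP; exists r => //= s; rewrite /ball/= => st.
by have := hr s; rewrite -!CofRB !cmod_CofR distrC => /(_ st); rewrite distrC.
Qed.

Lemma rcont_Re f t : rcont CofR f t -> rcont CofR (fun s => CofR (Re (f s))) t.
Proof.
move=> h e e0; have [r r0 hr] := h _ e0; exists r => // s /hr; apply: le_trans.
by rewrite -CofRB cmod_CofR -ReN -ReD Re_le_cmod.
Qed.
Lemma rcont_Im f t : rcont CofR f t -> rcont CofR (fun s => CofR (Im (f s))) t.
Proof.
move=> h e e0; have [r r0 hr] := h _ e0; exists r => // s /hr; apply: le_trans.
by rewrite -CofRB cmod_CofR -ImN -ImD Im_le_cmod.
Qed.

Lemma cmeas_rcont D f : (forall t, rcont CofR f t) -> mset D -> cmeasR D f.
Proof.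
move=> h mD; apply: (@cmeasS _ _ _ setT) => //; split.
  by apply: continuous_measurable_fun; apply: rcont_continuous => t; exact: rcont_Re.
by apply: continuous_measurable_fun; apply: rcont_continuous => t; exact: rcont_Im.
Qed.

Lemma integrable_le D M (h : R -> R) : mset D -> @measurable_fun _ _ mR _ D h ->
  mu.-integrable D (EFin \o M) -> (forall x, D x -> `|h x| <= M x) ->
  mu.-integrable D (EFin \o h).
Proof.
move=> mD mh iM hM; apply: le_integrable iM => //.
  exact/measurable_EFinP.
by move=> x Dx /=; rewrite lee_fin (le_trans (hM _ Dx)) // ler_norm.
Qed.

Lemma cint_dom D M f : mset D -> cmeasR D f ->
  mu.-integrable D (EFin \o M) -> (forall x, D x -> cmod (f x) <= M x) ->
  cintegrable D f.
Proof.
move=> mD [m1 m2] iM fM; split; apply: integrable_le iM _ => // x Dx.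
  exact: le_trans (Re_le_cmod _) (fM _ Dx).
exact: le_trans (Im_le_cmod _) (fM _ Dx).
Qed.

Lemma Re_cintegral D f : Re (cintegral D f) = \int[mu]_(t in D) Re (f t).
Proof. by []. Qed.
Lemma Im_cintegral D f : Im (cintegral D f) = \int[mu]_(t in D) Im (f t).
Proof. by []. Qed.

Lemma eq_cintegral D f g : (forall x, D x -> f x = g x) ->
  cintegral D f = cintegral D g.
Proof.
by move=> fg; apply: cplx_ext; rewrite ?Re_cintegral ?Im_cintegral;
  apply: eq_Rintegral => x; rewrite inE => /fg ->.
Qed.

Lemma eq_cintegrable D f g : mset D -> (forall x, D x -> f x = g x) ->
  cintegrable D f -> cintegrable D g.
Proof.
move=> mD fg [a b]; split.
  by apply: (eq_integrable mD) a => x; rewrite inE => /fg /= ->.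
by apply: (eq_integrable mD) b => x; rewrite inE => /fg /= ->.
Qed.

Lemma cintegrableS D E f : mset E -> mset D -> D `<=` E ->
  cintegrable E f -> cintegrable D f.
Proof. by move=> mE mD DE [a b]; split; apply: integrableS mE mD DE _. Qed.

Lemma cintegrable_add D f g : mset D -> cintegrable D f ->
  cintegrable D g -> cintegrable D (fun x => f x + g x).
Proof.
move=> mD [f1 f2] [g1 g2]; split.
  have := integrableD mD f1 g1; apply: eq_integrable => // x _.
  by rewrite /= ReD EFinD.
have := integrableD mD f2 g2; apply: eq_integrable => // x _.
by rewrite /= ImD EFinD.
Qed.

Lemma cintegral_add D f g : mset D -> cintegrable D f ->
  cintegrable D g ->
  cintegral D (fun x => f x + g x) = cintegral D f + cintegral D g.
Proof.
move=> mD [f1 f2] [g1 g2]; apply: cplx_ext.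
  rewrite ReD !Re_cintegral -RintegralD //.
  by apply: eq_Rintegral => x _; rewrite ReD.
rewrite ImD !Im_cintegral -RintegralD //.
by apply: eq_Rintegral => x _; rewrite ImD.
Qed.

Lemma integrable_scale D (h : R -> R) (k : R) : mset D ->
  mu.-integrable D (EFin \o h) -> mu.-integrable D (EFin \o (fun x => k * h x)).
Proof.
move=> mD ih; have := integrableZl mD k ih.
by apply: eq_integrable => // x _; rewrite /= EFinM.
Qed.
Lemma integrable_addR D (h k : R -> R) : mset D ->
  mu.-integrable D (EFin \o h) -> mu.-integrable D (EFin \o k) ->
  mu.-integrable D (EFin \o (fun x => h x + k x)).
Proof.
move=> mD ih ik; have := integrableD mD ih ik.
by apply: eq_integrable => // x _; rewrite /= EFinD.
Qed.

Lemma cintegrable_scale D f c : mset D -> cintegrable D f ->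
  cintegrable D (fun x => c * f x).
Proof.
move=> mD [f1 f2]; split.
  have := integrable_addR mD (integrable_scale (Re c) mD f1) (integrable_scale (- Im c) mD f2).
  by apply: eq_integrable => // x _; rewrite /= ReM mulNr.
have := integrable_addR mD (integrable_scale (Re c) mD f2) (integrable_scale (Im c) mD f1).
by apply: eq_integrable => // x _; rewrite /= ImM.
Qed.

Lemma cintegral_scale D f c : mset D -> cintegrable D f ->
  cintegral D (fun x => c * f x) = c * cintegral D f.
Proof.
move=> mD [f1 f2]; apply: cplx_ext.
  rewrite ReM !Re_cintegral !Im_cintegral -!RintegralZl // -RintegralB //.
  - by apply: eq_Rintegral => x _; rewrite ReM.
  - exact: integrable_scale.
  - exact: integrable_scale.
rewrite ImM !Re_cintegral !Im_cintegral -!RintegralZl // -RintegralD //.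
- by apply: eq_Rintegral => x _; rewrite ImM.
- exact: integrable_scale.
- exact: integrable_scale.
Qed.

Lemma cintegrable_opp D f : mset D -> cintegrable D f ->
  cintegrable D (fun x => - f x).
Proof.
move=> mD /(cintegrable_scale (-1) mD); apply: eq_cintegrable => // x _.
by rewrite mulN1r.
Qed.
Lemma cintegral_opp D f : mset D -> cintegrable D f ->
  cintegral D (fun x => - f x) = - cintegral D f.
Proof.
move=> mD fi; rewrite -mulN1r -cintegral_scale //; apply: eq_cintegral => x _.
by rewrite mulN1r.
Qed.
Lemma cintegrable_sub D f g : mset D -> cintegrable D f ->
  cintegrable D g -> cintegrable D (fun x => f x - g x).
Proof. by move=> mD fi gi; apply: cintegrable_add => //; exact: cintegrable_opp. Qed.
Lemma cintegral_sub D f g : mset D -> cintegrable D f ->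
  cintegrable D g ->
  cintegral D (fun x => f x - g x) = cintegral D f - cintegral D g.
Proof.
by move=> mD fi gi; rewrite cintegral_add ?cintegral_opp //; exact: cintegrable_opp.
Qed.

(** Real and imaginary part are estimated separately, which costs the factor 2
    and avoids rotating the integral onto the positive axis. *)
Lemma cintegral_le D M f : mset D -> cintegrable D f ->
  mu.-integrable D (EFin \o M) -> (forall x, D x -> cmod (f x) <= M x) ->
  cmod (cintegral D f) <= 2 * \int[mu]_(x in D) M x.
Proof.
move=> mD [f1 f2] iM fM; apply: cmod_le2.
  rewrite Re_cintegral (le_trans (le_normr_Rintegral mD f1)) //.
  apply: le_Rintegral => //.
    by have := integrable_abse f1; apply: eq_integrable.
  by move=> x Dx; exact: le_trans (Re_le_cmod _) (fM _ Dx).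
rewrite Im_cintegral (le_trans (le_normr_Rintegral mD f2)) //.
apply: le_Rintegral => //.
  by have := integrable_abse f2; apply: eq_integrable.
by move=> x Dx; exact: le_trans (Im_le_cmod _) (fM _ Dx).
Qed.

Definition ccvg (u : nat -> C) (l : C) : Prop :=
  (Re (u n) @[n --> \oo] --> Re l) /\ (Im (u n) @[n --> \oo] --> Im l).

Lemma ccvgP (u : nat -> C) l : (forall e : R, 0 < e ->
  \forall n \near \oo, cmod (u n - l) <= e) -> ccvg u l.
Proof.
move=> h; split; apply/cvgrPdist_le => e e0; near=> n.
  have : cmod (u n - l) <= e by near: n; exact: h.
  by rewrite distrC; apply: le_trans; rewrite -ReN -ReD Re_le_cmod.
have : cmod (u n - l) <= e by near: n; exact: h.
by rewrite distrC; apply: le_trans; rewrite -ImN -ImD Im_le_cmod.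
Unshelve. all: by end_near. Qed.

Lemma ccvg_ge (u : nat -> C) l (e : R) : ccvg u l -> 0 < e ->
  \forall n \near \oo, cmod (u n - l) <= e.
Proof.
move=> [h1 h2] e0; have e2 : 0 < e / 2 by rewrite divr_gt0.
near=> n; have -> : e = 2 * (e / 2) by field.
apply: cmod_le2; rewrite !ReImE distrC; near: n.
  by move/cvgrPdist_le : h1; exact.
by move/cvgrPdist_le : h2; exact.
Unshelve. all: by end_near. Qed.

Lemma ccvg_uniq (u : nat -> C) l l' : ccvg u l -> ccvg u l' -> l = l'.
Proof.
move=> [a b] [c d]; apply: cplx_ext; first exact: (cvg_unique _ a c).
exact: (cvg_unique _ b d).
Qed.


Lemma ccvg_dom D M (u : nat -> R -> C) f : mset D ->
  (forall n, cmeasR D (u n)) -> cmeasR D f ->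
  mu.-integrable D (EFin \o M) ->
  (forall n x, D x -> cmod (u n x) <= M x) ->
  (forall x, D x -> ccvg (u ^~ x) (f x)) ->
  ccvg (fun n => cintegral D (u n)) (cintegral D f).
Proof.
move=> mD mu_ mf iM uM uf.
have aux (U : nat -> R -> R) (F : R -> R) : (forall n, @measurable_fun _ _ mR _ D (U n)) ->
    @measurable_fun _ _ mR _ D F -> (forall n x, D x -> `|U n x| <= M x) ->
    (forall x, D x -> U n x @[n --> \oo] --> F x) ->
    \int[mu]_(x in D) U n x @[n --> \oo] --> \int[mu]_(x in D) F x.
  move=> mU mF UM UF.
  have [] := @dominated_convergence _ _ _ mu D mD (fun n => EFin \o U n)
    (EFin \o F) (EFin \o M).
  - by move=> n; exact/measurable_EFinP.
  - exact/measurable_EFinP.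
  - by apply: aeW => x Dx; apply: cvg_EFin; [exact: nearW|exact: UF].
  - exact: iM.
  - by apply: aeW => x n Dx; rewrite lee_fin UM.
  move=> iF _ h; apply: fine_cvg; rewrite fineK //.
  exact: integrable_fin_num.
split; apply: aux.
- by move=> n; have [] := mu_ n.
- by have [] := mf.
- by move=> n x Dx; exact: le_trans (Re_le_cmod _) (uM _ _ Dx).
- by move=> x /uf[].
- by move=> n; have [] := mu_ n.
- by have [] := mf.
- by move=> n x Dx; exact: le_trans (Im_le_cmod _) (uM _ _ Dx).
- by move=> x /uf[].
Qed.

End ComplexIntegral.

(** * The fundamental theorem of calculus and substitution *)

Notation mset D := (@measurable _ (measurableTypeR _) D).
Notation cmeasR D f := (@cmeas _ _ (measurableTypeR _) D f).

Section FTC.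
Context {R : realType}.
Local Notation C := (Cplx R).
Local Notation mu := (@lebesgue_measure R).
Implicit Types f g : R -> C.

Lemma is_derive_continuous (h h1 : R -> R) :
  (forall t : R, is_derive t 1 h (h1 t)) -> continuous h.
Proof.
move=> dh t; apply: differentiable_continuous; apply/derivable1_diffP.
by have [] := dh t.
Qed.

Lemma RintegralFTC (h h1 : R -> R) (a b : R) : a <= b ->
  (forall t : R, is_derive t 1 h (h1 t)) -> continuous h1 ->
  \int[mu]_(t in `[a, b]) h1 t = h b - h a.
Proof.
rewrite le_eqVlt => /predU1P[->|ab] dh ch.
  by rewrite set_itv1 Rintegral_set1 subrr.
have ch0 := is_derive_continuous dh.
rewrite /Rintegral (@continuous_FTC2 R h1 h a b ab) //.
- exact: continuous_subspaceT.
- split.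
  + by move=> t _; have [] := dh t.
  + by apply: cvg_at_right_filter; exact: ch0.
  + by apply: cvg_at_left_filter; exact: ch0.
- by move=> t _; rewrite derive1E; have [_ ->] := dh t.
Qed.

Lemma cintegrable_itv f (a b : R) : (forall t, rcont CofR f t) ->
  cintegrable `[a, b] f.
Proof.
move=> cf; split; apply: continuous_compact_integrable;
  [exact: segment_compact| |exact: segment_compact|];
  apply: continuous_subspaceT; apply: rcont_continuous => t.
  exact: rcont_Re.
exact: rcont_Im.
Qed.

Lemma cintegral_FTC f f1 (a b : R) : a <= b ->
  (forall t, rderiv CofR f t (f1 t)) -> (forall t, rcont CofR f1 t) ->
  cintegral `[a, b] f1 = f b - f a.
Proof.
move=> ab df cf; apply: cplx_ext.
  rewrite Re_cintegral ReD ReN.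
  apply: (@RintegralFTC (fun t => Re (f t)) (fun t => Re (f1 t)) a b ab) => [t|].
    exact: rderiv_Re.
  by apply: rcont_continuous => t; exact: rcont_Re.
rewrite Im_cintegral ImD ImN.
apply: (@RintegralFTC (fun t => Im (f t)) (fun t => Im (f1 t)) a b ab) => [t|].
  exact: rderiv_Im.
by apply: rcont_continuous => t; exact: rcont_Im.
Qed.

Lemma nat_gt (x : R) : \forall n \near \oo, x <= n%:R.
Proof.
near=> n; rewrite (le_trans (ler_norm x)) // ltW //.
by near: n; exact: nbhs_infty_gtr.
Unshelve. all: by end_near. Qed.

(** Cutting f off outside an interval that grows to D does not change the
    limit of the integrals. *)
Lemma ccvg_exhaust (D : set R) (E : nat -> set R) f : mset D ->
  (forall n, mset (E n)) -> (forall n, E n `<=` D) ->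
  (forall x, D x -> \forall n \near \oo, E n x) -> cintegrable D f ->
  ccvg (fun n => cintegral (E n) f) (cintegral D f).
Proof.
move=> mD mE ED DE [f1 f2].
have aux (F : R -> R) : mu.-integrable D (EFin \o F) ->
    \int[mu]_(x in E n) F x @[n --> \oo] --> \int[mu]_(x in D) F x.
  move=> iF.
  have EE n : \int[mu]_(x in E n) F x = \int[mu]_(x in D) (F \_ (E n)) x.
    by rewrite -Rintegral_mkcondr; congr (Rintegral mu _ F); rewrite setIidr.
  under eq_fun do rewrite EE.
  have [mF _] := integrableP _ _ _ iF.
  have [] := @dominated_convergence _ _ _ mu D mD (fun n => EFin \o (F \_ (E n)))
    (EFin \o F) (fun x => `|(EFin \o F) x|%E).
  - move=> n; apply/measurable_EFinP; apply/measurable_restrict => //.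
    by apply/measurable_EFinP; apply: measurable_funS mF => //; exact: subIsetl.
  - exact: mF.
  - apply: aeW => x Dx; apply: cvg_near_cst; have := DE x Dx.
    by apply: filterS => n Enx; rewrite /= patchE mem_set.
  - exact: integrable_abse.
  - by apply: aeW => x n Dx; rewrite /= patchE; case: ifP => // _; rewrite lee_fin normr0.
  move=> _ _ h; apply: fine_cvg; rewrite fineK //.
  exact: integrable_fin_num.
by split; exact: aux.
Qed.


Definition vanish_pinfty f := forall e : R, 0 < e ->
  exists B : R, forall t, B <= t -> cmod (f t) <= e.
Definition vanish_ninfty f := forall e : R, 0 < e ->
  exists B : R, forall t, t <= B -> cmod (f t) <= e.

Lemma cintegral_FTC_pinfty f f1 (a : R) :
  (forall t, rderiv CofR f t (f1 t)) -> (forall t, rcont CofR f1 t) ->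
  cintegrable `[a, +oo[ f1 -> vanish_pinfty f ->
  cintegral `[a, +oo[ f1 = - f a.
Proof.
move=> df cf ci f0.
have A : ccvg (fun n => cintegral `[a, a + n%:R] f1) (cintegral `[a, +oo[ f1).
  apply: ccvg_exhaust => //.
  - by move=> n x; rewrite /= !in_itv/= => /andP[->].
  - move=> x; rewrite /= in_itv/= andbT => ax.
    by have := nat_gt (x - a); apply: filterS => n; rewrite in_itv/= ax; lra.
apply: (ccvg_uniq A); apply: ccvgP => e e0; have [B hB] := f0 _ e0.
have := nat_gt (B - a); apply: filterS => n hn.
rewrite (cintegral_FTC _ df cf) ?lerDl ?ler0n // opprK subrK hB //; lra.
Qed.

Lemma cintegral_FTC_ninfty f f1 (a : R) :
  (forall t, rderiv CofR f t (f1 t)) -> (forall t, rcont CofR f1 t) ->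
  cintegrable `]-oo, a] f1 -> vanish_ninfty f ->
  cintegral `]-oo, a] f1 = f a.
Proof.
move=> df cf ci f0.
have A : ccvg (fun n => cintegral `[a - n%:R, a] f1) (cintegral `]-oo, a] f1).
  apply: ccvg_exhaust => //.
  - by move=> n x; rewrite /= !in_itv/= => /andP[_ ->].
  - move=> x; rewrite /= in_itv/= => ax.
    by have := nat_gt (a - x); apply: filterS => n; rewrite in_itv/= ax andbT; lra.
apply: (ccvg_uniq A); apply: ccvgP => e e0; have [B hB] := f0 _ e0.
have := nat_gt (a - B); apply: filterS => n hn.
rewrite (cintegral_FTC _ df cf) ?gerBl ?ler0n // addrAC subrr sub0r cmodN hB //; lra.
Qed.

Lemma cintegral_FTC_line f f1 :
  (forall t, rderiv CofR f t (f1 t)) -> (forall t, rcont CofR f1 t) ->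
  cintegrable setT f1 -> vanish_pinfty f -> vanish_ninfty f ->
  cintegral setT f1 = 0.
Proof.
move=> df cf ci f0 f0'.
have A : ccvg (fun n => cintegral `[- n%:R, n%:R] f1) (cintegral setT f1).
  apply: ccvg_exhaust => //.
  move=> x _; have := nat_gt `|x|; apply: filterS => n.
  by rewrite /= in_itv/= ler_norml.
apply: (ccvg_uniq A); apply: ccvgP => e e0; have e2 : 0 < e / 2 by rewrite divr_gt0.
have [B hB] := f0 _ e2; have [B' hB'] := f0' _ e2.
near=> n.
have h1 : B <= n%:R by near: n; exact: nat_gt.
have h2 : - B' <= n%:R by near: n; exact: nat_gt.
rewrite (cintegral_FTC _ df cf) ?subr0; last by rewrite (le_trans (y := 0)) ?oppr_le0 ?ler0n.
by have := cmodB (f n%:R) (f (- n%:R)); have := hB _ h1; have := hB' (- n%:R); rewrite lerNl => /(_ h2); lra.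
Unshelve. all: by end_near. Qed.

Lemma cintegral_split f (a : R) : cintegrable setT f ->
  cintegral setT f = cintegral `]-oo, a] f + cintegral `[a, +oo[ f.
Proof.
have E : (setT : set R) = `]-oo, a] `|` `]a, +oo[.
  by apply/seteqP; split => x //= _; rewrite !in_itv/= andbT; case: (leP x a); [left|right].
have dis : [disjoint (`]-oo, a] : set R) & `]a, +oo[].
  by apply/disj_set2P; apply/seteqP; split => x //= []; rewrite !in_itv/= andbT; lra.
move=> [f1 f2].
have aux (F : R -> R) : mu.-integrable setT (EFin \o F) ->
    \int[mu]_t F t = \int[mu]_(t in `]-oo, a]) F t + \int[mu]_(t in `[a, +oo[) F t.
  move=> iF; rewrite {1}E Rintegral_setU // -?E // Rintegral_itv_obnd_cbnd //.
  by apply: integrableS iF.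
by apply: cplx_ext; rewrite ?ReD ?ImD; exact: aux.
Qed.

End FTC.
Section Substitution.
Context {R : realType}.
Local Notation C := (Cplx R).
Local Notation mu := (@lebesgue_measure R).

Section RealSubstitution.
Variables (phi phi1 : R -> R) (E : set R).
Hypothesis dphi : forall t : R, is_derive t 1 phi (phi1 t).
Hypothesis cphi1 : continuous phi1.
Hypothesis phi1_gt0 : forall t, 0 < phi1 t.
Hypothesis Ephi : E = \bigcup_n `[phi (- n%:R), phi n%:R]%classic.

Let phi_ndecr a b : a <= b -> phi a <= phi b.
Proof.
by move=> ab; apply: (@is_derive_ndecr _ phi phi1) => // t _; exact: ltW.
Qed.

Let phi_incr a b : a < b -> phi a < phi b.
Proof.
move=> ab; have [c _ e] := @MVT _ phi phi1 a b ab (fun x _ => dphi x)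
  (continuous_subspaceT (is_derive_continuous dphi)).
by rewrite -subr_gt0 e mulr_gt0 // subr_gt0.
Qed.

(** The substitution theorem for closed intervals; the general case exhausts E
    by the images of [-n, n]. *)
Lemma substitution_itv (G : R -> R) n : (forall t, E t -> {for t, continuous G}) ->
  (\int[mu]_(x in `[(phi (- n%:R))%R, (phi n%:R)%R]) (G x)%:E =
   \int[mu]_(x in `[(- n%:R)%R, (n%:R)%R]) (G (phi x) * phi1 x)%:E)%E.
Proof.
move=> cG; have ch0 := is_derive_continuous dphi.
have d1 : phi^`()%classic = phi1 by apply/funext => t; rewrite derive1E; have [_ ->] := dphi t.
rewrite integration_by_substitution_increasing ?d1 //.
- by rewrite (le_trans (y := 0)) ?oppr_le0 ?ler0n.
- by move=> x y _ _; exact: phi_incr.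
- by apply: cvgP; apply: cvg_at_right_filter; exact: cphi1.
- by apply: cvgP; apply: cvg_at_left_filter; exact: cphi1.
- split.
  + by move=> t _; have [] := dphi t.
  + by apply: cvg_at_right_filter; exact: ch0.
  + by apply: cvg_at_left_filter; exact: ch0.
- apply: continuous_in_subspaceT => t; rewrite inE => tn; apply: cG.
  by rewrite Ephi; exists n.
Qed.

Lemma mset_image : mset E.
Proof. by rewrite Ephi; apply: bigcup_measurable. Qed.

Lemma substitution_R (G : R -> R) : (forall t, E t -> {for t, continuous G}) ->
  mu.-integrable setT (EFin \o (fun t => G (phi t) * phi1 t)) ->
  mu.-integrable E (EFin \o G) /\
  \int[mu]_(t in E) G t = \int[mu]_t (G (phi t) * phi1 t).
Proof.
move=> cG iH.
have mE := mset_image.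
have mn n : mset (`[phi (- n%:R), phi n%:R]%classic : set R) by [].
have nd : nondecreasing_seq (fun n => `[phi (- n%:R), phi n%:R]%classic : set R).
  move=> m n mn'; apply/subsetPset => x; rewrite /= !in_itv/= => /andP[h1 h2].
  have mnR : m%:R <= n%:R :> R by rewrite ler_nat.
  by rewrite (le_trans _ h1) ?(le_trans h2) ?phi_ndecr ?lerN2.
have mGn n : @measurable_fun _ _ (measurableTypeR R) _ `[phi (- n%:R), phi n%:R] G.
  apply: subspace_continuous_measurable_fun => //.
  apply: continuous_in_subspaceT => t; rewrite inE => tn; apply: cG.
  by rewrite Ephi; exists n.
have mG : @measurable_fun _ _ (measurableTypeR R) _ E G.
  by rewrite Ephi; apply/measurable_fun_bigcup.
have iG : mu.-integrable E (EFin \o G).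
  apply/integrableP; split; first exact/measurable_EFinP.
  rewrite Ephi.
  have := @ge0_nondecreasing_set_cvg_integral _ (measurableTypeR R) R (fun n => `[phi (- n%:R), phi n%:R]%classic)
    (fun x => `|(EFin \o G) x|%E) mu nd mn.
  move=> /(_ _ _)/cvg_lim <- //; last first.
    by move=> n; apply: measurableT_comp => //; exact/measurable_EFinP.
  have [_ fin] := integrableP _ _ _ iH.
  apply: le_lt_trans fin.
  apply: lime_le.
    apply: ereal_nondecreasing_is_cvgn.
    apply: ge0_nondecreasing_set_nondecreasing_integral => // n.
    by apply: measurableT_comp => //; exact/measurable_EFinP.
  apply: nearW => n.
  have -> : (\int[mu]_(x in `[(phi (- n%:R))%R, (phi n%:R)%R]) `|(EFin \o G) x| =
     \int[mu]_(x in `[(- n%:R)%R, (n%:R)%R]) (`|G (phi x)| * phi1 x)%:E)%E.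
    rewrite -(@substitution_itv (fun x => `|G x|)) // => t /cG ct.
    by apply: (@continuous_comp _ _ _ G (@Num.norm _ R)) => //; exact: norm_continuous.
  apply: (@le_trans _ _ (\int[mu]_(x in `[(- n%:R)%R, (n%:R)%R]) `|(G (phi x) * phi1 x)%:E|)%E).
    rewrite (_ : (\int[mu]_(x in _) (`|G (phi x)| * phi1 x)%:E =
      \int[mu]_(x in `[(- n%:R)%R, (n%:R)%R]) `|(G (phi x) * phi1 x)%:E|)%E) //.
    by apply: eq_integral => x _; rewrite /= normrM (gtr0_norm (phi1_gt0 x)).
  apply: ge0_subset_integral => //.
  by apply: measurableT_comp => //; have [] := integrableP _ _ _ iH.
split => //.
have A : ccvg (fun n => cintegral `[phi (- n%:R), phi n%:R] (fun t => CofR (G t)))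
    (cintegral E (fun t => CofR (G t))).
  apply: ccvg_exhaust => //.
  - by move=> n x xn; rewrite Ephi; exists n.
  - rewrite Ephi => x [n _ xn]; exists n => // m /= nm.
    by move/subsetPset: (nd _ _ nm); exact.
  - split => //; rewrite /comp /=; apply: (eq_integrable mE (cst 0%E)) => //.
    exact: integrable0.
have B : ccvg (fun n => cintegral `[- n%:R, n%:R] (fun t => CofR (G (phi t) * phi1 t)))
    (cintegral setT (fun t => CofR (G (phi t) * phi1 t))).
  apply: ccvg_exhaust => //.
  - move=> x _; have := nat_gt `|x|; apply: filterS => n.
    by rewrite /= in_itv/= ler_norml.
  - split => //; rewrite /comp /=; apply: (eq_integrable measurableT (cst 0%E)) => //.
    exact: integrable0.
have AB : (fun n => cintegral `[phi (- n%:R), phi n%:R] (fun t => CofR (G t))) =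
   (fun n => cintegral `[- n%:R, n%:R] (fun t => CofR (G (phi t) * phi1 t))).
  apply/funext => n; apply: cplx_ext; rewrite ?Re_cintegral ?Im_cintegral /=.
    by rewrite /Rintegral substitution_itv.
  rewrite /Rintegral !integral0_eq //.
rewrite AB in A.
by have := ccvg_uniq A B => /(congr1 (@Re R)); rewrite !Re_cintegral.
Qed.

Lemma substitution_C (f : R -> C) : (forall t, E t -> rcont CofR f t) ->
  cintegrable setT (fun t => f (phi t) * CofR (phi1 t)) ->
  cintegrable E f /\
  cintegral E f = cintegral setT (fun t => f (phi t) * CofR (phi1 t)).
Proof.
move=> cf [i1 i2].
have cont (g : R -> R) t : rcont CofR (fun s => CofR (g s) : C) t -> {for t, continuous g}.
  move=> h; apply/cvgrPdist_le => e e0; have [r r0 hr] := h _ e0.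
  apply/nbhs_ballP; exists r => //= s; rewrite /ball/= => st.
  by have := hr s; rewrite -!CofRB !cmod_CofR distrC => /(_ st); rewrite distrC.
have [||j1 e1] := @substitution_R (fun t => Re (f t)).
- by move=> t /cf ct; apply: cont; exact: rcont_Re.
- by apply: (eq_integrable measurableT) i1 => t _; rewrite /= ReM Im_CofR mulr0 subr0.
have [||j2 e2] := @substitution_R (fun t => Im (f t)).
- by move=> t /cf ct; apply: cont; exact: rcont_Im.
- by apply: (eq_integrable measurableT) i2 => t _; rewrite /= ImM Im_CofR mulr0 add0r.
split; first by [].
apply: cplx_ext.
  rewrite !Re_cintegral e1; apply: eq_Rintegral => t _.
  by rewrite ReM Im_CofR mulr0 subr0.
rewrite !Im_cintegral e2; apply: eq_Rintegral => t _.
by rewrite ImM Im_CofR mulr0 add0r.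
Qed.
End RealSubstitution.

Lemma rcontP (f : R -> C) t : {for t, continuous (fun s => Re (f s))} ->
  {for t, continuous (fun s => Im (f s))} -> rcont CofR f t.
Proof.
move=> h1 h2 e e0; have e2 : 0 < e / 2 by rewrite divr_gt0.
move/cvgrPdist_le : h1 => /(_ _ e2)/nbhs_ballP[r /= r0 hr].
move/cvgrPdist_le : h2 => /(_ _ e2)/nbhs_ballP[s /= s0 hs].
exists (Num.min r s); first by rewrite lt_min r0.
move=> y; rewrite -CofRB cmod_CofR distrC lt_min => /andP[yr ys].
have -> : e = 2 * (e / 2) by field.
apply: cmod_le2; rewrite !ReImE distrC; first exact: hr.
exact: hs.
Qed.

Lemma cintegrable_translate (f : R -> C) (c : R) :
  (forall t, rcont CofR f t) -> cintegrable setT (fun t => f (t + c)) ->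
  cintegrable setT f /\ cintegral setT f = cintegral setT (fun t => f (t + c)).
Proof.
move=> cf fi.
have e t : f (t + c) = f (t + c) * CofR 1 by rewrite CofR1 mulr1.
have [||||||i ->] := @substitution_C (fun t => t + c) (fun=> 1) setT _ _ _ _ f.
- move=> t; have := is_deriveD (is_derive_id t 1) (is_derive_cst c t 1).
  by rewrite addr0.
- by move=> t; exact: cvg_cst.
- by [].
- apply/seteqP; split => // x _.
  have [n _ hn] := nat_gt (`|x - c|).
  exists n => //=; rewrite in_itv/=; have := hn n (leqnn n); rewrite ler_norml; lra.
- by move=> t _; exact: cf.
- by apply: eq_cintegrable fi.
by split => //; apply: eq_cintegral => t _; rewrite -e.
Qed.

End Substitution.

(** * Exponential domination, Cauchy formula and Taylor expansion *)

Section Domination.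
Context {R : realType}.
Local Notation C := (Cplx R).
Local Notation mu := (@lebesgue_measure R).
Local Notation mR := (measurableTypeR R).

Definition expabs (k u : R) : R := expR (- (k * `|u|)).

Lemma expabs_ge0 k u : 0 <= expabs k u. Proof. exact: expR_ge0. Qed.

Lemma expR_to0 (k : R) : 0 < k -> expR (- (k * x)) @[x --> +oo%R] --> (0 : R).
Proof.
move=> k0; apply/cvgrPdist_le => e e0.
near=> x; rewrite sub0r normrN ger0_norm ?expR_ge0 // -[leRHS]lnK ?posrE // ler_expR.
rewrite lerNl mulrC -ler_pdivrMr //; near: x; exact: nbhs_pinfty_ge.
Unshelve. all: by end_near. Qed.

Lemma continuous_expabs (k : R) : continuous (expabs k).
Proof.
move=> x; apply: (@continuous_comp _ _ _ (fun u => - (k * `|u|)) expR); last exact: continuous_expR.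
apply: cvgN; apply: cvgM; [exact: cvg_cst|exact: norm_continuous].
Qed.

Lemma integrable_expabs (k : R) : 0 < k -> mu.-integrable setT (EFin \o expabs k).
Proof.
move=> k0; have mE := continuous_measurable_fun (continuous_expabs (k := k)).
apply/integrableP; split; first exact/measurable_EFinP.
under eq_integral do rewrite /= ger0_norm ?expabs_ge0 //.
rewrite ge0_symfun_integralT.
- rewrite -set_itvcy.
  rewrite (_ : (\int[mu]_(x in `[0%R, +oo[) (expabs k x)%:E = \int[mu]_(x in `[0%R, +oo[) (expR (- (k * x)))%:E)%E); last first.
    by apply: eq_integral => x; rewrite inE /= in_itv/= andbT => x0; rewrite /expabs ger0_norm.
  have dF (x : R) : is_derive x 1 (fun x => - (k^-1 * expR (- (k * x)))) (expR (- (k * x))).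
    have h1 : is_derive x 1 (fun x => - (k * x)) (- k).
      by have := is_deriveN (is_derive_mull k x).
    have h2 : is_derive x 1 (fun x => expR (- (k * x))) (expR (- (k * x)) * - k).
      exact: (@is_derive1_comp R expR (fun x => - (k * x)) x _ _ (is_derive_expR _) h1).
    have h3 := is_deriveZ k^-1 h2.
    have := is_deriveN h3; congr is_derive.
    by rewrite /GRing.scale/=; field; rewrite gt_eqF.
  rewrite (@ge0_continuous_FTC2y R (fun x => expR (- (k * x))) (fun x => - (k^-1 * expR (- (k * x)))) 0 0).
  + by rewrite ltey.
  + by move=> x _; exact: expR_ge0.
  + apply: continuous_subspaceT => x.
    apply: (@continuous_comp _ _ _ (fun u => - (k * u)) expR); last exact: continuous_expR.
    by apply: cvgN; apply: cvgM; [exact: cvg_cst|exact: cvg_id].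
  + rewrite -oppr0 -(mulr0 k^-1); apply: cvgN; apply: cvgM; [exact: cvg_cst|exact: expR_to0].
  + by move=> x _; have [] := dF x.
  + by apply: cvg_at_right_filter; exact: (is_derive_continuous dF).
  + by move=> x _; rewrite derive1E; have [_ ->] := dF x.
- by move=> x; exact: expabs_ge0.
- exact: continuous_expabs.
- by move=> x; rewrite /= /expabs normrN.
Qed.

Lemma cint_expabs (D : set R) (K k : R) (f : R -> C) : mset D -> 0 < k -> cmeasR D f ->
  (forall x, D x -> cmod (f x) <= K * expabs k x) -> cintegrable D f.
Proof.
move=> mD k0 mf fK; apply: (cint_dom mD mf _ fK).
by apply: integrable_scale => //; apply: integrableS (integrable_expabs k0) => //.
Qed.

Lemma cintegral_expabs_le (D : set R) (k : R) : mset D -> 0 < k -> exists2 B : R, 0 <= B &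
  forall (f : R -> C) (K : R), cmeasR D f ->
  (forall x, D x -> cmod (f x) <= K * expabs k x) -> cmod (cintegral D f) <= K * B.
Proof.
move=> mD k0; exists (2 * \int[mu]_(x in D) expabs k x).
  by rewrite mulr_ge0 // Rintegral_ge0 // => x _; exact: expabs_ge0.
move=> f K mf fK; have iE : mu.-integrable D (EFin \o expabs k) by apply: integrableS (integrable_expabs k0) => //.
rewrite (le_trans (cintegral_le mD _ (integrable_scale K mD iE) fK)) //.
  exact: cint_expabs fK.
by rewrite RintegralZl // mulrCA.
Qed.

Lemma cFubini (F : R -> R -> C) (M N : R -> R) :
  cmeas setT (fun xy : mR * mR => F xy.1 xy.2) ->
  mu.-integrable setT (EFin \o M) -> mu.-integrable setT (EFin \o N) ->
  (forall x y, cmod (F x y) <= M x * N y) ->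
  cintegrable setT (fun x => cintegral setT (F x)) /\
   cintegral setT (fun x => cintegral setT (F x)) =
   cintegral setT (fun y => cintegral setT (F ^~ y)).
Proof.
move=> [m1 m2] iM iN FMN.
have aux (G : R -> R -> R) : measurable_fun setT (fun xy : mR * mR => G xy.1 xy.2) ->
    (forall x y, `|G x y| <= M x * N y) ->
    mu.-integrable setT (EFin \o (fun x => \int[mu]_y G x y)) /\
     \int[mu]_x \int[mu]_y G x y = \int[mu]_y \int[mu]_x G x y.
  move=> mG GMN.
  have mG' : measurable_fun setT (fun xy : mR * mR => (G xy.1 xy.2)%:E) by exact/measurable_EFinP.
  have ia : mu.-integrable setT (EFin \o (fun x => `|M x|)).
    by have := integrable_abse iM; apply: eq_integrable.
  have ib : mu.-integrable setT (EFin \o (fun x => `|N x|)).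
    by have := integrable_abse iN; apply: eq_integrable.
  have GMN' x y : `|G x y| <= `|M x| * `|N y|.
    by rewrite (le_trans (GMN x y)) // -normrM ler_norm.
  have iy x : mu.-integrable setT (EFin \o (fun y => G x y)).
    apply: (@integrable_le _ _ (fun y => `|M x| * `|N y|)) => //.
      apply: (@measurableT_comp _ _ _ _ _ _ (fun xy : mR * mR => G xy.1 xy.2) _ (fun y : mR => (x, y))). 
        done.
      exact: pair1_measurable.
    exact: integrable_scale.
  have ix y : mu.-integrable setT (EFin \o (fun x => G x y)).
    apply: (@integrable_le _ _ (fun x => `|N y| * `|M x|)) => //.
    - apply: (@measurableT_comp _ _ _ _ _ _ (fun xy : mR * mR => G xy.1 xy.2) _ (fun x : mR => (x, y))).
        done.
      exact: pair2_measurable.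
    - exact: integrable_scale.
    - by move=> x _; rewrite mulrC.
  have Ey x : (\int[mu]_y (G x y)%:E = (\int[mu]_y G x y)%:E)%E.
    by rewrite /Rintegral fineK //; apply: integrable_fin_num (iy x).
  have Ex y : (\int[mu]_x (G x y)%:E = (\int[mu]_x G x y)%:E)%E.
    by rewrite /Rintegral fineK //; apply: integrable_fin_num (ix y).
  have iG : (mu \x mu)%E.-integrable setT (fun xy : mR * mR => (G xy.1 xy.2)%:E).
    apply/(@integrable12ltyP _ _ _ _ R mu mu _ mG').
    apply: (@le_lt_trans _ _ (\int[mu]_x (`|M x| * \int[mu]_y `|N y|)%:E)%E).
      apply: ge0_le_integral => //.
      - by move=> x _; apply: integral_ge0.
      - refine (@measurable_fun_fubini_tonelli_F _ _ mR mR R mu (fun xy : mR * mR => `|(G xy.1 xy.2)%:E|%E) _ _) => //.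
        exact: measurableT_comp.
      - apply/measurable_EFinP; apply: measurable_funM => //.
        by have [/measurable_EFinP] := integrableP _ _ _ ia.
      move=> x _ /=; rewrite -[X in (_ <= X)%E]/((fun z => z%:E) _).
      rewrite -RintegralZl // /Rintegral. rewrite fineK; last first.
        apply: (integrable_fin_num measurableT (integrable_scale `|M x| measurableT ib)).
      apply: ge0_le_integral => //.
      - apply: measurableT_comp => //; apply: measurableT_comp => //.
        by have [/measurable_EFinP] := integrableP _ _ _ (iy x).
      - by have [] := integrableP _ _ _ (integrable_scale `|M x| measurableT ib).
      - by move=> y _; rewrite lee_fin.
    have h := integrable_lty measurableT (integrable_scale (\int[mu]_y `|N y|) measurableT ia).
    apply: le_lt_trans h.
    by rewrite le_eqVlt; apply/orP; left; apply/eqP; apply: eq_integral => x _; rewrite /= mulrC.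
  split.
  - have := integrable_fubini_F iG; apply: eq_integrable => // x _.
    by rewrite /fubini_F /= Ey.
  - have := Fubini iG; rewrite /=.
    under eq_integral do rewrite Ey.
    under [X in _ = X -> _]eq_integral do rewrite Ex.
    by rewrite /Rintegral => ->.
have [a1 c1] := aux _ m1 (fun x y => le_trans (Re_le_cmod _) (FMN x y)).
have [a2 c2] := aux _ m2 (fun x y => le_trans (Im_le_cmod _) (FMN x y)).
by split; [split|apply: cplx_ext].
Qed.

End Domination.
Section Cauchy.
Context {R : realType}.
Local Notation C := (Cplx R).
Local Notation mu := (@lebesgue_measure R).

(** A continuous function is bounded on the compact square around the disc. *)
Lemma disc_bounded (f : C -> C) (x : C) (r : R) : 0 < r ->
  (forall z, cmod (z - x) < 2 * r -> rcont id f z) ->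
  exists2 L : R, 0 <= L & forall z, cmod (z - x) <= r -> cmod (f z) <= L.
Proof.
move=> r0 cf.
pose g (p : R * R) : R := cmod (f (x + (CofR p.1 + iC * CofR p.2))).
pose A := (`[- r, r]%classic `*` `[- r, r]%classic) : set (R * R).
have cA : compact A by apply: compact_setX; exact: segment_compact.
have A0 : A !=set0 by exists (0, 0); split; rewrite /= in_itv/= oppr_le0 (ltW r0).
have cg : {within A, continuous g}.
  apply: continuous_in_subspaceT => -[s t]; rewrite inE => -[/= sr tr].
  rewrite !in_itv/= -!ler_norml in sr tr.
  have inb : cmod (x + (CofR s + iC * CofR t) - x) < 2 * r.
    rewrite addrAC subrr add0r -(@ltr_pXn2r _ 2) ?nnegrE ?cmod_ge0 ?mulr_ge0 ?ltW //.
    have -> : cmod (CofR s + iC * CofR t) ^+ 2 = s ^+ 2 + t ^+ 2.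
      by rewrite cmod_sqr !ReImE; ring.
    have : s ^+ 2 <= r ^+ 2 by rewrite -[s ^+ 2]real_normK ?num_real // ler_pXn2r ?nnegrE // ltW.
    have : t ^+ 2 <= r ^+ 2 by rewrite -[t ^+ 2]real_normK ?num_real // ler_pXn2r ?nnegrE // ltW.
    have : 0 < r ^+ 2 by rewrite exprn_gt0.
    rewrite exprMn; lra.
  apply/cvgrPdist_le => e e0; have [d d0 hd] := cf _ inb _ e0.
  have d4 : 0 < d / 4 by rewrite divr_gt0.
  exists (ball s (d / 4), ball t (d / 4)); first by split; exact: nbhsx_ballx.
  move=> -[s' t'] [/= h1 h2]; rewrite /ball/= in h1 h2.
  have near : cmod (x + (CofR s' + iC * CofR t') - (x + (CofR s + iC * CofR t))) < d.
    have -> : x + (CofR s' + iC * CofR t') - (x + (CofR s + iC * CofR t)) =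
      CofR (s' - s) + iC * CofR (t' - t) by rewrite !CofRB; ring.
    apply: le_lt_trans (cmodD _ _) _; rewrite cmodM cmod_iC mul1r !cmod_CofR.
    by rewrite distrC (distrC t'); lra.
  have := hd _ near; rewrite /g /=; move: (f _) (f _) => a b ab.
  rewrite ler_norml; have := cmodD (a - b) b; have := cmodD (b - a) a.
  by have := cmodBC b a; rewrite !subrK; lra.
have [p Ap mp] := compact_EVT_max A0 cA cg.
exists (g p); first exact: cmod_ge0.
move=> z zr; have := mp (Re (z - x), Im (z - x)).
rewrite /g /= -CE (addrC x) subrK; apply.
rewrite inE; split; rewrite /= in_itv/= -ler_norml.
  exact: le_trans (Re_le_cmod _) zr.
exact: le_trans (Im_le_cmod _) zr.
Qed.

(** Differentiation under the integral sign: as a function of l the integral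
    has derivative zero. *)
Lemma cintegral_const (G G1 : R -> R -> C) (u v a b L l1 l2 : R) :
  (forall l, u < l < v -> forall t, a <= t <= b -> rderiv CofR (G ^~ t) l (G1 l t)) ->
  (forall l, u < l < v -> cintegrable `[a, b] (G l)) ->
  (forall l, u < l < v -> forall t, a <= t <= b -> cmod (G1 l t) <= L) ->
  (forall l, u < l < v -> cintegral `[a, b] (G1 l) = 0) ->
  u < l1 -> l1 <= l2 -> l2 < v ->
  cintegral `[a, b] (G l1) = cintegral `[a, b] (G l2).
Proof.
move=> dG iG GL G0 ul l12 lv.
have aux (F F1 : R -> R -> R) :
    (forall l, u < l < v -> forall t, a <= t <= b -> is_derive l 1 (F ^~ t) (F1 l t)) ->
    (forall l, u < l < v -> mu.-integrable `[a, b] (EFin \o F l)) ->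
    (forall l, u < l < v -> forall t, a <= t <= b -> `|F1 l t| <= L) ->
    (forall l, u < l < v -> \int[mu]_(t in `[a, b]) F1 l t = 0) ->
    \int[mu]_(t in `[a, b]) F l1 t = \int[mu]_(t in `[a, b]) F l2 t.
  move=> dF iF FL F0.
  have dI (l : R) : u < l < v -> is_derive l 1 (fun l => \int[mu]_(t in `[a, b]) F l t) 0.
    move=> luv.
    have L0 : forall y : R, 0 <= Num.max 0 L by move=> _; rewrite le_max lexx.
    have iL : mu.-integrable `[a, b] (EFin \o (fun=> Num.max 0 L)).
      by apply: continuous_compact_integrable; [exact: segment_compact|apply: continuous_subspaceT => ?; exact: cvg_cst].
    have h1 : forall l, `]u, v[%classic l -> mu.-integrable `[a, b] (EFin \o F l).
      by move=> k; rewrite /= in_itv/= => /iF.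
    have h2 : forall l t, `]u, v[%classic l -> `[a, b]%classic t -> derivable (F ^~ t) l 1.
      by move=> k t; rewrite /= !in_itv/= => kuv tab; have [] := dF _ kuv _ tab.
    have d1E k t : u < k < v -> a <= t <= b -> partial1of2 F k t = F1 k t.
      by move=> kuv tab; rewrite partial1of2E; have [_ ->] := dF _ kuv _ tab.
    have h3 : forall l t, `]u, v[%classic l -> `[a, b]%classic t -> `|partial1of2 F l t| <= Num.max 0 L.
      move=> k t; rewrite /= !in_itv/= => kuv tab; rewrite d1E // le_max.
      by rewrite (FL _ kuv _ tab) orbT.
    have luv' : `]u, v[%classic l by rewrite /= in_itv.
    have mab : mset (`[a, b]%classic : set R) by [].
    have D := @derivable_under_integral R _ _ mu F _ mab l u v luv' h1 h2 _ L0 iL h3.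
    have E := @differentiation_under_integral R _ _ mu F _ mab l u v luv' h1 h2 _ L0 iL h3.
    apply: DeriveDef; first exact: D.
    rewrite -derive1E E -(F0 l luv); apply: eq_Rintegral => t.
    by rewrite inE /= in_itv/= => tab; rewrite -(d1E _ _ luv tab).
  apply/eqP; rewrite eq_sym -subr_eq0; apply/eqP.
  have [||c _ ->] := @MVT_segment R (fun l => \int[mu]_(t in `[a, b]) F l t) (fun=> 0) l1 l2 l12.
  - by move=> l; rewrite in_itv/= => /andP[h1 h2]; apply: dI; rewrite (lt_trans ul h1) (lt_trans h2 lv).
  - apply: derivable_within_continuous => l; rewrite in_itv/= => /andP[h1 h2].
    by have [] := dI l _; rewrite // (lt_le_trans ul h1) (le_lt_trans h2 lv).
  - by rewrite mul0r.
apply: cplx_ext; rewrite ?Re_cintegral ?Im_cintegral.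
  apply: (aux (fun l t => Re (G l t)) (fun l t => Re (G1 l t))).
  - by move=> l luv t tab; exact: rderiv_Re (dG _ luv _ tab).
  - by move=> l /iG[].
  - by move=> l luv t tab; exact: le_trans (Re_le_cmod _) (GL _ luv _ tab).
  - by move=> l /G0/(congr1 (@Re R)).
apply: (aux (fun l t => Im (G l t)) (fun l t => Im (G1 l t))).
- by move=> l luv t tab; exact: rderiv_Im (dG _ luv _ tab).
- by move=> l /iG[].
- by move=> l luv t tab; exact: le_trans (Im_le_cmod _) (GL _ luv _ tab).
- by move=> l /G0/(congr1 (@Im R)).
Qed.

Definition cis (t : R) : C := cexp (iC * CofR t).

Lemma cmod_cis t : cmod (cis t) = 1.
Proof. by rewrite /cis cmod_cexp !ReImE mul0r mul1r subr0 expR0. Qed.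
Lemma cis_neq0 t : cis t != 0. Proof. exact: cexp_neq0. Qed.
Lemma rderiv_cis t : rderiv CofR cis t (iC * cis t).
Proof.
have := rderiv_cexp_line iC t; rewrite [X in rderiv _ _ _ X]mulrC.
rewrite (mulrC _ iC) -/(cis t); apply: rderiv_ext => s.
by rewrite mulrC.
Qed.
Lemma rcont_cis t : rcont CofR cis t.
Proof. exact: rderiv_cont (rderiv_cis t). Qed.
Lemma cis0 : cis 0 = 1.
Proof. by rewrite /cis CofR0 mulr0 cexp0. Qed.
Lemma cis_2pi : cis (2 * pi) = 1.
Proof.
by apply: cplx_ext; rewrite /cis /= ?mul0r ?mulr0 ?mul1r ?subr0 ?addr0 ?add0r expR0 mul1r
  mulr_natl ?cos2pi ?sin2pi.
Qed.

End Cauchy.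
Section CauchyFormula.
Context {R : realType}.
Local Notation C := (Cplx R).
Local Notation mu := (@lebesgue_measure R).

Lemma iC_neq0 : (iC : C) != 0. Proof. by rewrite -cmod_gt0 cmod_iC. Qed.

Lemma pi2_ge0 : 0 <= 2 * pi :> R.
Proof. by rewrite mulr_ge0 // pi_ge0. Qed.

Lemma cintegral_periodic (f f1 : R -> C) : (forall t, rderiv CofR f t (f1 t)) ->
  (forall t, rcont CofR f1 t) -> f (2 * pi) = f 0 -> cintegral `[0, 2 * pi] f1 = 0.
Proof. by move=> df cf per; rewrite (cintegral_FTC pi2_ge0 df cf) per subrr. Qed.

Lemma cintegral_cst1 (a b : R) : a <= b -> cintegral `[a, b] (fun=> 1) = CofR (b - a) :> C.
Proof.
move=> ab; rewrite (@cintegral_FTC _ CofR (fun=> 1)) //; first by rewrite CofRB.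
  by move=> t; exact: rderiv_id.
by move=> t; exact: rcont_cst.
Qed.

Section Kernel.
Variables (r : R) (v : C).
Hypotheses (r0 : 0 < r) (vr : cmod v <= r / 2).

Lemma kernel_lb (l t : R) : `|l| <= 3 / 2 -> r / 4 <= cmod (CofR r * cis t - CofR l * v).
Proof.
move=> l32; have := cmod_lbD (CofR r * cis t) (- (CofR l * v)).
rewrite cmodN !cmodM !cmod_CofR cmod_cis mulr1 gtr0_norm //.
have : `|l| * cmod v <= 3 / 2 * (r / 2) by rewrite ler_pM ?cmod_ge0.
lra.
Qed.

Lemma kernel_neq0 (l t : R) : `|l| <= 3 / 2 -> CofR r * cis t - CofR l * v != 0.
Proof. by move=> /kernel_lb h; rewrite -cmod_gt0; apply: lt_le_trans (h t); rewrite divr_gt0. Qed.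

Lemma rderiv_circle (t : R) : rderiv CofR (fun s => CofR r * cis s) t (CofR r * (iC * cis t)).
Proof. by apply: rderiv_scale; exact: rderiv_cis. Qed.

(** Shrink v to l v: the l-derivative of the kernel is the t-derivative of a
    periodic function, so the integral is that for l = 0. *)
Lemma kernel_integral :
  cintegral `[0, 2 * pi] (fun t => CofR r * cis t / (CofR r * cis t - v)) = CofR (2 * pi).
Proof.
pose G (l t : R) := CofR r * cis t / (CofR r * cis t - CofR l * v).
pose G1 (l t : R) := CofR r * cis t * v / (CofR r * cis t - CofR l * v) ^+ 2.
have lb (l : R) : - (1 / 4) < l < 5 / 4 -> `|l| <= 3 / 2 by rewrite ler_norml; lra.
have cden (l t : R) : `|l| <= 3 / 2 -> rcont CofR (fun t => (CofR r * cis t - CofR l * v)^-1) t.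
  move=> hl; apply: (@rcont_comp R R CofR (fun t => CofR r * cis t - CofR l * v) (fun z => z^-1)).
    exact: rderiv_cont (rderiv_inv (kernel_neq0 t hl)).
  apply: rcont_add; last exact: rcont_cst.
  exact: rderiv_cont (rderiv_circle t).
have cG1 (l t : R) : `|l| <= 3 / 2 -> rcont CofR (G1 l) t.
  move=> hl; rewrite /G1; under eq_fun do rewrite -exprVn expr2.
  apply: rcont_mul; last by apply: rcont_mul; exact: cden.
  apply: rcont_mul; last exact: rcont_cst.
  exact: rderiv_cont (rderiv_circle t).
have -> : (fun t => CofR r * cis t / (CofR r * cis t - v)) = G 1.
  by apply/funext => t; rewrite /G CofR1 mul1r.
have I0 : - (1 / 4) < 0 :> R by lra.
have I1 : 1 < 5 / 4 :> R by lra.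
rewrite -(@cintegral_const R G G1 (- (1 / 4)) (5 / 4) 0 (2 * pi) (r * r * (r / 4) ^- 2) 0 1) //.
- rewrite (_ : G 0 = (fun=> 1)) ?cintegral_cst1 ?subr0 ?pi2_ge0 //.
  apply/funext => t; rewrite /G CofR0 mul0r subr0 divff // mulf_neq0 ?cis_neq0 //.
  by rewrite CofR_eq0 gt_eqF.
- move=> l /lb hl t _; rewrite /G /G1.
  apply: rderiv_eq.
    apply: rderiv_scale.
    apply: (@rderiv_comp R R CofR (fun l => CofR r * cis t - CofR l * v) (fun z => z^-1)).
      exact: rderiv_inv (kernel_neq0 t hl).
    apply: rderiv_sub; first exact: rderiv_cst.
    by apply: rderiv_mul; [exact: rderiv_id|exact: rderiv_cst].
  rewrite /=; have := kernel_neq0 t hl => h; field; exact: h.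
- move=> l /lb hl; apply: cintegrable_itv => t; apply: rcont_mul; last exact: cden.
  exact: rderiv_cont (rderiv_circle t).
- move=> l /lb hl t _; rewrite /G1 cmodM cmodV cmodX !cmodM cmod_CofR cmod_cis mulr1 gtr0_norm //.
  apply: ler_pM; rewrite ?invr_ge0 ?exprn_ge0 ?mulr_ge0 ?cmod_ge0 ?(ltW r0) //.
    by apply: ler_wpM2l; [exact: ltW|move: vr r0; lra].
  have q0 : 0 < r / 4 by rewrite divr_gt0.
  have k0 := lt_le_trans q0 (kernel_lb t hl).
  by rewrite lef_pV2 ?posrE ?exprn_gt0 // ler_pXn2r ?nnegrE ?cmod_ge0 ?kernel_lb // ltW.
- move=> l /lb hl.
  apply: (@cintegral_periodic (fun t => iC * v / (CofR r * cis t - CofR l * v))).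
  + move=> t; apply: rderiv_eq.
      apply: rderiv_scale.
      apply: (@rderiv_comp R R CofR (fun t => CofR r * cis t - CofR l * v) (fun z => z^-1)).
        exact: rderiv_inv (kernel_neq0 t hl).
      by apply: rderiv_sub; [exact: rderiv_circle|exact: rderiv_cst].
    rewrite /G1 subr0; have := kernel_neq0 t hl => h.
    have -> : iC * v * (- (CofR r * cis t - CofR l * v) ^- 2 * (CofR r * (iC * cis t))) =
      - (iC * iC) * (CofR r * cis t * v / (CofR r * cis t - CofR l * v) ^+ 2) by field; exact: h.
    by rewrite iC2 opprK mul1r.
  + by move=> t; exact: cG1.
  + by rewrite cis_2pi cis0.
Qed.
End Kernel.


Section Formula.
Variables (f f1 : C -> C) (x : C) (r : R).
Hypothesis r0 : 0 < r.
Hypothesis df : forall z, cmod (z - x) < 6 * r -> rderiv id f z (f1 z).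
Hypothesis cf : forall z, cmod (z - x) < 6 * r -> rcont id f1 z.

Let circle_in (w : C) (l t : R) : cmod (w - x) <= r / 2 -> `|l| <= 3 / 2 ->
  cmod (w + CofR l * (CofR r * cis t - (w - x)) - x) <= 11 / 4 * r.
Proof.
move=> wr hl.
have -> : w + CofR l * (CofR r * cis t - (w - x)) - x =
  CofR (1 - l) * (w - x) + CofR l * (CofR r * cis t) by rewrite CofRB CofR1; ring.
apply: le_trans (cmodD _ _) _; rewrite !cmodM !cmod_CofR cmod_cis mulr1 (gtr0_norm r0).
have h1 : `|1 - l| <= 5 / 2 by move: hl; rewrite !ler_norml; lra.
have := ler_pM (normr_ge0 _) (cmod_ge0 _) h1 wr.
have : `|l| * r <= 3 / 2 * r by rewrite ler_wpM2r // ltW.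
lra.
Qed.

(** The homotopy w + l (x + r e^(i t) - w) contracts the argument of f to w.
    The l-derivative of the integrand is, up to the factor l, the t-derivative
    of the same periodic function, so the integral keeps its value, and for l
    = 0 it is kernel_integral. *)
Lemma Cauchy_formula (w : C) : cmod (w - x) <= r / 2 ->
  cintegral `[0, 2 * pi] (fun t => f (x + CofR r * cis t) *
    (CofR r * cis t / (CofR r * cis t - (w - x)))) = CofR (2 * pi) * f w.
Proof.
move=> wr.
have [||L L0 hL] := @disc_bounded R f1 x (11 / 4 * r); [by move: r0; lra| |].
  by move=> z hz; apply: cf; move: hz r0; lra.
pose c (l t : R) := w + CofR l * (CofR r * cis t - (w - x)).
pose k (t : R) := CofR r * cis t / (CofR r * cis t - (w - x)).
pose G (l t : R) := f (c l t) * k t.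
pose G1 (l t : R) := f1 (c l t) * (CofR r * cis t).
have lb (l : R) : - (1 / 4) < l < 5 / 4 -> `|l| <= 3 / 2 by rewrite ler_norml; lra.
have l1 : `|1| <= 3 / 2 :> R by rewrite normr1; lra.
have k0 t : CofR r * cis t - (w - x) != 0.
  by have := kernel_neq0 r0 wr t l1; rewrite CofR1 mul1r.
have cin l t : `|l| <= 3 / 2 -> cmod (c l t - x) < 6 * r.
  by move=> /(circle_in t wr); rewrite /c; move: r0; lra.
have dc l t : rderiv CofR (c l) t (CofR l * (CofR r * (iC * cis t))).
  apply: rderiv_eq.
    apply: rderiv_add; first exact: rderiv_cst.
    apply: rderiv_scale; apply: rderiv_sub; [exact: rderiv_circle|exact: rderiv_cst].
  by ring.
have ccirc t : rcont CofR (fun t => CofR r * cis t) t by exact: rderiv_cont (rderiv_circle r t).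
have cden t : rcont CofR (fun t => (CofR r * cis t - (w - x))^-1) t.
  apply: (@rcont_comp R R CofR (fun t => CofR r * cis t - (w - x)) (fun z => z^-1)).
    exact: rderiv_cont (rderiv_inv (k0 t)).
  by apply: rcont_add; [exact: ccirc|exact: rcont_cst].
have cG1 l t : `|l| <= 3 / 2 -> rcont CofR (G1 l) t.
  move=> hl; apply: rcont_mul; last exact: ccirc.
  apply: (@rcont_comp R R CofR (c l) f1); first exact: cf (cin _ _ hl).
  exact: rderiv_cont (dc l t).
have -> : (fun t => f (x + CofR r * cis t) * (CofR r * cis t / (CofR r * cis t - (w - x)))) = G 1.
  by apply/funext => t; rewrite /G /c CofR1 mul1r; congr (f _ * _); ring.
have I0 : - (1 / 4) < 0 :> R by lra.
have I1 : 1 < 5 / 4 :> R by lra.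
rewrite -(@cintegral_const R G G1 (- (1 / 4)) (5 / 4) 0 (2 * pi) (L * r) 0 1) //.
- rewrite -(kernel_integral r0 wr) [RHS]mulrC -cintegral_scale //.
    by apply: eq_cintegral => t _; rewrite /G /c CofR0 mul0r addr0.
  apply: cintegrable_itv => t; apply: rcont_mul; [exact: ccirc|exact: cden].
- move=> l /lb hl t _; rewrite /G.
  apply: rderiv_eq.
    apply: rderiv_mul; last exact: rderiv_cst.
    exact: rderiv_along (df (cin l t hl)).
  by rewrite /G1 /k /c /=; have h := k0 t; field.
- move=> l /lb hl; apply: cintegrable_itv => t; apply: rcont_mul.
    apply: (@rcont_comp R R CofR (c l) f); last exact: rderiv_cont (dc l t).
    exact: rderiv_cont (df (cin l t hl)).
  by apply: rcont_mul; [exact: ccirc|exact: cden].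
- move=> l /lb hl t _; rewrite /G1 !cmodM cmod_CofR cmod_cis mulr1 gtr0_norm //.
  by rewrite ler_wpM2r ?(ltW r0) // hL // /c circle_in.
- move=> l /lb hl.
  have [l0|l0] := eqVneq l 0.
    apply: (@cintegral_periodic (fun t => f1 w * CofR r * cis t / iC)).
    + move=> t; apply: rderiv_eq.
        apply: rderiv_mul; last exact: rderiv_cst.
        by apply: rderiv_scale; exact: rderiv_cis.
      by rewrite /G1 /c l0 CofR0 mul0r addr0 /=; field; exact: iC_neq0.
    + by move=> t; exact: cG1.
    + by rewrite cis_2pi cis0.
  apply: (@cintegral_periodic (fun t => f (c l t) / (iC * CofR l))).
  + move=> t; apply: rderiv_eq.
      apply: rderiv_mul; last exact: rderiv_cst.
      apply: (@rderiv_comp R R CofR (c l) f); last exact: dc.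
      exact: df (cin l t hl).
    by rewrite /G1 /=; field; rewrite CofR_eq0 l0 iC_neq0.
  + by move=> t; exact: cG1.
  + by rewrite /c cis_2pi cis0.
Qed.

Definition taylor_coef (k : nat) : C := (CofR (2 * pi))^-1 *
  cintegral `[0, 2 * pi] (fun t => f (x + CofR r * cis t) * (CofR r * cis t) ^- k).

(** Expanding the Cauchy kernel as a finite geometric sum gives a Taylor
    polynomial with an explicit remainder. *)
Lemma Taylor_remainder (M : R) : (forall t, cmod (f (x + CofR r * cis t)) <= M) ->
  forall n w, cmod (w - x) <= r / 2 ->
  cmod (f w - \sum_(k < n) taylor_coef k * (w - x) ^+ k) <=
    4 * (M * (cmod (w - x) / r) ^+ n).
Proof.
move=> fM n w wr; set v := w - x.
have r0' : CofR r != 0 :> C by rewrite CofR_eq0 gt_eqF.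
have l1 : `|1| <= 3 / 2 :> R by rewrite normr1; lra.
have k0 t : CofR r * cis t - v != 0.
  by have := kernel_neq0 r0 wr t l1; rewrite CofR1 mul1r.
have c0 t : CofR r * cis t != 0 by rewrite mulf_neq0 ?cis_neq0.
have ccirc t : rcont CofR (fun t => CofR r * cis t) t by exact: rderiv_cont (rderiv_circle r t).
have cinv t : rcont CofR (fun t => (CofR r * cis t)^-1) t.
  apply: (@rcont_comp R R CofR (fun t => CofR r * cis t) (fun z => z^-1)) => //.
  exact: rderiv_cont (rderiv_inv (c0 t)).
have cden t : rcont CofR (fun t => (CofR r * cis t - v)^-1) t.
  apply: (@rcont_comp R R CofR (fun t => CofR r * cis t - v) (fun z => z^-1)).
    exact: rderiv_cont (rderiv_inv (k0 t)).
  by apply: rcont_add; [exact: ccirc|exact: rcont_cst].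
have cpow k t : rcont CofR (fun t => (CofR r * cis t) ^- k) t.
  elim: k => [|k ih]; first by under eq_fun do rewrite expr0 invr1; exact: rcont_cst.
  by under eq_fun do rewrite exprS invfM; exact: rcont_mul.
have cfc t : rcont CofR (fun t => f (x + CofR r * cis t)) t.
  apply: (@rcont_comp R R CofR (fun t => x + CofR r * cis t) f).
    apply: rderiv_cont (df _); rewrite addrAC subrr add0r cmodM cmod_cis cmod_CofR gtr0_norm //.
    by move: r0; lra.
  by apply: rcont_add; [exact: rcont_cst|exact: ccirc].
pose F k t := f (x + CofR r * cis t) * (CofR r * cis t) ^- k.
have cF k t : rcont CofR (F k) t by apply: rcont_mul.
pose Rm k t := F k t * v ^+ k * (CofR r * cis t / (CofR r * cis t - v)).
have cRm k t : rcont CofR (Rm k) t.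
  apply: rcont_mul; first by apply: rcont_mul; [exact: cF|exact: rcont_cst].
  by apply: rcont_mul; [exact: ccirc|exact: cden].
have pi0 : CofR (2 * pi) != 0 :> C by rewrite CofR_eq0 mulf_neq0 ?gt_eqF ?pi_gt0.
have step k : cintegral `[0, 2 * pi] (Rm k) =
    CofR (2 * pi) * (taylor_coef k * v ^+ k) + cintegral `[0, 2 * pi] (Rm k.+1).
  rewrite /taylor_coef mulrA mulVKf // [_ * v ^+ k]mulrC -cintegral_scale //; last exact: (cintegrable_itv _ _ (cF k)).
  rewrite -cintegral_add //; last by apply: cintegrable_itv => t; exact: cRm.
    apply: eq_cintegral => t _; rewrite /Rm /F.
    have h1 := k0 t; have h2 := c0 t; rewrite exprS exprS; field.
    by rewrite ?h1 ?h2 ?expf_neq0 ?r0' ?cis_neq0.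
  by apply: cintegrable_scale => //; exact: (cintegrable_itv _ _ (cF k)).
have main k : CofR (2 * pi) * f w = CofR (2 * pi) * \sum_(j < k) taylor_coef j * v ^+ j + cintegral `[0, 2 * pi] (Rm k).
  elim: k => [|k ih].
    rewrite big_ord0 mulr0 add0r -(Cauchy_formula wr).
    by apply: eq_cintegral => t _; rewrite /Rm /F -/v !expr0 invr1 !mulr1.
  by rewrite ih step big_ord_recr /=; ring.
have -> : f w - \sum_(k < n) taylor_coef k * v ^+ k = (CofR (2 * pi))^-1 * cintegral `[0, 2 * pi] (Rm n).
  apply: (mulfI pi0); rewrite mulrBr mulVKf // (main n); ring.
have M0 : 0 <= M by apply: le_trans (cmod_ge0 _) (fM 0).
have p0 : 0 < 2 * pi :> R by rewrite mulr_gt0 // pi_gt0.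
rewrite cmodM cmodV cmod_CofR (gtr0_norm p0) mulrC ler_pdivrMr //.
have q0 : 0 <= cmod v / r by rewrite divr_ge0 ?cmod_ge0 // ltW.
set B := M * (cmod v / r) ^+ n * 2.
have iB : mu.-integrable `[0, 2 * pi] (EFin \o (fun=> B)).
  by apply: continuous_compact_integrable; [exact: segment_compact|apply: continuous_subspaceT => ?; exact: cvg_cst].
have := @cintegral_le R `[0, 2 * pi] (fun=> B) (Rm n) _ _ iB _.
have -> : \int[mu]_(x in `[0, 2 * pi]) B = 2 * pi * B.
  have := @RintegralFTC R (fun t => B * t) (fun=> B) 0 (2 * pi) (ltW p0) (is_derive_mull B) (fun=> cvg_cst _).
  by move=> ->; ring.
have -> : 4 * (M * (cmod v / r) ^+ n) * (2 * pi) = 2 * (2 * pi * B) by rewrite /B; ring.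
apply=> //; first exact: (cintegrable_itv _ _ (cRm n)).
move=> t _.
have -> : cmod (Rm n t) = cmod (f (x + CofR r * cis t)) * (cmod v / r) ^+ n * (r / cmod (CofR r * cis t - v)).
  rewrite /Rm /F !cmodM !cmodV !cmodX !cmodM cmod_cis cmod_CofR mulr1 (gtr0_norm r0).
  by rewrite exprMn exprVn; ring.
apply: ler_pM.
- by rewrite mulr_ge0 ?cmod_ge0 // exprn_ge0.
- by rewrite mulr_ge0 ?invr_ge0 ?cmod_ge0 ?(ltW r0).
- by rewrite ler_wpM2r // exprn_ge0.
have lb2 : r / 2 <= cmod (CofR r * cis t - v).
  have := cmod_lbD (CofR r * cis t) (- v).
  by rewrite cmodN cmodM cmod_cis cmod_CofR mulr1 (gtr0_norm r0); move: wr; rewrite -/v; lra.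
have lb20 : 0 < cmod (CofR r * cis t - v) by apply: lt_le_trans lb2; rewrite divr_gt0.
by rewrite ler_pdivrMr //; move: lb2; lra.
Qed.
End Formula.

End CauchyFormula.

(** * Holomorphic functions: identity theorem, parametric integrals, contour shifts *)

Section Holomorphic.
Context {R : realType}.
Local Notation C := (Cplx R).
Local Notation mu := (@lebesgue_measure R).

Definition holo_at (f f1 : C -> C) (z : C) : Prop :=
  rderiv id f z (f1 z) /\ rcont id f1 z.

Lemma rderiv_bound (f : C -> C) (z d : C) (K r : R) : rderiv id f z d -> 0 < r -> 0 <= K ->
  (forall w, cmod (w - z) <= r -> cmod (f w - f z) <= K * cmod (w - z)) -> cmod d <= K.
Proof.
move=> df r0 K0 fK; rewrite leNgt; apply/negP => Kd.
have e0 : 0 < (cmod d - K) / 2 by rewrite divr_gt0 // subr_gt0.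
have [s s0 hs] := df _ e0.
pose t := Num.min (r / 2) (s / 2).
have t0 : 0 < t by rewrite lt_min !divr_gt0.
have [tr ts] : t <= r / 2 /\ t <= s / 2 by split; rewrite ge_min lexx ?orbT.
have E : cmod (z + CofR t - z) = t by rewrite addrAC subrr add0r cmod_CofR gtr0_norm.
have h1 : cmod (f (z + CofR t) - f z) <= K * t by rewrite -{2}E; apply: fK; rewrite E; move: r0 tr; lra.
have h2 : cmod (f (z + CofR t) - f z - d * (z + CofR t - z)) <= (cmod d - K) / 2 * t.
  by rewrite -[in X in _ <= X]E; apply: hs; rewrite /= E; move: s0 ts; lra.
have h3 := cmodB (f (z + CofR t) - f z) (f (z + CofR t) - f z - d * (z + CofR t - z)).
have e3 : f (z + CofR t) - f z - (f (z + CofR t) - f z - d * (z + CofR t - z)) = d * (z + CofR t - z) by ring.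
rewrite e3 cmodM E in h3.
have : 0 < (cmod d - K) * t by rewrite mulr_gt0 // subr_gt0.
by move: h1 h2 h3; lra.
Qed.

Lemma rderiv_uniq (f : C -> C) (z d d' : C) : rderiv id f z d -> rderiv id f z d' -> d = d'.
Proof.
move=> h h'; have := rderiv_sub h h'.
move=> /rderiv_bound k; apply/eqP; rewrite -subr_eq0 -cmod_eq0 eq_le cmod_ge0 andbT.
by apply: (k 0 1) => // w _; rewrite !subrr cmod0 mul0r.
Qed.

Lemma quadratic_rderiv (f : C -> C) (z d : C) (K r : R) : 0 < r -> 0 <= K ->
  (forall w, cmod (w - z) <= r -> cmod (f w - f z - d * (w - z)) <= K * cmod (w - z) ^+ 2) ->
  rderiv id f z d.
Proof.
move=> r0 K0 h e e0; have k0 : 0 < K + 1 by rewrite ltr_wpDl.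
exists (Num.min r (e / (K + 1))); first by rewrite lt_min r0 divr_gt0.
move=> w; rewrite lt_min => /andP[/ltW/h wr]; rewrite ltr_pdivlMr // => we.
rewrite (le_trans wr) // expr2 mulrA ler_wpM2r ?cmod_ge0 //.
have := cmod_ge0 (w - z); rewrite /= in we; move: we; lra.
Qed.

Section Disc.
Variables (f f1 : C -> C) (x : C) (r : R).
Hypothesis r0 : 0 < r.
Hypothesis hf : forall z, cmod (z - x) < 6 * r -> holo_at f f1 z.

Let T := @Taylor_remainder _ f f1 x r r0 (fun z h => (hf h).1) (fun z h => (hf h).2).
Let a := taylor_coef f x r.

Let M0 M : (forall t, cmod (f (x + CofR r * cis t)) <= M) -> 0 <= M.
Proof. by move=> h; apply: le_trans (cmod_ge0 _) (h 0). Qed.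

Lemma taylor_linear (M : R) : (forall t, cmod (f (x + CofR r * cis t)) <= M) ->
  taylor_coef f x r 1 = f1 x /\
  forall w, cmod (w - x) <= r / 2 ->
    cmod (f w - f x - f1 x * (w - x)) <= 4 * M / r ^+ 2 * cmod (w - x) ^+ 2.
Proof.
move=> fM; have M00 := M0 fM.
have a0 : a 0%N = f x.
  apply/eqP; rewrite eq_sym -subr_eq0 -cmod_eq0 eq_le cmod_ge0 andbT.
  have := T fM 1 (_ : cmod (x - x) <= r / 2); rewrite subrr cmod0 => /(_ (divr_ge0 (ltW r0) (ler0n _ _))).
  by rewrite big_ord1 expr0 mulr1 mul0r expr1 !mulr0.
have T2 w : cmod (w - x) <= r / 2 -> cmod (f w - f x - a 1%N * (w - x)) <= 4 * M / r ^+ 2 * cmod (w - x) ^+ 2.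
  move=> /(T fM 2); rewrite big_ord_recr big_ord1 /= expr0 mulr1 -/a a0 expr1 opprD addrA.
  move=> /le_trans; apply; rewrite le_eqVlt; apply/orP; left; apply/eqP.
  by rewrite exprMn exprVn; ring.
have K0 : 0 <= 4 * M / r ^+ 2 by rewrite !mulr_ge0 // invr_ge0 exprn_ge0 // ltW.
have r20 : 0 < r / 2 by rewrite divr_gt0.
have [d1 _] : holo_at f f1 x by apply: hf; rewrite subrr cmod0 mulr_gt0.
have a1 : a 1%N = f1 x by apply: rderiv_uniq d1; exact: (quadratic_rderiv r20 K0 T2).
by split => //; rewrite -a1.
Qed.

(** Cauchy estimates on a single disc, for the derivative and for the
    second-order remainder; both constants involve f only through its bound M
    on the circle. *)
Lemma Cauchy_quadratic (M : R) : (forall t, cmod (f (x + CofR r * cis t)) <= M) ->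
  cmod (f1 x) <= 4 * M / r /\
  forall w, cmod (w - x) <= r / 2 ->
    cmod (f w - f x - f1 x * (w - x)) <= 4 * M / r ^+ 2 * cmod (w - x) ^+ 2.
Proof.
move=> fM; have M00 := M0 fM; have [_ T2] := taylor_linear fM; split => //.
have K0 : 0 <= 4 * M / r ^+ 2 by rewrite !mulr_ge0 // invr_ge0 exprn_ge0 // ltW.
have r20 : 0 < r / 2 by rewrite divr_gt0.
have a0 : taylor_coef f x r 0 = f x.
  apply/eqP; rewrite eq_sym -subr_eq0 -cmod_eq0 eq_le cmod_ge0 andbT.
  have := T fM 1 (_ : cmod (x - x) <= r / 2); rewrite subrr cmod0 => /(_ (divr_ge0 (ltW r0) (ler0n _ _))).
  by rewrite big_ord1 expr0 mulr1 mul0r expr1 !mulr0.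
have T1 w : cmod (w - x) <= r / 2 -> cmod (f w - f x) <= 4 * M / r * cmod (w - x).
  move=> /(T fM 1); rewrite big_ord1 expr0 mulr1 a0 expr1.
  by move=> /le_trans; apply; rewrite le_eqVlt; apply/orP; left; apply/eqP; ring.
apply: (rderiv_bound (quadratic_rderiv r20 K0 T2) r20) => //.
by rewrite !mulr_ge0 // invr_ge0 ltW.
Qed.

(** A holomorphic function that vanishes on a segment issuing from x has only
    zero Taylor coefficients at x. *)
Lemma identity_disc (u : C) (h : R) : u != 0 -> 0 < h ->
  (forall t, 0 < t < h -> f (x + CofR t * u) = 0) ->
  forall w, cmod (w - x) <= r / 2 -> f w = 0.
Proof.
move=> u0 h0 fu.
have [|M M00 hM] := @disc_bounded R f x r r0.
  by move=> z zr; apply: rderiv_cont (hf _).1; move: zr r0; lra.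
have fM t : cmod (f (x + CofR r * cis t)) <= M.
  by apply: hM; rewrite addrAC subrr add0r cmodM cmod_cis cmod_CofR mulr1 gtr0_norm.
have cu : 0 < cmod u by rewrite cmod_gt0.
have az k : a k = 0.
  elim/ltn_ind: k => k ih; apply/eqP; rewrite -cmod_eq0 eq_le cmod_ge0 andbT leNgt; apply/negP => ak.
  pose K := 4 * M / r ^+ k.+1 + 1.
  have K0 : 0 < K by rewrite ltr_wpDl // !mulr_ge0 // invr_ge0 exprn_ge0 // ltW.
  pose t := Num.min (h / 2) (Num.min (r / 2 / cmod u) (cmod (a k) / 2 / K / cmod u)).
  have t0 : 0 < t by rewrite !lt_min !divr_gt0.
  have [th [tr tk]] : t <= h / 2 /\ t <= r / 2 / cmod u /\ t <= cmod (a k) / 2 / K / cmod u.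
    by do !split; rewrite /t !ge_min lexx ?orbT.
  rewrite ler_pdivlMr // in tr; rewrite ler_pdivlMr // ler_pdivlMr // in tk.
  have E : x + CofR t * u - x = CofR t * u by ring.
  have cE : cmod (CofR t * u) = t * cmod u by rewrite cmodM cmod_CofR gtr0_norm.
  have := T fM k.+1 (_ : cmod (x + CofR t * u - x) <= r / 2).
  rewrite E cE => /(_ tr); rewrite fu; last by rewrite t0; move: h0 th; lra.
  rewrite big_ord_recr /= big1; last by move=> j _; rewrite -/a ih ?mul0r.
  rewrite !add0r cmodN cmodM cmodX cE.
  set q := t * cmod u; have q0 : 0 < q by rewrite mulr_gt0.
  rewrite expr_div_n exprS.
  have -> : 4 * (M * (q * q ^+ k / r ^+ k.+1)) = (4 * M / r ^+ k.+1 * q) * q ^+ k by ring.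
  rewrite ler_pM2r ?exprn_gt0 // => le.
  have : 4 * M / r ^+ k.+1 * q <= q * K by rewrite /K mulrDr mulr1 mulrC lerDl ltW.
  by move: ak tk le; rewrite -/q; lra.
move=> w wr; apply/eqP; rewrite -cmod_eq0 eq_le cmod_ge0 andbT.
apply/ler_addgt0Pl => e e0; rewrite addr0.
have k0 : 0 < e / (4 * M + 1) by rewrite divr_gt0 // ltr_wpDl // mulr_ge0.
have : (fun n => (1 / 2 : R) ^+ n) @ \oo --> (0 : R).
  by apply: cvg_expr; rewrite ger0_norm; lra.
move/cvgrPdist_lt => /(_ _ k0)[n _ /(_ n (leqnn n))].
rewrite sub0r normrN ger0_norm ?exprn_ge0 // => hn.
have := T fM n wr; rewrite big1 ?subr0; last by move=> j _; rewrite -/a az mul0r.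
move=> /le_trans; apply.
have q1 : cmod (w - x) / r <= 1 / 2 by rewrite ler_pdivrMr //; move: wr; lra.
have q0 : 0 <= cmod (w - x) / r by rewrite divr_ge0 ?cmod_ge0 // ltW.
have := ler_pXn2r (n := n.+1) isT; have : (cmod (w - x) / r) ^+ n <= (1 / 2) ^+ n.
  by rewrite lerXn2r ?nnegrE //; lra.
move=> le _; have k1 : 0 < 4 * M + 1 by rewrite ltr_wpDl // mulr_ge0.
rewrite ltr_pdivlMr // in hn.
apply: (@le_trans _ _ (4 * (M * (1 / 2) ^+ n))).
  by rewrite ler_pM2l // ler_wpM2l.
have : 0 <= (1 / 2 : R) ^+ n by rewrite exprn_ge0 //; lra.
by move: hn; rewrite mulrDr mulr1; lra.
Qed.
End Disc.

(** Walk along the segment in steps of r / (2 |u|): the zeros just behind a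
    point force f to vanish on the disc around it. *)
Lemma identity_segment (f f1 : C -> C) (x u : C) (r h : R) : 0 < r -> 0 < h ->
  (forall t, 0 <= t <= 1 -> forall z, cmod (z - (x + CofR t * u)) < 6 * r -> holo_at f f1 z) ->
  (forall t, 0 < t < h -> f (x + CofR t * u) = 0) ->
  forall t, 0 < t <= 1 -> f (x + CofR t * u) = 0.
Proof.
move=> r0 h0 hf fu.
have [u0|u0] := eqVneq u 0.
  move=> t _; have := fu (h / 2); rewrite u0 !mulr0; apply.
  by rewrite divr_gt0 //=; lra.
have cu : 0 < cmod u by rewrite cmod_gt0.
pose d := r / 2 / cmod u.
have d0 : 0 < d by rewrite !divr_gt0.
have step n : forall t, 0 < t <= 1 -> t < h + n%:R * d -> f (x + CofR t * u) = 0.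
  elim: n => [|n ih] t /andP[t0 t1] tn.
    by apply: fu; rewrite t0; move: tn; rewrite mul0r addr0.
  have [tl|tg] := ltP t (h + n%:R * d); first by apply: ih => //; rewrite t0.
  pose s := h + n%:R * d.
  have s0 : 0 < s by rewrite ltr_pwDl // mulr_ge0 // ltW.
  have st : s <= t by [].
  have hs : 0 <= s <= 1 by rewrite ltW //= (le_trans st).
  have nu : - u != 0 by rewrite oppr_eq0.
  apply: (@identity_disc f f1 (x + CofR s * u) r r0 (hf s hs) (- u) s nu s0).
    move=> k /andP[k0 ks].
    have -> : x + CofR s * u + CofR k * - u = x + CofR (s - k) * u by rewrite CofRB; ring.
    apply: ih; first by rewrite subr_gt0 ks /=; move: hs; lra.
    by rewrite -/s; lra.
  have -> : x + CofR t * u - (x + CofR s * u) = CofR (t - s) * u by rewrite CofRB; ring.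
  rewrite cmodM cmod_CofR ger0_norm ?subr_ge0 // -ler_pdivlMr //.
  by move: tn; rewrite -/d -natr1 mulrDl mul1r /s; lra.
move=> t ht; have [n _ /(_ n (leqnn n)) hn] := nat_gt (1 / d).
apply: (step n) => //; rewrite ler_pdivrMr // in hn.
by case/andP: ht; move: h0 hn; lra.
Qed.

End Holomorphic.
Section ParametricIntegral.
Context {R : realType}.
Local Notation C := (Cplx R).
Local Notation mu := (@lebesgue_measure R).

Section ParameterDisc.
Variables (D : set R) (f f1 : C -> R -> C) (M : R -> R) (x0 : C) (r : R).
Hypothesis mD : mset D.
Hypothesis r0 : 0 < r.
Hypothesis hf : forall x, D x -> forall z, cmod (z - x0) < 7 * r -> holo_at (f ^~ x) (f1 ^~ x) z.
Hypothesis mf : forall z, cmod (z - x0) < 7 * r -> cmeasR D (f z).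
Hypothesis mf1 : forall z, cmod (z - x0) < 7 * r -> cmeasR D (f1 z).
Hypothesis iM : mu.-integrable D (EFin \o M).
Hypothesis fM : forall x, D x -> forall z, cmod (z - x0) < 7 * r -> cmod (f z x) <= M x.

Let sub_disc z w : cmod (z - x0) < r -> cmod (w - z) < 6 * r -> cmod (w - x0) < 7 * r.
Proof. by have := cmodBD z w x0; lra. Qed.

Let Mcircle z x : cmod (z - x0) < r -> D x -> forall t, cmod (f (z + CofR r * cis t) x) <= M x.
Proof.
move=> zr Dx t; apply: fM => //; apply: (sub_disc zr).
by rewrite addrAC subrr add0r cmodM cmod_cis cmod_CofR mulr1 gtr0_norm //; move: r0; lra.
Qed.

Let z7 z : cmod (z - x0) < r -> cmod (z - x0) < 7 * r.
Proof. by move: r0; lra. Qed.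

Lemma param_integrable z : cmod (z - x0) < 7 * r -> cintegrable D (f z).
Proof. by move=> zr; apply: (cint_dom mD (mf zr) iM) => x Dx; exact: fM. Qed.

Lemma param_derivative_bound z x : cmod (z - x0) < r -> D x -> cmod (f1 z x) <= 4 / r * M x.
Proof.
move=> zr Dx.
have [h _] := Cauchy_quadratic r0 (fun w h => hf Dx (sub_disc zr h)) (Mcircle zr Dx).
by apply: le_trans h _; rewrite le_eqVlt; apply/orP; left; apply/eqP; ring.
Qed.

Lemma param_integrable1 z : cmod (z - x0) < r -> cintegrable D (f1 z).
Proof.
move=> zr; apply: (cint_dom mD (mf1 (z7 zr)) (integrable_scale (4 / r) mD iM)) => x Dx.
exact: param_derivative_bound.
Qed.

Let F z := cintegral D (f z).
Let F1 z := cintegral D (f1 z).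
Let K := 2 * (4 / r ^+ 2 * \int[mu]_(x in D) M x).

Let quad z w : cmod (z - x0) < r -> cmod (w - z) <= r / 2 ->
  cmod (F w - F z - F1 z * (w - z)) <= K * cmod (w - z) ^+ 2.
Proof.
move=> zr wr.
have w7 : cmod (w - x0) < 7 * r by apply: (sub_disc zr); move: r0 wr; lra.
have i1 := param_integrable w7; have i2 := param_integrable (z7 zr); have i3 := param_integrable1 zr.
rewrite /F /F1 [_ * (w - z)]mulrC -cintegral_scale // -cintegral_sub // -cintegral_sub //; last exact: cintegrable_scale.
  have := @cintegral_le R D (fun x => 4 / r ^+ 2 * cmod (w - z) ^+ 2 * M x) (fun x => f w x - f z x - (w - z) * f1 z x).
  rewrite RintegralZl //.
  have -> : 2 * (4 / r ^+ 2 * cmod (w - z) ^+ 2 * \int[mu]_(x in D) M x) = K * cmod (w - z) ^+ 2.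
    by rewrite /K; ring.
  apply => //.
  - apply: cintegrable_sub => //; last exact: cintegrable_scale.
    exact: cintegrable_sub.
  - exact: integrable_scale.
  - move=> x Dx.
    have [_ h] := Cauchy_quadratic r0 (fun w h => hf Dx (sub_disc zr h)) (Mcircle zr Dx).
    rewrite [_ * f1 z x]mulrC; apply: le_trans (h _ wr) _.
    by rewrite le_eqVlt; apply/orP; left; apply/eqP; ring.
exact: cintegrable_sub.
Qed.

Let K0 : 0 <= K.
Proof.
rewrite !mulr_ge0 ?invr_ge0 ?exprn_ge0 ?(ltW r0) // Rintegral_ge0 // => x Dx.
by apply: le_trans (cmod_ge0 _) (fM Dx (z := x0) _); rewrite subrr cmod0 mulr_gt0.
Qed.

(** Domination of f alone suffices: Cauchy's estimates on discs bound the
    second-order remainder of f(., x) by a multiple of M x. *)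
Lemma param_holo : holo_at F F1 x0.
Proof.
have x00 : cmod (x0 - x0) < r by rewrite subrr cmod0.
have r2 : 0 < r / 2 by rewrite divr_gt0.
split; first exact: (quadratic_rderiv r2 K0 (fun w => quad x00)).
move=> e e0; have k0 : 0 < 2 * K + 1 by rewrite ltr_wpDl // mulr_ge0.
exists (Num.min (r / 2) (e / (2 * K + 1))); first by rewrite lt_min r2 divr_gt0.
move=> w; rewrite /= lt_min => /andP[wr we].
have [->|wx] := eqVneq w x0; first by rewrite subrr cmod0 ltW.
have cw : 0 < cmod (w - x0) by rewrite cmod_gt0 subr_eq0.
have q1 := quad x00 (ltW wr).
have wr' : cmod (w - x0) < r by move: r0 wr; lra.
have q2 : cmod (F x0 - F w - F1 w * (x0 - w)) <= K * cmod (x0 - w) ^+ 2.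
  by apply: quad => //; rewrite cmodBC ltW.
rewrite (cmodBC x0 w) in q2.
have := cmodB (- (F x0 - F w - F1 w * (x0 - w))) (F w - F x0 - F1 x0 * (w - x0)).
have -> : - (F x0 - F w - F1 w * (x0 - w)) - (F w - F x0 - F1 x0 * (w - x0)) = (F1 x0 - F1 w) * (w - x0) by ring.
rewrite cmodN cmodM (cmodBC (F1 x0)) => le.
have le2 : cmod (F1 w - F1 x0) * cmod (w - x0) <= (2 * K * cmod (w - x0)) * cmod (w - x0).
  by apply: le_trans le _; move: q1 q2; rewrite expr2; lra.
rewrite ler_pM2r // in le2; apply: le_trans le2 _.
rewrite ltr_pdivlMr // in we; move: we cw; lra.
Qed.
End ParameterDisc.

Lemma holo_zero_cst (F F1 : C -> C) (z w : C) :
  (forall t, 0 <= t <= 1 -> holo_at F F1 (z + CofR t * (w - z))) ->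
  (forall t, 0 <= t <= 1 -> F1 (z + CofR t * (w - z)) = 0) -> F w = F z.
Proof.
move=> hF F0; apply/eqP; rewrite -subr_eq0 -cmod_eq0 eq_le cmod_ge0 andbT.
have := @mean_value_segment R F F1 z w 0; rewrite mul0r mulr0; apply=> t ht.
  exact: (hF t ht).1.
by rewrite F0 // cmod0.
Qed.

Lemma expabs_vanish (f : R -> C) (K k : R) : 0 < k ->
  (forall t, cmod (f t) <= K * expabs k t) -> vanish_pinfty f /\ vanish_ninfty f.
Proof.
move=> k0 fK.
have K0 : 0 <= K.
  have := le_trans (cmod_ge0 _) (fK 0); rewrite pmulr_lge0 //; exact: expR_gt0.
have key (e : R) : 0 < e -> exists B : R, forall t, B <= `|t| -> cmod (f t) <= e.
  move=> e0; have K1 : 0 < K + 1 by rewrite ltr_wpDl.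
  exists (- (ln (e / (K + 1)) / k)) => t tB; apply: le_trans (fK t) _.
  have : expabs k t <= e / (K + 1).
    rewrite -[leRHS]lnK ?posrE ?divr_gt0 // /expabs ler_expR.
    have := ler_wpM2l (ltW k0) tB; rewrite mulrN mulrCA divff ?gt_eqF // mulr1; lra.
  rewrite ler_pdivlMr // => h; apply: le_trans h; rewrite mulrC ler_wpM2l ?expabs_ge0 //; lra.
split=> e /key[B hB].
  by exists (Num.max B 0) => t; rewrite ge_max => /andP[Bt t0]; apply: hB; rewrite ger0_norm.
exists (Num.min (- B) 0) => t; rewrite le_min => /andP[Bt t0]; apply: hB; rewrite ler0_norm //.
by rewrite lerNr.
Qed.

Lemma expabs_shift (k x s : R) : 0 <= k -> expabs k (x + s) <= expR (k * `|s|) * expabs k x.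
Proof.
move=> k0; rewrite /expabs -expRD ler_expR.
have := ler_normB (x + s) s; rewrite addrK => h.
by have := ler_wpM2l k0 h; rewrite mulrDr; lra.
Qed.

Lemma vanish_pinfty_half (f : R -> C) (K k : R) : 0 < k ->
  (forall t, 0 <= t -> cmod (f t) <= K * expabs k t) -> vanish_pinfty f.
Proof.
move=> k0 fK; have K0 : 0 <= K.
  have := le_trans (cmod_ge0 _) (fK 0 (lexx _)); rewrite pmulr_lge0 //; exact: expR_gt0.
have [|v _] := @expabs_vanish (fun t => if 0 <= t then f t else 0) K k k0.
  by move=> t; case: ifP => [/fK|_] //; rewrite cmod0 mulr_ge0 ?expabs_ge0.
move=> e /v[B hB]; exists (Num.max B 0) => t; rewrite ge_max => /andP[Bt t0].
by have := hB t Bt; rewrite t0.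
Qed.

Lemma vanish_ninfty_half (f : R -> C) (K k : R) : 0 < k ->
  (forall t, t <= 0 -> cmod (f t) <= K * expabs k t) -> vanish_ninfty f.
Proof.
move=> k0 fK; have K0 : 0 <= K.
  have := le_trans (cmod_ge0 _) (fK 0 (lexx _)); rewrite pmulr_lge0 //; exact: expR_gt0.
have [|_ v] := @expabs_vanish (fun t => if t <= 0 then f t else 0) K k k0.
  by move=> t; case: ifP => [/fK|_] //; rewrite cmod0 mulr_ge0 ?expabs_ge0.
move=> e /v[B hB]; exists (Num.min B 0) => t; rewrite le_min => /andP[Bt t0].
by have := hB t Bt; rewrite t0.
Qed.

(** The function g decays exponentially in the strip lo < Im z < hi over the
    abscissas in P; the predicate P serves to move a half-line only. *)
Section Shift.
Variables (g g1 : C -> C) (lo hi k K : R) (P : R -> Prop).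
Hypothesis k0 : 0 < k.
Hypothesis hg : forall z, lo < Im z < hi -> holo_at g g1 z.
Hypothesis gK : forall z, lo < Im z < hi -> P (Re z) -> cmod (g z) <= K * expabs k (Re z).

Let inb (x : R) (z : C) : Im (CofR x + z) = Im z.
Proof. by rewrite !ReImE add0r. Qed.

Lemma line_rderiv z t : lo < Im z < hi -> rderiv CofR (fun x => g (CofR x + z)) t (g1 (CofR t + z)).
Proof.
move=> hz; apply: rderiv_eq.
  apply: (@rderiv_comp R R CofR (fun x => CofR x + z) g).
    have [d _] : holo_at g g1 (CofR t + z) by apply: hg; rewrite inb.
    exact: d.
  by apply: rderiv_add; [exact: rderiv_id|exact: rderiv_cst].
by rewrite addr0 mulr1.
Qed.

Lemma line_rcont1 z t : lo < Im z < hi -> rcont CofR (fun x => g1 (CofR x + z)) t.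
Proof.
move=> hz; apply: (@rcont_comp R R CofR (fun x => CofR x + z) g1).
  have [_ c] : holo_at g g1 (CofR t + z) by apply: hg; rewrite inb.
  exact: c.
by apply: rcont_add; [exact: rcont_id|exact: rcont_cst].
Qed.

Lemma line_rcont z t : lo < Im z < hi -> rcont CofR (fun x => g (CofR x + z)) t.
Proof. by move=> hz; exact: rderiv_cont (line_rderiv t hz). Qed.

Let domain_margin z0 : lo < Im z0 < hi ->
  exists2 r : R, 0 < r & forall z, cmod (z - z0) < 7 * r -> lo < Im z < hi /\ `|Re (z - z0)| <= 1.
Proof.
move=> /andP[h1 h2]; exists (Num.min (Num.min (Im z0 - lo) (hi - Im z0)) 1 / 7).
  by rewrite divr_gt0 // !lt_min !subr_gt0 h1 h2 ltr01.
move=> z; rewrite mulrC divfK // => zz; have := le_lt_trans (Im_le_cmod _) zz; have := le_lt_trans (Re_le_cmod _) zz.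
rewrite !ReImE !lt_min => /andP[_ /ltW h] hh; split => //; move: hh; rewrite !ltr_norml; lra.
Qed.

Lemma shift_param (D : set R) z0 : mset D ->
  (forall x, D x -> forall s, `|s| <= 1 -> P (x + s)) -> lo < Im z0 < hi -> Re z0 = 0 ->
  [/\ cintegrable D (fun x => g (CofR x + z0)),
      cintegrable D (fun x => g1 (CofR x + z0)) &
  holo_at (fun z => cintegral D (fun x => g (CofR x + z)))
    (fun z => cintegral D (fun x => g1 (CofR x + z))) z0].
Proof.
move=> mD DP hz0 rz0; have [r r0 hr] := domain_margin hz0.
pose M x := `|K| * (expR (k * (cmod z0 + 7 * r)) * expabs k x).
have iM : mu.-integrable D (EFin \o M).
  apply: integrable_scale => //; apply: integrable_scale => //.
  by apply: integrableS (integrable_expabs k0).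
have H1 : forall x, D x -> forall z, cmod (z - z0) < 7 * r -> holo_at (fun z => g (CofR x + z)) (fun z => g1 (CofR x + z)) z.
  move=> x _ z /hr[hz _]; have [d c] : holo_at g g1 (CofR x + z) by apply: hg; rewrite inb.
  split.
    apply: rderiv_eq; first apply: (@rderiv_comp R C id (fun z => CofR x + z) g _ _ _ d).
      by apply: rderiv_add; [exact: rderiv_cst|exact: rderiv_id].
    by rewrite add0r mulr1.
  apply: (@rcont_comp R C id (fun z => CofR x + z) g1 _ c).
  by apply: rcont_add; [exact: rcont_cst|exact: rcont_id].
have H2 : forall z, cmod (z - z0) < 7 * r -> cmeasR D (fun x => g (CofR x + z)).
  by move=> z /hr[hz _]; apply: cmeas_rcont => // t; exact: line_rcont.
have H3 : forall z, cmod (z - z0) < 7 * r -> cmeasR D (fun x => g1 (CofR x + z)).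
  by move=> z /hr[hz _]; apply: cmeas_rcont => // t; exact: line_rcont1.
have H4 : forall x, D x -> forall z, cmod (z - z0) < 7 * r -> cmod (g (CofR x + z)) <= M x.
  move=> x Dx z hz; have [hz1 hz2] := hr z hz; apply: le_trans (gK _ _) _; first by rewrite inb.
    by rewrite ReD Re_CofR; apply: DP => //; move: hz2; rewrite ReD ReN rz0 subr0.
  rewrite ReD Re_CofR /M.
  apply: (@le_trans _ _ (`|K| * expabs k (x + Re z))).
    by rewrite ler_wpM2r ?expabs_ge0 // ler_norm.
  rewrite ler_wpM2l //; apply: le_trans (expabs_shift _ _ (ltW k0)) _.
  rewrite ler_wpM2r ?expabs_ge0 // ler_expR ler_pM2l //.
  by apply: le_trans (Re_le_cmod z) _; have := cmodD (z - z0) z0; rewrite subrK; lra.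
have z00 : cmod (z0 - z0) < 7 * r by rewrite subrr cmod0 mulr_gt0.
have z00' : cmod (z0 - z0) < r by rewrite subrr cmod0.
split.
- exact: (param_integrable mD H2 iM H4).
- exact: (param_integrable1 mD r0 H1 H3 iM H4).
- exact: (param_holo mD r0 H1 H2 H3 iM H4).
Qed.

Let seg (t1 t2 t : R) : lo < t1 < hi -> lo < t2 < hi -> 0 <= t <= 1 ->
  lo < Im (iC * CofR t1 + CofR t * (iC * CofR t2 - iC * CofR t1) : C) < hi.
Proof.
move=> h1 h2 ht; rewrite !ReImE !(mul0r, mulr0, mul1r, addr0, add0r, subr0, oppr0).
have -> : t1 + t * (t2 - t1) = (1 - t) * t1 + t * t2 by ring.
have a : 0 <= 1 - t by move: ht; lra.
have b : 0 <= t by move: ht; lra.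
case/andP: h1 => h1 h1'; case/andP: h2 => h2 h2'.
have [t0|t0] := eqVneq t 0; first by rewrite t0 subr0 mul1r mul0r addr0 h1 h1'.
have bp : 0 < t by rewrite lt0r t0.
have := ler_wpM2l a (ltW h1); have := ler_wpM2l a (ltW h1').
by have := ltr_pM2l bp lo t2; have := ltr_pM2l bp t2 hi; rewrite h2 h2'; lra.
Qed.

Let seg_Re (t1 t2 t : R) : Re (iC * CofR t1 + CofR t * (iC * CofR t2 - iC * CofR t1) : C) = 0.
Proof. by rewrite !ReImE !(mul0r, mulr0, mul1r, addr0, add0r, subr0, oppr0). Qed.

Let bound0 z x : lo < Im z < hi -> Re z = 0 -> P x -> cmod (g (CofR x + z)) <= K * expabs k x.
Proof. by move=> hz z0 Px; have := gK (z := CofR x + z); rewrite inb ReD Re_CofR z0 addr0; apply. Qed.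

(** As a function of the height the integral has the derivative i times the
    integral of g1, which vanishes by the fundamental theorem of calculus. *)
Lemma line_shift_gen (t1 t2 : R) : (forall x, P x) -> lo < t1 < hi -> lo < t2 < hi ->
  cintegral setT (fun x => g (CofR x + iC * CofR t1)) = cintegral setT (fun x => g (CofR x + iC * CofR t2)).
Proof.
move=> PT h1 h2; apply: esym.
have PT' x : (setT : set R) x -> forall s, `|s| <= 1 -> P (x + s) by [].
apply: (@holo_zero_cst (fun z => cintegral setT (fun x => g (CofR x + z)))
  (fun z => cintegral setT (fun x => g1 (CofR x + z)))) => t ht.
  by have [] := @shift_param setT _ measurableT PT' (seg h1 h2 ht) (seg_Re _ _ _).
have hz := seg h1 h2 ht; have [_ i1 _] := @shift_param setT _ measurableT PT' hz (seg_Re _ _ _).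
have [v1 v2] := expabs_vanish k0 (fun x => bound0 hz (seg_Re _ _ _) (PT x)).
by apply: (@cintegral_FTC_line R (fun x => g (CofR x + _)) _ _ _ i1 v1 v2) => s; [exact: line_rderiv|exact: line_rcont1].
Qed.

Let seg_Im (t1 t2 t : R) : 0 <= t <= 1 -> Num.min t1 t2 <= t1 + t * (t2 - t1) <= Num.max t1 t2.
Proof.
move=> /andP[ht0 ht1]; rewrite ge_min le_max.
have [t12|t12] := leP t1 t2; apply/andP; split; apply/orP; [left|right|right|left]; nra.
Qed.

(** Moving a half-line that ends at u0 costs at most the integral of g along
    the vertical segment above u0. *)
Lemma half_line_shift (u0 t1 t2 B : R) : (forall x, x <= u0 + 1 -> P x) -> lo < t1 < hi -> lo < t2 < hi ->
  (forall t, Num.min t1 t2 <= t <= Num.max t1 t2 -> cmod (g (CofR u0 + iC * CofR t)) <= B) ->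
  cmod (cintegral `]-oo, u0] (fun x => g (CofR x + iC * CofR t2)) -
        cintegral `]-oo, u0] (fun x => g (CofR x + iC * CofR t1))) <= 2 * (B * `|t2 - t1|).
Proof.
move=> Pu h1 h2 hB.
have DP x : `]-oo, u0]%classic x -> forall s, `|s| <= 1 -> P (x + s).
  by rewrite /= in_itv/= => xu s s1; apply: Pu; move: s1; rewrite ler_norml; lra.
have := @mean_value_segment R (fun z => cintegral `]-oo, u0] (fun x => g (CofR x + z)))
  (fun z => cintegral `]-oo, u0] (fun x => g1 (CofR x + z))) (iC * CofR t1) (iC * CofR t2) B.
have -> : cmod (iC * CofR t2 - iC * CofR t1 : C) = `|t2 - t1|.
  by rewrite -mulrBr cmodM cmod_iC mul1r -CofRB cmod_CofR.
apply=> t ht; have hz := seg h1 h2 ht; have z0 := seg_Re t1 t2 t;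
  have [_ i1 [d _]] := @shift_param `]-oo, u0] _ (measurable_itv _) DP hz z0.
  exact: d.
have v : vanish_ninfty (fun x => g (CofR x + (iC * CofR t1 + CofR t * (iC * CofR t2 - iC * CofR t1)))).
  have [|_ v] := @expabs_vanish (fun x => if x <= u0 then g (CofR x + (iC * CofR t1 + CofR t * (iC * CofR t2 - iC * CofR t1))) else 0) `|K| k k0.
    move=> x; case: ifP => [xu|_]; last by rewrite cmod0 mulr_ge0 ?expabs_ge0.
    apply: le_trans (bound0 hz z0 _) _; first by apply: Pu; lra.
    by rewrite ler_wpM2r ?expabs_ge0 // ler_norm.
  move=> e /v[B' hB']; exists (Num.min B' u0) => x; rewrite le_min => /andP[xB xu].
  by have := hB' x xB; rewrite xu.
rewrite (@cintegral_FTC_ninfty R (fun x => g (CofR x + _)) _ u0 _ _ i1 v); last 2 first.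
- by move=> s; exact: line_rderiv.
- by move=> s; exact: line_rcont1.
have -> : iC * CofR t1 + CofR t * (iC * CofR t2 - iC * CofR t1) = iC * CofR (t1 + t * (t2 - t1)) :> C.
  by rewrite CofRD CofRM CofRB; ring.
exact: hB (seg_Im _ _ ht).
Qed.

End Shift.

Section ShiftLine.
Variables (g g1 : C -> C) (lo hi k K : R).
Hypothesis k0 : 0 < k.
Hypothesis hg : forall z, lo < Im z < hi -> holo_at g g1 z.
Hypothesis gK : forall z, lo < Im z < hi -> cmod (g z) <= K * expabs k (Re z).

Lemma line_integrable (t : R) : lo < t < hi -> cintegrable setT (fun x => g (CofR x + iC * CofR t)).
Proof.
move=> ht.
have hz : lo < Im (iC * CofR t : C) < hi by rewrite !ReImE !(mul0r, mulr0, mul1r, addr0, add0r, subr0).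
have rz : Re (iC * CofR t : C) = 0 by rewrite !ReImE !(mul0r, mulr0, mul1r, addr0, add0r, subr0).
by case: (@shift_param g g1 lo hi k K (fun=> True) k0 hg (fun z h _ => gK h) setT (iC * CofR t) measurableT (fun _ _ _ _ => I) hz rz).
Qed.

Lemma line_shift (t1 t2 : R) : lo < t1 < hi -> lo < t2 < hi ->
  cintegral setT (fun x => g (CofR x + iC * CofR t1)) = cintegral setT (fun x => g (CofR x + iC * CofR t2)).
Proof. exact: (@line_shift_gen g g1 lo hi k K (fun=> True) k0 hg (fun z h _ => gK h)). Qed.

End ShiftLine.

End ParametricIntegral.
Section HoloRules.
Context {R : realType}.
Local Notation C := (Cplx R).
Implicit Types f g : C -> C.

Lemma holo_eq f f1 g1 (z : C) : holo_at f f1 z -> (forall w, f1 w = g1 w) -> holo_at f g1 z.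
Proof. by move=> h /funext <-. Qed.
Lemma holo_ext f g f1 (z : C) : (forall w, f w = g w) -> holo_at f f1 z -> holo_at g f1 z.
Proof. by move=> /funext ->. Qed.
Lemma holo_cst (c z : C) : holo_at (fun=> c) (fun=> 0) z.
Proof. by split; [exact: rderiv_cst|exact: rcont_cst]. Qed.
Lemma holo_id (z : C) : holo_at (fun w => w) (fun=> 1) z.
Proof. by split; [exact: rderiv_id|exact: rcont_cst]. Qed.
Lemma holo_add f f1 g g1 (z : C) : holo_at f f1 z -> holo_at g g1 z ->
  holo_at (fun w => f w + g w) (fun w => f1 w + g1 w) z.
Proof. by move=> [a b] [c d]; split; [exact: rderiv_add|exact: rcont_add]. Qed.
Lemma holo_scale (c : C) f f1 (z : C) : holo_at f f1 z ->
  holo_at (fun w => c * f w) (fun w => c * f1 w) z.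
Proof. by move=> [a b]; split; [exact: rderiv_scale|apply: rcont_mul => //; exact: rcont_cst]. Qed.
Lemma holo_opp f f1 (z : C) : holo_at f f1 z ->
  holo_at (fun w => - f w) (fun w => - f1 w) z.
Proof.
move=> /(holo_scale (-1)) h; apply: (@holo_ext (fun w => -1 * f w)) => [w|]; first by rewrite mulN1r.
by apply: (holo_eq h) => w; rewrite mulN1r.
Qed.
Lemma holo_sub f f1 g g1 (z : C) : holo_at f f1 z -> holo_at g g1 z ->
  holo_at (fun w => f w - g w) (fun w => f1 w - g1 w) z.
Proof. by move=> hf hg; exact: holo_add hf (holo_opp hg). Qed.
Lemma holo_rcont f f1 (z : C) : holo_at f f1 z -> rcont id f z.
Proof. by move=> [a _]; exact: rderiv_cont a. Qed.
Lemma holo_mul f f1 g g1 (z : C) : holo_at f f1 z -> holo_at g g1 z ->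
  holo_at (fun w => f w * g w) (fun w => f1 w * g w + f w * g1 w) z.
Proof.
move=> hf hg; split; first exact: rderiv_mul hf.1 hg.1.
by apply: rcont_add; apply: rcont_mul; [exact: hf.2|exact: holo_rcont hg|exact: holo_rcont hf|exact: hg.2].
Qed.
Lemma holo_comp f f1 g g1 (z : C) : holo_at g g1 (f z) -> holo_at f f1 z ->
  holo_at (fun w => g (f w)) (fun w => g1 (f w) * f1 w) z.
Proof.
move=> hg hf; split; first exact: (rderiv_comp hg.1 hf.1).
apply: rcont_mul; last exact: hf.2.
by apply: rcont_comp; [exact: hg.2|exact: holo_rcont hf].
Qed.
Lemma holo_cexp f f1 (z : C) : holo_at f f1 z ->
  holo_at (fun w => cexp (f w)) (fun w => cexp (f w) * f1 w) z.
Proof. by move=> hf; apply: (holo_comp _ hf); split; [exact: rderiv_cexp|exact: rcont_cexp]. Qed.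
Lemma holo_inv f f1 (z : C) : f z != 0 -> holo_at f f1 z ->
  holo_at (fun w => (f w)^-1) (fun w => - f1 w * (f w)^-1 * (f w)^-1) z.
Proof.
move=> h0 hf; have ci : rcont id (fun w => (f w)^-1) z.
  apply: (@rcont_comp R C id f (fun z => z^-1)); last exact: holo_rcont hf.
  exact: rderiv_cont (rderiv_inv h0).
split.
  apply: rderiv_eq; first exact: (@rderiv_comp R C id f (fun z => z^-1) _ _ _ (rderiv_inv h0) hf.1).
  by field.
apply: rcont_mul => //; apply: rcont_mul => //.
have -> : (fun w => - f1 w) = (fun w => -1 * f1 w) by apply/funext => w; rewrite mulN1r.
by apply: rcont_mul; [exact: rcont_cst|exact: hf.2].
Qed.

End HoloRules.

Section DominationBounds.
Context {R : realType}.

(** The tangent of the convex function d e^u at u = - ln d. *)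
Lemma le_exp_affine (d u : R) : 0 < d -> u <= d * expR u - ln d - 1.
Proof.
move=> d0; have := expR_ge1Dx (u + ln d).
by rewrite expRD lnK ?posrE // mulrC; lra.
Qed.

Lemma expR_dominated (a c u : R) : 0 < a -> 0 < c ->
  expR (a * u - c * expR u) <= expR ((a + 1) * ln ((a + 1) / c + 1)) * expabs (Num.min a 1) u.
Proof.
move=> a0 c0; rewrite /expabs -expRD ler_expR.
have a1 : 0 < a + 1 by lra.
have l0 : 0 <= ln ((a + 1) / c + 1) by apply: ln_ge0; rewrite lerDr divr_ge0 // ltW.
have [u0|u0] := leP 0 u.
  rewrite ger0_norm //.
  have h : (a + 1) * u <= c * expR u + (a + 1) * ln ((a + 1) / c + 1).
    have d0 : 0 < c / (a + 1) by rewrite divr_gt0.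
    have := ler_wpM2l (ltW a1) (le_exp_affine u d0).
    have -> : (a + 1) * (c / (a + 1) * expR u - ln (c / (a + 1)) - 1) =
       c * expR u + (a + 1) * (- ln (c / (a + 1)) - 1) by field; rewrite gt_eqF.
    have : - ln (c / (a + 1)) <= ln ((a + 1) / c + 1).
      rewrite -lnV ?posrE // invf_div ler_ln ?posrE ?addr_gt0 ?divr_gt0 //; lra.
    move=> /(ler_wpM2l (ltW a1)); rewrite mulrBr; lra.
  have : Num.min a 1 * u <= u by rewrite -{2}[u]mul1r ler_wpM2r // ge_min lexx orbT.
  lra.
rewrite ltr0_norm //.
have : Num.min a 1 * - u <= a * - u by apply: ler_wpM2r; [lra|rewrite ge_min lexx].
have : 0 <= c * expR u by rewrite mulr_ge0 ?expR_ge0 // ltW.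
have : 0 <= (a + 1) * ln ((a + 1) / c + 1) by rewrite mulr_ge0 // ltW.
lra.
Qed.

Lemma expR_dominated2 (a c p u : R) : 0 < a -> 0 < c ->
  expR (a * u + p * expR u - c * expR (2 * u)) <=
  expR ((p + 1) ^+ 2 / (4 * c) + (a + 1) * ln (a + 2)) * expabs (Num.min a 1) u.
Proof.
move=> a0 c0; have := expR_dominated u a0 ltr01.
have -> : (a + 1) / 1 + 1 = a + 2 by field.
move=> h; rewrite [X in _ <= X * _]expRD -mulrA.
have e0 := expR_ge0 ((p + 1) ^+ 2 / (4 * c)); apply: le_trans (ler_wpM2l e0 h).
rewrite -expRD ler_expR mul1r.
have -> : expR (2 * u) = expR u ^+ 2 by rewrite -expRM_natl.
set x := expR u.
have : 0 <= (2 * c * x - (p + 1)) ^+ 2 / (4 * c) by rewrite divr_ge0 ?sqr_ge0 // mulr_ge0 // ltW.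
have -> : (2 * c * x - (p + 1)) ^+ 2 / (4 * c) = c * x ^+ 2 - (p + 1) * x + (p + 1) ^+ 2 / (4 * c).
  by field; rewrite gt_eqF.
lra.
Qed.
End DominationBounds.

(** * The Gamma function on vertical lines *)

Section GammaIntegral.
Context {R : realType}.
Local Notation C := (Cplx R).
Implicit Types (b w : C).

(** The integrand of Euler's integral after t = e ^ w; it is entire in w, so
    the line of integration can be moved. *)
Definition gamma_kernel b w : C := cexp (b * w - cexp w).
Definition Gam b : C := cintegral setT (fun u => gamma_kernel b (CofR u)).

Lemma holo_gamma_kernel b w :
  holo_at (gamma_kernel b) (fun w => gamma_kernel b w * (b - cexp w)) w.
Proof.
apply: (holo_eq (holo_cexp (holo_sub (holo_scale b (holo_id w)) (holo_cexp (holo_id w))))) => z.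
by rewrite !mulr1.
Qed.

Lemma cmod_gamma_kernel b (u t : R) : cmod (gamma_kernel b (CofR u + iC * CofR t)) =
  expR (- (Im b * t)) * expR (Re b * u - cos t * expR u).
Proof.
rewrite /gamma_kernel cmod_cexp -expRD; congr expR.
rewrite !(ReD, ReN, ReM) Re_cexp !ReImE !(mul0r, mulr0, mul1r, addr0, add0r, subr0); ring.
Qed.


Lemma le_cos (s t : R) : 0 <= s -> s <= t -> t <= pi -> cos t <= cos s.
Proof.
move=> s0 st tp; rewrite -lerN2.
apply: (@is_derive_ndecr R (fun x => - cos x) (@sin R)) => // x /andP[sx xt].
  by have := is_deriveN (is_derive_cos x); rewrite opprK.
by apply: sin_ge0_pi; rewrite (le_trans s0 sx) (le_trans xt tp).
Qed.

Lemma cos_lb (t0 t : R) : `|t| <= t0 -> t0 <= pi -> cos t0 <= cos t.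
Proof. by move=> tt0 t0p; rewrite -[cos t]cos_norm; apply: le_cos. Qed.

Definition exp_const (a c : R) : R := expR ((a + 1) * ln ((a + 1) / c + 1)).

(** Up to the factor e^(- t Im b) the modulus on the line at height t is the
    integrand of Gamma (Re b) with e^u multiplied by cos t. *)
Lemma gamma_kernel_le b (t0 u t : R) : 0 < Re b -> `|t| <= t0 -> t0 < pi / 2 ->
  cmod (gamma_kernel b (CofR u + iC * CofR t)) <=
  expR (- (Im b * t)) * exp_const (Re b) (cos t0) * expabs (Num.min (Re b) 1) u.
Proof.
move=> b0 tt0 t0p; have t00 : 0 <= t0 := le_trans (normr_ge0 _) tt0.
have p2 : pi / 2 <= pi :> R by have := @pi_gt0 R; lra.
have c0 : 0 < cos t0 by apply: cos_gt0_pihalf; rewrite t0p andbT; have := @pi_gt0 R; lra.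
rewrite cmod_gamma_kernel -mulrA ler_wpM2l ?expR_ge0 //.
apply: le_trans (expR_dominated u b0 c0).
rewrite ler_expR lerD2l lerN2 ler_wpM2r ?expR_ge0 // cos_lb //; lra.
Qed.

Lemma minr_gt0 (a : R) : 0 < a -> 0 < Num.min a 1.
Proof. by move=> a0; rewrite lt_min a0 ltr01. Qed.

Lemma iC0 w : w + iC * CofR 0 = w.
Proof. by rewrite CofR0 mulr0 addr0. Qed.

(** The ray of Euler's integral may be turned within the right half-plane. *)
Lemma Gam_rot b (t : R) : 0 < Re b -> `|t| < pi / 2 ->
  cintegrable setT (fun u => gamma_kernel b (CofR u + iC * CofR t)) /\
  cintegral setT (fun u => gamma_kernel b (CofR u + iC * CofR t)) = Gam b.
Proof.
move=> b0 tp; pose t0 := (`|t| + pi / 2) / 2.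
have p0 : 0 < pi / 2 :> R by rewrite divr_gt0 // pi_gt0.
have t0p : t0 < pi / 2 by rewrite /t0; lra.
have tt0 : `|t| < t0 by rewrite /t0; lra.
have t00 : 0 < t0 by apply: le_lt_trans tt0.
have hg w : - t0 < Im w < t0 -> holo_at (gamma_kernel b) (fun w => gamma_kernel b w * (b - cexp w)) w.
  by move=> _; exact: holo_gamma_kernel.
have gK w : - t0 < Im w < t0 -> cmod (gamma_kernel b w) <=
    expR (`|Im b| * t0) * exp_const (Re b) (cos t0) * expabs (Num.min (Re b) 1) (Re w).
  move=> wt; rewrite {1}(CE w); apply: le_trans (gamma_kernel_le _ b0 _ t0p) _.
    by rewrite ler_norml; move: wt; lra.
  rewrite ler_wpM2r ?expabs_ge0 // ler_wpM2r ?expR_ge0 // ler_expR.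
  rewrite -mulrN (le_trans (ler_norm _)) // normrM normrN ler_wpM2l //.
  by rewrite ler_norml; move: wt; lra.
have k0 := minr_gt0 b0.
have h1 : - t0 < t < t0 by rewrite -ltr_norml.
have h2 : - t0 < 0 < t0 by rewrite oppr_lt0 t00.
split.
  exact: (line_integrable k0 hg gK h1).
by rewrite (line_shift k0 hg gK h1 h2); apply: eq_cintegral => u _; rewrite iC0.
Qed.

Lemma Gam_integrable b : 0 < Re b -> cintegrable setT (fun u => gamma_kernel b (CofR u)).
Proof.
move=> b0; have p0 : `|(0 : R)| < pi / 2 by rewrite normr0 divr_gt0 // pi_gt0.
have [h _] := Gam_rot b0 p0; apply: eq_cintegrable h => // u _; by rewrite iC0.
Qed.

(** The substitution t = e^u. *)
Lemma euler_integralE b : 0 < Re b -> euler_integral b = Gam b.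
Proof.
move=> b0; have E : (`]0, +oo[%classic : set R) = \bigcup_n `[expR (- n%:R), expR n%:R]%classic.
  apply/seteqP; split=> x /=.
    rewrite in_itv/= andbT => x0; have [n _ hn] := nat_gt `|ln x|; exists n => //=.
    have := hn n (leqnn n); rewrite ler_norml => /andP[h1 h2].
    by rewrite in_itv/= -{1 2}[x]lnK ?posrE // !ler_expR h1 h2.
  by move=> [n _]; rewrite /= !in_itv/= => /andP[h _]; rewrite andbT (lt_le_trans _ h) ?expR_gt0.
have kE (u : R) : rcpow (expR u) (b - 1) * CofR (expR (- expR u)) * CofR (expR u) = gamma_kernel b (CofR u).
  rewrite /rcpow /gamma_kernel expRK -!cexp_CofR -!cexpD; congr cexp.
  by rewrite cexp_CofR CofRN; ring.
have [||||_] := @substitution_C R (@expR R) (@expR R) `]0, +oo[ _ _ _ E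
  (fun t => rcpow t (b - 1) * CofR (expR (- t))).
- exact: continuous_expR.
- exact: expR_gt0.
- move=> t; rewrite /= in_itv/= andbT => t0; apply: rcont_mul.
    apply: (@rcont_comp R R CofR (fun t => (b - 1) * CofR (ln t)) cexp); first exact: rcont_cexp.
    apply: rcont_mul; first exact: rcont_cst.
    exact: rderiv_cont (is_derive_rderiv (is_derive1_ln t0)).
  under eq_fun do rewrite -cexp_CofR CofRN -mulN1r.
  apply: (@rcont_comp R R CofR (fun t => -1 * CofR t) cexp); first exact: rcont_cexp.
  by apply: rcont_mul; [exact: rcont_cst|exact: rcont_id].
- by apply: eq_cintegrable (Gam_integrable b0) => // u _; rewrite kE.
by move=> h; rewrite /euler_integral h; apply: eq_cintegral => u _; rewrite kE.
Qed.

Lemma cGammaE b : 0 < Re b -> cGamma b = Gam b.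
Proof.
move=> b0; rewrite /cGamma.
have -> : Num.truncn (1 - Re b) = 0%N.
  by apply/truncn0Pn; rewrite -ltNge; lra.
by rewrite big_ord0 addr0 divr1 euler_integralE.
Qed.

Lemma sin_ge_cos1 (x : R) : 0 <= x <= 1 -> cos 1 * x <= sin x.
Proof.
move=> /andP[x0 x1]; have pi2 : 2 <= pi :> R by exact: pi_ge2.
suff : sin 0 - cos 1 * 0 <= sin x - cos 1 * x by rewrite sin0 mulr0; lra.
apply: (@is_derive_ndecr R (fun y => sin y - cos 1 * y) (fun y => cos y - cos 1)) => // y /andP[y0 yx].
  by have h1 := is_derive_sin y; have h2 := is_derive_mull (cos 1) y; exact: is_deriveB.
by rewrite subr_ge0; apply: le_cos => //; lra.
Qed.

Lemma exp_const_le (a c q : R) : 0 < a <= 1 -> 0 < c -> 1 <= q -> (a + 1) / c + 1 <= q ->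
  exp_const a c <= q ^+ 2.
Proof.
move=> /andP[a0 a1] c0 q1 h; have q0 : 0 < q by lra.
have X0 : 0 < (a + 1) / c + 1 by rewrite addr_gt0 // divr_gt0 // addr_gt0.
rewrite /exp_const -[q ^+ 2]lnK ?posrE ?exprn_gt0 // ler_expR lnXn // -[_ *+ 2]mulr_natl.
have l1 : ln ((a + 1) / c + 1) <= ln q by rewrite ler_ln ?posrE.
have l0 : 0 <= ln ((a + 1) / c + 1) by apply: ln_ge0; rewrite lerDr divr_ge0 //; lra.
by apply: ler_pM => //; lra.
Qed.

(** Turn the ray up to the distance of order 1 / (1 + |Im b|) from the
    imaginary axis: the rotation gains the exponential factor, and the
    remaining integral grows at most quadratically in Im b. *)
Lemma Gam_le (a : R) : 0 < a <= 1 -> exists2 K : R, 0 <= K & forall b, Re b = a ->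
  cmod (Gam b) <= K * (1 + `|Im b|) ^+ 2 * expR (- (pi / 2 * `|Im b|)).
Proof.
move=> /andP[a0 a1]; have [B B0 hB] := @cintegral_expabs_le R setT _ measurableT (minr_gt0 a0).
have c1 := @cos1_gt0 R.
(* q (1 + |Im b|) bounds the argument of exp_const at the angle chosen below,
   as cos t0 >= cos 1 / (1 + |Im b|) there. *)
pose q := 2 / cos 1 + 1 : R.
have q0 : 0 <= q by rewrite addr_ge0 // divr_ge0 // ltW.
exists (expR 1 * q ^+ 2 * B); first by rewrite !mulr_ge0 ?expR_ge0 ?exprn_ge0.
move=> b ba; set y := Im b; pose h := 1 / (1 + `|y|).
have y1 : 0 < 1 + `|y| by rewrite ltr_pwDl.
have h0 : 0 < h by rewrite divr_gt0.
have h1 : h <= 1 by rewrite ler_pdivrMr // mul1r lerDl.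
have pi1 : 1 <= pi / 2 :> R by exact: pihalf_ge1.
pose t0 := pi / 2 - h; pose t := if 0 <= y then t0 else - t0.
have tt0 : `|t| = t0.
  have t00 : 0 <= t0 by rewrite /t0; lra.
  by rewrite /t; case: ifP => _; rewrite ?normrN ger0_norm.
have yt : y * t = `|y| * t0.
  rewrite /t; case: ifP => [y0|/negbT]; first by rewrite ger0_norm.
  by rewrite -ltNge => y0; rewrite ltr0_norm // mulrN mulNr.
have tp : `|t| < pi / 2 by rewrite tt0 /t0; lra.
have b0 : 0 < Re b by rewrite ba.
have [gi <-] := Gam_rot b0 tp.
have mf : cmeasR setT (fun u => gamma_kernel b (CofR u + iC * CofR t)).
  apply: cmeas_rcont => // u.
  apply: (@rcont_comp R R CofR (fun u => CofR u + iC * CofR t) (gamma_kernel b)).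
    exact: holo_rcont (holo_gamma_kernel b _).
  by apply: rcont_add; [exact: rcont_id|exact: rcont_cst].
have fK (u : R) : setT u -> cmod (gamma_kernel b (CofR u + iC * CofR t)) <=
    expR (- (y * t)) * exp_const a (cos t0) * expabs (Num.min a 1) u.
  have t0p : t0 < pi / 2 by rewrite /t0; lra.
  have le0 : `|t| <= t0 by rewrite tt0.
  by have := gamma_kernel_le u b0 le0 t0p; rewrite ba.
apply: le_trans (hB _ _ mf fK) _.
have ct0 : cos 1 * h <= cos t0.
  by rewrite /t0 cosB cos_pihalf sin_pihalf mul0r add0r mul1r sin_ge_cos1 // ltW.
have c0 : 0 < cos t0 by apply: lt_le_trans ct0; rewrite mulr_gt0.
have Q : exp_const a (cos t0) <= (q * (1 + `|y|)) ^+ 2.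
  have q1 : 1 <= q by rewrite lerDr divr_ge0 // ltW.
  apply: exp_const_le; rewrite ?a0 //.
    by have := normr_ge0 y; nra.
  have : (a + 1) / cos t0 <= 2 / (cos 1 * h).
    by apply: ler_pM; rewrite ?invr_ge0 ?(ltW c0) ?lef_pV2 ?posrE ?mulr_gt0 //; lra.
  have -> : 2 / (cos 1 * h) = 2 / cos 1 * (1 + `|y|).
    by rewrite /h; field; rewrite !gt_eqF.
  have := normr_ge0 y; rewrite /q; lra.
have E : expR (- (y * t)) <= expR 1 * expR (- (pi / 2 * `|y|)).
  rewrite -expRD ler_expR yt /t0 mulrBr.
  have : `|y| * h <= 1 by rewrite mulrA mulr1 ler_pdivrMr // mul1r lerDr.
  lra.
rewrite [X in _ <= X](_ : _ = (expR 1 * expR (- (pi / 2 * `|y|))) * (q * (1 + `|y|)) ^+ 2 * B).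
  by rewrite ler_wpM2r // ler_pM ?expR_ge0.
by rewrite exprMn; ring.
Qed.

End GammaIntegral.

(** * The reflection formula *)

Section Reflection.
Context {R : realType}.
Local Notation C := (Cplx R).
Implicit Types (b w : C).

Lemma cintegral_FTC_limit (f f1 : R -> C) (l : C) :
  (forall t, rderiv CofR f t (f1 t)) -> (forall t, rcont CofR f1 t) ->
  cintegrable setT f1 -> vanish_pinfty (fun t => f t - l) -> vanish_ninfty f ->
  cintegral setT f1 = l.
Proof.
move=> df cf ci v1 v2; rewrite (cintegral_split 0 ci).
rewrite (cintegral_FTC_ninfty df cf _ v2); last by apply: cintegrableS ci.
rewrite (@cintegral_FTC_pinfty R (fun t => f t - l) f1 0 _ cf _ v1); last by apply: cintegrableS ci.
  by ring.
by move=> t; apply: rderiv_eq; [apply: rderiv_sub (df t) _; exact: rderiv_cst|rewrite subr0].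
Qed.

Lemma one_plus_cexp_lb w :
  (1 + cos (Im w)) / 2 * (1 + expR (Re w)) ^+ 2 <= cmod (1 + cexp w) ^+ 2.
Proof.
rewrite cmod_sqr !ReD !ImD Re1 Im1 add0r Re_cexp Im_cexp.
set r := expR (Re w); set c := cos _; set s := sin _.
have cs : s ^+ 2 = 1 - c ^+ 2 by rewrite /s /c -(cos2Dsin2 (Im w)); ring.
have -> : (1 + r * c) ^+ 2 + (r * s) ^+ 2 = 1 + 2 * r * c + r ^+ 2.
  by rewrite [(r * s) ^+ 2]exprMn cs; ring.
have : 0 <= (1 - c) / 2 * (1 - r) ^+ 2.
  by rewrite mulr_ge0 ?sqr_ge0 // divr_ge0 // subr_ge0 cos_le1.
by rewrite !expr2; lra.
Qed.

Lemma one_plus_cexp_ge (t0 : R) : 0 <= t0 < pi -> exists2 s : R, 0 < s &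
  forall w, `|Im w| <= t0 -> s * (1 + expR (Re w)) <= cmod (1 + cexp w).
Proof.
move=> /andP[t00 t0p]; have c0 : 0 < (1 + cos t0) / 2.
  rewrite divr_gt0 // -ltrBlDl sub0r -cospi ltr_cos // !in_itv/= ?pi_ge0 ?lexx //.
  by rewrite t00 ltW.
exists (Num.sqrt ((1 + cos t0) / 2)); first by rewrite sqrtr_gt0.
move=> w wt; rewrite -ler_sqr ?nnegrE ?cmod_ge0 ?mulr_ge0 ?sqrtr_ge0 ?addr_ge0 ?expR_ge0 //.
rewrite exprMn sqr_sqrtr ?(ltW c0) //; apply: le_trans (one_plus_cexp_lb w).
rewrite ler_wpM2r ?sqr_ge0 // ler_pM2r // lerD2l.
by apply: cos_lb wt _; exact: ltW.
Qed.

Lemma one_plus_cexp_neq0 w : `|Im w| < pi -> 1 + cexp w != 0.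
Proof.
move=> wp; have [|s s0 h] := @one_plus_cexp_ge `|Im w|; first by rewrite normr_ge0.
rewrite -cmod_gt0; apply: lt_le_trans (h w (lexx _)).
by rewrite mulr_gt0 // ltr_pwDl ?expR_ge0.
Qed.

Definition beta_kernel b w : C := cexp (b * w) * (1 + cexp w)^-1.
(** The Beta integral B(b, 1 - b) in the variable e^u. *)
Definition beta_integral b : C := cintegral setT (fun u => beta_kernel b (CofR u)).
Definition beta_kernel1 b w : C := cexp (b * w) * b * (1 + cexp w)^-1 +
  cexp (b * w) * (- cexp w * (1 + cexp w)^-1 * (1 + cexp w)^-1).

Lemma holo_beta_kernel b w : `|Im w| < pi -> holo_at (beta_kernel b) (beta_kernel1 b) w.
Proof.
move=> wp; have h0 := one_plus_cexp_neq0 wp.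
have h1 := holo_add (holo_cst 1 w) (holo_cexp (holo_id w)).
apply: (holo_eq (holo_mul (holo_cexp (holo_scale b (holo_id w))) (@holo_inv R (fun w => 1 + cexp w) _ w h0 h1))) => z.
by rewrite /beta_kernel1 !mulr1 add0r.
Qed.

Lemma beta_rate b : 0 < Re b < 1 -> 0 < Num.min (Re b) (1 - Re b).
Proof. by move=> /andP[h1 h2]; rewrite lt_min h1 subr_gt0. Qed.

Lemma expR_beta_le (a u : R) : 0 < a < 1 ->
  expR (a * u) <= (1 + expR u) * expabs (Num.min a (1 - a)) u.
Proof.
move=> /andP[a0 a1].
have le : expR (a * u) <= Num.max 1 (expR u) * expabs (Num.min a (1 - a)) u.
  rewrite /expabs; have [u0|u0] := leP 0 u.
    have e1 : 1 <= expR u by rewrite -expR0 ler_expR.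
    rewrite ger0_norm // (max_r e1) -expRD ler_expR.
    have : Num.min a (1 - a) * u <= (1 - a) * u by rewrite ler_wpM2r // ge_min lexx orbT.
    by rewrite mulrBl mul1r; lra.
  have e1 : expR u <= 1 by rewrite -expR0 ler_expR ltW.
  rewrite ltr0_norm // (max_l e1) mul1r ler_expR.
  have : Num.min a (1 - a) * - u <= a * - u by rewrite ler_wpM2r ?ge_min ?lexx //; lra.
  lra.
apply: le_trans le _; rewrite ler_wpM2r ?expabs_ge0 // ge_max lerDl lerDr ler01 expR_ge0 //.
Qed.

Lemma beta_kernel_le b (t0 : R) : 0 < Re b < 1 -> 0 <= t0 < pi -> exists2 K : R, 0 <= K &
  forall w, `|Im w| <= t0 -> cmod (beta_kernel b w) <= K * expabs (Num.min (Re b) (1 - Re b)) (Re w).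
Proof.
move=> b01 t0p; have [s s0 hs] := one_plus_cexp_ge t0p.
exists (expR (`|Im b| * t0) / s); first by rewrite divr_ge0 ?expR_ge0 // ltW.
move=> w wt; have e1 : 0 < 1 + expR (Re w) by rewrite ltr_pwDl ?expR_ge0.
have cw : 0 < cmod (1 + cexp w) by apply: lt_le_trans (hs w wt); rewrite mulr_gt0.
rewrite /beta_kernel cmodM cmodV ler_pdivrMr // cmod_cexp ReM.
have h1 : expR (Re b * Re w - Im b * Im w) <= expR (`|Im b| * t0) * expR (Re b * Re w).
  rewrite -expRD ler_expR addrC lerD2r -mulNr (le_trans (ler_norm _)) // normrM normrN.
  by rewrite ler_wpM2l.
apply: le_trans h1 _; rewrite -!mulrA ler_wpM2l ?expR_ge0 //.
apply: le_trans (expR_beta_le _ b01) _.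
rewrite mulrC mulrCA ler_wpM2l ?expabs_ge0 // mulrC ler_pdivlMr // mulrC.
exact: hs.
Qed.

Lemma beta_rot b (t : R) : 0 < Re b < 1 -> `|t| < pi ->
  cintegrable setT (fun u => beta_kernel b (CofR u + iC * CofR t)) /\
  cintegral setT (fun u => beta_kernel b (CofR u + iC * CofR t)) = beta_integral b.
Proof.
move=> b01 tp; pose t0 := (`|t| + pi) / 2.
have p0 := @pi_gt0 R.
have t0p : t0 < pi by rewrite /t0; lra.
have tt0 : `|t| < t0 by rewrite /t0; lra.
have t00 : 0 < t0 by apply: le_lt_trans tt0.
have [|K K0 hK] := @beta_kernel_le b t0 b01; first by rewrite ltW.
have hg w : - t0 < Im w < t0 -> holo_at (beta_kernel b) (beta_kernel1 b) w.
  by rewrite -ltr_norml => h; apply: holo_beta_kernel; exact: lt_trans h t0p.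
have gK w : - t0 < Im w < t0 -> cmod (beta_kernel b w) <= K * expabs (Num.min (Re b) (1 - Re b)) (Re w).
  by rewrite -ltr_norml => h; apply: hK; exact: ltW.
have k0 := beta_rate b01.
have h1 : - t0 < t < t0 by rewrite -ltr_norml.
have h2 : - t0 < 0 < t0 by rewrite oppr_lt0 t00.
split.
  exact: (line_integrable k0 hg gK h1).
by rewrite (line_shift k0 hg gK h1 h2); apply: eq_cintegral => u _; rewrite iC0.
Qed.

Lemma beta_integrable b : 0 < Re b < 1 -> cintegrable setT (fun u => beta_kernel b (CofR u)).
Proof.
move=> b01; have p0 : `|(0 : R)| < pi by rewrite normr0 pi_gt0.
by have [h _] := beta_rot b01 p0; apply: eq_cintegrable h => // u _; rewrite iC0.
Qed.

Lemma rderiv_cexp_real (t : R) : rderiv CofR (fun s => cexp (CofR s) : C) t (cexp (CofR t)).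
Proof. by apply: rderiv_eq; [apply: (@rderiv_comp R R CofR CofR cexp _ _ _ (rderiv_cexp _)); exact: rderiv_id|rewrite mulr1]. Qed.

(** The exponential distribution: the inner integral of Gamma(b) Gamma(1 - b)
    once the two variables are replaced by their ratio and one of them. *)
Lemma exp_density_integral (c : R) : 1 <= c ->
  cintegrable setT (fun v => cexp (CofR v - CofR c * cexp (CofR v)) : C) ->
  cintegral setT (fun v => cexp (CofR v - CofR c * cexp (CofR v)) : C) = (CofR c)^-1.
Proof.
move=> c1 ci; have c0 : 0 < c by lra.
have c0' : CofR c != 0 :> C by rewrite CofR_eq0 gt_eqF.
pose E v : C := cexp (- (CofR c * cexp (CofR v))).
have dE v : rderiv CofR E v (- (CofR c * cexp (CofR v)) * E v).
  apply: rderiv_eq.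
    apply: (@rderiv_comp R R CofR (fun v => - (CofR c * cexp (CofR v))) cexp); first exact: rderiv_cexp.
    by apply: rderiv_opp; apply: rderiv_scale; exact: rderiv_cexp_real.
  by rewrite mulrC.
have cE v : cmod (E v) = expR (- (c * expR v)).
  by rewrite /E cmod_cexp cexp_CofR -CofRM -CofRN.
apply: (@cintegral_FTC_limit (fun v => (CofR c)^-1 * (1 - E v))) => //.
- move=> v; apply: rderiv_eq; first by apply: rderiv_scale; apply: rderiv_sub; [exact: rderiv_cst|exact: dE].
  by rewrite /E sub0r mulNr opprK -!mulrA mulKf // -cexpD.
- move=> v; apply: (@rcont_comp R R CofR (fun v => CofR v - CofR c * cexp (CofR v)) cexp); first exact: rcont_cexp.
  apply: rderiv_cont; apply: rderiv_sub; first exact: rderiv_id.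
  by apply: rderiv_scale; exact: rderiv_cexp_real.
- apply: (@vanish_pinfty_half R _ c^-1 1 ltr01) => v v0.
  have -> : (CofR c)^-1 * (1 - E v) - (CofR c)^-1 = - ((CofR c)^-1 * E v) by ring.
  rewrite cmodN cmodM cmodV cmod_CofR (gtr0_norm c0) cE ler_wpM2l ?invr_ge0 ?(ltW c0) //.
  rewrite /expabs mul1r ger0_norm // ler_expR lerN2.
  have := expR_ge1Dx v; have := expR_ge0 v; nra.
- apply: (@vanish_ninfty_half R _ 1 1 ltr01) => v v0.
  rewrite cmodM cmodV cmod_CofR (gtr0_norm c0) mul1r /expabs mul1r ler0_norm // opprK.
  have -> : 1 - E v = CofR (1 - expR (- (c * expR v))).
    by rewrite CofRB CofR1 /E cexp_CofR -CofRM -CofRN cexp_CofR.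
  rewrite cmod_CofR ler_pdivrMl // ger0_norm.
    have := expR_ge1Dx (- (c * expR v)); lra.
  rewrite subr_ge0 -expR0 ler_expR oppr_le0 mulr_ge0 ?expR_ge0 // ltW //.
Qed.

(** Fubini, after the second variable is replaced by the ratio of the two. *)
Lemma beta_GamE b : 0 < Re b < 1 -> Gam b * Gam (1 - b) = beta_integral b.
Proof.
move=> b01; have b0 : 0 < Re b by case/andP: b01.
have b'0 : 0 < Re (1 - b) by rewrite ReD ReN Re1 subr_gt0; case/andP: b01.
pose F (v x : R) := gamma_kernel b (CofR (x + v)) * gamma_kernel (1 - b) (CofR v).
have cg (c : C) (t : R) : rcont CofR (fun u => gamma_kernel c (CofR u)) t.
  apply: (@rcont_comp R R CofR CofR (gamma_kernel c)); last exact: rcont_id.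
  exact: holo_rcont (holo_gamma_kernel _ _).
have p20 : 0 < pi / 2 :> R by rewrite divr_gt0 // pi_gt0.
have gle (c : C) : 0 < Re c -> exists2 K : R, 0 <= K & forall u,
    cmod (gamma_kernel c (CofR u)) <= K * expabs (Num.min (Re c) 1) u.
  move=> c0; have z0 : `|(0 : R)| <= 0 by rewrite normr0.
  exists (expR (- (Im c * 0)) * exp_const (Re c) (cos 0)); first by rewrite mulr_ge0 ?expR_ge0.
  by move=> u; have := gamma_kernel_le u c0 z0 p20; rewrite iC0.
have e1 : Gam b * Gam (1 - b) = cintegral setT (fun v => cintegral setT (F v)).
  rewrite /Gam -cintegral_scale //; last exact: Gam_integrable.
  apply: eq_cintegral => v _; rewrite mulrC.
  have cs (t : R) : rcont CofR (fun u => gamma_kernel b (CofR (u + v))) t.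
    apply: (@rcont_comp R R CofR (fun u => CofR (u + v)) (gamma_kernel b)).
      exact: holo_rcont (holo_gamma_kernel _ _).
    under eq_fun do rewrite CofRD.
    by apply: rcont_add; [exact: rcont_id|exact: rcont_cst].
  have i0 : cintegrable setT (fun u => gamma_kernel b (CofR (u - v + v))).
    by apply: eq_cintegrable (Gam_integrable b0) => // u _; rewrite subrK.
  have [i1 e2] := @cintegrable_translate R (fun u => gamma_kernel b (CofR (u + v))) (- v) cs i0.
  rewrite /F.
  have -> : (fun x => gamma_kernel b (CofR (x + v)) * gamma_kernel (1 - b) (CofR v)) =
    (fun x => gamma_kernel (1 - b) (CofR v) * gamma_kernel b (CofR (x + v))).
    by apply/funext => x; rewrite mulrC.
  rewrite (cintegral_scale _ measurableT i1) e2.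
  have -> : (fun t => gamma_kernel b (CofR (t - v + v))) = (fun t => gamma_kernel b (CofR t)).
    by apply/funext => u; rewrite subrK.
  by [].
clear cg.
have innerE v x : F v x = cexp (b * CofR x) * cexp (CofR v - CofR (1 + expR x) * cexp (CofR v)).
  rewrite /F /gamma_kernel -!cexpD; congr cexp.
  by rewrite !(CofRD, cexpD) CofR1 !cexp_CofR; ring.
have inner x : F ^~ x = (fun v => cexp (b * CofR x) * cexp (CofR v - CofR (1 + expR x) * cexp (CofR v))).
  by apply/funext => v; exact: innerE.
have [K1 K10 h1] := gle _ b0; have [K2 K20 h2] := gle _ b'0.
pose k := Num.min (Num.min (Re b) 1) (Num.min (Re (1 - b)) 1).
have k0 : 0 < k by rewrite lt_min !minr_gt0.
have k20 : 0 < k / 2 by rewrite divr_gt0.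
have FM v x : cmod (F v x) <= (K1 * K2 * expabs (k / 2) v) * expabs (k / 2) x.
  rewrite /F cmodM; apply: le_trans (ler_pM (cmod_ge0 _) (cmod_ge0 _) (h1 _) (h2 _)) _.
  rewrite mulrACA -[X in _ <= X]mulrA ler_wpM2l ?mulr_ge0 // /expabs -!expRD ler_expR.
  have a1 : k * `|x + v| <= Num.min (Re b) 1 * `|x + v| by rewrite ler_wpM2r // ge_min lexx.
  have a2 : k * `|v| <= Num.min (Re (1 - b)) 1 * `|v| by rewrite ler_wpM2r // ge_min lexx orbT.
  have a3 : k / 2 * `|x| <= k / 2 * (`|x + v| + `|v|).
    by rewrite ler_wpM2l ?(ltW k20) //; have := ler_normB (x + v) v; rewrite addrK.
  have a4 : 0 <= k / 2 * `|x + v| by rewrite mulr_ge0 // ltW.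
  lra.
have mF : cmeas setT (fun xy : measurableTypeR R * measurableTypeR R => F xy.1 xy.2).
  have m1 : measurable_fun setT (fun xy : measurableTypeR R * measurableTypeR R => xy.1 : R) by exact: measurable_fst.
  have m2 : measurable_fun setT (fun xy : measurableTypeR R * measurableTypeR R => xy.2 : R) by exact: measurable_snd.
  have mg (c : C) (h : measurableTypeR R * measurableTypeR R -> R) : measurable_fun setT h ->
      cmeas setT (fun xy => gamma_kernel c (CofR (h xy))).
    move=> mh; apply: cmeas_cexp; apply: cmeas_add.
      by apply: cmeas_mul; [exact: cmeas_cst|exact: cmeas_real].
    by apply: cmeas_opp; apply: cmeas_cexp; exact: cmeas_real.
  by apply: cmeas_mul; apply: mg => //; apply: measurable_funD.
have iE := integrable_expabs k20.
have [_ fub] := cFubini mF (integrable_scale (K1 * K2) measurableT iE) iE FM.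
rewrite e1 fub; apply: eq_cintegral => x _; rewrite (inner x).
have ci : cintegrable setT (fun v => cexp (CofR v - CofR (1 + expR x) * cexp (CofR v)) : C).
  have mE : cmeasR setT (fun v => cexp (b * CofR x) * cexp (CofR v - CofR (1 + expR x) * cexp (CofR v))).
    apply: cmeas_rcont measurableT => v; apply: rcont_mul; first exact: rcont_cst.
    apply: (@rcont_comp R R CofR (fun v => CofR v - CofR (1 + expR x) * cexp (CofR v)) cexp); first exact: rcont_cexp.
    apply: rderiv_cont; apply: rderiv_sub; first exact: rderiv_id.
    by apply: rderiv_scale; exact: rderiv_cexp_real.
  have mFx : cmeasR setT (F ^~ x) by apply: cmeas_ext mE => v; rewrite innerE.
  have bF (v : R) : setT v -> cmod (F v x) <= K1 * K2 * expabs (k / 2) x * expabs (k / 2) v.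
    by move=> _; have := FM v x; rewrite mulrAC.
  have iF := cint_expabs measurableT k20 mFx bF.
  apply: (eq_cintegrable measurableT _ (cintegrable_scale (cexp (b * CofR x))^-1 measurableT iF)) => v _.
  by rewrite innerE (mulKf (cexp_neq0 _)).
rewrite (cintegral_scale _ measurableT ci) (exp_density_integral _ ci); last by rewrite lerDl expR_ge0.
by rewrite /beta_kernel cexp_CofR CofRD.
Qed.


(** epi c - epi (- c) is 2 i sin (pi c), the form in which the sine appears
    below. *)
Definition epi (c : C) : C := cexp (iC * CofR pi * c).

Lemma epiD (c d : C) : epi (c + d) = epi c * epi d.
Proof. by rewrite /epi mulrDr cexpD. Qed.
Lemma epiN (c : C) : epi (- c) = (epi c)^-1.
Proof. by rewrite /epi mulrN cexpN. Qed.
Lemma epi_neq0 (c : C) : epi c != 0. Proof. exact: cexp_neq0. Qed.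
Lemma cis_pihalf : cis (pi / 2) = iC :> C.
Proof.
by apply: cplx_ext; rewrite /cis ?Re_cexp ?Im_cexp !ReImE !(mul0r, mulr0, mul1r, addr0, add0r, subr0)
  expR0 mul1r ?cos_pihalf ?sin_pihalf.
Qed.
Lemma epi_half : epi (1 / 2) = iC.
Proof.
rewrite -cis_pihalf /epi /cis -mulrA; congr (cexp (_ * _)).
by rewrite CofRM CofRV CofR_nat mul1r.
Qed.

(** On the lines Im w = pi / 2 and Im w = - pi / 2 the denominators of the
    integrand are 1 + i e^u and 1 - i e^u; a combination of the two integrands
    has the denominator 1 + e^(2 u), which is again a Beta integral. *)
Lemma beta_doubling b : 0 < Re b < 1 ->
  beta_integral ((b + 1) / 2) * iC = beta_integral b * (epi (b / 2) - epi (- (b / 2))).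
Proof.
move=> b01; have p := @pi_gt0 R.
have hp : `|pi / 2| < pi :> R by rewrite ger0_norm; lra.
have hn : `|- (pi / 2)| < pi :> R by rewrite normrN.
have [i1 r1] := beta_rot b01 hp; have [i2 r2] := beta_rot b01 hn.
pose X (u : R) : C := cexp (CofR u).
pose k (u : R) : C := cexp ((b + 1) * CofR u) * (1 + cexp (2 * CofR u))^-1.
have Xi u : 1 + iC * X u != 0 /\ 1 - iC * X u != 0.
  by split; apply/eqP => /(congr1 (@Re R)); rewrite !ReImE /X Im_cexp /= sin0 mulr0 !(mul0r, mulr0, subr0, addr0, oppr0) => /eqP; rewrite oner_eq0.
have E1 u : beta_kernel b (CofR u + iC * CofR (pi / 2)) = epi (b / 2) * (cexp (b * CofR u) * (1 + iC * X u)^-1).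
  rewrite /beta_kernel /X !cexpD -/(cis (pi / 2)) cis_pihalf mulrDr cexpD [X in _ = X * _](_ : _ = cexp (b * (iC * CofR (pi / 2)))).
    by rewrite (mulrC _ iC); ring.
  by rewrite /epi; congr cexp; rewrite CofRM CofRV CofR_nat; ring.
have E2 u : beta_kernel b (CofR u + iC * CofR (- (pi / 2))) = epi (- (b / 2)) * (cexp (b * CofR u) * (1 - iC * X u)^-1).
  have cisN : cexp (iC * CofR (- (pi / 2))) = - iC :> C.
    rewrite CofRN mulrN cexpN -/(cis (pi / 2)) cis_pihalf.
    by apply: (mulfI iC_neq0); rewrite mulfV ?iC_neq0 // mulrN iC2 opprK.
  rewrite /beta_kernel /X !cexpD cisN mulrDr cexpD [X in _ = X * _](_ : _ = cexp (b * (iC * CofR (- (pi / 2))))).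
    by rewrite mulrN (mulrC _ iC); ring.
  by rewrite /epi; congr cexp; rewrite CofRN CofRM CofRV CofR_nat; ring.
have c1 := cintegrable_scale (epi (b / 2))^-1 measurableT i1.
have c2 := cintegrable_scale (epi (- (b / 2)))^-1 measurableT i2.
have T u : (epi (- (b / 2)))^-1 * beta_kernel b (CofR u + iC * CofR (- (pi / 2))) -
    (epi (b / 2))^-1 * beta_kernel b (CofR u + iC * CofR (pi / 2)) = 2 * iC * k u.
  rewrite E1 E2 !(mulKf (epi_neq0 _)) /k.
  have [x1 x2] := Xi u.
  have -> : (1 + cexp (2 * CofR u)) = (1 + iC * X u) * (1 - iC * X u).
    have -> : (1 + iC * X u) * (1 - iC * X u) = 1 - (iC * iC) * (X u * X u) by ring.
    by rewrite iC2 mulN1r opprK /X -cexpD; congr (1 + cexp _); ring.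
  have -> : cexp ((b + 1) * CofR u) = cexp (b * CofR u) * X u by rewrite /X -cexpD; congr cexp; ring.
  by field; rewrite x1 x2.
have ck : cintegrable setT (fun u => 2 * iC * k u).
  by apply: (eq_cintegrable measurableT _ (cintegrable_sub measurableT c2 c1)) => u _; rewrite T.
have S1 : beta_integral b * (epi (b / 2) - epi (- (b / 2))) = cintegral setT (fun u => 2 * iC * k u).
  rewrite -(eq_cintegral (fun u _ => T u)) cintegral_sub //.
  rewrite (cintegral_scale _ measurableT i1) (cintegral_scale _ measurableT i2) r1 r2 epiN invrK; ring.
have i0 : (iC : C) != 0 := iC_neq0.
have two0 : (2 : C) != 0 by rewrite -CofR_nat CofR_eq0 pnatr_eq0.
have ck2 : cintegrable setT (fun u => 2 * k u).
  apply: (eq_cintegrable measurableT _ (cintegrable_scale iC^-1 measurableT ck)) => u _.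
  by field.
rewrite S1.
have -> : (fun u => 2 * iC * k u) = (fun u => iC * (2 * k u)) by apply/funext => u; ring.
rewrite (cintegral_scale _ measurableT ck2) mulrC; congr (_ * _).
have dbl (u : R) : beta_kernel ((b + 1) / 2) (CofR (2 * u)) * CofR 2 = 2 * k u.
  rewrite /beta_kernel /k CofRM CofR_nat mulrC; congr (_ * (_ * _)).
  by congr cexp; field.
have h0 : forall t : R, is_derive t 1 (fun u : R => 2 * u) 2 by move=> t; exact: is_derive_mull.
have [|||||_ h] := @substitution_C R (fun u => 2 * u) (fun=> 2) setT h0 _ _ _ (fun u => beta_kernel ((b + 1) / 2) (CofR u)).
- by move=> t; exact: cvg_cst.
- by [].
- apply/seteqP; split => // x _; have [n _ hn'] := nat_gt `|x|.
  by exists n => //=; rewrite in_itv/=; have := hn' n (leqnn n); rewrite ler_norml; lra.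
- move=> t _; apply: (@rcont_comp R R CofR CofR (beta_kernel ((b + 1) / 2))); last exact: rcont_id.
  by apply: holo_rcont (holo_beta_kernel _ _); rewrite Im_CofR normr0.
- by apply: (eq_cintegrable measurableT _ ck2) => u _; rewrite dbl.
rewrite /beta_integral h; apply: eq_cintegral => u _; exact: dbl.
Qed.

(** The reflection u -> - u. *)
Lemma beta_sym b : 0 < Re b < 1 -> beta_integral (1 - b) = beta_integral b.
Proof.
move=> b01; have b01' : 0 < Re (1 - b) < 1 by rewrite ReD ReN Re1; lra.
by rewrite -!beta_GamE // mulrC; congr (Gam _ * _); ring.
Qed.

(** The duplication formula of the sine makes B(b) sin(pi b) invariant under
    b -> b / 2. *)
Lemma beta_halving b : 0 < Re b < 1 ->
  beta_integral (b / 2) * (epi (b / 2) - epi (- (b / 2))) =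
  beta_integral b * (epi b - epi (- b)).
Proof.
move=> b01; have b01' : 0 < Re (1 - b) < 1 by rewrite ReD ReN Re1; lra.
have Reh : Re (b / 2) = Re b / 2 by rewrite -CofR_nat -CofRV mulrC ReM Re_CofR Im_CofR mul0r subr0 mulrC.
have bh : 0 < Re (b / 2) < 1 by rewrite Reh; lra.
have two0 : (2 : C) != 0 by rewrite -CofR_nat CofR_eq0 pnatr_eq0.
have := beta_doubling b01'.
have -> : (1 - b + 1) / 2 = 1 - b / 2 by field.
rewrite (beta_sym bh) (beta_sym b01).
have -> : (1 - b) / 2 = 1 / 2 + - (b / 2) by field.
have e2 : - (1 / 2 + - (b / 2)) = - (1 / 2) + b / 2 by ring.
rewrite {}e2 !epiD (epiN (1 / 2)) epi_half.
have i0 : (iC : C) != 0 := iC_neq0.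
have -> : (iC : C)^-1 = - iC by apply: (mulfI i0); rewrite mulfV // mulrN iC2 opprK.
move=> h.
have {}h : beta_integral (b / 2) = beta_integral b * (epi (b / 2) + epi (- (b / 2))).
  by apply: (mulIf i0); rewrite h; ring.
have -> : epi b = epi (b / 2) * epi (b / 2) by rewrite -epiD; congr epi; field.
have -> : epi (- b) = epi (- (b / 2)) * epi (- (b / 2)) by rewrite -epiD; congr epi; field.
by rewrite h; ring.
Qed.

End Reflection.
Section ReflectionFormula.
Context {R : realType}.
Local Notation C := (Cplx R).
Implicit Types (b w : C).

Let rk b w : C := cexp (b * w) * (cexp w * (1 + cexp w)^-1 * (1 + cexp w)^-1).

Lemma rcont_rk b (t : R) : rcont CofR (fun u => rk b (CofR u)) t.
Proof.
apply: (@rcont_comp R R CofR CofR (rk b)); last exact: rcont_id.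
have h0 : 1 + cexp (CofR t) != 0 :> C by apply: one_plus_cexp_neq0; rewrite Im_CofR normr0 pi_gt0.
have h1 := holo_add (holo_cst 1 (CofR t)) (holo_cexp (holo_id (CofR t))).
have h2 := @holo_inv R (fun w => 1 + cexp w) _ (CofR t) h0 h1.
have h3 := holo_cexp (holo_scale b (holo_id (CofR t))).
exact: holo_rcont (holo_mul h3 (holo_mul (holo_mul (holo_cexp (holo_id _)) h2) h2)).
Qed.

Lemma eq_leR (x y : R) : x = y -> x <= y. Proof. by move=> ->. Qed.

Lemma rcont_sub (f g : R -> C) (t : R) : rcont CofR f t -> rcont CofR g t -> rcont CofR (fun u => f u - g u) t.
Proof.
move=> hf hg; have := rcont_add hf (rcont_mul (rcont_cst CofR (-1) t) hg).
by congr rcont; apply/funext => u; rewrite mulN1r.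
Qed.

Lemma rcont_beta b (t : R) : rcont CofR (fun u => beta_kernel b (CofR u)) t.
Proof.
apply: (@rcont_comp R R CofR CofR (beta_kernel b)); last exact: rcont_id.
by apply: holo_rcont (holo_beta_kernel _ _); rewrite Im_CofR normr0 pi_gt0.
Qed.

Lemma cmod_one_plus_real (t : R) : cmod (1 + cexp (CofR t)) = 1 + expR t :> R.
Proof. by rewrite cexp_CofR -CofR1 -CofRD cmod_CofR ger0_norm // addr_ge0 // expR_ge0. Qed.

Lemma rk0_le (t : R) : cmod (cexp (CofR t) * (1 + cexp (CofR t))^-1 * (1 + cexp (CofR t))^-1) <= expabs 1 t.
Proof.
rewrite !cmodM !cmodV cmod_one_plus_real cexp_CofR cmod_CofR ger0_norm ?expR_ge0 //.
have e0 := expR_gt0 t; have e1 : 0 < 1 + expR t by lra.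
rewrite /expabs mul1r; have [t0|t0] := leP 0 t.
  rewrite ger0_norm // expRN ler_pdivrMr // ler_pdivrMr // -[leRHS]mulrA ler_pdivlMl //; nra.
rewrite ltr0_norm // opprK ler_pdivrMr // ler_pdivrMr //; nra.
Qed.

(** Integration by parts makes the left-hand side regular at b = 0. *)
Lemma beta_parts b : 0 < Re b < 1 -> b * beta_integral b = cintegral setT (fun u => rk b (CofR u)).
Proof.
move=> b01; have k0 : 0 < Num.min (Re b) (1 - Re b) by rewrite lt_min; lra.
have [|K K0 hK] := @beta_kernel_le R b 0 b01; first by rewrite lexx pi_gt0.
have hK' u : cmod (beta_kernel b (CofR u)) <= K * expabs (Num.min (Re b) (1 - Re b)) u.
  by have := hK (CofR u); rewrite Im_CofR Re_CofR normr0 => /(_ (lexx _)).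
have ib := beta_integrable b01.
have E u : rk b (CofR u) = beta_kernel b (CofR u) * (cexp (CofR u) * (1 + cexp (CofR u))^-1).
  by rewrite /rk /beta_kernel; ring.
have ir : cintegrable setT (fun u => rk b (CofR u)).
  apply: (@cint_expabs R setT K _ _ measurableT k0); first by apply: cmeas_rcont => // t; exact: rcont_rk.
  move=> u _; rewrite E cmodM -[leRHS]mulr1 ler_pM ?cmod_ge0 //.
  rewrite cmodM cmodV cmod_one_plus_real cexp_CofR cmod_CofR ger0_norm ?expR_ge0 //.
  have := expR_gt0 u; move=> e0; rewrite ler_pdivrMr; lra.
have ibs := cintegrable_scale b measurableT ib.
rewrite /beta_integral -(cintegral_scale b measurableT ib); apply/eqP; rewrite -subr_eq0 -cintegral_sub //; apply/eqP.
have [v1 v2] := expabs_vanish k0 hK'.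
have hz (t : R) : `|Im (CofR t : C)| < pi by rewrite Im_CofR normr0 pi_gt0.
apply: (@cintegral_FTC_line R (fun u => beta_kernel b (CofR u))) v1 v2.
- move=> t; have [h _] := holo_beta_kernel b (hz t).
  apply: rderiv_eq; first by apply: (@rderiv_comp R R CofR CofR (beta_kernel b) _ _ _ h); exact: rderiv_id.
  by rewrite /beta_kernel1 E /beta_kernel; ring.
- move=> t; apply: rcont_sub; last exact: rcont_rk.
  by apply: rcont_mul; [exact: rcont_cst|exact: rcont_beta].
- exact: cintegrable_sub.
Qed.

Lemma rk0_integral : cintegral setT (fun u => rk 0 (CofR u)) = 1.
Proof.
have one0 (t : R) : 1 + cexp (CofR t) != 0 :> C by apply: one_plus_cexp_neq0; rewrite Im_CofR normr0 pi_gt0.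
have E (u : R) : rk 0 (CofR u) = cexp (CofR u) * (1 + cexp (CofR u))^-1 * (1 + cexp (CofR u))^-1.
  by rewrite /rk mul0r cexp0 mul1r.
have ir : cintegrable setT (fun u => rk 0 (CofR u)).
  apply: (@cint_expabs R setT 1 _ _ measurableT ltr01); first by apply: cmeas_rcont => // t; exact: rcont_rk.
  by move=> u _; rewrite E mul1r rk0_le.
apply: (@cintegral_FTC_limit R (fun u => cexp (CofR u) * (1 + cexp (CofR u))^-1)) => //.
- move=> t; have h1 := holo_add (holo_cst 1 (CofR t)) (holo_cexp (holo_id (CofR t))).
  have [h _] := holo_mul (holo_cexp (holo_id (CofR t))) (@holo_inv R (fun w => 1 + cexp w) _ (CofR t) (one0 t) h1).
  apply: rderiv_eq; first by apply: (@rderiv_comp R R CofR CofR (fun w => cexp w * (1 + cexp w)^-1) _ _ _ h); exact: rderiv_id.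
  by rewrite /= E; field.
- by move=> t; exact: rcont_rk.
- apply: (@vanish_pinfty_half R _ 1 1 ltr01) => t t0.
  have -> : cexp (CofR t) / (1 + cexp (CofR t)) - 1 = - (1 + cexp (CofR t))^-1 :> C by field.
  rewrite mul1r cmodN cmodV cmod_one_plus_real /expabs mul1r ger0_norm // expRN lef_pV2 ?posrE ?expR_gt0 ?ltr_pwDl ?expR_ge0 //; lra.
- apply: (@vanish_ninfty_half R _ 1 1 ltr01) => t t0.
  rewrite mul1r cmodM cmodV cmod_one_plus_real cexp_CofR cmod_CofR ger0_norm ?expR_ge0 // /expabs mul1r ler0_norm // opprK.
  have e0 := expR_gt0 t; rewrite ler_pdivrMr; nra.
Qed.

(** b B(b) -> 1 as b -> 0, at a linear rate. *)
Lemma beta_small : exists2 K : R, 0 <= K & forall b, 0 < Re b < 1 -> cmod b <= 1 / 4 ->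
  cmod (b * beta_integral b - 1) <= K * cmod b.
Proof.
have k0 : 0 < 1 / 2 :> R by lra.
have [B B0 hB] := @cintegral_expabs_le R setT _ measurableT k0.
exists (8 * B); first lra.
move=> b b01 b4; have zr (u : R) : rk b (CofR u) - rk 0 (CofR u) = (cexp (b * CofR u) - 1) * (cexp (CofR u) * (1 + cexp (CofR u))^-1 * (1 + cexp (CofR u))^-1).
  by rewrite /rk mul0r cexp0; ring.
have bd (u : R) : cmod (rk b (CofR u) - rk 0 (CofR u)) <= (8 * cmod b) * expabs (1 / 2) u.
  rewrite zr cmodM (le_trans (ler_wpM2l (cmod_ge0 _) (rk0_le u))) //.
  rewrite (le_trans (ler_wpM2r (expabs_ge0 _ _) (cexp_sub1_le _))) // cmodM cmod_CofR.
  have h1 : expR (cmod b * `|u|) <= expR (`|u| / 4) by rewrite ler_expR; have := normr_ge0 u; nra.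
  have h2 : `|u| <= 4 * expR (`|u| / 4) by have := expR_ge1Dx (`|u| / 4); have := normr_ge0 u; lra.
  rewrite /expabs.
  have -> : expR (- (1 / 2 * `|u|)) = expR (`|u| / 4) * expR (`|u| / 4) * expR (- (1 * `|u|)) :> R.
    by rewrite -!expRD; congr expR; field.
  rewrite [leRHS]mulrA ler_wpM2r ?expR_ge0 //.
  have : expR (cmod b * `|u|) * (cmod b * `|u|) <= expR (`|u| / 4) * (cmod b * (4 * expR (`|u| / 4))).
    by rewrite ler_pM ?expR_ge0 ?mulr_ge0 ?cmod_ge0 // ler_wpM2l ?cmod_ge0.
  lra.
have m c : cmeasR setT (fun u => rk c (CofR u)).
  by apply: cmeas_rcont => // t; exact: rcont_rk.
have ir0 : cintegrable setT (fun u => rk 0 (CofR u)).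
  apply: (@cint_expabs R setT 1 _ _ measurableT ltr01) => //.
  by move=> u _; rewrite /rk mul0r cexp0 !mul1r rk0_le.
have idf : cintegrable setT (fun u => rk b (CofR u) - rk 0 (CofR u)).
  apply: (@cint_expabs R setT _ _ _ measurableT k0) => [|u _]; last exact: bd.
  by apply: cmeas_rcont => // t; apply: rcont_sub; exact: rcont_rk.
rewrite (beta_parts b01) -rk0_integral.
have -> : cintegral setT (fun u => rk b (CofR u)) = cintegral setT (fun u => rk b (CofR u) - rk 0 (CofR u)) + cintegral setT (fun u => rk 0 (CofR u)).
  by rewrite -cintegral_add //; apply: eq_cintegral => u _; rewrite subrK.
rewrite addrK (le_trans (hB _ (8 * cmod b) _ _)) //.
- by case: idf => i1 i2; apply: cmeas_rcont => // t; apply: rcont_sub; exact: rcont_rk.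
- by apply: eq_leR; ring.
Qed.

Lemma epi_small b : cmod b <= 1 -> cmod (epi b - epi (- b) - 2 * iC * CofR pi * b) <= 8 * expR pi * pi ^+ 2 * cmod b ^+ 2.
Proof.
move=> b1; have p0 := @pi_gt0 R.
have -> : epi b - epi (- b) - 2 * iC * CofR pi * b =
  (cexp (iC * CofR pi * b) - 1 - iC * CofR pi * b) - (cexp (iC * CofR pi * - b) - 1 - iC * CofR pi * - b).
  by rewrite /epi; ring.
have h (c : C) : cmod c <= 1 -> cmod (cexp (iC * CofR pi * c) - 1 - iC * CofR pi * c) <= 4 * expR pi * pi ^+ 2 * cmod c ^+ 2.
  move=> c1; apply: le_trans (cexp_sub2_le _) _.
  rewrite !cmodM cmod_iC mul1r cmod_CofR (ger0_norm (ltW p0)) exprMn -!mulrA ler_wpM2l // ler_wpM2r //.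
    by rewrite !mulr_ge0 ?sqr_ge0 ?cmod_ge0 ?(ltW p0).
  by rewrite ler_expR ler_piMr // ltW.
apply: le_trans (cmodB _ _) _; have h1 := h _ b1; have := h (- b); rewrite cmodN => /(_ b1) h2.
by rewrite (le_trans (lerD h1 h2)) // -mulrDl; apply: eq_leR; ring.
Qed.

Lemma epi_diff_le b : cmod (epi b - epi (- b)) <= 2 * expR (pi * `|Im b|).
Proof.
have h c : `|Im c| = `|Im b| -> cmod (epi c) <= expR (pi * `|Im b|).
  move=> cb; rewrite /epi cmod_cexp ler_expR !ReImE !(mul0r, mul1r, add0r, addr0, mulr0, sub0r).
  rewrite -cb; have := ler_norm (- Im c); rewrite normrN; have := @pi_ge0 R; nra.
rewrite (le_trans (cmodB _ _)) // mulrDl mul1r lerD // h // ImN normrN //.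
Qed.

(** B(b) sin (pi b) does not change when b is halved, and tends to pi as b ->
    0. *)
Lemma reflection b : 0 < Re b < 1 -> Gam b * Gam (1 - b) * (epi b - epi (- b)) = 2 * iC * CofR pi.
Proof.
move=> b01; rewrite beta_GamE //.
have [K K0 hK] := beta_small.
pose h n : C := b / 2 ^+ n.
have two0 : (2 : C) != 0 by rewrite -CofR_nat CofR_eq0 pnatr_eq0.
have hE n : h n = b * CofR ((2 ^+ n)^-1) by rewrite /h CofRV CofRX CofR_nat.
have pn n : 1 <= 2 ^+ n :> R by rewrite exprn_ege1 // ler1n.
have Reh n : Re (h n) = Re b / 2 ^+ n by rewrite hE ReM Re_CofR Im_CofR mulr0 subr0.
have h01 n : 0 < Re (h n) < 1.
  have := pn n => p1; rewrite Reh divr_gt0 ?ltr_pdivrMr; lra.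
have inv n : beta_integral (h n) * (epi (h n) - epi (- h n)) = beta_integral b * (epi b - epi (- b)).
  elim: n => [|n IH]; first by rewrite /h expr0 divr1.
  by rewrite -IH -(beta_halving (h01 n)) /h exprSr invfM mulrA.
have b0 : b != 0 by apply/eqP => b0; move: b01; rewrite b0 Re0 ltxx.
pose L : R := (K * 2 * pi + (8 * expR pi * pi ^+ 2) * (1 + K)) * cmod b.
have p0 := @pi_gt0 R.
have L0 : 0 <= L by rewrite /L mulr_ge0 ?cmod_ge0 // addr_ge0 ?mulr_ge0 ?expR_ge0 ?exprn_ge0 ?(ltW p0) // addr_ge0.
apply/eqP; rewrite -subr_eq0 -cmod_eq0; apply/eqP/le_anti; rewrite cmod_ge0 andbT.
apply/ler_addgt0Pr => e e0; rewrite add0r.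
have [N _ hN] := nat_gt (4 * cmod b + L / e); have {hN} := hN N (leqnn N) => hN.
have cb := cmod_ge0 b.
have Le : 0 <= L / e by rewrite divr_ge0 // ltW.
have N2 : N%:R <= 2 ^+ N :> R by rewrite -natrX ler_nat ltnW // ltn_expl.
have t0 : 0 < 2 ^+ N :> R by have := pn N; lra.
have chE : cmod (h N) = cmod b / 2 ^+ N by rewrite hE cmodM cmod_CofR ger0_norm // invr_ge0 ltW.
have ch4 : cmod (h N) <= 1 / 4 by rewrite chE ler_pdivrMr //; lra.
have hN0 : h N != 0 by rewrite /h mulf_neq0 // invr_eq0 expf_neq0.
have s1 := hK _ (h01 N) ch4.
have s2 : cmod ((epi (h N) - epi (- h N)) / h N - 2 * iC * CofR pi) <= 8 * expR pi * pi ^+ 2 * cmod (h N).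
  have -> : (epi (h N) - epi (- h N)) / h N - 2 * iC * CofR pi = (epi (h N) - epi (- h N) - 2 * iC * CofR pi * h N) / h N by field.
  rewrite cmodM cmodV ler_pdivrMr ?cmod_gt0 // -[leRHS]mulrA -expr2 epi_small //; lra.
rewrite -(inv N).
set X := h N * beta_integral (h N) in s1 *; set Y := (epi (h N) - _) / h N in s2 *.
have -> : beta_integral (h N) * (epi (h N) - epi (- h N)) - 2 * iC * CofR pi = (X - 1) * (2 * iC * CofR pi) + X * (Y - 2 * iC * CofR pi).
  by rewrite /X /Y; field.
have cX : cmod X <= 1 + K.
  have -> : X = 1 + (X - 1) by ring.
  apply: le_trans (cmodD _ _) _; rewrite cmod1 lerD2l (le_trans s1) //.
  by rewrite ler_piMr //; lra.
have c2 : cmod (2 * iC * CofR pi : C) = 2 * pi.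
  by rewrite !cmodM cmod_iC mulr1 cmod_nat cmod_CofR ger0_norm // ltW.
apply: le_trans (cmodD _ _) _; rewrite [cmod ((X - 1) * _)]cmodM [cmod (X * _)]cmodM c2.
have q1 : cmod (X - 1) * (2 * pi) <= K * cmod (h N) * (2 * pi) by rewrite ler_wpM2r // mulr_ge0 // ltW.
have q2 : cmod X * cmod (Y - 2 * iC * CofR pi) <= (1 + K) * (8 * expR pi * pi ^+ 2 * cmod (h N)) by rewrite ler_pM ?cmod_ge0.
apply: le_trans (lerD q1 q2) _.
have -> : K * cmod (h N) * (2 * pi) + (1 + K) * (8 * expR pi * pi ^+ 2 * cmod (h N)) = L / 2 ^+ N.
  by rewrite chE /L; field; rewrite gt_eqF.
by rewrite ler_pdivrMr // -ler_pdivrMl // mulrC; lra.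
Qed.

Lemma Gam_neq0 b : 0 < Re b < 1 -> Gam b != 0.
Proof.
move=> b01; apply/eqP => g0; have := reflection b01; rewrite g0 !mul0r => /esym/eqP.
by rewrite !mulf_eq0 -CofR_nat !CofR_eq0 pnatr_eq0 (negPf iC_neq0) /= gt_eqF // pi_gt0.
Qed.

(** The reflection formula turns the upper bound for Gamma (1 - b) into a
    lower bound for Gamma (b). *)
Lemma Gam_inv_le (a : R) : 0 < a < 1 -> exists2 K : R, 0 <= K & forall b, Re b = a ->
  cmod (Gam b)^-1 <= K * (1 + `|Im b|) ^+ 2 * expR (pi / 2 * `|Im b|).
Proof.
move=> a01; have [|K K0 hK] := @Gam_le R (1 - a); first lra.
have p0 := @pi_gt0 R.
exists (K / pi); first by rewrite divr_ge0 // ltW.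
move=> b ba; have b01 : 0 < Re b < 1 by rewrite ba.
have g0 := Gam_neq0 b01; have tp0 : (2 * iC * CofR pi : C) != 0.
  by rewrite !mulf_neq0 ?iC_neq0 // -?CofR_nat CofR_eq0 ?pnatr_eq0 // gt_eqF.
have -> : (Gam b)^-1 = Gam (1 - b) * (epi b - epi (- b)) / (2 * iC * CofR pi).
  by apply: (mulfI g0); rewrite mulfV // !mulrA reflection // mulfV.
rewrite !cmodM cmodV !cmodM cmod_iC mulr1 cmod_nat cmod_CofR (ger0_norm (ltW p0)).
have h1 := hK (1 - b); rewrite ReD ReN Re1 ba ImD ImN Im1 sub0r normrN in h1.
have {h1} := h1 erefl => h1; have h2 := epi_diff_le b.
have h3 : cmod (Gam (1 - b)) * cmod (epi b - epi (- b)) <=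
   K * (1 + `|Im b|) ^+ 2 * expR (- (pi / 2 * `|Im b|)) * (2 * expR (pi * `|Im b|)) by rewrite ler_pM ?cmod_ge0.
rewrite ler_pdivrMr ?mulr_gt0 // (le_trans h3) //.
have -> : expR (pi * `|Im b|) = expR (pi / 2 * `|Im b|) * expR (pi / 2 * `|Im b|) by rewrite -expRD; congr expR; field.
rewrite expRN; apply: eq_leR; move: (expR_gt0 (pi / 2 * `|Im b|)) p0 {tp0 h1 h2 h3}; move: (expR _) => E; move: (pi) => P E0 P0.
by field; rewrite !gt_eqF.
Qed.

Lemma Gam_half : Gam (1 / 2 : C) = CofR (Num.sqrt pi).
Proof.
have b01 : 0 < Re (1 / 2 : C) < 1.
  have -> : (1 / 2 : C) = CofR (1 / 2) by rewrite CofRM CofRV CofR_nat mul1r.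
  by rewrite Re_CofR; lra.
have := reflection b01.
have two0 : (2 : C) != 0 by rewrite -CofR_nat CofR_eq0 pnatr_eq0.
have -> : (1 - 1 / 2 : C) = 1 / 2 by field.
rewrite epiN epi_half; have i0 : (iC : C) != 0 := iC_neq0.
have -> : (iC : C)^-1 = - iC by apply: (mulfI i0); rewrite mulfV // mulrN iC2 opprK.
rewrite opprK => h.
have {}h : Gam (1 / 2) * Gam (1 / 2) = CofR pi :> C.
  by apply: (mulfI (mulf_neq0 two0 i0)); rewrite -h; ring.
have gR (u : R) : gamma_kernel (1 / 2) (CofR u) = CofR (expR (u / 2 - expR u)).
  by rewrite /gamma_kernel -cexp_CofR; congr cexp; rewrite CofRB cexp_CofR CofRM CofRV CofR_nat; congr (_ - _); ring.
have GE : Gam (1 / 2) = CofR (Re (Gam (1 / 2))) :> C.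
  apply: cplx_ext; rewrite ?Re_CofR ?Im_CofR // /Gam Im_cintegral /Rintegral.
  by rewrite integral0_eq // => v _; rewrite gR Im_CofR.
have G0 : 0 <= Re (Gam (1 / 2) : C).
  by apply: Rintegral_ge0 => u _; rewrite gR Re_CofR expR_ge0.
move: h; rewrite GE -CofRM => /CofR_inj <-; rewrite -expr2 sqrtr_sqr ger0_norm //.
Qed.

End ReflectionFormula.

(** * Uniqueness of the Tricomi function *)

Section RecessiveSolution.
Context {R : realType}.
Local Notation C := (Cplx R).

Definition dotC (u w : C) : R := Re u * Re w + Im u * Im w.

Lemma dotCE u w : dotC u w = Re (w * u^*).
Proof. by rewrite ReM /dotC; case: u w => [? ?] [? ?] /=; ring. Qed.

Lemma is_derive_expR_comp (g : R -> R) (t d : R) : is_derive t 1 g d ->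
  is_derive t 1 (fun s => expR (g s)) (expR (g t) * d).
Proof. by move=> h; exact: (is_derive1_comp (is_derive_expR (g t)) h). Qed.

Lemma dotC_le u w : dotC u w <= cmod u * cmod w.
Proof.
by rewrite dotCE (le_trans (ler_norm _)) // (le_trans (Re_le_cmod _)) // cmodM cmod_conj mulrC.
Qed.

Lemma dotC_sub u v w : dotC u v - cmod u * cmod (v - w) <= dotC u w.
Proof. by have := dotC_le u (v - w); rewrite /dotC ReD ReN ImD ImN; lra. Qed.

Lemma dotC_id u : dotC u u = cmod u ^+ 2.
Proof. by rewrite cmod_sqr /dotC !expr2. Qed.

Lemma is_derive_dotC (u : C) (W : R -> C) (t : R) (d : C) : rderiv CofR W t d ->
  is_derive t 1 (fun s => dotC u (W s)) (dotC u d).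
Proof.
move=> h; rewrite dotCE.
have -> : (fun s => dotC u (W s)) = (fun s => Re (W s * u^*)) by apply/funext => s; rewrite dotCE.
by apply: rderiv_Re; apply: rderiv_eq; [apply: rderiv_mul h _; exact: rderiv_cst|rewrite mulr0 addr0].
Qed.

(** The contradiction in which both growth arguments below end. *)
Lemma expR_superlinear (k A B z0 : R) : 0 < k -> 0 < A ->
  ~ (forall z : R, z0 <= z -> 0 < z -> A * expR (k * z) <= B * z).
Proof.
move=> k0 A0 h; pose z := `|z0| + 4 * (`|B| + 1) / (A * k ^+ 2) + 1.
have k2 : 0 < A * k ^+ 2 by rewrite mulr_gt0 ?exprn_gt0.
have q0 : 0 <= 4 * (`|B| + 1) / (A * k ^+ 2) by rewrite divr_ge0 ?(ltW k2) // mulr_ge0 // addr_ge0.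
have z1 : 1 <= z by rewrite /z; have := normr_ge0 z0; lra.
have := h z; have -> : z0 <= z by rewrite /z; have := ler_norm z0; lra.
have z00 : 0 < z by lra.
move=> /(_ isT z00); apply/negP; rewrite -ltNge.
have -> : expR (k * z) = expR (k * z / 2) ^+ 2 by rewrite -expRM_natl; congr expR; field.
have e1 : (k * z / 2) ^+ 2 <= expR (k * z / 2) ^+ 2.
  rewrite ler_sqr ?nnegrE ?expR_ge0 ?divr_ge0 ?mulr_ge0 ?(ltW k0) ?(ltW z00) //.
  by have := expR_ge1Dx (k * z / 2); lra.
apply: lt_le_trans (ler_wpM2l (ltW A0) e1).
have -> : A * (k * z / 2) ^+ 2 = (A * k ^+ 2 * z / 4) * z by field.
rewrite ltr_pM2r // (le_lt_trans (ler_norm B)) // ltr_pdivlMr // mulrC -ltr_pdivrMl //.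
by rewrite /z; have := normr_ge0 z0; rewrite mulrC; have : 4 * `|B| / (A * k ^+ 2) <= 4 * (`|B| + 1) / (A * k ^+ 2); [rewrite ler_pM2r ?invr_gt0 // ; lra|lra].
Qed.

Section Growth.
Variables (a : C) (b k K x0 : R) (W W1 W2 : R -> C).
Hypotheses (b1 : b <= 1) (k0 : 0 < k) (k1 : k <= 1) (x00 : 0 <= x0).
Hypothesis dW : forall t, rderiv CofR W t (W1 t).
Hypothesis dW1 : forall t, rderiv CofR W1 t (W2 t).
Hypothesis ode : forall t, W2 t + (CofR b - 1 - cexp (CofR t)) * W1 t = a * cexp (CofR t) * W t.
Hypothesis WK : forall t, x0 <= t -> cmod (W t) <= K * expR ((1 - k) * expR t).

(** The integrating factor p of the confluent equation in t = ln z, which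
    becomes (p W')' = p a e^t W. *)
Definition ode_weight (t : R) : C := cexp ((CofR b - 1) * CofR t - cexp (CofR t)).

Lemma rderiv_ode_weight t :
  rderiv CofR ode_weight t (ode_weight t * (CofR b - 1 - cexp (CofR t))).
Proof.
apply: rderiv_eq.
  apply: (@rderiv_comp R R CofR _ cexp); first exact: rderiv_cexp.
  apply: rderiv_sub; last exact: rderiv_cexp_real.
  apply: rderiv_mul; [exact: rderiv_cst|exact: rderiv_id].
by rewrite /ode_weight; ring.
Qed.

Lemma rderiv_flux t : rderiv CofR (fun s => ode_weight s * W1 s) t (ode_weight t * (a * cexp (CofR t) * W t)).
Proof.
apply: rderiv_eq; first by apply: rderiv_mul; [exact: rderiv_ode_weight|exact: dW1].
by rewrite -ode; ring.
Qed.

Lemma cmod_ode_weight t : cmod (ode_weight t) = expR ((b - 1) * t - expR t).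
Proof.
by rewrite /ode_weight cmod_cexp cexp_CofR -CofR1 -CofRB -CofRM -CofRB Re_CofR.
Qed.

Let E t := expR (- (k * expR t)).
Let L := 2 * (cmod a * K / k).

Let K0 : 0 <= K.
Proof. by have := le_trans (cmod_ge0 _) (WK (lexx x0)); rewrite pmulr_lge0 ?expR_gt0. Qed.

Lemma flux_increment t s : x0 <= t -> t <= s ->
  cmod (ode_weight s * W1 s - ode_weight t * W1 t) <= L * E t.
Proof.
move=> xt ts.
have := @mean_value_ineq R (fun s => ode_weight s * W1 s) _ (fun s => - (cmod a * K / k) * E s)
  (fun s => cmod a * K * expR s * E s) t s ts (fun r _ => rderiv_flux r).
have dE (r : R) : is_derive r 1 E (E r * - (k * expR r)).
  by move: (is_deriveN (is_deriveZ k (is_derive_expR r))) => h; exact: (is_derive_expR_comp h).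
have dm (r : R) : is_derive r 1 (fun s => - (cmod a * K / k) * E s) (cmod a * K * expR r * E r).
  have h := is_deriveZ (- (cmod a * K / k)) (dE r).
  apply: (is_derive_eq h); rewrite /GRing.scale /=; field; exact: lt0r_neq0.
move=> /(_ (fun r _ => dm r)) h; apply: le_trans (h _) _; last first.
  have -> : L * E t = 2 * (cmod a * K / k * E t) by rewrite /L; ring.
  rewrite ler_pM2l // !mulNr opprK gerDr oppr_le0 mulr_ge0 ?expR_ge0 // divr_ge0 ?mulr_ge0 ?cmod_ge0 //; exact: ltW.
move=> r /andP[tr _]; rewrite !cmodM cmod_ode_weight cexp_CofR cmod_CofR ger0_norm ?expR_ge0 //.
have xr := le_trans xt tr; have r0 := le_trans x00 xr.
have w1 : expR ((b - 1) * r - expR r) <= expR (- expR r) by rewrite ler_expR gerDr mulr_le0_ge0 // subr_le0.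
have -> : E r = expR (- expR r) * expR ((1 - k) * expR r) by rewrite /E -expRD; congr expR; ring.
have := ler_pM (expR_ge0 _) (cmod_ge0 _) w1 (WK xr).
move=> /(ler_wpM2l (mulr_ge0 (cmod_ge0 a) (expR_ge0 r))); lra.
Qed.

(** If the flux p W' at t exceeded its later variation, W' would point in a
    fixed direction with size at least that of 1 / p, and W would exceed its
    bound. *)
Lemma flux_decay t : x0 <= t -> cmod (ode_weight t * W1 t) <= L * E t.
Proof.
move=> xt; rewrite leNgt; apply/negP => gt; set g := ode_weight t * W1 t in gt *.
pose d := cmod g * (cmod g - L * E t).
have L0 : 0 <= L by rewrite /L mulr_ge0 // divr_ge0 ?mulr_ge0 ?cmod_ge0 // ltW.
have g0 : 0 < cmod g by apply: le_lt_trans gt; rewrite mulr_ge0 ?expR_ge0.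
have d0 : 0 < d by rewrite mulr_gt0 // subr_gt0.
have hd s : t <= s -> d * expR (expR s) <= dotC g (W1 s).
  move=> ts; have xs := le_trans x00 (le_trans xt ts).
  have -> : W1 s = CofR (expR (expR s - (b - 1) * s)) * (ode_weight s * W1 s).
    rewrite mulrA; have -> : CofR (expR (expR s - (b - 1) * s)) = (ode_weight s)^-1 :> C.
      by rewrite /ode_weight -cexpN -cexp_CofR; congr cexp; rewrite CofRB cexp_CofR CofRM CofRB CofR1; ring.
    by rewrite mulVf ?mul1r // cexp_neq0.
  set X := ode_weight s * W1 s; set c := expR (expR s - (b - 1) * s).
  have -> : dotC g (CofR c * X) = c * dotC g X by rewrite /dotC !ReImE !mul0r subr0 addr0; ring.
  have h1 : d <= dotC g X.
    have := dotC_sub g g X; rewrite dotC_id; have := flux_increment xt ts; rewrite -/g -/X cmodBC => h h'.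
    by apply: le_trans h'; rewrite /d mulrBr -expr2 lerB // ler_wpM2l // ltW.
  have h2 : expR (expR s) <= c by rewrite ler_expR lerDl oppr_ge0 mulr_le0_ge0 // subr_le0.
  by rewrite [leRHS]mulrC ler_pM ?expR_ge0 // ltW.
pose n (s : R) := expR (expR s - s).
have dn (s : R) : is_derive s 1 n (n s * (expR s - 1)).
  by move: (is_deriveB (is_derive_expR s) (is_derive_id s 1)) => h; exact: (is_derive_expR_comp h).
pose c0 := dotC g (W t) - d * n t.
have lb s : t <= s -> d * n s + c0 <= dotC g (W s).
  move=> ts; have := @is_derive_ndecr R (fun s => dotC g (W s) - d * n s) (fun s => dotC g (W1 s) - d * (n s * (expR s - 1))) t s ts.
  rewrite /c0 => h; suff : dotC g (W t) - d * n t <= dotC g (W s) - d * n s by lra.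
  apply: h => r /andP[tr _].
    have h1 := is_derive_dotC g (dW r); have h2 := dn r.
    have h := is_deriveB h1 (is_deriveZ d h2); exact: (is_derive_eq h).
  rewrite subr_ge0 (le_trans _ (hd r tr)) // ler_wpM2l ?(ltW d0) //.
  rewrite /n expRD expRN mulrBr mulr1 -[leRHS]subr0 -[X in X - _]mulrA mulVf ?mulr1 ?gt_eqF ?expR_gt0 //.
  by rewrite lerD2l lerN2 divr_ge0 ?expR_ge0.
apply: (@expR_superlinear k d (cmod g * K + `|c0|) (expR t)) => // z tz z0.
have [s zs] : exists s, z = expR s by exists (ln z); rewrite lnK.
have ts : t <= s by rewrite -ler_expR -zs.
have h1 := lb s ts; have h2 := dotC_le g (W s); have h3 := WK (le_trans xt ts).
have h4 : d * n s <= cmod g * (K * expR ((1 - k) * z)) + `|c0|.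
  have := ler_wpM2l (ltW g0) h3; have := ler_norm (- c0); rewrite normrN -zs; lra.
have nE : n s = expR (k * z) * expR ((1 - k) * z) / z.
  by rewrite /n zs -expRD expRD expRN -zs; congr (expR _ / _); ring.
have h5 : 1 <= expR ((1 - k) * z) by rewrite -[leLHS]expR0 ler_expR; apply: mulr_ge0; [by rewrite subr_ge0|exact: ltW].
have h6 : d * (expR (k * z) * expR ((1 - k) * z) / z) <= (cmod g * K + `|c0|) * expR ((1 - k) * z).
  rewrite -nE (le_trans h4) //; have := ler_peMr (normr_ge0 c0) h5; lra.
have := ler_wpM2r (ltW z0) h6.
have -> : d * (expR (k * z) * expR ((1 - k) * z) / z) * z = d * expR (k * z) * expR ((1 - k) * z).
  by field; exact: lt0r_neq0.
by rewrite [leRHS]mulrAC (ler_pM2r (expR_gt0 _)).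
Qed.

End Growth.


Section Uniqueness.
Variables (a : C) (b x0 K : R) (W W1 W2 V V1 V2 : R -> C).
Hypotheses (b1 : b <= 1) (x00 : 0 <= x0).
Hypothesis dW : forall t, rderiv CofR W t (W1 t).
Hypothesis dW1 : forall t, rderiv CofR W1 t (W2 t).
Hypothesis odeW : forall t, W2 t + (CofR b - 1 - cexp (CofR t)) * W1 t = a * cexp (CofR t) * W t.
Hypothesis WK : forall t, x0 <= t -> cmod (W t) <= K * expR (1 / 2 * expR t).
Hypothesis dV : forall t, rderiv CofR V t (V1 t).
Hypothesis dV1 : forall t, rderiv CofR V1 t (V2 t).
Hypothesis odeV : forall t, V2 t + (CofR b - 1 - cexp (CofR t)) * V1 t = a * cexp (CofR t) * V t.
Hypothesis VK : forall t, x0 <= t -> cmod (V t) <= K * expR (1 / 4 * expR t).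
Hypothesis V0 : forall t, x0 <= t -> V t != 0.

Let wronskian t := W t * (ode_weight b t * V1 t) - ode_weight b t * W1 t * V t.

(** p times the Wronskian is constant, and each of its terms is a flux times
    the other solution, hence of size e^(- e^t / 4). *)
Lemma wronskian_eq0 t : x0 <= t -> wronskian t = 0.
Proof.
move=> xt.
have K0 : 0 <= K by have := le_trans (cmod_ge0 _) (WK (lexx x0)); rewrite pmulr_lge0 ?expR_gt0.
have cst s : t <= s -> wronskian s = wronskian t.
  move=> ts; apply/eqP; rewrite -subr_eq0 -cmod_eq0 eq_le cmod_ge0 andbT.
  have := @mean_value_lip R wronskian (fun=> 0) 0 t s ts; rewrite mul0r mulr0; apply => r _; last by rewrite cmod0.
  apply: rderiv_eq.
    apply: rderiv_sub; apply: rderiv_mul.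
    - exact: dW.
    - exact: (rderiv_flux dV1 odeV).
    - exact: (rderiv_flux dW1 odeW).
    - exact: dV.
  by rewrite /=; ring.
have h2 : (0 : R) < 1 / 2 by rewrite divr_gt0.
have h4 : (0 : R) < 3 / 4 by rewrite divr_gt0.
have h2' : (1 / 2 : R) <= 1 by lra.
have h4' : (3 / 4 : R) <= 1 by lra.
have e2 : 1 - 1 / 2 = 1 / 2 :> R by lra.
have e4 : 1 - 3 / 4 = 1 / 4 :> R by lra.
have WK' s : x0 <= s -> cmod (W s) <= K * expR ((1 - 1 / 2) * expR s) by rewrite e2; exact: WK.
have VK' s : x0 <= s -> cmod (V s) <= K * expR ((1 - 3 / 4) * expR s) by rewrite e4; exact: VK.
pose L2 := 2 * (cmod a * K / (1 / 2)); pose L4 := 2 * (cmod a * K / (3 / 4)).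
have bound s : t <= s -> cmod (wronskian t) <= (K * L4 + L2 * K) * expR (- (1 / 4 * expR s)).
  move=> ts; rewrite -(cst s ts); have xs := le_trans xt ts.
  have f1 := flux_decay b1 h2 h2' x00 dW dW1 odeW WK' xs.
  have f2 := flux_decay b1 h4 h4' x00 dV dV1 odeV VK' xs.
  have E1 : expR (- (1 / 4 * expR s)) = expR (1 / 2 * expR s) * expR (- (3 / 4 * expR s)) by rewrite -expRD; congr expR; field.
  have E2 : expR (- (1 / 4 * expR s)) = expR (- (1 / 2 * expR s)) * expR (1 / 4 * expR s) by rewrite -expRD; congr expR; field.
  apply: le_trans (cmodB _ _) _; rewrite mulrDl lerD //.
    rewrite cmodM (le_trans (ler_pM (cmod_ge0 _) (cmod_ge0 _) (WK xs) f2)) // E1 /L4; apply: eq_leR; ring.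
  rewrite cmodM (le_trans (ler_pM (cmod_ge0 _) (cmod_ge0 _) f1 (VK xs))) // E2 /L2; apply: eq_leR; ring.
apply/eqP; rewrite -cmod_eq0; apply/negPn/negP => w0.
have {}w0 : 0 < cmod (wronskian t) by rewrite lt_def w0 cmod_ge0.
have q4 : (0 : R) < 1 / 4 by rewrite divr_gt0.
apply: (@expR_superlinear (1 / 4) (cmod (wronskian t)) (K * L4 + L2 * K) (expR t + 1) q4 w0) => // z tz z0.
have [s zs] : exists s, z = expR s by exists (ln z); rewrite lnK.
have ts : t <= s by rewrite -ler_expR -zs; lra.
have z1 : 1 <= z by have := expR_ge0 t; lra.
have := bound s ts; rewrite -zs expRN ler_pdivlMr ?expR_gt0 // => /le_trans; apply.
have : 0 <= K * L4 + L2 * K by rewrite /L2 /L4 !addr_ge0 ?mulr_ge0 ?cmod_ge0 // ?invr_ge0 ?divr_ge0 ?mulr_ge0.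
nra.
Qed.

(** The Wronskian of a solution below e^(z/2) and the recessive one
    vanishes, as it does at infinity. *)
Lemma recessive_proportional : exists c, forall t, x0 <= t -> W t = c * V t.
Proof.
exists (W x0 / V x0) => t xt.
have d s : x0 <= s -> rderiv CofR (fun s => W s * (V s)^-1) s 0.
  move=> xs; have v0 := V0 xs; have := wronskian_eq0 xs.
  have w0 : ode_weight b s != 0 by exact: cexp_neq0.
  rewrite /wronskian => h; have {}h : W s * V1 s = W1 s * V s.
    by apply: (mulfI w0); apply/eqP; rewrite -subr_eq0 -h; apply/eqP; ring.
  apply: rderiv_eq.
    apply: rderiv_mul; first exact: dW.
    apply: (@rderiv_comp R R CofR V (fun w => w^-1)); [exact: (rderiv_inv v0)|exact: dV].
  have -> : W1 s * (V s)^-1 + W s * (- (V s) ^- 2 * V1 s) = (W1 s * V s - W s * V1 s) / (V s) ^+ 2 by field.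
  by rewrite h subrr mul0r.
have : W t / V t = W x0 / V x0.
  apply/eqP; rewrite -subr_eq0 -cmod_eq0 eq_le cmod_ge0 andbT.
  have := @mean_value_lip R (fun s => W s * (V s)^-1) (fun=> 0) 0 x0 t xt; rewrite mul0r mulr0; apply => r; last by rewrite cmod0.
  by move=> /andP[xr _]; exact: d.
by move=> <-; rewrite mulfVK // V0.
Qed.

End Uniqueness.

(** Derivatives of holomorphic functions are holomorphic: f1 is the first
    Taylor coefficient, a circle average of f, and so a parametric integral
    that can be differentiated. *)
Lemma holo_derivative (f f1 : C -> C) (z0 : C) (r : R) : 0 < r ->
  (forall z, cmod (z - z0) < 20 * r -> holo_at f f1 z) ->
  holo_at f1 (fun z => (CofR (2 * pi))^-1 * cintegral `[0, 2 * pi] (fun t => f1 (z + CofR r * cis t) * (CofR r * cis t) ^- 1)) z0.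
Proof.
move=> r0 hf.
have [|z hz|M M0 hM] := @disc_bounded R f z0 (8 * r); first lra.
  by apply: holo_rcont (hf z _); lra.
have circ z t : cmod (z - z0) < 7 * r -> cmod (z + CofR r * cis t - z0) < 8 * r.
  move=> zr; have := cmodD (z - z0) (CofR r * cis t); rewrite cmodM cmod_cis cmod_CofR mulr1 gtr0_norm //.
  by rewrite addrAC; lra.
pose F z t := f (z + CofR r * cis t) * (CofR r * cis t) ^- 1.
pose F1 z t := f1 (z + CofR r * cis t) * (CofR r * cis t) ^- 1.
have c0 t : CofR r * cis t != 0 by rewrite mulf_neq0 ?cis_neq0 // CofR_eq0 gt_eqF.
have E z : cmod (z - z0) < 7 * r -> f1 z = (CofR (2 * pi))^-1 * cintegral `[0, 2 * pi] (F z).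
  move=> zr; have [||<- _] // := @taylor_linear R f f1 z r r0 _ M.
    by move=> w wz; apply: hf; have := cmodBD z w z0; lra.
  by move=> t; apply: hM; have := circ z t zr; lra.
have cc t : rcont CofR (fun t => CofR r * cis t) t.
  by apply: rcont_mul; [exact: rcont_cst|exact: rcont_cis].
have cinv t : rcont CofR (fun t => (CofR r * cis t) ^- 1) t.
  by apply: (@rcont_comp R R CofR _ (fun z => z^-1)); [exact: (rderiv_cont (rderiv_inv (c0 t)))|exact: cc].
have cz z t : rcont CofR (fun t => z + CofR r * cis t) t.
  by apply: rcont_add; [exact: rcont_cst|exact: cc].
have m2 : measurable (`[0, 2 * pi] : set (measurableTypeR R)) by exact: measurable_itv.
have iM : (@lebesgue_measure R).-integrable `[0, 2 * pi] (EFin \o (fun=> M / r)).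
  by apply: continuous_compact_integrable; [exact: segment_compact|apply: continuous_subspaceT => ?; exact: cvg_cst].
have h := @param_holo R `[0, 2 * pi] F F1 (fun=> M / r) z0 r m2 r0 _ _ _ iM _.
have {}h : holo_at (fun z => (CofR (2 * pi))^-1 * cintegral `[0, 2 * pi] (F z)) (fun z => (CofR (2 * pi))^-1 * cintegral `[0, 2 * pi] (F1 z)) z0.
  apply: holo_scale; apply: h.
  - move=> t _ z zr.
    have hz : holo_at f f1 (z + CofR r * cis t) by apply: hf; have := circ z t zr; lra.
    have h1 := @holo_comp R (fun z => z + CofR r * cis t) (fun=> 1 + 0) f f1 z hz (holo_add (holo_id z) (holo_cst _ z)).
    have h2 := holo_mul h1 (holo_cst ((CofR r * cis t) ^- 1) z).
    by apply: (holo_eq h2) => w; rewrite /F1 addr0 mulr1 mulr0 addr0.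
  - move=> z zr; apply: cmeas_rcont => // t.
    apply: rcont_mul; last exact: cinv.
    apply: (@rcont_comp R R CofR (fun t => z + CofR r * cis t) f) => //.
    by apply: holo_rcont (hf _ _); have := circ z t zr; lra.
  - move=> z zr; apply: cmeas_rcont => // t.
    apply: rcont_mul; last exact: cinv.
    apply: (@rcont_comp R R CofR (fun t => z + CofR r * cis t) f1) => //.
    by apply: (hf _ _).2; have := circ z t zr; lra.
  - move=> t _ z zr; rewrite cmodM cmodV expr1 cmodM cmod_cis cmod_CofR mulr1 gtr0_norm //.
    by rewrite ler_pM2r ?invr_gt0 // hM //; have := circ z t zr; lra.
split; last exact: h.2.
move=> e e0; have [d d0 hd] := h.1 e e0.
exists (Num.min d (7 * r)); first by rewrite lt_min d0 mulr_gt0.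
move=> w; rewrite lt_min => /andP[wd wr]; rewrite !E ?subrr ?cmod0 ?mulr_gt0 //.
exact: hd.
Qed.

Lemma entire_derivative (f f1 : C -> C) : (forall z, holo_at f f1 z) -> exists f2, forall z, holo_at f1 f2 z.
Proof.
move=> hf; exists (fun z => (CofR (2 * pi))^-1 * cintegral `[0, 2 * pi] (fun t => f1 (z + CofR 1 * cis t) * (CofR 1 * cis t) ^- 1)) => z.
by apply: (@holo_derivative f f1 z 1) => // w _; exact: hf.
Qed.

Lemma expR_dominates (p : R) (t : R) : 0 <= t -> expR (p * t) <= expR (4 * p ^+ 2) * expR (1 / 4 * expR t).
Proof.
move=> t0; rewrite -expRD ler_expR.
have h : (t / 2) ^+ 2 <= expR t.
  have -> : expR t = expR (t / 2) ^+ 2 by rewrite -expRM_natl; congr expR; field.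
  rewrite ler_sqr ?nnegrE ?expR_ge0 ?divr_ge0 //; have := expR_ge1Dx (t / 2); lra.
have := sqr_ge0 (2 * p - t / 4); rewrite !expr2 in h *; nra.
Qed.


(** The confluent equation in the coordinate t = ln z: z w'' + (b - z) w' - a
    w = 0 becomes F'' + (b - 1 - e^t) F' = a e^t F. *)
Definition real_solution (a : C) (b : R) (F F1 F2 : R -> C) : Prop :=
  [/\ forall t, rderiv CofR F t (F1 t), forall t, rderiv CofR F1 t (F2 t) &
   forall t, F2 t + (CofR b - 1 - cexp (CofR t)) * F1 t = a * cexp (CofR t) * F t].

Definition real_asymp (a : C) (F : R -> C) (l : C) : Prop :=
  forall e : R, 0 < e -> exists x0 : R, forall t, x0 <= t ->
    cmod (F t * cexp (a * CofR t) - l) <= e.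

Lemma rderiv_real (f : C -> C) (t : R) d : rderiv id f (CofR t) d -> rderiv CofR (fun s => f (CofR s)) t d.
Proof.
move=> h; rewrite -[d]mulr1.
by apply: (@rderiv_comp R R CofR CofR f); [exact: h|exact: rderiv_id].
Qed.

Lemma tricomi_real_solution (a : C) (b : R) (W : C -> C) : is_tricomi a (CofR b) W ->
  exists F1 F2, real_solution a b (fun t => W (CofR t)) F1 F2.
Proof.
move=> [[eW eD] ode _].
have E z : derive1 W z = cexp z * dlog W z by rewrite /dlog cexpN mulVKf ?cexp_neq0.
have E2 z : derive1 (dlog W) z = cexp z * dlog (dlog W) z by rewrite {2}/dlog cexpN mulVKf ?cexp_neq0.
pose F1 (t : R) : C := cexp (CofR t) * dlog W (CofR t).
pose F2 (t : R) : C := cexp (CofR t) * dlog W (CofR t) + cexp (CofR t) * (cexp (CofR t) * dlog (dlog W) (CofR t)).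
exists F1, F2; split => t.
- by rewrite /F1 -E; apply: rderiv_real; apply: derivable_rderiv; exact: eW.
- apply: rderiv_mul; first exact: rderiv_cexp_real.
  by rewrite -E2; apply: rderiv_real; apply: derivable_rderiv; exact: eD.
- have h := ode (CofR t).
  have {}h : a * W (CofR t) = cexp (CofR t) * dlog (dlog W) (CofR t) + (CofR b - cexp (CofR t)) * dlog W (CofR t).
    by apply/eqP; rewrite eq_sym -subr_eq0 h.
  rewrite /F1 /F2; move: (dlog (dlog W) _) (dlog W _) (W _) (cexp _) h => D2 D w e h.
  have -> : a * e * w = e * (a * w) by ring.
  by rewrite h; ring.
Qed.

Lemma tricomi_real_asymp (a b : C) (W : C -> C) : is_tricomi a b W -> real_asymp a (fun t => W (CofR t)) 1.
Proof.
move=> [_ _ as0] e e0; have p0 := @pi_gt0 R.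
have [x0 [_ h]] := as0 pi p0 e e0.
exists (x0 + 1) => t xt; have xt' : x0 < t by lra.
have := h t xt' 0; rewrite normr0; have -> : 0 <= 3 / 2 * pi - pi :> R by lra.
by move=> /(_ isT) /ltW; rewrite mulNr cexpN invrK.
Qed.

Lemma asymp_bound (a : C) (F : R -> C) l : real_asymp a F l -> exists x0 : R,
  forall t, x0 <= t -> 0 <= t -> cmod (F t) <= (cmod l + 1) * expR (4 * Re a ^+ 2) * expR (1 / 4 * expR t).
Proof.
move=> /(_ 1 ltr01)[x0 h]; exists x0 => t /h ht t0.
have h1 : cmod (F t * cexp (a * CofR t)) <= cmod l + 1.
  by have := cmodD (F t * cexp (a * CofR t) - l) l; rewrite subrK; lra.
have e1 : cmod (cexp (a * CofR t)) = expR (Re a * t).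
  by rewrite cmod_cexp ReM Re_CofR Im_CofR mulr0 subr0.
rewrite cmodM e1 -ler_pdivlMr ?expR_gt0 // -expRN in h1.
apply: le_trans h1 _; rewrite -[leRHS]mulrA ler_wpM2l ?addr_ge0 ?cmod_ge0 //.
have := expR_dominates (- Re a) t0; rewrite sqrrN mulNr; exact.
Qed.

(** The solution asymptotic to z^(-a) is recessive, so any solution of
    algebraic size on the real axis is a multiple of it. *)
Lemma tricomi_proportional (a : C) (b : R) (W : C -> C) (F F1 F2 : R -> C) (l : C) : b <= 1 ->
  is_tricomi a (CofR b) W -> real_solution a b F F1 F2 -> real_asymp a F l ->
  exists x0 : R, forall t, x0 <= t -> F t = l * W (CofR t).
Proof.
move=> b1 tW [dF dF1 odeF] aF.
have aW := tricomi_real_asymp tW; have [V1 [V2 [dV dV1 odeV]]] := tricomi_real_solution tW.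
have h2 : (0 : R) < 1 / 2 by rewrite divr_gt0.
have [xF hF] := asymp_bound aF; have [xW hW] := asymp_bound aW; have [x1 h1] := aW _ h2.
pose X := `|xF| + `|xW| + `|x1|.
have nF := ler_norm xF; have nW := ler_norm xW; have n1 := ler_norm x1.
have pF := normr_ge0 xF; have pW := normr_ge0 xW; have p1 := normr_ge0 x1.
have X0 : 0 <= X by rewrite /X; lra.
pose K := (cmod l + 1) * expR (4 * Re a ^+ 2) + (cmod (1 : C) + 1) * expR (4 * Re a ^+ 2).
have K1 : 0 <= (cmod l + 1) * expR (4 * Re a ^+ 2) by rewrite mulr_ge0 ?expR_ge0 // addr_ge0 ?cmod_ge0.
have K2 : 0 <= (cmod (1 : C) + 1) * expR (4 * Re a ^+ 2) by rewrite mulr_ge0 ?expR_ge0 // addr_ge0 ?cmod_ge0.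
have FK t : X <= t -> cmod (F t) <= K * expR (1 / 2 * expR t).
  rewrite /X => Xt; have t0 : 0 <= t by lra.
  have xt : xF <= t by lra.
  apply: le_trans (hF t xt t0) _; rewrite ler_pM ?expR_ge0 // ?lerDl // ler_expR.
  by have := expR_ge0 t; lra.
have WK t : X <= t -> cmod (W (CofR t)) <= K * expR (1 / 4 * expR t).
  rewrite /X => Xt; have t0 : 0 <= t by lra.
  have xt : xW <= t by lra.
  by apply: le_trans (hW t xt t0) _; rewrite ler_wpM2r ?expR_ge0 // lerDr.
have W0 t : X <= t -> W (CofR t) != 0.
  rewrite /X => Xt; have xt : x1 <= t by lra.
  apply/eqP => w0; have := h1 t xt; rewrite w0 mul0r sub0r cmodN cmod1; lra.
have [c hc] := recessive_proportional b1 X0 dF dF1 odeF FK dV dV1 odeV WK W0.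
exists X => t Xt; rewrite hc //; congr (_ * _).
apply/eqP; rewrite -subr_eq0 -cmod_eq0 eq_le cmod_ge0 andbT.
apply/ler_addgt0Pr => e e0; rewrite add0r.
have c1 : 0 < cmod c + 1 by rewrite ltr_wpDl ?cmod_ge0.
have e2 : 0 < e / (cmod c + 1) by rewrite divr_gt0.
have [y1 hy1] := aF _ e2; have [y2 hy2] := aW _ e2.
pose y := X + `|y1| + `|y2|.
have q1 : y1 <= y by rewrite /y; have := ler_norm y1; have := normr_ge0 y2; lra.
have q2 : y2 <= y by rewrite /y; have := ler_norm y2; have := normr_ge0 y1; lra.
have q3 : X <= y by rewrite /y; have := normr_ge0 y2; have := normr_ge0 y1; lra.
have r1 := hy1 y q1; have r2 := hy2 y q2; rewrite hc // -mulrA in r1.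
set Y := W (CofR y) * _ in r1 r2.
have -> : c - l = (c * Y - l) - c * (Y - 1) by ring.
apply: le_trans (cmodB _ _) _; rewrite [cmod (c * _)]cmodM.
have -> : e = e / (cmod c + 1) + cmod c * (e / (cmod c + 1)) by field; exact: lt0r_neq0.
by rewrite lerD // ler_wpM2l ?cmod_ge0.
Qed.

Lemma holo_entire (f : C -> C) : entire f -> (forall z, rcont id (derive1 f) z) -> forall z, holo_at f (derive1 f) z.
Proof. by move=> ef cf z; split => //; apply: derivable_rderiv; exact: ef. Qed.

Lemma tricomi_holo (a b : C) (W : C -> C) : is_tricomi a b W -> forall z, holo_at W (derive1 W) z.
Proof.
move=> [[eW eD] _ _]; apply: holo_entire => // z.
have -> : derive1 W = (fun z => cexp z * dlog W z).
  by apply/funext => w; rewrite /dlog cexpN mulVKf ?cexp_neq0.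
apply: rcont_mul; first exact: rcont_cexp.
exact: rderiv_cont (derivable_rderiv (eD z)).
Qed.

(** A disc around x0 that contains the given point is admissible in the
    identity theorem for every radius. *)
Lemma entire_eq (f f1 g g1 : C -> C) (x0 : R) : (forall z, holo_at f f1 z) -> (forall z, holo_at g g1 z) ->
  (forall t : R, x0 <= t -> f (CofR t) = g (CofR t)) -> f = g.
Proof.
move=> hf hg fg; apply/funext => w; apply/eqP; rewrite -subr_eq0; apply/eqP.
pose r := 2 * cmod (w - CofR x0) + 1.
have r0 : 0 < r by rewrite /r ltr_wpDl // mulr_ge0 ?cmod_ge0.
apply: (@identity_disc R (fun w => f w - g w) (fun w => f1 w - g1 w) (CofR x0) r r0 _ 1 1) => //.
- by move=> z _; exact: holo_sub.
- by move=> t /andP[t0 _]; rewrite mulr1 -CofRD fg ?subrr // lerDl ltW.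
- by rewrite /r; lra.
Qed.

(** Both solutions are recessive on the real axis, and their asymptotics make
    the factor of proportionality 1. *)
Lemma tricomi_unique (a : C) (b : R) (W W' : C -> C) : b <= 1 ->
  is_tricomi a (CofR b) W -> is_tricomi a (CofR b) W' -> W = W'.
Proof.
move=> b1 tW tW'; have [F1 [F2 sF]] := tricomi_real_solution tW.
have [x0 h] := tricomi_proportional b1 tW' sF (tricomi_real_asymp tW).
apply: (entire_eq (tricomi_holo tW) (tricomi_holo tW')) => t xt.
by have := h t xt; rewrite mul1r.
Qed.

Lemma tricomiU_eq (a : C) (b : R) (W : C -> C) : b <= 1 ->
  is_tricomi a (CofR b) W -> tricomiU a (CofR b) = W.
Proof.
move=> b1 tW; apply: (tricomi_unique b1) (tW).
have : exists W, [set W | is_tricomi a (CofR b) W] W by exists W.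
by move=> /(@xgetPex _ (fun=> 0)).
Qed.

End RecessiveSolution.

(** * Watson lemma and the Laplace integral of the Tricomi function *)

Section Watson.
Context {R : realType}.
Local Notation C := (Cplx R).

(** Watson's lemma on a line, in the logarithmic variable: after the change
    of variable w -> w - zeta only the factor m depends on zeta, and m - 1 is
    small on the left. *)
Lemma watson (b : C) (k th : R) : 0 < Re b -> 0 < k -> th < pi / 2 -> exists2 K : R, 0 <= K &
  forall (m : R -> C) (M om : R) (z : C), (forall t, rcont CofR m t) -> `|Im z + om| <= th ->
  (forall u, cmod (m u - 1) <= M * expR (k * u)) ->
  cintegrable setT (fun u => cexp (b * (CofR u + iC * CofR om) - cexp (z + (CofR u + iC * CofR om))) * m u) /\
  cmod (cintegral setT (fun u => cexp (b * (CofR u + iC * CofR om) - cexp (z + (CofR u + iC * CofR om))) * m u)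
    * cexp (b * z) - Gam b) <= K * M * expR (- (k * Re z)).
Proof.
move=> b0 k0 thp; have bk0 : 0 < Re (b + CofR k) by rewrite ReD Re_CofR addr_gt0.
pose q := Num.min (Re (b + CofR k)) 1; have q0 : 0 < q := minr_gt0 bk0.
have [B B0 hB] := @cintegral_expabs_le R setT q measurableT q0.
pose K1 := expR (`|Im b| * th) * exp_const (Re (b + CofR k)) (cos th).
have K10 : 0 <= K1 by rewrite mulr_ge0 ?expR_ge0.
exists (K1 * B) => [|m M om z cm zt mM]; first by rewrite mulr_ge0.
pose x := Re z; pose y := Im z + om.
have yp : `|y| < pi / 2 by apply: le_lt_trans thp.
pose G (v : R) : C := gamma_kernel b (CofR v + iC * CofR y).
pose H (v : R) : C := G v * (m (v - x) - 1).
have cG t : rcont CofR G t.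
  have h := holo_gamma_kernel b (CofR t + iC * CofR y).
  apply: (@rcont_comp R R CofR (fun v => CofR v + iC * CofR y) (gamma_kernel b)); first exact: holo_rcont h.
  by apply: rcont_add; [exact: rcont_id|exact: rcont_cst].
have cmx t : rcont CofR (fun v => m (v - x)) t.
  move=> e e0; have [r r0 hr] := cm (t - x) e e0; exists r => // s; rewrite -CofRB => st.
  by apply: hr; rewrite -CofRB opprB addrA subrK.
have cGx t : rcont CofR (fun v => G (v + x)) t.
  move=> e e0; have [r r0 hr] := cG (t + x) e e0; exists r => // s; rewrite -CofRB => st.
  by apply: hr; rewrite -CofRB opprD addrACA subrr addr0.
have cH t : rcont CofR H t by apply: rcont_mul; [exact: cG|apply: rcont_sub; [exact: cmx|exact: rcont_cst]].
have Hle v : cmod (H v) <= K1 * M * expR (- (k * x)) * expabs q v.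
  have g1 : cmod (gamma_kernel (b + CofR k) (CofR v + iC * CofR y)) <= K1 * expabs q v.
    apply: le_trans (gamma_kernel_le v bk0 zt thp) _.
    rewrite ler_wpM2r ?expabs_ge0 // /K1 ler_wpM2r ?expR_ge0 // ler_expR.
    rewrite ImD Im_CofR addr0 (le_trans (ler_norm _)) // normrN normrM ler_wpM2l //.
  have g2 : cmod (gamma_kernel (b + CofR k) (CofR v + iC * CofR y)) = cmod (G v) * expR (k * v).
    have -> : gamma_kernel (b + CofR k) (CofR v + iC * CofR y) = G v * cexp (CofR k * (CofR v + iC * CofR y)).
      by rewrite /G /gamma_kernel -cexpD; congr cexp; ring.
    by rewrite cmodM cmod_cexp !ReImE !(mul0r, subr0, addr0, mulr0).
  rewrite g2 in g1; rewrite /H cmodM (le_trans (ler_wpM2l (cmod_ge0 _) (mM _))) //.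
  have -> : k * (v - x) = k * v + - (k * x) by ring.
  have M0 : 0 <= M by have := le_trans (cmod_ge0 _) (mM 0); rewrite pmulr_lge0 ?expR_gt0.
  have := ler_wpM2l (mulr_ge0 M0 (expR_ge0 (- (k * x)))) g1; rewrite expRD; lra.
have mH : cmeas (setT : set (measurableTypeR R)) H by apply: cmeas_rcont => // t; exact: cH.
have iH : cintegrable setT H by apply: (@cint_expabs R setT _ q H measurableT q0 mH) => v _; exact: Hle.
have [iG eG] := Gam_rot b0 yp.
have iGH : cintegrable setT (fun v => G v + H v) by apply: cintegrable_add.
pose P u : C := G (u + x) * m u.
have E u : P (u + - x) = G u + H u by rewrite /P /H addrNK; ring.
have [||iP eP] := @cintegrable_translate R P (- x).
- by move=> t; apply: rcont_mul; [exact: cGx|exact: cm].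
- by apply: (eq_cintegrable measurableT _ iGH) => u _; rewrite E.
have F u : cexp (b * (CofR u + iC * CofR om) - cexp (z + (CofR u + iC * CofR om))) * m u = cexp (- (b * z)) * P u.
  rewrite /P /G /gamma_kernel mulrA -cexpD; congr (cexp _ * _).
  have -> : CofR (u + x) + iC * CofR y = z + (CofR u + iC * CofR om) by rewrite [z in RHS]CE /x /y !CofRD; ring.
  by ring.
split; first by apply: (eq_cintegrable measurableT _ (cintegrable_scale _ measurableT iP)) => u _; rewrite F.
have eGH : cintegral setT P = Gam b + cintegral setT H.
  by rewrite eP -eG -(cintegral_add measurableT iG iH); apply: eq_cintegral => u _; exact: E.
have -> : cintegral setT (fun u => cexp (b * (CofR u + iC * CofR om) - cexp (z + (CofR u + iC * CofR om))) * m u) =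
    cexp (- (b * z)) * cintegral setT P.
  by rewrite -(cintegral_scale _ measurableT iP); apply: eq_cintegral => u _; exact: F.
have -> : cexp (- (b * z)) * cintegral setT P * cexp (b * z) - Gam b = cintegral setT H.
  rewrite eGH; have e0 := cexp_neq0 (b * z); rewrite cexpN.
  move: (cexp (b * z)) (Gam b) (cintegral setT H) e0 => e g h e0; by field.
by apply: le_trans (hB H _ mH (fun v _ => Hle v)) _; apply: eq_leR; rewrite /x; ring.
Qed.

End Watson.

Section TricomiIntegral.
Context {R : realType}.
Local Notation C := (Cplx R).
Implicit Types (a c z : C) (t u : R).

Definition ln1e u : R := ln (1 + expR u).

Lemma one_expR_gt0 u : 0 < 1 + expR u.
Proof. by rewrite ltr_pwDl ?expR_ge0. Qed.

Lemma expR_ln1e u : expR (ln1e u) = 1 + expR u.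
Proof. by rewrite lnK // posrE one_expR_gt0. Qed.

Lemma ln1e_ge0 u : 0 <= ln1e u.
Proof. by rewrite ln_ge0 // lerDl expR_ge0. Qed.

Lemma ln1e_le u : ln1e u <= expR u.
Proof. by rewrite -ler_expR expR_ln1e expR_ge1Dx. Qed.

Lemma is_derive_ln1e u : is_derive u 1 ln1e (expR u / (1 + expR u)).
Proof.
have h1 : is_derive u 1 (fun s => 1 + expR s) (0 + expR u) := is_deriveD (is_derive_cst (1 : R) u (1 : R)) (is_derive_expR u).
have h2 := @is_derive1_comp R (@ln R) (fun s => 1 + expR s) u _ _ (is_derive1_ln (one_expR_gt0 u)) h1.
by apply: (is_derive_eq h2); rewrite add0r mulrC.
Qed.

Definition tker a c z u : C := cexp (a * CofR u + c * CofR (ln1e u) - z * cexp (CofR u)).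
(** Gamma (a) U(a, b, z) with c = b - a - 1: the Laplace integral over e^u. *)
Definition tint a c z : C := cintegral setT (tker a c z).

Lemma tkerS a c z u : tker (a + 1) c z u = tker a c z u * cexp (CofR u).
Proof. by rewrite /tker -cexpD; congr cexp; ring. Qed.

Lemma rderiv_tker a c z t : rderiv CofR (tker a c z) t
  (tker a c z t * (a + c * CofR (expR t / (1 + expR t)) - z * cexp (CofR t))).
Proof.
apply: rderiv_eq.
  apply: (@rderiv_comp R R CofR _ cexp); first exact: rderiv_cexp.
  apply: rderiv_sub; last by apply: rderiv_mul; [exact: rderiv_cst|exact: rderiv_cexp_real].
  apply: rderiv_add; first by apply: rderiv_mul; [exact: rderiv_cst|exact: rderiv_id].
  by apply: rderiv_mul; [exact: rderiv_cst|exact: is_derive_rderiv (is_derive_ln1e t)].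
by rewrite /= /tker; ring.
Qed.

Lemma rcont_tker a c z t : rcont CofR (tker a c z) t.
Proof. exact: rderiv_cont (rderiv_tker a c z t). Qed.

Lemma cmeas_tker a c z : cmeas (setT : set (measurableTypeR R)) (tker a c z).
Proof. by apply: cmeas_rcont => // t; exact: rcont_tker. Qed.

Lemma tker_le a c z (d : R) u : 0 < Re a -> Re c <= 0 -> 0 < d -> d <= Re z ->
  cmod (tker a c z u) <= exp_const (Re a) d * expabs (Num.min (Re a) 1) u.
Proof.
move=> a0 c0 d0 dz; apply: le_trans (expR_dominated u a0 d0).
rewrite cmod_cexp ler_expR cexp_CofR !ReImE !mulr0 !subr0.
have h1 := mulr_le0_ge0 c0 (ln1e_ge0 u); have h2 := ler_wpM2r (expR_ge0 u) dz; lra.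
Qed.

Lemma tker_integrable a c z : 0 < Re a -> Re c <= 0 -> 0 < Re z -> cintegrable setT (tker a c z).
Proof.
move=> a0 c0 z0; apply: (cint_expabs measurableT (minr_gt0 a0) (cmeas_tker a c z)) => u _.
exact: (tker_le u a0 c0 z0 (lexx _)).
Qed.

Lemma tint_holo a c z : 0 < Re a -> Re c <= 0 -> 0 < Re z ->
  holo_at (tint a c) (fun z => - tint (a + 1) c z) z.
Proof.
move=> a0 c0 z0; pose r := Re z / 14; have r0 : 0 < r by rewrite divr_gt0.
have a1 : 0 < Re (a + 1) by rewrite ReD Re1 addr_gt0.
have near w : cmod (w - z) < 7 * r -> Re z / 2 <= Re w.
  by move=> h; have := Re_le_cmod (w - z); rewrite ReD ReN ler_norml /r in h *; lra.
have d0 : 0 < Re z / 2 by rewrite divr_gt0.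
pose f z u := tker a c z u; pose f1 z u := - tker (a + 1) c z u.
have h := @param_holo R setT f f1 (fun u => exp_const (Re a) (Re z / 2) * expabs (Num.min (Re a) 1) u) z r measurableT r0 _ _ _ _ _.
have {}h : holo_at (fun z => cintegral setT (f z)) (fun z => cintegral setT (f1 z)) z.
  apply: h.
  - move=> u _ w _; have h := holo_cexp (holo_sub (holo_cst (a * CofR u + c * CofR (ln1e u)) w) (holo_mul (holo_id w) (holo_cst (cexp (CofR u)) w))).
    by apply: (holo_eq h) => v; rewrite /f1 tkerS /tker; ring.
  - by move=> w _; exact: cmeas_tker.
  - move=> w _; apply: cmeas_rcont => // t; have := rcont_mul (rcont_cst CofR (-1) t) (rcont_tker (a + 1) c w t).
    by congr rcont; apply/funext => u; rewrite mulN1r.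
  - by apply: integrable_scale => //; exact: integrable_expabs (minr_gt0 a0).
  - by move=> u _ w /near wz; exact: (tker_le u a0 c0 d0 wz).
split; first by rewrite /tint -(cintegral_opp measurableT (tker_integrable a1 c0 z0)); exact: h.1.
move=> e e0; have [s s0 hs] := h.2 e e0; exists (Num.min s (7 * r)); first by rewrite lt_min s0 mulr_gt0.
move=> w; rewrite lt_min => /andP[ws /near wz]; have w0 : 0 < Re w by apply: lt_le_trans wz.
rewrite /tint -(cintegral_opp measurableT (tker_integrable a1 c0 z0)) -(cintegral_opp measurableT (tker_integrable a1 c0 w0)).
exact: hs.
Qed.

Lemma vanish_pinfty_add (f g : R -> C) : vanish_pinfty f -> vanish_pinfty g -> vanish_pinfty (fun t => f t + g t).
Proof.
move=> hf hg e e0; have e2 : 0 < e / 2 by rewrite divr_gt0.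
have [x hx] := hf _ e2; have [y hy] := hg _ e2; exists (Num.max x y) => t; rewrite ge_max => /andP[xt yt].
have := cmodD (f t) (g t); have := hx t xt; have := hy t yt; lra.
Qed.

Lemma vanish_ninfty_add (f g : R -> C) : vanish_ninfty f -> vanish_ninfty g -> vanish_ninfty (fun t => f t + g t).
Proof.
move=> hf hg e e0; have e2 : 0 < e / 2 by rewrite divr_gt0.
have [x hx] := hf _ e2; have [y hy] := hg _ e2; exists (Num.min x y) => t; rewrite le_min => /andP[xt yt].
have := cmodD (f t) (g t); have := hx t xt; have := hy t yt; lra.
Qed.

(** The integral of a derivative vanishes. *)
Lemma tint_recurrence a c z : 0 < Re a -> Re c <= 0 -> 0 < Re z ->
  a * tint a c z + (a + c + 1 - z) * tint (a + 1) c z = z * tint (a + 2) c z.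
Proof.
move=> a0 c0 z0.
have a1 : 0 < Re (a + 1) by rewrite ReD Re1 addr_gt0.
have a12 : a + 1 + 1 = a + 2 by ring.
have a2 : 0 < Re (a + 2) by rewrite -a12 ReD Re1 addr_gt0.
have i0 := tker_integrable a0 c0 z0; have i1 := tker_integrable a1 c0 z0; have i2 := tker_integrable a2 c0 z0.
have s0 := cintegrable_scale a measurableT i0.
have s1 := cintegrable_scale (a + c + 1 - z) measurableT i1.
have s2 := cintegrable_scale z measurableT i2.
have s01 := cintegrable_add measurableT s0 s1; have s012 := cintegrable_sub measurableT s01 s2.
apply/eqP; rewrite -subr_eq0; apply/eqP.
rewrite /tint -(cintegral_scale _ measurableT i0) -(cintegral_scale _ measurableT i1) -(cintegral_scale _ measurableT i2).
rewrite -cintegral_add // -cintegral_sub //.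
have [v1 v2] := expabs_vanish (minr_gt0 a0) (fun u => tker_le u a0 c0 z0 (lexx _)).
have [w1 w2] := expabs_vanish (minr_gt0 a1) (fun u => tker_le u a1 c0 z0 (lexx _)).
apply: (@cintegral_FTC_line R (fun u => tker a c z u + tker (a + 1) c z u)) => //.
- move=> t; apply: rderiv_eq; first by apply: rderiv_add; exact: rderiv_tker.
  have e0 : CofR (1 + expR t) != 0 :> C by rewrite CofR_eq0 gt_eqF ?one_expR_gt0.
  rewrite -a12 !tkerS CofRM CofRV cexp_CofR; move: e0; rewrite CofRD CofR1; move: (CofR (expR t)) (tker a c z t) => e T e0.
  by field.
- move=> t; apply: rcont_sub; last by apply: rcont_mul; [exact: rcont_cst|exact: rcont_tker].
  by apply: rcont_add; (apply: rcont_mul; [exact: rcont_cst|exact: rcont_tker]).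
- exact: vanish_pinfty_add.
- exact: vanish_ninfty_add.
Qed.

(** Since d/dz raises a by one, the confluent equation is tint_recurrence. *)
Lemma tint_solution a c (b : R) : 0 < Re a -> Re c <= 0 -> a + c + 1 = CofR b ->
  exists F1 F2, real_solution a b (fun t => tint a c (cexp (CofR t))) F1 F2.
Proof.
move=> a0 c0 abc.
have a12 : a + 1 + 1 = a + 2 by ring.
have a1 : 0 < Re (a + 1) by rewrite ReD Re1 addr_gt0.
have e0 t : 0 < Re (cexp (CofR t)) by rewrite cexp_CofR Re_CofR expR_gt0.
exists (fun t => - cexp (CofR t) * tint (a + 1) c (cexp (CofR t))).
exists (fun t => - cexp (CofR t) * tint (a + 1) c (cexp (CofR t)) + cexp (CofR t) ^+ 2 * tint (a + 2) c (cexp (CofR t))).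
have d (a' : C) t : 0 < Re a' -> rderiv CofR (fun t => tint a' c (cexp (CofR t))) t (- tint (a' + 1) c (cexp (CofR t)) * cexp (CofR t)).
  move=> a'0; apply: (@rderiv_comp R R CofR (fun t => cexp (CofR t)) (tint a' c)); last exact: rderiv_cexp_real.
  exact: (tint_holo a'0 c0 (e0 t)).1.
split => t.
- by apply: (rderiv_eq (d a t a0)); ring.
- apply: rderiv_eq.
    apply: rderiv_mul; last exact: (d _ t a1).
    exact: (rderiv_opp (rderiv_cexp_real t)).
  by rewrite a12 /=; ring.
- have h := tint_recurrence a0 c0 (e0 t); rewrite abc in h.
  move: h; move: (cexp (CofR t)) (tint a c _) (tint (a + 1) c _) (tint (a + 2) c _) => e T0 T1 T2 h.
  have -> : a * e * T0 = e * (a * T0 + (CofR b - e) * T1) - e * (CofR b - e) * T1 by ring.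
  by rewrite h; ring.
Qed.

Lemma cexp_decay_lip (c : C) (s : R) : Re c <= 0 -> 0 <= s -> cmod (cexp (c * CofR s) - 1) <= 2 * (cmod c * s).
Proof.
move=> c0 s0.
have := @mean_value_lip R (fun t => cexp (CofR t * c)) (fun t => cexp (CofR t * c) * c) (cmod c) 0 s s0.
rewrite CofR0 mul0r cexp0 subr0 [CofR s * c]mulrC; apply=> t; first by move=> _; exact: rderiv_cexp_line.
move=> /andP[t0 _]; rewrite cmodM ler_piMl ?cmod_ge0 // cmod_cexp -expR0 ler_expR !ReImE mul0r subr0.
by rewrite mulr_ge0_le0.
Qed.

Lemma tint_asymp a c : 0 < Re a -> Re c <= 0 -> real_asymp a (fun t => tint a c (cexp (CofR t))) (Gam a).
Proof.
move=> a0 c0 e e0; have p0 := @pi_gt0 R.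
have h0 : (0 : R) < pi / 2 by rewrite divr_gt0.
have [K K0 hK] := watson a0 ltr01 h0.
pose M := 2 * cmod c; exists (ln ((K * M + 1) / e)) => t te.
have M0 : 0 <= M by rewrite mulr_ge0 ?cmod_ge0.
have [|||_] := hK (fun u => cexp (c * CofR (ln1e u))) M 0 (CofR t).
- move=> s; apply: (@rderiv_cont _ _ _ _ s); apply: (@rderiv_comp R R CofR _ cexp); first exact: rderiv_cexp.
  by apply: rderiv_mul; [exact: rderiv_cst|exact: is_derive_rderiv (is_derive_ln1e s)].
- by rewrite Im_CofR addr0 normr0.
- move=> u; apply: le_trans (cexp_decay_lip c0 (ln1e_ge0 u)) _; rewrite mul1r /M -mulrA ler_pM2l //.
  by rewrite ler_wpM2l ?cmod_ge0 // ln1e_le.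
have -> : (fun u => cexp (a * (CofR u + iC * CofR 0) - cexp (CofR t + (CofR u + iC * CofR 0))) * cexp (c * CofR (ln1e u))) = tker a c (cexp (CofR t)).
  by apply/funext => u; rewrite iC0 /tker -cexpD [cexp (CofR t + _)]cexpD; congr cexp; ring.
rewrite Re_CofR mul1r => /le_trans; apply.
have KM : 0 <= K * M by rewrite mulr_ge0.
rewrite expRN ler_pdivrMr ?expR_gt0 //.
have q0 : 0 < (K * M + 1) / e by rewrite divr_gt0 //; lra.
have : (K * M + 1) / e <= expR t by rewrite -[leLHS]lnK // ler_expR.
by rewrite ler_pdivrMr //; lra.
Qed.

End TricomiIntegral.

(** * The parabolic cylinder function as an integral *)

Section ParabolicIntegral.
Context {R : realType}.
Local Notation C := (Cplx R).
Implicit Types (a p w z : C) (t u : R).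

Definition pker a p w : C := cexp (a * w - cexp (2 * w) / 2 - p * cexp w).
(** 2^(- a) Gamma (2 a) U(a, 1/2, p^2 / 2) is pint (2 * a) p: the classical
    integral for D_(- 2 a)(p) in the logarithm of its variable. *)
Definition pint a p : C := cintegral setT (fun u => pker a p (CofR u)).

Lemma pkerS a p w : pker (a + 1) p w = pker a p w * cexp w.
Proof. by rewrite /pker -cexpD; congr cexp; ring. Qed.

Lemma pkerSS a p w : pker (a + 2) p w = pker a p w * cexp (2 * w).
Proof. by rewrite /pker -cexpD; congr cexp; ring. Qed.

Lemma half_CofR (x : R) : CofR x / 2 = CofR (x / 2) :> C.
Proof. by rewrite CofRM CofRV CofR_nat. Qed.

Lemma cmod_pker a p w : cmod (pker a p w) = expR (Re a * Re w - Im a * Im w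
  - expR (2 * Re w) * cos (2 * Im w) / 2 - Re (p * cexp w)).
Proof.
have e : cexp (2 * w) / 2 = CofR (2^-1) * cexp (2 * w) by rewrite CofRV CofR_nat mulrC.
have d : 2 * w = CofR 2 * w by rewrite CofR_nat.
have r2 : Re (cexp (2 * w) / 2) = expR (2 * Re w) * cos (2 * Im w) / 2.
  rewrite e ReM Re_CofR Im_CofR mul0r subr0 Re_cexp d ReM ImM Re_CofR Im_CofR !mul0r subr0 addr0; ring.
by rewrite cmod_cexp ReD ReN ReD ReN r2 ReM.
Qed.

Lemma holo_pker a p w : holo_at (pker a p) (fun w => pker a p w * (a - cexp (2 * w) - p * cexp w)) w.
Proof.
have h1 := holo_scale a (holo_id w).
have h2 := holo_scale (2^-1) (holo_cexp (holo_scale 2 (holo_id w))).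
have h3 := holo_scale p (holo_cexp (holo_id w)).
have h := holo_cexp (holo_sub (holo_sub h1 h2) h3).
have two0 : (2 : C) != 0 by rewrite -CofR_nat CofR_eq0 pnatr_eq0.
apply: (holo_eq (holo_ext _ h)) => v; first by rewrite /pker [_ / 2]mulrC.
rewrite /pker [_ / 2]mulrC; move: (cexp v) (cexp (2 * v)) (cexp (_ - _ - _)) => e y x; by field.
Qed.

Definition pker_const (x P c : R) : R := expR ((P + 1) ^+ 2 / (4 * c) + (x + 1) * ln (x + 2)).

Lemma pker_le a p (P t0 : R) w : 0 < Re a -> cmod p <= P -> `|Im w| <= t0 -> 0 <= t0 < pi / 4 ->
  cmod (pker a p w) <= expR (`|Im a| * t0) * pker_const (Re a) P (cos (2 * t0) / 2) * expabs (Num.min (Re a) 1) (Re w).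
Proof.
move=> a0 pP wt /andP[t00 t4]; have p0 := @pi_gt0 R.
have c0 : 0 < cos (2 * t0) / 2 by rewrite divr_gt0 // cos_gt0_pihalf //; lra.
rewrite -mulrA; apply: le_trans (ler_wpM2l (expR_ge0 _) (expR_dominated2 P (Re w) a0 c0)).
rewrite -expRD cmod_pker ler_expR.
have h1 : - (Im a * Im w) <= `|Im a| * t0.
  by rewrite (le_trans (ler_norm _)) // normrN normrM ler_wpM2l.
have h2 : - Re (p * cexp w) <= P * expR (Re w).
  have := Re_le_cmod (p * cexp w); rewrite cmodM cmod_cexp ler_norml => /andP[h _].
  by have := ler_wpM2r (expR_ge0 (Re w)) pP; lra.
have h3 : cos (2 * t0) <= cos (2 * Im w).
  have -> : cos (2 * Im w) = cos (2 * `|Im w|).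
    by have [_|_] := ger0P (Im w) => //; rewrite mulrN cosN.
  have q0 := normr_ge0 (Im w); apply: le_cos; lra.
have := ler_wpM2l (expR_ge0 (2 * Re w)) h3; lra.
Qed.

Let pi4 : 0 <= (0 : R) < pi / 4. Proof. by rewrite lexx divr_gt0 // pi_gt0. Qed.

Lemma pker_le_real a p (P : R) u : 0 < Re a -> cmod p <= P ->
  cmod (pker a p (CofR u)) <= pker_const (Re a) P (1 / 2) * expabs (Num.min (Re a) 1) u.
Proof.
move=> a0 pP; have w0 : `|Im (CofR u : C)| <= 0 by rewrite Im_CofR normr0.
have := pker_le a0 pP w0 pi4.
by rewrite !mulr0 expR0 cos0 mul1r Re_CofR.
Qed.

Lemma rcont_pker a p t : rcont CofR (fun u => pker a p (CofR u)) t.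
Proof.
by apply: (@rcont_comp R R CofR CofR (pker a p)); [exact: holo_rcont (holo_pker _ _ _)|exact: rcont_id].
Qed.

Lemma cmeas_pker a p : cmeas (setT : set (measurableTypeR R)) (fun u => pker a p (CofR u)).
Proof. by apply: cmeas_rcont => // t; exact: rcont_pker. Qed.

Lemma pker_integrable a p : 0 < Re a -> cintegrable setT (fun u => pker a p (CofR u)).
Proof.
move=> a0; apply: (cint_expabs measurableT (minr_gt0 a0) (cmeas_pker a p)) => u _.
exact: (pker_le_real u a0 (lexx _)).
Qed.

Lemma ReS a n : Re (a + n%:R) = Re a + n%:R.
Proof. by rewrite -CofR_nat ReD Re_CofR. Qed.

Lemma pint_holo a p : 0 < Re a -> holo_at (pint a) (fun p => - pint (a + 1) p) p.
Proof.
move=> a0; have a1 : 0 < Re (a + 1) by rewrite ReD Re1 addr_gt0.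
pose f p u := pker a p (CofR u); pose f1 p u := - pker (a + 1) p (CofR u).
have F1 q : - pint (a + 1) q = cintegral setT (f1 q).
  by rewrite /pint /f1 (cintegral_opp measurableT (pker_integrable q a1)).
have -> : (fun p => - pint (a + 1) p) = (fun q => cintegral setT (f1 q)) by apply/funext => q; exact: F1.
apply: (@param_holo R setT f f1 (fun u => pker_const (Re a) (cmod p + 7) (1 / 2) * expabs (Num.min (Re a) 1) u) p 1 measurableT ltr01).
- move=> u _ q _; have h := holo_cexp (holo_sub (holo_cst (a * CofR u - cexp (2 * CofR u) / 2) q) (holo_mul (holo_id q) (holo_cst (cexp (CofR u)) q))).
  by apply: (holo_eq h) => v; rewrite /f1 pkerS /pker; ring.
- by move=> q _; exact: cmeas_pker.
- move=> q _; apply: cmeas_rcont => // t; have := rcont_mul (rcont_cst CofR (-1) t) (rcont_pker (a + 1) q t).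
  by congr rcont; apply/funext => u; rewrite mulN1r.
- by apply: integrable_scale => //; exact: integrable_expabs (minr_gt0 a0).
- move=> u _ q; rewrite mulr1 => qp; apply: pker_le_real => //.
  by have := cmodD (q - p) p; rewrite subrK; lra.
Qed.

Lemma pint_recurrence a p : 0 < Re a -> a * pint a p = pint (a + 2) p + p * pint (a + 1) p.
Proof.
move=> a0; have a1 : 0 < Re (a + 1) by rewrite ReD Re1 addr_gt0.
have a2 : 0 < Re (a + 2) by rewrite ReS addr_gt0.
have i0 := pker_integrable p a0; have i1 := pker_integrable p a1; have i2 := pker_integrable p a2.
have s0 := cintegrable_scale a measurableT i0; have s1 := cintegrable_scale p measurableT i1.
have s21 := cintegrable_add measurableT i2 s1; have s := cintegrable_sub measurableT s0 s21.
apply/eqP; rewrite -subr_eq0; apply/eqP.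
rewrite /pint -(cintegral_scale _ measurableT i0) -(cintegral_scale _ measurableT i1).
rewrite -(cintegral_add measurableT i2 s1) -(cintegral_sub measurableT s0 s21).
have [v1 v2] := expabs_vanish (minr_gt0 a0) (fun u => pker_le_real u a0 (lexx (cmod p))).
apply: (@cintegral_FTC_line R (fun u => pker a p (CofR u))) => //.
- move=> t; have [h _] := holo_pker a p (CofR t); have {}h := rderiv_real h.
  by apply: (rderiv_eq h); rewrite pkerS pkerSS; ring.
- move=> t; apply: rcont_sub; first by apply: rcont_mul; [exact: rcont_cst|exact: rcont_pker].
  by apply: rcont_add; [exact: rcont_pker|apply: rcont_mul; [exact: rcont_cst|exact: rcont_pker]].
Qed.

Lemma pint_rot a p (t : R) : 0 < Re a -> `|t| < pi / 4 ->
  cintegrable setT (fun u => pker a p (CofR u + iC * CofR t)) /\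
  cintegral setT (fun u => pker a p (CofR u + iC * CofR t)) = pint a p.
Proof.
move=> a0 tp; pose t0 := (`|t| + pi / 4) / 2.
have t00 : `|t| < t0 by rewrite /t0; lra.
have tz := normr_ge0 t.
have t04 : 0 <= t0 < pi / 4 by rewrite /t0; apply/andP; split; lra.
have k0 := minr_gt0 a0.
have h1 : - t0 < t < t0 by rewrite -ltr_norml.
have h2 : - t0 < 0 < t0 by apply/andP; split; lra.
have hg z : - t0 < Im z < t0 -> holo_at (pker a p) (fun w => pker a p w * (a - cexp (2 * w) - p * cexp w)) z.
  by move=> _; exact: holo_pker.
have gK z : - t0 < Im z < t0 -> cmod (pker a p z) <= expR (`|Im a| * t0) * pker_const (Re a) (cmod p) (cos (2 * t0) / 2) * expabs (Num.min (Re a) 1) (Re z).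
  by rewrite -ltr_norml => /ltW h; exact: pker_le.
split; first exact: (line_integrable k0 hg gK h1).
by rewrite (line_shift k0 hg gK h1 h2); apply: eq_cintegral => u _; rewrite iC0.
Qed.

(** In the coordinate zeta = log z, with W1 and W2 the first two derivatives
    of W, the equation loses the singular factors e^(- zeta); the exponential
    rate in the asymptotics is the one that Watson lemma supplies. *)
Lemma is_tricomiI a (b : C) (W W1 W2 : C -> C) :
  (forall z, holo_at W W1 z) -> (forall z, holo_at W1 W2 z) ->
  (forall z, W2 z + (b - 1 - cexp z) * W1 z = a * cexp z * W z) ->
  (forall d : R, 0 < d -> exists2 K : R, 0 <= K & exists2 k : R, 0 < k & exists r0 : R, forall z, r0 <= Re z -> `|Im z| <= 3 / 2 * pi - d ->
     cmod (W z * cexp (a * z) - 1) <= K * expR (- (k * Re z))) ->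
  is_tricomi a b W.
Proof.
move=> hW hW1 ode as_.
have D1 : derive1 W = W1 by apply/funext => z; have [_ ->] := rderiv_derive1 (hW z).1.
have E : dlog W = fun z => cexp (- z) * W1 z by apply/funext => z; rewrite /dlog D1.
have hE z : holo_at (dlog W) (fun z => cexp (- z) * (W2 z - W1 z)) z.
  rewrite E; apply: (holo_eq (holo_mul (holo_cexp (holo_opp (holo_id z))) (hW1 z))) => v; ring.
split.
- split=> z; first by have [] := rderiv_derive1 (hW z).1.
  by have [] := rderiv_derive1 (hE z).1.
- move=> z; have E2 : dlog (dlog W) z = cexp (- z) * (cexp (- z) * (W2 z - W1 z)).
    by rewrite {1}/dlog; have [_ ->] := rderiv_derive1 (hE z).1.
  rewrite E2 E; have := ode z; rewrite cexpN; have := cexp_neq0 z.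
  move: (cexp z) (W z) (W1 z) (W2 z) => e w w1 w2 e0 h.
  have -> : w2 = a * e * w - (b - 1 - e) * w1 by rewrite -h; ring.
  by field.
- move=> d d0 e e0; have [K K0 [k k0 [r0 h]]] := as_ d d0.
  pose r1 := Num.max r0 (ln ((K + 1) / e) / k).
  exists r1; split; first by rewrite num_real.
  move=> r; rewrite gt_max => /andP[rr0 rr1] th hth /=; rewrite mulNr cexpN invrK.
  apply: le_lt_trans (h _ _ _) _ => //; first exact: ltW.
  rewrite expRN ltr_pdivrMr ?expR_gt0 // /=.
  have q0 : 0 < (K + 1) / e by rewrite divr_gt0 //; lra.
  rewrite ltr_pdivrMr // in rr1.
  have : (K + 1) / e < expR (k * r) by rewrite -[ltLHS]lnK // ltr_expR [k * r]mulrC.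
  by rewrite ltr_pdivrMr //; lra.
Qed.


Section Witness.
Variable a : C.
Hypothesis a0 : 0 < Re a < 1 / 2.

Lemma CofR_half : (1 / 2 : C) = CofR (1 / 2).
Proof. by rewrite CofRM CofRV CofR_nat CofR1. Qed.

Let two0 : (2 : C) != 0. Proof. by rewrite -CofR_nat CofR_eq0 pnatr_eq0. Qed.

Let Re2a : 0 < Re (2 * a) < 1.
Proof. by rewrite -CofR_nat ReM Re_CofR Im_CofR mul0r subr0; move: a0; lra. Qed.

Let g0 : Gam (2 * a) != 0 := Gam_neq0 Re2a.
Let k : C := cexp (a * CofR (ln 2)) / Gam (2 * a).
Let lam z : C := (CofR (ln 2) + z) / 2.
Let pz z : C := cexp (lam z).
Definition parabolic_tricomi z : C := k * pint (2 * a) (pz z).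
Let W1 z : C := - (k * (pint (2 * a + 1) (pz z) * (pz z / 2))).
Let W2 z : C := k * (pint (2 * a + 2) (pz z) * (pz z / 2) * (pz z / 2) - pint (2 * a + 1) (pz z) * (pz z / 2 / 2)).

Let pz_sqr z : pz z * pz z = 2 * cexp z.
Proof.
rewrite /pz -cexpD /lam; have -> : (CofR (ln 2) + z) / 2 + (CofR (ln 2) + z) / 2 = CofR (ln 2) + z by field.
by rewrite cexpD cexp_CofR lnK ?posrE // CofR_nat.
Qed.

Let holo_pz z : holo_at pz (fun z => pz z / 2) z.
Proof.
have h := holo_cexp (holo_scale (2^-1) (holo_add (holo_cst (CofR (ln 2)) z) (holo_id z))).
apply: (holo_eq (holo_ext _ h)) => v; first by rewrite /pz /lam mulrC.
by rewrite /pz /lam add0r mulr1 [(_ + _) / 2]mulrC.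
Qed.

Let holo_pint_pz b z : 0 < Re b -> holo_at (fun z => pint b (pz z)) (fun z => - pint (b + 1) (pz z) * (pz z / 2)) z.
Proof. by move=> b0; exact: holo_comp (pint_holo (pz z) b0) (holo_pz z). Qed.

Let cmod_minus_ge0 (w : C) : 0 <= Re w -> cmod (cexp (- w) - 1) <= 2 * cmod w.
Proof.
move=> w0; have := @cexp_decay_lip R (- w) 1; rewrite CofR1 mulr1 mulr1 cmodN; apply => //.
by rewrite ReN oppr_le0.
Qed.

(** The equation is pint_recurrence. For the asymptotics the contour is moved
    to Im w = - Im z / 6: both p e^w and e^(2 w) stay in the right half-plane
    for |Im z| < 3 pi / 2. *)
Lemma parabolic_is_tricomi : is_tricomi a (1 / 2) parabolic_tricomi.
Proof.
case/andP: (Re2a) => r0 r1; have rr1 : 0 < Re (2 * a + 1) by rewrite ReD Re1 addr_gt0.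
have e2 : 2 * a + 1 + 1 = 2 * a + 2 by ring.
have p0 := @pi_gt0 R.
apply: (@is_tricomiI a (1 / 2) parabolic_tricomi W1 W2).
- move=> z; apply: (holo_eq (holo_scale k (holo_pint_pz z r0))) => v; rewrite /W1; ring.
- move=> z; have h := holo_scale (- k) (holo_mul (holo_pint_pz z rr1) (holo_scale (2^-1) (holo_pz z))).
  apply: (holo_eq (holo_ext _ h)) => v; first by rewrite /W1; ring.
  by rewrite /W2 e2; ring.
- move=> z; have h := pint_recurrence (pz z) r0; have hp := pz_sqr z.
  have -> : cexp z = pz z * pz z / 2 by rewrite hp; field.
  have e : a * pint (2 * a) (pz z) = (pint (2 * a + 2) (pz z) + pz z * pint (2 * a + 1) (pz z)) / 2.
    by rewrite -h; field.
  rewrite /W1 /W2 /parabolic_tricomi; clear h hp.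
  move: (pz z) (pint (2 * a) _) (pint (2 * a + 1) _) (pint (2 * a + 2) _) e => P J0 J1 J2 e.
  have -> : a * (P * P / 2) * (k * J0) = k * (P * P / 2) * (a * J0) by ring.
  by rewrite e; move: (k) => k'; field.
- move=> d d0; have th : pi / 2 - d / 3 < pi / 2 by lra.
  have k20 : (0 : R) < 2 by [].
  have [K K0 hK] := watson r0 k20 th.
  exists (K / cmod (Gam (2 * a))); first by rewrite divr_ge0 ?cmod_ge0.
  exists 1 => //; exists 0 => z z0 zd; rewrite mul1r.
  pose om := - (Im z / 6).
  have Iml : Im (lam z) = Im z / 2.
    by rewrite /lam -CofR_nat -CofRV mulrC ImM Re_CofR Im_CofR mul0r addr0 ImD Im_CofR add0r mulrC.
  have Rel : Re (lam z) = (ln 2 + Re z) / 2.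
    by rewrite /lam -CofR_nat -CofRV mulrC ReM Re_CofR Im_CofR mul0r subr0 ReD Re_CofR mulrC.
  have om4 : `|om| < pi / 4 by rewrite /om ltr_norml; move: zd; rewrite ler_norml; lra.
  pose m u := cexp (- (cexp (2 * (CofR u + iC * CofR om)) / 2)) : C.
  have [|||_] := hK m 1 om (lam z).
  - move=> t; apply: (@rcont_comp R R CofR (fun u => CofR u + iC * CofR om) (fun w => cexp (- (cexp (2 * w) / 2)))); last first.
      by apply: rcont_add; [exact: rcont_id|exact: rcont_cst].
    have h := holo_cexp (holo_opp (holo_scale (2^-1) (holo_cexp (holo_scale 2 (holo_id (CofR t + iC * CofR om)))))).
    by apply: holo_rcont (holo_ext _ h) => v; rewrite [_ / 2]mulrC.
  - by rewrite Iml /om ler_norml; move: zd; rewrite ler_norml; lra.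
  - move=> u; have R2 : Re (2 * (CofR u + iC * CofR om)) = 2 * u.
      by rewrite -CofR_nat ReM Re_CofR Im_CofR mul0r subr0 !ReImE !(mul0r, mulr0, subr0, addr0).
    have I2 : Im (2 * (CofR u + iC * CofR om)) = 2 * om.
      by rewrite -CofR_nat ImM Re_CofR Im_CofR mul0r addr0 !ReImE !(mul0r, mulr0, mul1r, add0r, subr0, addr0).
    apply: le_trans (cmod_minus_ge0 _) _.
      rewrite -CofR_nat -CofRV mulrC ReM Re_CofR Im_CofR mul0r subr0 Re_cexp mulr_ge0 // mulr_ge0 ?expR_ge0 //.
      by apply: cos_ge0_pihalf; rewrite ?CofR_nat I2; move: om4; rewrite ltr_norml; lra.
    by rewrite cmodM cmodV cmod_nat cmod_cexp R2 mul1r mulrC mulfVK.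
  have -> : (fun u => cexp (2 * a * (CofR u + iC * CofR om) - cexp (lam z + (CofR u + iC * CofR om))) * m u) =
    (fun u => pker (2 * a) (pz z) (CofR u + iC * CofR om)).
    apply/funext => u; rewrite /pker /m /pz -cexpD [cexp (lam z + _)]cexpD; congr cexp; ring.
  have [_ ->] := pint_rot (pz z) r0 om4.
  rewrite mulr1 Rel => h.
  have -> : parabolic_tricomi z * cexp (a * z) - 1 = (pint (2 * a) (pz z) * cexp (2 * a * lam z) - Gam (2 * a)) / Gam (2 * a).
    have -> : cexp (2 * a * lam z) = cexp (a * CofR (ln 2)) * cexp (a * z).
      by rewrite -cexpD; congr cexp; rewrite /lam; field.
    by rewrite /parabolic_tricomi /k; move: (cexp _) (cexp _) (pint _ _) (Gam _) g0 => x y J g gg; field.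
  rewrite cmodM cmodV [leRHS]mulrAC ler_pM2r ?invr_gt0 ?cmod_gt0 // (le_trans h) // ler_wpM2l // ler_expR.
  have l2 : 0 <= ln 2 :> R by rewrite ln_ge0 // ler1n.
  by move: z0; lra.
Qed.

Lemma cexp_clog z : z != 0 -> cexp (clog z) = z.
Proof.
move=> z0; have c0 : 0 < cmod z by rewrite cmod_gt0.
have bd : -1 <= Re z / cmod z <= 1.
  have := Re_le_cmod z; rewrite ler_norml => /andP[h1 h2].
  by rewrite ler_pdivlMr // ler_pdivrMr // mulN1r mul1r h1 h2.
have s2 : 1 - (Re z / cmod z) ^+ 2 = (Im z / cmod z) ^+ 2.
  have := cmod_sqr z; have : cmod z != 0 by rewrite gt_eqF.
  move: (cmod z) (Re z) (Im z) => m x y m0 h; rewrite !exprMn; have -> : y ^+ 2 = m ^+ 2 - x ^+ 2 by rewrite h addrAC subrr add0r.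
  by field.
have st : sin (acos (Re z / cmod z)) = `|Im z| / cmod z.
  by rewrite sin_acos // s2 sqrtr_sqr normrM normfV (gtr0_norm c0).
apply: cplx_ext; rewrite ?Re_cexp ?Im_cexp /clog /= lnK // /carg.
  have -> : cos (if 0 <= Im z then acos (Re z / cmod z) else - acos (Re z / cmod z)) = Re z / cmod z.
    by case: ifP => _; rewrite ?cosN acosK.
  by rewrite mulrC divfK ?gt_eqF.
have -> : sin (if 0 <= Im z then acos (Re z / cmod z) else - acos (Re z / cmod z)) = Im z / cmod z.
  by case: ifPn => h; rewrite ?sinN st; [rewrite ger0_norm|rewrite ltr0_norm ?ltNge // mulNr opprK].
by rewrite mulrC divfK ?gt_eqF.
Qed.

Lemma parcyl_punctured_pint nu z : - (nu / 2) = a -> z != 0 ->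
  parcyl_punctured nu z = cexp (- (z ^+ 2 / 4)) * (pint (2 * a) z / Gam (2 * a)).
Proof.
move=> nua z0; rewrite /parcyl_punctured nua.
have tw : tricomiU a (1 / 2) = parabolic_tricomi.
  rewrite CofR_half; apply: tricomiU_eq; first lra.
  by rewrite -CofR_half; exact: parabolic_is_tricomi.
rewrite tw /parabolic_tricomi.
have -> : pz (2 * clog z - CofR (ln 2)) = z.
  by rewrite /pz /lam -[RHS]cexp_clog //; congr cexp; field.
have -> : rcpow 2 (nu / 2) = (cexp (a * CofR (ln 2)))^-1 :> C.
  by rewrite /rcpow -cexpN -nua; congr cexp; ring.
rewrite /k; move: (cexp_neq0 (a * CofR (ln 2))) (g0); move: (cexp (a * CofR (ln 2))) (Gam (2 * a)).
move: (pint (2 * a) z) (cexp (- (z ^+ 2 / 4))) => J f e g ee gg.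
by field; rewrite ?gg ?ee.
Qed.

Lemma rcont_lim (f g : C -> C) z : (forall w, w != z -> f w = g w) -> rcont id g z -> lim (f w @[w --> z^']) = g z.
Proof.
move=> fg cg; apply/cvg_lim; first exact: norm_hausdorff.
apply/cvgrPdist_le => e e0.
have ee : e = CofR (Re e) by rewrite {1}(CE e) (ltc0_Im e0) CofR0 mulr0 addr0.
have e0' : 0 < Re e by move: e0; rewrite ltcE => /andP[].
have [r r0 hr] := cg _ e0'.
apply/nbhs_ballP; exists (CofR r); first by rewrite /= ltcR.
move=> w /=; rewrite /ball/= => wr ne; rewrite fg // distrC norm_cmod ee lecR.
by apply: hr; move: wr; rewrite distrC norm_cmod ltcR.
Qed.

(** At the origin the definition of D_nu takes a limit, which the continuity
    of pint evaluates. *)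
Lemma parcylE nu z : - (nu / 2) = a ->
  parcyl nu z = cexp (- (z ^+ 2 / 4)) * (pint (2 * a) z / Gam (2 * a)).
Proof.
move=> nua; rewrite /parcyl; case: eqVneq => [->|z0]; last exact: parcyl_punctured_pint.
apply: (@rcont_lim _ (fun z => cexp (- (z ^+ 2 / 4)) * (pint (2 * a) z / Gam (2 * a)))).
  by move=> w w0; exact: parcyl_punctured_pint.
case/andP: (Re2a) => r0 _.
have h1 := holo_cexp (holo_opp (holo_scale (4^-1) (holo_mul (holo_id (0 : C)) (holo_id 0)))).
have h2 := holo_mul h1 (holo_mul (pint_holo 0 r0) (holo_cst (Gam (2 * a))^-1 0)).
by apply: holo_rcont (holo_ext _ h2) => w /=; rewrite [_ / 4]mulrC expr2.
Qed.

End Witness.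

End ParabolicIntegral.

(** * The parabolic integral for parameters with large imaginary part *)

Section SaddleBound.
Context {R : realType}.
Local Notation C := (Cplx R).
Implicit Types (a p w z : C) (t u : R).

(** Re (p e^w) / T at the saddle e^w = T e^(- i pi / 4). *)
Definition tilt p : R := Re (p * cis (- (pi / 4))).

Lemma tilt_le p : `|tilt p| <= cmod p.
Proof. by rewrite (le_trans (Re_le_cmod _)) // cmodM cmod_cis mulr1. Qed.

Lemma cisD t u : cis (t + u) = cis t * cis u :> C.
Proof. by rewrite /cis -cexpD; congr cexp; rewrite CofRD; ring. Qed.

Lemma cis_sub1_le t : cmod (cis t - 1 : C) <= 2 * `|t|.
Proof.
have h s : 0 <= s -> forall c : C, Re c = 0 -> cmod c = 1 -> cmod (cexp (c * CofR s) - 1) <= 2 * s.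
  by move=> s0 c c0 c1; have := @cexp_decay_lip R c s; rewrite c0 c1 mul1r; apply.
rewrite /cis; have [t0|t0] := leP 0 t; first by rewrite ger0_norm // h ?cmod_iC.
have -> : iC * CofR t = (- iC) * CofR (- t) :> C by rewrite CofRN; ring.
rewrite ltr0_norm // h ?cmodN ?cmod_iC ?ReN //; first by rewrite oppr_ge0 ltW.
by rewrite /= oppr0.
Qed.

Lemma sin_sub_le (x : R) : `|x| <= 1 -> `|sin x - x| <= 4 * expR 1 * x ^+ 2.
Proof.
move=> x1; have := cexp_sub2_le (iC * CofR x : C).
have -> : cmod (iC * CofR x : C) = `|x| by rewrite cmodM cmod_iC mul1r cmod_CofR.
move=> h; have := le_trans (Im_le_cmod _) h.
rewrite !ImD !ImN Im_cexp Im1 subr0 !ReImE !(mul0r, mul1r, mulr0, subr0, add0r, addr0) ?oppr0 expR0 mul1r.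
move=> /le_trans; apply; rewrite -mulrA ler_pM2l // real_normK ?num_real // ler_wpM2r ?sqr_ge0 //.
by rewrite ler_expR.
Qed.

(** Size of the integrand near the ray arg w = - pi / 4 through the saddle. *)
Lemma pker_tilted a p u (k : R) : cmod (pker a p (CofR u + iC * CofR (- (pi / 4) - k))) <=
  expR (Re a * u + Im a * (pi / 4) + Im a * k + expR (2 * u) * sin (2 * k) / 2 - expR u * tilt p + 2 * cmod p * `|k| * expR u).
Proof.
rewrite cmod_pker ler_expR !ReD !ImD Re_CofR Im_CofR.
have -> : Re (iC * CofR (- (pi / 4) - k) : C) = 0 by rewrite !ReImE !(mul0r, mulr0, subr0).
have -> : Im (iC * CofR (- (pi / 4) - k) : C) = - (pi / 4) - k by rewrite !ReImE !(mul0r, mul1r, add0r).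
rewrite add0r addr0.
have -> : cos (2 * (- (pi / 4) - k)) = - sin (2 * k).
  have -> : 2 * (- (pi / 4) - k) = - (2 * k + pi / 2) by field.
  by rewrite cosN cosDpihalf.
have -> : p * cexp (CofR u + iC * CofR (- (pi / 4) - k)) = CofR (expR u) * (p * cis (- (pi / 4)) + p * cis (- (pi / 4)) * (cis (- k) - 1)).
  by rewrite cexpD cexp_CofR -/(cis _) cisD; ring.
rewrite ReM Re_CofR Im_CofR mul0r subr0 ReD -/(tilt p).
have h := Re_le_cmod (p * cis (- (pi / 4)) * (cis (- k) - 1)).
have h2 : `|Re (p * cis (- (pi / 4)) * (cis (- k) - 1))| <= 2 * cmod p * `|k|.
  rewrite (le_trans h) // !cmodM cmod_cis mulr1.
  by have := ler_wpM2l (cmod_ge0 p) (cis_sub1_le (- k)); rewrite normrN; lra.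
rewrite ler_norml in h2; case/andP: h2 => h2 _.
have := ler_wpM2l (expR_ge0 u) h2; lra.
Qed.

(** For Im a = - T^2 the modulus of the integrand is stationary near w = ln T
    - i pi / 4. It decreases to the left of this point on a line slightly
    below it and to the right on a line slightly above it, so the contour
    follows the lower line up to ln T, climbs there, and follows the upper
    line. The vertical distance k = c / T is large enough to absorb the term p
    e^w and small enough to cost only a bounded factor. *)
Section Staircase.
Variables (al M : R).
Hypotheses (al01 : 0 < al <= 1) (M0 : 0 <= M).
Let D : R := 8 * expR 1.
Let c : R := 3 * M + 1.
Let E1 : R := 2 * M * c + D * c ^+ 2.

Variables (a p : C) (T : R).
Hypotheses (Ra : Re a = al) (Ia : Im a = - T ^+ 2) (pM : cmod p <= M) (TD : 2 * D * c + 2 <= T).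
Let k : R := c / T.
Let u0 : R := ln T.

Let D8 : 8 <= D. Proof. by rewrite /D ler_peMr // -[leLHS]expR0 ler_expR. Qed.
Let c1 : 1 <= c. Proof. by rewrite /c lerDr mulr_ge0. Qed.
Let T2 : 2 <= T. Proof. by apply: le_trans TD; rewrite lerDr !mulr_ge0 //; move: D8 c1; lra. Qed.
Let T0 : 0 < T. Proof. by move: T2; lra. Qed.
Let eu0 : expR u0 = T. Proof. by rewrite lnK // posrE. Qed.
Let k0 : 0 < k. Proof. by rewrite divr_gt0 //; move: c1; lra. Qed.
Let kT : k * T = c. Proof. by rewrite /k mulfVK // gt_eqF. Qed.
Let kD : k * (2 * D) <= 1.
Proof. by rewrite -(ler_pM2r T0) mulrAC kT mul1r; apply: le_trans TD; rewrite mulrC lerDl. Qed.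
Let k2 : 2 * k <= 1.
Proof. by apply: le_trans kD; rewrite mulrC ler_pM2l // ler_peMr //; move: D8; lra. Qed.
Let e2u u : expR (2 * u) = expR u ^+ 2. Proof. by rewrite expRM_natl. Qed.
Let sink s : `|s| <= k -> `|sin (2 * s) / 2 - s| <= D * k ^+ 2.
Proof.
move=> sk; have s1 : `|2 * s| <= 1 by rewrite normrM ger0_norm //; move: k2; lra.
have := sin_sub_le s1; have -> : sin (2 * s) - 2 * s = 2 * (sin (2 * s) / 2 - s) by field.
rewrite normrM [`|2|]ger0_norm //.
have : s ^+ 2 <= k ^+ 2 by rewrite -real_normK ?num_real // ler_sqr ?nnegrE // ltW.
have -> : 4 * expR 1 = D / 2 by rewrite /D; field.
move=> h1 h2; have D0 : 0 <= D by move: D8; lra.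
have := ler_wpM2l D0 h1; rewrite exprMn in h2; lra.
Qed.
Let lnT0 : 0 <= u0. Proof. by rewrite ln_ge0 //; move: T2; lra. Qed.

Definition saddle_size : R := expR (E1 - T ^+ 2 * (pi / 4) - T * tilt p).

Let vertical s : `|s| <= k -> cmod (pker a p (CofR u0 + iC * CofR (- (pi / 4) - s))) <= T * saddle_size.
Proof.
move=> sk; apply: le_trans (pker_tilted _ _ _ _) _.
rewrite -[X in _ <= X * _]eu0 -expRD ler_expR e2u eu0 Ra Ia.
have h1 := sink sk; rewrite ler_norml in h1; case/andP: h1 => _ h1.
have h2 := ler_wpM2l (sqr_ge0 T) h1.
have h3 : T ^+ 2 * (D * k ^+ 2) = D * c ^+ 2 by rewrite -kT; ring.
have h4 : 2 * cmod p * `|s| * T <= 2 * M * c.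
  by rewrite -kT mulrA ler_pM2r // ler_pM ?mulr_ge0 ?cmod_ge0 // ler_pM2l.
have h5 : al * u0 <= u0 by rewrite ler_piMl //; case/andP: al01.
rewrite h3 in h2; rewrite /E1; lra.
Qed.

Let left_bound u : u <= u0 -> cmod (pker a p (CofR u + iC * CofR (- (pi / 4) - k))) <= T ^+ 2 * saddle_size * expabs al u.
Proof.
move=> uu; apply: le_trans (pker_tilted _ _ _ _) _.
have r0 := expR_gt0 u; have rT : expR u <= T by rewrite -eu0 ler_expR.
rewrite Ra Ia e2u (gtr0_norm k0).
have kk : `|k| <= k by rewrite gtr0_norm.
have h1 := sink kk; rewrite ler_norml in h1; case/andP: h1 => _ h1.
have h2 := ler_wpM2l (sqr_ge0 (expR u)) h1.
have D0 : 0 <= D by move: D8; lra.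
have h3 : expR u ^+ 2 * (D * k ^+ 2) <= D * c ^+ 2.
  have -> : D * c ^+ 2 = T ^+ 2 * (D * k ^+ 2) by rewrite -kT; ring.
  apply: ler_wpM2r; first by rewrite mulr_ge0 ?sqr_ge0.
  by rewrite ler_sqr ?nnegrE ?(ltW T0) ?(ltW r0).
have h4 : 2 * cmod p * k * expR u <= 2 * M * c.
  have -> : 2 * M * c = 2 * M * k * T by rewrite -kT; ring.
  have : k * expR u <= k * T by rewrite ler_wpM2l // ltW.
  move=> kr; have := ler_pM (cmod_ge0 p) (mulr_ge0 (ltW k0) (ltW r0)) pM kr; lra.
have h5 : - (expR u * tilt p) <= - (T * tilt p) + (T - expR u) * M.
  have := tilt_le p; rewrite ler_norml => /andP[_ h]; have {}h := le_trans h pM.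
  have d0 : 0 <= T - expR u by lra.
  have := ler_wpM2l d0 h; lra.
have h6 : - (T ^+ 2 * k) + expR u ^+ 2 * k + (T - expR u) * M <= 0.
  have -> : - (T ^+ 2 * k) + expR u ^+ 2 * k + (T - expR u) * M = - ((T - expR u) * (k * T - M + k * expR u)) by ring.
  rewrite oppr_le0; apply: mulr_ge0; first by rewrite subr_ge0.
  apply: addr_ge0; last by rewrite mulr_ge0 ?(ltW k0) ?(ltW r0).
  by rewrite kT subr_ge0 /c; move: M0; lra.
have h7 : al * u <= 2 * u0 - al * `|u|.
  case/andP: al01 => x0 x1; have [u00|u00] := leP 0 u.
    by rewrite ger0_norm //; nra.
  rewrite ltr0_norm //; move: lnT0; nra.
have -> : T ^+ 2 = expR (2 * u0) by rewrite e2u eu0.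
rewrite /saddle_size /expabs -!expRD ler_expR e2u eu0 /E1; lra.
Qed.

Let right_bound u : u0 <= u -> cmod (pker a p (CofR u + iC * CofR (- (pi / 4) - - k))) <= T ^+ 2 * saddle_size * expabs al u.
Proof.
move=> uu; apply: le_trans (pker_tilted _ _ _ _) _.
have r0 := expR_gt0 u; have rT : T <= expR u by rewrite -eu0 ler_expR.
rewrite Ra Ia e2u normrN (gtr0_norm k0).
have kk : `|- k| <= k by rewrite normrN gtr0_norm.
have h1 := sink kk; rewrite ler_norml in h1; case/andP: h1 => _ h1.
have h2 := ler_wpM2l (sqr_ge0 (expR u)) h1.
have D0 : 0 <= D by move: D8; lra.
set r := expR u in r0 rT h2 *.
have h3 : T ^+ 2 * k + r ^+ 2 * (- k + D * k ^+ 2) <= D * c ^+ 2 - c * (r - T).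
  have -> : D * c ^+ 2 = T ^+ 2 * (D * k ^+ 2) by rewrite -kT; ring.
  have : 0 <= (r - T) * (r + T) * (k * (1 / 2 - D * k)).
    apply: mulr_ge0; first by rewrite mulr_ge0 ?subr_ge0 ?addr_ge0 ?(ltW r0) ?(ltW T0).
    by apply: mulr_ge0; [exact: ltW|move: kD; move: (k) (D) => k' D'; lra].
  have : 0 <= (r - T) * (r - T) * k by rewrite mulr_ge0 ?(ltW k0) // -expr2 sqr_ge0.
  rewrite -kT; nra.
have h4 : 2 * cmod p * k * r <= 2 * M * c + 2 * M * (r - T).
  have : 2 * cmod p * k * r <= 2 * M * k * r.
    by rewrite ler_wpM2r ?(ltW r0) // ler_pM2r // ler_pM2l.
  have : 0 <= 2 * M * (r - T) * (1 - k).
    rewrite mulr_ge0 ?mulr_ge0 ?subr_ge0 //; move: k2 k0; lra.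
  rewrite -kT; nra.
have h5 : - (r * tilt p) <= - (T * tilt p) + (r - T) * M.
  have := tilt_le p; rewrite ler_norml => /andP[h _].
  have d0 : 0 <= r - T by lra.
  have {}h : - tilt p <= M by move: pM; lra.
  have := ler_wpM2l d0 h; lra.
have h6 : 2 * (u - u0) <= r - T.
  have -> : r = T * expR (u - u0) by rewrite expRD expRN eu0 mulrC mulfVK // gt_eqF.
  have := expR_ge1Dx (u - u0); have d0 : 0 <= u - u0 by lra.
  have := T2; nra.
have h7 : al * u <= u.
  by case/andP: al01 => x0 x1; move: lnT0; nra.
have u00 : 0 <= u by move: lnT0; lra.
have h8 : al * `|u| <= u by rewrite ger0_norm.
have -> : T ^+ 2 = expR (2 * u0) by rewrite e2u eu0.
have h9 : - c * (r - T) + 3 * M * (r - T) = - (r - T) by rewrite /c; ring.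
rewrite /saddle_size /expabs -!expRD ler_expR e2u eu0 /E1.
have h10 : r ^+ 2 * (sin (2 * - k) / 2) <= r ^+ 2 * (- k + D * k ^+ 2).
  by move: h2; lra.
rewrite -/r; lra.
Qed.

Lemma pker_left_coarse u t : u <= u0 + 1 -> - (pi / 4) - 2 * k < t < 1 ->
  cmod (pker a p (CofR u + iC * CofR t)) <=
  expR (T ^+ 2 * pi + expR (u0 + 1) ^+ 2 + M * expR (u0 + 1) + 2 * (u0 + 1)) * expabs al u.
Proof.
move=> uu /andP[t1 t2]; rewrite cmod_pker !ReD !ImD Re_CofR Im_CofR Ra Ia.
have -> : Re (iC * CofR t : C) = 0 by rewrite !ReImE !(mul0r, mulr0, subr0).
have -> : Im (iC * CofR t : C) = t by rewrite !ReImE !(mul0r, mul1r, add0r).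
rewrite add0r addr0 /expabs -expRD ler_expR.
have r0 := expR_gt0 u; have rle : expR u <= expR (u0 + 1) by rewrite ler_expR.
have p2 := @pi_ge2 R.
have h1 : - (- T ^+ 2 * t) <= T ^+ 2 * pi.
  have : 0 <= T ^+ 2 * (pi - t) by rewrite mulr_ge0 ?sqr_ge0 //; lra.
  lra.
have h2 : - (expR (2 * u) * cos (2 * t) / 2) <= expR (u0 + 1) ^+ 2.
  have q : expR (2 * u) <= expR (u0 + 1) ^+ 2 by rewrite e2u ler_sqr ?nnegrE ?expR_ge0.
  have c0 := cos_geN1 (2 * t); have := ler_wpM2l (expR_ge0 (2 * u)) c0; have := expR_ge0 (2 * u); lra.
have h3 : - Re (p * cexp (CofR u + iC * CofR t)) <= M * expR (u0 + 1).
  have := Re_le_cmod (p * cexp (CofR u + iC * CofR t)); rewrite cmodM cmod_cexp ReD Re_CofR.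
  have -> : Re (iC * CofR t : C) = 0 by rewrite !ReImE !(mul0r, mulr0, subr0).
  rewrite addr0 ler_norml => /andP[h _]; have := ler_pM (cmod_ge0 p) (ltW r0) pM rle; lra.
have h7 : al * u <= 2 * (u0 + 1) - al * `|u|.
  case/andP: al01 => x0 x1; have l0 := lnT0; have [u00|u00] := leP 0 u.
    by rewrite ger0_norm //; nra.
  rewrite ltr0_norm //; nra.
lra.
Qed.

Variable B : R.
Hypothesis B0 : 0 <= B.
Hypothesis hBl : forall (f : R -> C) (K : R), cmeas (`]-oo, u0]%classic : set (measurableTypeR R)) f ->
  (forall x, `]-oo, u0]%classic x -> cmod (f x) <= K * expabs al x) -> cmod (cintegral `]-oo, u0] f) <= K * B.
Hypothesis hBr : forall (f : R -> C) (K : R), cmeas (`[u0, +oo[%classic : set (measurableTypeR R)) f ->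
  (forall x, `[u0, +oo[%classic x -> cmod (f x) <= K * expabs al x) -> cmod (cintegral `[u0, +oo[ f) <= K * B.

Let line t : forall s, rcont CofR (fun u => pker a p (CofR u + iC * CofR t)) s.
Proof.
move=> s; apply: (@rcont_comp R R CofR (fun u => CofR u + iC * CofR t) (pker a p)); first exact: holo_rcont (holo_pker _ _ _).
by apply: rcont_add; [exact: rcont_id|exact: rcont_cst].
Qed.

Lemma pint_staircase : cmod (pint a p) <= (2 * B + 4) * T ^+ 2 * saddle_size.
Proof.
have p2 := @pi_ge2 R; have kk2 := k2; have kk0 := k0.
have a0 : 0 < Re a by rewrite Ra; case/andP: al01.
have t2 : `|- (pi / 4) - - k| < pi / 4 by rewrite ltr_norml; lra.
have [i2 <-] := pint_rot p a0 t2.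
rewrite (cintegral_split u0 i2).
set L2 := cintegral `]-oo, u0] _; set R2 := cintegral `[u0, +oo[ _.
pose L1 := cintegral `]-oo, u0] (fun u => pker a p (CofR u + iC * CofR (- (pi / 4) - k))).
have s0 : 0 <= saddle_size by exact: expR_ge0.
have hR : cmod R2 <= T ^+ 2 * saddle_size * B.
  apply: hBr; first by apply: cmeas_rcont => [t|]; [exact: line|exact: measurable_itv].
  by move=> x; rewrite /= in_itv/= andbT; exact: right_bound.
have hL : cmod L1 <= T ^+ 2 * saddle_size * B.
  apply: hBl; first by apply: cmeas_rcont => [t|]; [exact: line|exact: measurable_itv].
  by move=> x; rewrite /= in_itv/=; exact: left_bound.
have hd : cmod (L2 - L1) <= 2 * (T * saddle_size * `|- (pi / 4) - - k - (- (pi / 4) - k)|).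
  have al0 : 0 < al by case/andP: al01.
  apply: (@half_line_shift R (pker a p) _ (- (pi / 4) - 2 * k) 1 al _ (fun x => x <= u0 + 1) al0 (fun z _ => holo_pker a p z) _ u0 (- (pi / 4) - k)) => //.
  - by move=> z hz zu; have := pker_left_coarse zu hz; rewrite -CE; exact.
  - by apply/andP; split; lra.
  - by apply/andP; split; lra.
  - move=> t; rewrite ge_min le_max => /andP[h1 h2].
    have -> : t = - (pi / 4) - (- (pi / 4) - t) by ring.
    apply: vertical; rewrite ler_norml; apply/andP; split.
      by case/orP: h2; lra.
    by case/orP: h1; lra.
have kabs : `|- (pi / 4) - - k - (- (pi / 4) - k)| <= 1 by rewrite ler_norml; lra.
have q : T * saddle_size * `|- (pi / 4) - - k - (- (pi / 4) - k)| <= T ^+ 2 * saddle_size.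
  apply: (@le_trans _ _ (T * saddle_size)).
    by rewrite ler_piMr // mulr_ge0 // ltW.
  by rewrite ler_wpM2r // expr2 ler_peMr ?(ltW T0) //; move: T2; lra.
have -> : L2 + R2 = (L2 - L1) + L1 + R2 by ring.
have := cmodD (L2 - L1 + L1) R2; have := cmodD (L2 - L1) L1.
have : 0 <= T ^+ 2 * saddle_size by rewrite mulr_ge0 ?sqr_ge0.
lra.
Qed.

End Staircase.


Lemma cintegral_expabs_unif (k : R) : 0 < k -> exists2 B : R, 0 <= B &
  forall (D : set R) (x0 : R), D x0 -> measurable (D : set (measurableTypeR R)) -> forall (f : R -> C) (K : R), cmeas (D : set (measurableTypeR R)) f ->
  (forall x, D x -> cmod (f x) <= K * expabs k x) -> cmod (cintegral D f) <= K * B.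
Proof.
move=> k0; have iT := integrable_expabs k0.
exists (2 * \int[lebesgue_measure]_(x in setT) expabs k x).
  by rewrite mulr_ge0 // Rintegral_ge0 // => x _; exact: expabs_ge0.
move=> D x Dx mD f K mf fK.
have iE : (@lebesgue_measure R).-integrable D (EFin \o expabs k) by apply: integrableS iT => //.
have K0 : 0 <= K by have := le_trans (cmod_ge0 _) (fK x Dx); rewrite pmulr_lge0 ?expR_gt0.
rewrite (le_trans (cintegral_le mD _ (integrable_scale K mD iE) fK)) //.
  exact: cint_expabs fK.
rewrite RintegralZl // mulrCA ler_wpM2l // ler_pM2l // fine_le ?integrable_fin_num //.
apply: ge0_subset_integral => //.
  by apply/measurable_EFinP; apply: continuous_measurable_fun; exact: continuous_expabs.
by move=> y _; rewrite lee_fin expabs_ge0.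
Qed.

(** The staircase contour settles large T; for bounded T the integrand on the
    real line is bounded by a fixed integrable function. *)
Lemma pint_bound_neg (al M : R) : 0 < al <= 1 -> 0 <= M -> exists2 K : R, 0 <= K &
  forall a p (T : R), Re a = al -> Im a = - T ^+ 2 -> 0 <= T -> cmod p <= M ->
  cmod (pint a p) <= K * (1 + T) ^+ 2 * expR (- (T ^+ 2 * (pi / 4)) - T * tilt p).
Proof.
move=> al01 M0; have al0 : 0 < al by case/andP: al01.
have [B B0 hBS] := cintegral_expabs_unif al0; have hB := hBS setT 0 I measurableT.
pose D : R := 8 * expR 1; pose c : R := 3 * M + 1; pose T0 := 2 * D * c + 2.
pose E1 : R := 2 * M * c + D * c ^+ 2.
have D0 : 0 <= D by rewrite mulr_ge0 ?expR_ge0.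
have c0 : 0 <= c by rewrite addr_ge0 // mulr_ge0.
have T00 : 0 <= T0 by rewrite addr_ge0 // !mulr_ge0.
pose K1 := (2 * B + 4) * expR E1.
pose K2 := pker_const al M (1 / 2) * B * expR (T0 ^+ 2 * (pi / 4) + T0 * M).
have K10 : 0 <= K1 by rewrite mulr_ge0 ?expR_ge0 // addr_ge0 // !mulr_ge0.
have K20 : 0 <= K2 by rewrite !mulr_ge0 ?expR_ge0.
exists (K1 + K2) => [|a p T Ra Ia Tp pM]; first by rewrite addr_ge0.
have [TT|TT] := leP T0 T.
  have h := @pint_staircase al M al01 M0 a p T Ra Ia pM TT B _ _.
  apply: le_trans (h _ _) _.
  - by apply: (hBS _ (ln T)); [rewrite /= in_itv/= lexx|exact: measurable_itv].
  - by apply: (hBS _ (ln T)); [rewrite /= in_itv/= lexx|exact: measurable_itv].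
  rewrite /saddle_size -/D -/c -/E1.
  have -> : E1 - T ^+ 2 * (pi / 4) - T * tilt p = E1 + (- (T ^+ 2 * (pi / 4)) - T * tilt p) by ring.
  rewrite expRD mulrA ler_wpM2r ?expR_ge0 // mulrAC -/K1 ler_pM ?sqr_ge0 // ?lerDl // ler_sqr ?nnegrE ?addr_ge0 // lerDr //.
have a0 : 0 < Re a by rewrite Ra.
have h : cmod (pint a p) <= pker_const al M (1 / 2) * B.
  apply: hB => [|u _]; first exact: cmeas_pker.
  rewrite -{2}Ra; apply: le_trans (pker_le_real u a0 pM) _; rewrite Ra ler_wpM2l ?expR_ge0 // /expabs ler_expR lerN2.
  by rewrite ler_wpM2r // le_min lexx; case/andP: al01.
apply: le_trans h _; rewrite -[leLHS]mulr1.
have e1 : 1 <= expR (T0 ^+ 2 * (pi / 4) + T0 * M) * expR (- (T ^+ 2 * (pi / 4)) - T * tilt p).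
  rewrite -expRD -[leLHS]expR0 ler_expR.
  have := tilt_le p; rewrite ler_norml => /andP[_ t1].
  have p2 := @pi_ge2 R.
  have h1 : T ^+ 2 * (pi / 4) <= T0 ^+ 2 * (pi / 4) by rewrite ler_wpM2r ?divr_ge0 ?pi_ge0 // ler_sqr ?nnegrE // ltW.
  have h2 : T * tilt p <= T0 * M.
    apply: (@le_trans _ _ (T * M)); first by rewrite ler_wpM2l //; lra.
    by rewrite ler_wpM2r // ltW.
  lra.
have q : K2 <= (K1 + K2) * (1 + T) ^+ 2.
  have t1 : 1 <= (1 + T) ^+ 2 by rewrite expr_ge1 // ?addr_ge0 // lerDl.
  have := ler_wpM2l (addr_ge0 K10 K20) t1; lra.
apply: (@le_trans _ _ (K2 * expR (- (T ^+ 2 * (pi / 4)) - T * tilt p))); last by rewrite ler_wpM2r ?expR_ge0.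
by rewrite /K2 -[leRHS]mulrA ler_wpM2l // mulr_ge0 ?expR_ge0.
Qed.

Lemma cexp_conj w : cexp (conjc w) = conjc (cexp w).
Proof. by apply: cplx_ext; case: w => x y; rewrite /= ?cosN ?sinN ?mulrN. Qed.

Lemma cmod_pint_conj a p : 0 < Re a -> cmod (pint (conjc a) (conjc p)) = cmod (pint a p).
Proof.
move=> a0; suff -> : pint (conjc a) (conjc p) = conjc (pint a p) by rewrite cmod_conj.
have CR x : conjc (CofR x : C) = CofR x by apply: cplx_ext; rewrite /= ?oppr0.
have E u : pker (conjc a) (conjc p) (CofR u) = conjc (pker a p (CofR u)).
  have conjM (z w : C) : conjc (z * w : C) = (conjc z * conjc w : C) by apply: cplx_ext; case: z w => [? ?] [? ?] /=; ring.
  have conjB (z w : C) : conjc (z - w : C) = (conjc z - conjc w : C) by apply: cplx_ext; case: z w => [? ?] [? ?] /=; ring.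
  by rewrite /pker -cexp_conj !conjB -[2]CofR_nat -CofRV !conjM -!cexp_conj !conjM !CR.
have [i1 i2] := pker_integrable p a0.
rewrite /pint (eq_cintegral (fun u _ => E u)); apply: cplx_ext.
  rewrite Re_cintegral; have -> : forall z : C, Re (conjc z) = Re z by case.
  by rewrite Re_cintegral; apply: eq_Rintegral => u _; case: (pker a p _).
rewrite Im_cintegral; have -> : forall z : C, Im (conjc z) = - Im z by case.
rewrite Im_cintegral -mulN1r -RintegralZl //; apply: eq_Rintegral => u _.
by rewrite mulN1r; case: (pker a p _).
Qed.

End SaddleBound.

(** * The square root of 1 + e^w *)

Section SquareRoot.
Context {R : realType}.
Local Notation C := (Cplx R).
Implicit Types (w z : C) (t u : R).

Lemma identity_strip (f f1 : C -> C) (tau x0 : R) :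
  (forall z, `|Im z| < tau -> holo_at f f1 z) -> (forall t, x0 <= t -> f (CofR t) = 0) ->
  forall z, `|Im z| < tau -> x0 <= Re z -> f z = 0.
Proof.
move=> hf f0 z zt zx; pose r := (tau - `|Im z|) / 12.
have r0 : 0 < r by rewrite divr_gt0 // subr_gt0.
have ball w (t : R) : 0 <= t <= 1 -> cmod (w - (CofR (Re z) + CofR t * (iC * CofR (Im z)))) < 6 * r -> `|Im w| < tau.
  move=> /andP[t0 t1] h; have := le_lt_trans (Im_le_cmod _) h.
  rewrite ImD ImN; have -> : Im (CofR (Re z) + CofR t * (iC * CofR (Im z)) : C) = t * Im z.
    by rewrite !ReImE !(mul0r, mul1r, mulr0, subr0, addr0, add0r).
  have : `|t * Im z| <= `|Im z| by rewrite normrM ger0_norm // ler_piMl.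
  have := ler_normD (Im w - t * Im z) (t * Im z); rewrite subrK /r; lra.
have disc w : cmod (w - CofR (Re z)) <= r / 2 -> f w = 0.
  apply: (@identity_disc R f f1 (CofR (Re z)) r r0 _ 1 1) => //.
  - move=> v hv; apply: hf; apply: (ball v 0); first by rewrite lexx ler01.
    by rewrite CofR0 mul0r addr0.
  - by move=> t /andP[t0 _]; rewrite mulr1 -CofRD f0 //; lra.
pose h := r / 2 / (`|Im z| + 1).
have h0 : 0 < h.
  by apply: divr_gt0; [exact: divr_gt0|rewrite ltr_wpDl ?normr_ge0].
have := @identity_segment R f f1 (CofR (Re z)) (iC * CofR (Im z)) r h r0 h0 _ _ 1.
rewrite CofR1 mul1r -CE; apply; last by rewrite ltr01 lexx.
- by move=> t t01 v hv; apply: hf; exact: ball hv.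
- move=> t /andP[t0 th]; apply: disc.
  rewrite addrAC subrr add0r !cmodM cmod_iC mul1r !cmod_CofR (gtr0_norm t0).
  have : t * (`|Im z| + 1) <= r / 2 by rewrite -ler_pdivlMr ?ltr_wpDl // ltW.
  by have := normr_ge0 (Im z); nra.
Qed.

Lemma Re_sqrtc_ge0 z : 0 <= Re (sqrtc z).
Proof. by case: z => a b; rewrite /= sqrtr_ge0. Qed.

Lemma Re_sqrtc_gt0 z : 0 < cmod z + Re z -> 0 < Re (sqrtc z).
Proof. by case: z => a b /= h; rewrite sqrtr_gt0 divr_gt0. Qed.

Lemma sqrtc_CofR (x : R) : 0 <= x -> sqrtc (CofR x) = CofR (Num.sqrt x).
Proof.
move=> x0; rewrite /CofR /sqrtc /= expr0n /= addr0 sqrtr_sqr ger0_norm // eqxx mul1r subrr mul0r sqrtr0.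
by congr (Num.sqrt _ +i* _); field.
Qed.

Lemma holo_sqrtc (g g1 : C -> C) z : holo_at g g1 z -> 0 < Re (sqrtc (g z)) ->
  holo_at (fun w => sqrtc (g w)) (fun w => g1 w * (2 * sqrtc (g w))^-1) z.
Proof.
move=> hg s0; pose s w : C := sqrtc (g w); rewrite -/(s z) in s0.
have sq w : s w * s w = g w by rewrite -expr2; exact: sqr_sqrtc.
have lb w : Re (s z) <= cmod (s w + s z).
  apply: le_trans (Re_le_cmod _); rewrite ReD (le_trans _ (ler_norm _)) // lerDr; exact: Re_sqrtc_ge0.
have ne w : s w + s z != 0 by rewrite -cmod_gt0; exact: lt_le_trans (lb w).
have E w : s w - s z = (g w - g z) * (s w + s z)^-1 by rewrite -!sq; field.
have cs : rcont id s z.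
  move=> e e0; have e1 : 0 < e * Re (s z) by rewrite mulr_gt0.
  have [r r0 hr] := holo_rcont hg e1; exists r => // w /hr h.
  rewrite E cmodM cmodV ler_pdivrMr ?cmod_gt0 // (le_trans h) // ler_pM2l //.
have two0 : (2 : C) != 0 by rewrite -CofR_nat CofR_eq0 pnatr_eq0.
have sz : 2 * s z != 0.
  rewrite mulf_neq0 // -cmod_gt0; apply: lt_le_trans s0 _; exact: le_trans (ler_norm _) (Re_le_cmod _).
have ck : rcont id (fun w => (s w + s z)^-1) z.
  apply: (@rcont_comp R C id (fun w => s w + s z) (fun w => w^-1)); first exact: rderiv_cont (rderiv_inv (ne z)).
  by apply: rcont_add; [exact: cs|exact: rcont_cst].
split.
  have [L L0 hL] := rderiv_lip hg.1.
  move=> e e0; have m0 : 0 < cmod (g1 z) + 1 by rewrite ltr_wpDl ?cmod_ge0.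
  have k0 : 0 < cmod ((s z + s z)^-1) + 1 by rewrite ltr_wpDl ?cmod_ge0.
  have ea : 0 < e / 2 / (cmod (g1 z) + 1) by rewrite !divr_gt0.
  have eb : 0 < e / 2 / (cmod ((s z + s z)^-1) + 1) by rewrite !divr_gt0.
  have [r1 r10 h1] := ck _ ea; have [r2 r20 h2] := hg.1 _ eb.
  exists (Num.min L (Num.min r1 r2)) => [|w]; first by rewrite !lt_min L0 r10.
  rewrite !lt_min => /andP[wL /andP[w1 w2]].
  have {}hL := hL w wL; have {}h1 := h1 w w1; have {}h2 := h2 w w2.
  have -> : sqrtc (g w) - sqrtc (g z) - g1 z / (2 * sqrtc (g z)) * (id w - id z) =
    (g w - g z) * ((s w + s z)^-1 - (s z + s z)^-1) + (g w - g z - g1 z * (id w - id z)) * (s z + s z)^-1.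
    rewrite -/(s w) -/(s z) E; have -> : s z + s z = 2 * s z by ring.
    move: ((s w + s z)^-1) ((2 * s z)^-1) (g w) (g z) (g1 z) (id w) (id z) => A B G G0 D v v0; ring.
  apply: le_trans (cmodD _ _) _; rewrite cmodM [cmod ((g w - g z - _) * _)]cmodM.
  have q1 := ler_pM (cmod_ge0 _) (cmod_ge0 _) hL h1.
  have q2 : cmod (g w - g z - g1 z * (id w - id z)) * cmod ((s z + s z)^-1) <= e / 2 * cmod (id w - id z).
    have l1 : cmod ((s z + s z)^-1) <= cmod ((s z + s z)^-1) + 1 by rewrite lerDl.
    apply: le_trans (ler_pM (cmod_ge0 _) (cmod_ge0 _) h2 l1) _.
    by apply: eq_leR; field; exact: lt0r_neq0.
  have q3 : (cmod (g1 z) + 1) * cmod (id w - id z) * (e / 2 / (cmod (g1 z) + 1)) = e / 2 * cmod (id w - id z).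
    by field; exact: lt0r_neq0.
  rewrite q3 in q1; lra.
apply: rcont_mul; first exact: hg.2.
apply: (@rcont_comp R C id (fun w => 2 * s w) (fun w => w^-1)); first exact: rderiv_cont (rderiv_inv sz).
by apply: rcont_mul; [exact: rcont_cst|exact: cs].
Qed.

Definition root1e w : C := sqrtc (1 + cexp w).

Lemma root1e_sqr w : root1e w * root1e w = 1 + cexp w.
Proof. by rewrite -expr2; exact: sqr_sqrtc. Qed.

Lemma root1e_Re w : `|Im w| < pi -> 0 < Re (root1e w).
Proof.
move=> wp; apply: Re_sqrtc_gt0; set z := 1 + cexp w.
have [zp|zn] := ltP 0 (Re z); first by rewrite ltr_wpDl ?cmod_ge0.
have c1 : -1 < cos (Im w).
  rewrite -cos_norm -cospi ltr_cos // ?in_itv/= ?pi_ge0 ?lexx ?normr_ge0 //= ltW //.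
have I0 : Im z != 0.
  apply/eqP => i0; move: i0 zn; rewrite /z ImD Im1 add0r ReD Re1 Im_cexp Re_cexp => /eqP.
  rewrite mulf_eq0 gt_eqF ?expR_gt0 //= => /eqP s0; have := cos2Dsin2 (Im w); rewrite s0 expr0n /= addr0 => c2.
  have c0 : 0 < cos (Im w).
    rewrite ltNge; apply/negP => c0; have : (1 + cos (Im w)) * (1 - cos (Im w)) = 0 by (have -> : (1 + cos (Im w)) * (1 - cos (Im w)) = 1 - cos (Im w) ^+ 2 by ring); rewrite c2 subrr.
    by move/eqP; rewrite mulf_eq0 => /orP[] /eqP; lra.
  have := mulr_gt0 (expR_gt0 (Re w)) c0; lra.
have : Re z ^+ 2 < cmod z ^+ 2 by rewrite cmod_sqr ltrDl lt0r sqr_ge0 sqrf_eq0 I0.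
rewrite -[Re z ^+ 2]sqrrN ltr_sqr ?nnegrE ?cmod_ge0 ?oppr_ge0 //; lra.
Qed.

Lemma root1e_neq0 w : `|Im w| < pi -> root1e w != 0.
Proof. by move=> /root1e_Re h; rewrite -cmod_gt0; apply: lt_le_trans h _; exact: le_trans (ler_norm _) (Re_le_cmod _). Qed.

Lemma root1e_lb (t0 : R) : 0 <= t0 < pi -> exists2 s : R, 0 < s & forall w, `|Im w| <= t0 -> s <= cmod (root1e w).
Proof.
move=> t0p; have [s s0 hs] := one_plus_cexp_ge t0p; exists (Num.sqrt s); first by rewrite sqrtr_gt0.
move=> w /hs h; rewrite -ler_sqr ?nnegrE ?sqrtr_ge0 ?cmod_ge0 // sqr_sqrtr ?(ltW s0) // expr2 -cmodM root1e_sqr.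
by apply: le_trans h; rewrite ler_peMr ?(ltW s0) // lerDl expR_ge0.
Qed.

(** (1 / s - 1) = - e^w / (s (1 + s)) for the square root s, whose real part
    is positive. *)
Lemma root1e_sub1 w : `|Im w| < pi -> cmod ((root1e w)^-1 - 1) <= (cmod (root1e w))^-1 * expR (Re w).
Proof.
move=> wp; have n0 := root1e_neq0 wp; have r0 := root1e_Re wp.
have l1 : 1 <= cmod (1 + root1e w).
  apply: le_trans (Re_le_cmod _); rewrite ReD Re1 (le_trans _ (ler_norm _)) // lerDl ltW //.
have n1 : 1 + root1e w != 0 by rewrite -cmod_gt0; apply: lt_le_trans l1.
have -> : (root1e w)^-1 - 1 = - ((root1e w)^-1 * cexp w * (1 + root1e w)^-1).
  have -> : cexp w = root1e w * root1e w - 1 by rewrite root1e_sqr addrAC subrr add0r.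
  by field; rewrite n0 n1.
rewrite cmodN !cmodM !cmodV cmod_cexp ler_piMr ?mulr_ge0 ?invr_ge0 ?cmod_ge0 ?expR_ge0 //.
by rewrite invf_le1 // cmod_gt0.
Qed.

Lemma holo_root1e w : `|Im w| < pi -> holo_at root1e (fun w => cexp w / (2 * root1e w)) w.
Proof.
move=> wp; have h := holo_add (holo_cst 1 w) (holo_cexp (holo_id w)).
have := @holo_sqrtc (fun w => 1 + cexp w) _ w h (root1e_Re wp).
by move=> h'; apply: (holo_eq h') => v; rewrite add0r mulr1.
Qed.

Lemma root1e_real (u : R) : (root1e (CofR u))^-1 = cexp (- (1 / 2) * CofR (ln1e u)).
Proof.
rewrite /root1e cexp_CofR -CofR1 -CofRD sqrtc_CofR ?(ltW (one_expR_gt0 u)) //.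
have -> : Num.sqrt (1 + expR u) = expR (ln1e u / 2).
  rewrite -expR_ln1e; have -> : expR (ln1e u) = expR (ln1e u / 2) ^+ 2 by rewrite -expRM_natl; congr expR; field.
  by rewrite sqrtr_sqr ger0_norm // expR_ge0.
rewrite -CofRV -expRN -cexp_CofR; congr cexp; rewrite CofRN CofRM CofRV CofR_nat; ring.
Qed.

End SquareRoot.

(** * The Tricomi function of the Hankel function of order zero *)

Section BesselWitness.
Context {R : realType}.
Local Notation C := (Cplx R).
Local Notation mu := (@lebesgue_measure R).
Implicit Types (w z : C) (t u x : R).

Definition bkern z w : C := cexp (- cexp w - cexp (2 * z - w)).
Definition bA z : C := cintegral `]0, +oo[ (fun u => bkern z (CofR u)).
Definition bB z : C := cintegral `[0, 1] (fun y => bkern z (CofR y * z)).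
(** K_0(2 e^z), arranged so as to be entire in z. For real z = x it is the
    integral over ]x, +oo[ of exp (- e^v - e^(2 x - v)), half of the integral
    over the line by symmetry. The part between 0 and x is subtracted from the
    integral over ]0, +oo[, and rescaled to [0, 1]. *)
Definition bK z : C := bA z - z * bB z.

Let Re2 w : Re (2 * w) = 2 * Re w.
Proof. by rewrite -CofR_nat ReM Re_CofR Im_CofR mul0r subr0. Qed.

Lemma rcont_line_comp (f : C -> C) (g : R -> C) t : rcont id f (g t) -> rcont CofR g t -> rcont CofR (fun u => f (g u)) t.
Proof. by move=> hf hg; apply: (@rcont_comp R R CofR g f). Qed.

Lemma holo_bkern_w z w : holo_at (bkern z) (fun w => bkern z w * (- cexp w + cexp (2 * z - w))) w.
Proof.
have h1 := holo_opp (holo_cexp (holo_id w)).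
have h2 := holo_cexp (holo_sub (holo_cst (2 * z) w) (holo_id w)).
by apply: (holo_eq (holo_cexp (holo_sub h1 h2))) => v; rewrite /bkern; ring.
Qed.

Lemma bA_holo : exists f1, forall z0, holo_at bA f1 z0.
Proof.
pose f z u := bkern z (CofR u); pose f1 z u := bkern z (CofR u) * (- (2 * cexp (2 * z - CofR u))).
exists (fun z => cintegral `]0, +oo[ (f1 z)) => z0.
have mD : measurable (`]0, +oo[%classic : set (measurableTypeR R)) by exact: measurable_itv.
apply: (@param_holo R `]0, +oo[ f f1 (fun u => expR (expR (2 * (Re z0 + 7))) * expabs 1 u) z0 1 mD ltr01).
- move=> u _ w _; have h := holo_cexp (holo_sub (holo_cst (- cexp (CofR u)) w) (holo_cexp (holo_sub (holo_scale 2 (holo_id w)) (holo_cst (CofR u) w)))).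
  by apply: (holo_eq h) => v; rewrite /f1 /bkern; ring.
- move=> w _; apply: cmeas_rcont => // t; apply: rcont_line_comp; last exact: rcont_id.
  exact: holo_rcont (holo_bkern_w w _).
- move=> w _; apply: cmeas_rcont => // t.
  apply: (@rcont_line_comp (fun v => bkern w v * (- (2 * cexp (2 * w - v)))) (fun u => CofR u)); last exact: rcont_id.
  have h := holo_opp (holo_scale 2 (holo_cexp (holo_sub (holo_cst (2 * w) (CofR t)) (holo_id (CofR t))))).
  exact: holo_rcont (holo_mul (holo_bkern_w w _) h).
- by apply: integrable_scale => //; apply: integrableS (integrable_expabs ltr01) => //.
- move=> u; rewrite /= in_itv/= andbT => u0 w; rewrite mulr1 => wz.
  rewrite cmod_cexp /expabs -expRD ler_expR ReD !ReN cexp_CofR Re_CofR mul1r (gtr0_norm u0).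
  have h1 := expR_ge1Dx u; have h2 := Re_le_cmod (cexp (2 * w - CofR u)).
  rewrite cmod_cexp ReD ReN Re2 Re_CofR ler_norml in h2; case/andP: h2 => h2 _.
  have : Re w <= Re z0 + 7 by have := Re_le_cmod (w - z0); rewrite ReD ReN ler_norml; lra.
  move=> wl; have : expR (2 * Re w - u) <= expR (2 * (Re z0 + 7)) by rewrite ler_expR; lra.
  lra.
Qed.

Lemma bB_holo : exists f1, forall z0, holo_at bB f1 z0.
Proof.
pose f z y := bkern z (CofR y * z).
pose f1 z y := bkern z (CofR y * z) * (- (cexp (CofR y * z) * CofR y) - cexp (2 * z - CofR y * z) * (2 - CofR y)).
exists (fun z => cintegral `[0, 1] (f1 z)) => z0.
have mD : measurable (`[0, 1]%classic : set (measurableTypeR R)) by exact: measurable_itv.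
have cyz (w : C) t : rcont CofR (fun y => CofR y * w) t by apply: rcont_mul; [exact: rcont_id|exact: rcont_cst].
pose M := expR (expR (cmod z0 + 7) + expR (2 * (cmod z0 + 7))).
apply: (@param_holo R `[0, 1] f f1 (fun=> M) z0 1 mD ltr01).
- move=> y _ w _; have hy := holo_scale (CofR y) (holo_id w).
  have h := holo_cexp (holo_sub (holo_opp (holo_cexp hy)) (holo_cexp (holo_sub (holo_scale 2 (holo_id w)) hy))).
  by apply: (holo_eq h) => v; rewrite /f1 /bkern; ring.
- move=> w _; apply: cmeas_rcont => // t; apply: rcont_line_comp; last exact: cyz.
  exact: holo_rcont (holo_bkern_w w _).
- move=> w _; apply: cmeas_rcont => // t; apply: rcont_mul.
    apply: rcont_line_comp; last exact: cyz.
    exact: holo_rcont (holo_bkern_w w _).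
  apply: rcont_sub.
    have := rcont_mul (rcont_cst CofR (-1) t) (rcont_mul (rcont_line_comp (rcont_cexp _) (cyz w t)) (rcont_id CofR t)).
    by congr rcont; apply/funext => y; rewrite mulN1r.
  apply: rcont_mul; last by apply: rcont_sub; [exact: rcont_cst|exact: rcont_id].
  apply: (rcont_line_comp (rcont_cexp _)).
  by apply: rcont_sub; [exact: rcont_cst|exact: cyz].
- by apply: continuous_compact_integrable; [exact: segment_compact|apply: continuous_subspaceT => ?; exact: cvg_cst].
- move=> y; rewrite /= in_itv/= => /andP[y0 y1] w; rewrite mulr1 => wz.
  rewrite cmod_cexp /M ler_expR ReD !ReN.
  have cw : cmod w <= cmod z0 + 7 by have := cmodD (w - z0) z0; rewrite subrK; lra.
  have rw : `|Re w| <= cmod z0 + 7 := le_trans (Re_le_cmod w) cw.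
  rewrite ler_norml in rw; case/andP: rw => rw1 rw2.
  have c0 : 0 <= cmod z0 + 7 by rewrite addr_ge0 ?cmod_ge0.
  have h1 := Re_le_cmod (cexp (CofR y * w)); have h2 := Re_le_cmod (cexp (2 * w - CofR y * w)).
  rewrite cmod_cexp ReM Re_CofR Im_CofR mul0r subr0 ler_norml in h1; case/andP: h1 => h1 _.
  rewrite cmod_cexp ReD ReN Re2 ReM Re_CofR Im_CofR mul0r subr0 ler_norml in h2; case/andP: h2 => h2 _.
  have q1 : expR (y * Re w) <= expR (cmod z0 + 7) by rewrite ler_expR; nra.
  have q2 : expR (2 * Re w - y * Re w) <= expR (2 * (cmod z0 + 7)) by rewrite ler_expR; nra.
  lra.
Qed.

Let e x v : R := expR (- expR v - expR (2 * x - v)).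

Lemma bkern_real x v : bkern (CofR x) (CofR v) = CofR (e x v).
Proof.
rewrite /bkern /e -cexp_CofR; congr cexp.
by rewrite CofRB CofRN cexp_CofR -cexp_CofR; congr (_ - _); rewrite -cexp_CofR CofRB CofRM CofR_nat.
Qed.

Lemma bkern_derive x (v : R) : exists d : R, is_derive v 1 (e x) d.
Proof.
have h1 : is_derive v 1 (fun v => - expR v) (- expR v) := is_deriveN (is_derive_expR v).
have h2 : is_derive v 1 (fun v => 2 * x - v) (0 - 1) := is_deriveB (is_derive_cst (2 * x) v (1 : R)) (is_derive_id v (1 : R)).
have h3 := is_derive_expR_comp h2.
have h4 := is_derive_expR_comp (is_deriveB h1 h3).
by eexists; exact: h4.
Qed.

Lemma continuous_e x : continuous (e x).
Proof.
apply: rcont_continuous => v; have [d hd] := bkern_derive x v; exact: rderiv_cont (is_derive_rderiv hd).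
Qed.

Lemma e_integrable x : mu.-integrable `]0, +oo[ (EFin \o e x).
Proof.
apply: (@integrable_le R `]0, +oo[ (expabs 1)).
- exact: measurable_itv.
- by apply: measurable_funS (continuous_measurable_fun (@continuous_e x)) => //.
- by apply: integrableS (integrable_expabs ltr01) => //.
- move=> u; rewrite /= in_itv/= andbT => u0; rewrite ger0_norm ?expR_ge0 // /expabs ler_expR mul1r gtr0_norm //.
  have := expR_ge1Dx u; have := expR_ge0 (2 * x - u); lra.
Qed.

Lemma cintegral_CofR (D : set R) (f : R -> R) : cintegral D (fun u => CofR (f u)) = CofR (\int[mu]_(u in D) f u).
Proof.
apply: cplx_ext; rewrite ?Re_cintegral ?Im_cintegral ?Re_CofR ?Im_CofR; first by apply: eq_Rintegral => u _; rewrite Re_CofR.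
by rewrite /Rintegral integral0_eq // => u _; rewrite Im_CofR.
Qed.

Lemma bK_real x : 0 < x -> bK (CofR x) = cintegral `]x, +oo[ (fun v => CofR (e x v)).
Proof.
move=> x0; have ie := e_integrable x; rewrite /bK.
have -> : bA (CofR x) = CofR (\int[mu]_(v in `]0, +oo[) e x v).
  by rewrite -cintegral_CofR; apply: eq_cintegral => u _; rewrite bkern_real.
have -> : bB (CofR x) = CofR (\int[mu]_(y in `[0, 1]) e x (y * x)).
  by rewrite -cintegral_CofR; apply: eq_cintegral => u _; rewrite -CofRM bkern_real.
rewrite cintegral_CofR -CofRM -CofRB; congr CofR.
have := @Rintegral_itvB R (e x) (BRight 0) (BInfty R false) x ie.
rewrite /= bnd_simp => /(_ (ltW x0) isT) <-; congr (_ - _).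
have iex : mu.-integrable `]0, x] (EFin \o e x).
  by apply: integrableS ie => //; apply: subset_itvl.
rewrite Rintegral_itv_obnd_cbnd //.
have dF (y : R) : is_derive y 1 (fun y => x * y) x by exact: is_derive_mull.
have F1 : (fun y => x * y)^`()%classic = (fun=> x) by apply/funext => y; rewrite derive1E; have [_ ->] := dF y.
have cF : continuous (fun y : R => x * y) by apply: is_derive_continuous dF.
have := @integration_by_substitution_increasing R (fun y => x * y) (e x) 0 1 ler01.
rewrite F1 mulr0 mulr1 => h.
have iy : mu.-integrable `[0, 1] (EFin \o (fun y => e x (y * x))).
  apply: continuous_compact_integrable; first exact: segment_compact.
  apply: continuous_subspaceT; apply: rcont_continuous => y; have [d hd] := bkern_derive x (y * x).
  have dF' : is_derive y 1 (fun y => y * x) x by have := dF y; congr is_derive; apply/funext => z; rewrite mulrC.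
  exact: rderiv_cont (is_derive_rderiv (@is_derive1_comp R (e x) (fun y => y * x) y _ _ hd dF')).
rewrite -RintegralZl // /Rintegral h.
- by congr fine; apply: eq_integral => y _ /=; rewrite mulrC [y * x]mulrC.
- by move=> y y' _ _ yy; rewrite ltr_pM2l.
- by move=> y _; exact: cvg_cst.
- by apply: cvgP; exact: cvg_cst.
- by apply: cvgP; exact: cvg_cst.
- split; first by move=> y _; have [] := dF y.
  + by apply: cvg_at_right_filter; exact: cF.
  + by apply: cvg_at_left_filter; exact: cF.
- by apply: continuous_subspaceT; exact: continuous_e.
Qed.


(** The substitution e^u = sinh^2 ((v - x) / 2). *)
Let q u : R := expR (ln1e u / 2).
Let s u : R := expR (u / 2).
Let phi x u : R := x + 2 * ln (s u + q u).
Let phi1 u : R := expR (u / 2 - ln1e u / 2).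

Let q2 u : q u * q u = 1 + expR u.
Proof. by rewrite /q -expRD -expR_ln1e; congr expR; field. Qed.
Let s2 u : s u * s u = expR u.
Proof. by rewrite /s -expRD; congr expR; field. Qed.
Let s0 u : 0 < s u. Proof. exact: expR_gt0. Qed.
Let q0 u : 0 < q u. Proof. exact: expR_gt0. Qed.
Let q1 u : 1 <= q u.
Proof. by rewrite /q -[leLHS]expR0 ler_expR divr_ge0 // ln1e_ge0. Qed.
Let sq0 u : 0 < s u + q u. Proof. by rewrite addr_gt0. Qed.

Let is_derive_half (f : R -> R) (u d : R) : is_derive u 1 f d -> is_derive u 1 (fun u => f u / 2) (d / 2).
Proof.
move=> h; have h2 := is_deriveZ (2^-1) h.
have -> : (fun u => f u / 2) = (2^-1 : R) \*: f by apply/funext => v /=; rewrite mulrC.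
by apply: (is_derive_eq h2); rewrite /GRing.scale /= mulrC.
Qed.

Let dphi x (u : R) : is_derive u 1 (phi x) (phi1 u).
Proof.
have ds := is_derive_expR_comp (is_derive_half (is_derive_id u (1 : R))).
have dq := is_derive_expR_comp (is_derive_half (is_derive_ln1e u)).
have dsq : is_derive u 1 (fun u => s u + q u) _ := is_deriveD ds dq.
have dl := @is_derive1_comp R (@ln R) (fun u => s u + q u) u _ _ (is_derive1_ln (sq0 u)) dsq.
have h := is_deriveD (is_derive_cst x u (1 : R)) (is_deriveZ (2 : R) dl).
apply: (is_derive_eq h); rewrite add0r /GRing.scale /= -/(s u) -/(q u).
have -> : phi1 u = s u / q u by rewrite /phi1 expRD expRN.
rewrite -q2 -s2; have := sq0 u; have := q0 u; move: (s u) (q u) => S Q Q0 SQ0.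
by field; rewrite !gt_eqF.
Qed.

Let cphi1 : continuous phi1.
Proof.
have h (u : R) : is_derive u 1 phi1 (phi1 u * (1 / 2 - expR u / (1 + expR u) / 2)).
  exact: is_derive_expR_comp (is_deriveB (is_derive_half (is_derive_id u (1 : R))) (is_derive_half (is_derive_ln1e u))).
exact: is_derive_continuous h.
Qed.

Let Ephi x : `]x, +oo[%classic = \bigcup_n `[phi x (- n%:R), phi x n%:R]%classic.
Proof.
have phix u : x < phi x u.
  rewrite /phi ltrDl mulr_gt0 // ln_gt0 //; have := s0 u; have := q1 u; lra.
apply/seteqP; split => v /=; rewrite in_itv/= ?andbT; last first.
  by move=> [n _ /=]; rewrite in_itv/= => /andP[h _]; apply: lt_le_trans h.
move=> xv; have [n _ hn] := nat_gt (`|v - x| + 8 / (v - x)); have {hn} := hn n (leqnn n) => hn.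
have vx0 : 0 < v - x by rewrite subr_gt0.
have e0 : 0 <= 8 / (v - x) by rewrite divr_ge0 // ltW.
have n0 : 0 <= n%:R :> R by [].
exists n => //=; rewrite in_itv/=; apply/andP; split.
  have l1 : ln (s (- n%:R) + q (- n%:R)) <= 2 * s (- n%:R).
    have sn0 := s0 (- n%:R); have qn : q (- n%:R) <= 1 + s (- n%:R).
      rewrite -ler_sqr ?nnegrE ?(ltW (q0 _)) //; last by rewrite addr_ge0 // ltW.
      rewrite expr2 q2 -s2 expr2; nra.
    apply: (@le_trans _ _ (ln (1 + 2 * s (- n%:R)))); last by rewrite le_ln1Dx //; lra.
    by rewrite ler_ln ?posrE //; [lra|lra].
  have l2 : s (- n%:R) * (v - x) <= (v - x) * (v - x) / 4.
    have : s (- n%:R) <= (v - x) / 4.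
      rewrite /s mulNr expRN; have h1 := expR_ge1Dx (n%:R / 2 : R).
      have h2 : 8 / (v - x) <= n%:R by have := normr_ge0 (v - x); lra.
      rewrite ler_pdivrMr // in h2.
      rewrite -[leRHS]invrK lef_pV2 ?posrE ?expR_gt0 ?invr_gt0 ?divr_gt0 //.
      rewrite invf_div ler_pdivrMr //; nra.
    by move=> h; rewrite mulrC -mulrA ler_pM2l.
  rewrite /phi -lerBrDl.
  have : s (- n%:R) <= (v - x) / 4 by rewrite -(ler_pM2r vx0); lra.
  lra.
have l1 : n%:R / 2 <= ln (s n%:R + q n%:R).
  by rewrite -[leLHS]expRK ler_ln ?posrE ?expR_gt0 // -/(s _) lerDl ltW.
rewrite /phi -lerBlDl; have := ler_norm (v - x); lra.
Qed.

Lemma bessel_tint t : ln 4 < t ->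
  cexp (cexp (CofR t) / 2) * bK (CofR (t - ln 4)) = tint (1 / 2) (- (1 / 2)) (cexp (CofR t)).
Proof.
move=> t4; have x0 : 0 < t - ln 4 by rewrite subr_gt0.
set x := t - ln 4 in x0 *; have ex : expR x = expR t / 4 by rewrite /x expRD expRN lnK // posrE.
rewrite bK_real //.
have half : (1 / 2 : C) = CofR (1 / 2) := CofR_half.
have E u : CofR (e x (phi x u)) * CofR (phi1 u) = cexp (- (cexp (CofR t) / 2)) * tker (1 / 2) (- (1 / 2)) (cexp (CofR t)) u.
  have r1 : expR (phi x u) = expR x * ((s u + q u) * (s u + q u)).
    have -> : phi x u = x + (ln (s u + q u) + ln (s u + q u)) by rewrite /phi; ring.
    by rewrite !expRD lnK ?posrE.
  have r2 : expR (2 * x - phi x u) = expR x * ((q u - s u) * (q u - s u)).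
    have -> : 2 * x - phi x u = x - (ln (s u + q u) + ln (s u + q u)) by rewrite /phi; ring.
    rewrite expRD expRN expRD lnK ?posrE //; congr (_ * _).
    have d : (q u - s u) * (s u + q u) = 1 by rewrite -[RHS](addrK (expR u)) -q2 -s2; ring.
    have n0 : s u + q u != 0 by rewrite gt_eqF.
    have -> : q u - s u = (s u + q u)^-1 by apply: (mulIf n0); rewrite d mulVf.
    by rewrite invfM.
  have -> : e x (phi x u) = expR (- (expR t / 2) - expR t * expR u).
    rewrite /e r1 r2 ex; congr expR; rewrite -(s2 u).
    have : q u * q u = 1 + s u * s u by rewrite q2 s2.
    move: (q u) (s u) (expR t) => Q S T QS; have -> : - (T / 4 * ((S + Q) * (S + Q))) - T / 4 * ((Q - S) * (Q - S)) = - (T / 2 * (Q * Q + S * S)) by field.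
    by rewrite QS; field.
  rewrite /phi1 -CofRM -expRD -cexp_CofR /tker -cexpD; congr cexp.
  by rewrite !cexp_CofR !(CofRD, CofRB, CofRN, CofRM, CofRV, CofR_nat); ring.
have ti : cintegrable setT (tker (1 / 2) (- (1 / 2)) (cexp (CofR t))).
  have g1 : 0 < Re (1 / 2 : C) by rewrite CofR_half Re_CofR; lra.
  have g2 : Re (- (1 / 2) : C) <= 0 by rewrite ReN CofR_half Re_CofR; lra.
  by apply: tker_integrable; rewrite // cexp_CofR Re_CofR expR_gt0.
have [||i1 eq1] := @substitution_C R (phi x) phi1 _ (dphi x) cphi1 (fun u => expR_gt0 _) (Ephi x) (fun v => CofR (e x v)).
- by move=> v _; have [d hd] := bkern_derive x v; exact: rderiv_cont (is_derive_rderiv hd).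
- by apply: (eq_cintegrable measurableT _ (cintegrable_scale _ measurableT ti)) => u _; rewrite E.
rewrite eq1 (eq_cintegral (fun u _ => E u)) (cintegral_scale _ measurableT ti) mulrA -cexpD subrr cexp0 mul1r.
by [].
Qed.


(** The confluent integral on the contour w = u - 2 zeta / 3, which keeps both
    e^(zeta + w) in the right half-plane and 1 + e^w off the negative axis
    for |arg z| < 3 pi / 2. *)
Let tilted z u : C := CofR u - CofR (2 / 3) * z.
Definition vker z u : C := cexp (1 / 2 * tilted z u - cexp (z + tilted z u)) * (root1e (tilted z u))^-1.

Let Im_tilted z u : Im (tilted z u) = - (2 / 3 * Im z).
Proof. by rewrite /tilted ImD ImN ImM !Im_CofR Re_CofR mul0r addr0 add0r. Qed.
Let Re_tilted z u : Re (tilted z u) = u - 2 / 3 * Re z.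
Proof. by rewrite /tilted ReD ReN ReM !Re_CofR Im_CofR mul0r subr0. Qed.

Let tilted_pi z u : `|Im z| < 3 / 2 * pi -> `|Im (tilted z u)| < pi.
Proof. by rewrite Im_tilted !ltr_norml; lra. Qed.

Let vker1 z u : C := vker z u * (- (1 / 3)
  - cexp (z + tilted z u) / 3 + 1 / 3 * (cexp (tilted z u) * (1 + cexp (tilted z u))^-1)).

Lemma holo_vker u z : `|Im z| < 3 / 2 * pi -> holo_at (vker ^~ u) (vker1 ^~ u) z.
Proof.
move=> zt; have tp := tilted_pi u zt.
have ht : holo_at (tilted ^~ u) _ z := holo_sub (holo_cst (CofR u) z) (holo_scale (CofR (2 / 3)) (holo_id z)).
have h1 := holo_cexp (holo_sub (holo_scale (1 / 2) ht) (holo_cexp (holo_add (holo_id z) ht))).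
have h2 := @holo_inv R (fun z => root1e (tilted z u)) _ z (root1e_neq0 tp) (@holo_comp R (tilted ^~ u) _ root1e _ z (holo_root1e tp) ht).
have [d c] := holo_mul h1 h2.
have E w : `|Im w| < 3 / 2 * pi -> vker1 w u =
  cexp (1 / 2 * tilted w u - cexp (w + tilted w u)) * (1 / 2 * (0 - CofR (2 / 3) * 1) - cexp (w + tilted w u) * (1 + (0 - CofR (2 / 3) * 1))) * (root1e (tilted w u))^-1 +
  cexp (1 / 2 * tilted w u - cexp (w + tilted w u)) * (- (cexp (tilted w u) / (2 * root1e (tilted w u)) * (0 - CofR (2 / 3) * 1)) * (root1e (tilted w u))^-1 * (root1e (tilted w u))^-1).
  move=> wt; have r0 := root1e_neq0 (tilted_pi u wt).
  rewrite /vker1 /vker -root1e_sqr CofRM CofRV !CofR_nat.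
  move: (cexp (w + tilted w u)) (cexp (tilted w u)) (root1e (tilted w u)) (cexp (_ - _)) r0 => Y Z S X S0.
  by field.
split; first by rewrite E.
move=> e0 e00; have [r r0 hr] := c e0 e00.
exists (Num.min r (3 / 2 * pi - `|Im z|)); first by rewrite lt_min r0 subr_gt0.
move=> w; rewrite lt_min => /andP[wr wz].
have wt : `|Im w| < 3 / 2 * pi.
  have := Im_le_cmod (w - z); rewrite ImD ImN; have := ler_normD (Im w - Im z) (Im z); rewrite subrK.
  by move: wz; rewrite /=; lra.
by rewrite !E //; exact: hr.
Qed.

Lemma vker_le (tau rho : R) : 0 <= tau < 3 / 2 * pi -> exists2 K : R, 0 <= K &
  forall z u, `|Im z| <= tau -> `|Re z| <= rho -> cmod (vker z u) <= K * expabs (1 / 2) u.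
Proof.
move=> /andP[t0 tp]; have p0 := @pi_gt0 R.
have [|sg sg0 hs] := @root1e_lb R (2 / 3 * tau); first by apply/andP; split; lra.
have c0 : 0 < cos (tau / 3) by apply: cos_gt0_pihalf; apply/andP; split; lra.
pose d := cos (tau / 3) * expR (- rho / 3).
have d0 : 0 < d by rewrite mulr_gt0 ?expR_gt0.
have h0 : (0 : R) < 1 / 2 by lra.
exists (sg^-1 * (expR (rho / 3) * exp_const (1 / 2) d)).
  by rewrite !mulr_ge0 ?invr_ge0 ?expR_ge0 // ltW.
move=> z u zt zr.
have lb : sg <= cmod (root1e (tilted z u)).
  by apply: hs; rewrite Im_tilted normrN normrM ger0_norm // ler_pM2l.
have inv : (cmod (root1e (tilted z u)))^-1 <= sg^-1 by rewrite lef_pV2 ?posrE //; exact: lt_le_trans lb.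
have m : Num.min (1 / 2) 1 = 1 / 2 :> R by rewrite min_l //; lra.
have ub : expR (1 / 2 * u - d * expR u) <= exp_const (1 / 2) d * expabs (1 / 2) u.
  by have := expR_dominated u h0 d0; rewrite m.
suff main : cmod (cexp (1 / 2 * tilted z u - cexp (z + tilted z u))) <= expR (rho / 3) * (exp_const (1 / 2) d * expabs (1 / 2) u).
  have iv0 : 0 <= (cmod (root1e (tilted z u)))^-1 by rewrite invr_ge0 cmod_ge0.
  have := ler_pM (cmod_ge0 _) iv0 main inv; rewrite -cmodV -cmodM /vker => /le_trans; apply.
  by apply: eq_leR; ring.
apply: le_trans (ler_wpM2l (expR_ge0 _) ub).
rewrite -expRD cmod_cexp ler_expR ReD ReN Re_cexp CofR_half ReM Re_CofR Im_CofR mul0r subr0 Re_tilted.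
have -> : Re (z + tilted z u) = u + Re z / 3 by rewrite ReD Re_tilted; field.
have -> : Im (z + tilted z u) = Im z / 3 by rewrite ImD Im_tilted; field.
move: zr; rewrite ler_norml => /andP[r1 r2].
have e1 : d * expR u <= expR (u + Re z / 3) * cos (Im z / 3).
  rewrite /d mulrC expRD -mulrA ler_wpM2l ?expR_ge0 // mulrC ler_pM ?expR_ge0 ?(ltW c0) //.
    by rewrite ler_expR; lra.
  by apply: cos_lb; [rewrite normrM [`|3^-1|]ger0_norm //; lra|lra].
lra.
Qed.

Definition vint z : C := cintegral setT (vker z).

Lemma vint_holo : exists V1, forall z, `|Im z| < 3 / 2 * pi -> holo_at vint V1 z.
Proof.
exists (fun z => cintegral setT (vker1 z)) => z zt; have p0 := @pi_gt0 R.
pose r := (3 / 2 * pi - `|Im z|) / 14; have r0 : 0 < r by rewrite divr_gt0 // subr_gt0.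
have near w : cmod (w - z) < 7 * r -> `|Im w| <= (3 / 2 * pi + `|Im z|) / 2 /\ `|Re w| <= `|Re z| + 7 * r.
  move=> wz; have i1 := Im_le_cmod (w - z); have i2 := Re_le_cmod (w - z).
  rewrite ImD ImN in i1; rewrite ReD ReN in i2.
  have := ler_normD (Im w - Im z) (Im z); have := ler_normD (Re w - Re z) (Re z); rewrite !subrK /r in wz *; lra.
have zz := normr_ge0 (Im z).
have [|K K0 hK] := @vker_le ((3 / 2 * pi + `|Im z|) / 2) (`|Re z| + 7 * r); first by apply/andP; split; lra.
have h0 : (0 : R) < 1 / 2 by lra.
have near' w : cmod (w - z) < 7 * r -> `|Im w| < 3 / 2 * pi by move=> /near[h _]; lra.
have lin w t : rcont CofR (tilted w) t by apply: rcont_sub; [exact: rcont_id|exact: rcont_cst].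
have cv w t : `|Im w| < 3 / 2 * pi -> rcont CofR (vker w) t.
  move=> wt; have tp := tilted_pi t wt; apply: rcont_mul.
    apply: (rcont_line_comp (rcont_cexp _)); apply: rcont_sub; first by apply: rcont_mul; [exact: rcont_cst|exact: lin].
    by apply: (rcont_line_comp (rcont_cexp _)); apply: rcont_add; [exact: rcont_cst|exact: lin].
  apply: (@rcont_line_comp (fun v => (root1e v)^-1) (tilted w)); last exact: lin.
  exact: holo_rcont (@holo_inv R root1e _ _ (root1e_neq0 tp) (holo_root1e tp)).
apply: (@param_holo R setT vker vker1 (fun u => K * expabs (1 / 2) u) z r measurableT r0).
- by move=> u _ w /near' wt; exact: holo_vker.
- by move=> w /near' wt; apply: cmeas_rcont => // t; exact: cv.
- move=> w /near' wt; apply: cmeas_rcont => // t; apply: rcont_mul; first exact: cv.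
  have tp := tilted_pi t wt.
  apply: rcont_add.
    apply: rcont_sub; first exact: rcont_cst.
    apply: rcont_mul; last exact: rcont_cst.
    by apply: (rcont_line_comp (rcont_cexp _)); apply: rcont_add; [exact: rcont_cst|exact: lin].
  apply: rcont_mul; first exact: rcont_cst.
  apply: (@rcont_line_comp (fun v => cexp v * (1 + cexp v)^-1) (tilted w)); last exact: lin.
  have h := holo_add (holo_cst 1 (tilted w t)) (holo_cexp (holo_id (tilted w t))).
  exact: holo_rcont (holo_mul (holo_cexp (holo_id _)) (@holo_inv R (fun v => 1 + cexp v) _ _ (one_plus_cexp_neq0 tp) h)).
- by apply: integrable_scale => //; exact: integrable_expabs.
- by move=> u _ w /near[h1 h2]; exact: hK.
Qed.


Lemma rcont_vker z t : `|Im z| < 3 / 2 * pi -> rcont CofR (vker z) t.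
Proof.
move=> zt; have tp := tilted_pi t zt.
have lin : rcont CofR (tilted z) t by apply: rcont_sub; [exact: rcont_id|exact: rcont_cst].
apply: rcont_mul.
  apply: (rcont_line_comp (rcont_cexp _)); apply: rcont_sub; first by apply: rcont_mul; [exact: rcont_cst|exact: lin].
  by apply: (rcont_line_comp (rcont_cexp _)); apply: rcont_add; [exact: rcont_cst|exact: lin].
apply: (@rcont_line_comp (fun v => (root1e v)^-1) (tilted z)); last exact: lin.
exact: holo_rcont (@holo_inv R root1e _ _ (root1e_neq0 tp) (holo_root1e tp)).
Qed.

Lemma vker_shift z u : vker z (u + 2 / 3 * Re z) =
  cexp (1 / 2 * (CofR u + iC * CofR (- (2 / 3 * Im z))) - cexp (z + (CofR u + iC * CofR (- (2 / 3 * Im z)))))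
  * (root1e (CofR u + iC * CofR (- (2 / 3 * Im z))))^-1.
Proof.
rewrite /vker; suff -> : tilted z (u + 2 / 3 * Re z) = CofR u + iC * CofR (- (2 / 3 * Im z)) by [].
by rewrite /tilted [in X in _ - X](CE z) CofRD CofRN !(CofRM (2 / 3)); ring.
Qed.

Lemma vint_real t : vint (CofR t) = tint (1 / 2) (- (1 / 2)) (cexp (CofR t)).
Proof.
have zt : `|Im (CofR t : C)| < 3 / 2 * pi by rewrite Im_CofR normr0; have := @pi_gt0 R; lra.
have E u : vker (CofR t) (u + 2 / 3 * t) = tker (1 / 2) (- (1 / 2)) (cexp (CofR t)) u.
  have := vker_shift (CofR t) u; rewrite Re_CofR Im_CofR mulr0 oppr0 iC0 => ->.
  rewrite root1e_real -cexpD /tker; congr cexp; rewrite cexpD; ring.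
have ti : cintegrable setT (tker (1 / 2) (- (1 / 2)) (cexp (CofR t))).
  have g1 : 0 < Re (1 / 2 : C) by rewrite CofR_half Re_CofR; lra.
  have g2 : Re (- (1 / 2) : C) <= 0 by rewrite ReN CofR_half Re_CofR; lra.
  by apply: tker_integrable; rewrite // cexp_CofR Re_CofR expR_gt0.
have [||_ eP] := @cintegrable_translate R (vker (CofR t)) (2 / 3 * t).
- by move=> u; exact: rcont_vker.
- by apply: (eq_cintegrable measurableT _ ti) => u _; rewrite E.
by rewrite /vint eP; apply: eq_cintegral => u _; exact: E.
Qed.

(** After a translation by 2 / 3 Re z this is Watson lemma on the line Im w =
    - 2 / 3 Im z. *)
Lemma vint_asymp (d : R) : 0 < d -> exists2 K : R, 0 <= K & forall z, `|Im z| <= 3 / 2 * pi - d ->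
  cmod (vint z * cexp (1 / 2 * z) - Gam (1 / 2)) <= K * expR (- Re z).
Proof.
move=> d0; have p0 := @pi_gt0 R.
have h0 : 0 < Re (1 / 2 : C) by rewrite CofR_half Re_CofR; lra.
have th : pi / 2 - d / 3 < pi / 2 :> R by lra.
have [K K0 hK] := watson h0 ltr01 th.
have [dp|dp] := leP d (3 / 2 * pi); last first.
  by exists 0 => // z zd; have := normr_ge0 (Im z); lra.
have [|sg sg0 hs] := @root1e_lb R (pi - 2 / 3 * d); first by apply/andP; split; lra.
exists (K * sg^-1); first by rewrite mulr_ge0 // invr_ge0 ltW.
move=> z zd; have zt : `|Im z| < 3 / 2 * pi by lra.
pose om := - (2 / 3 * Im z).
pose m u : C := (root1e (CofR u + iC * CofR om))^-1.
have Imw u : Im (CofR u + iC * CofR om : C) = om by rewrite !ReImE !(mul0r, mul1r, add0r).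
have Rew u : Re (CofR u + iC * CofR om : C) = u by rewrite !ReImE !(mul0r, mulr0, subr0, addr0).
have omd : `|om| <= pi - 2 / 3 * d by rewrite /om normrN normrM ger0_norm //; lra.
have omp : `|om| < pi by lra.
have lin t : rcont CofR (fun u => CofR u + iC * CofR om) t by apply: rcont_add; [exact: rcont_id|exact: rcont_cst].
have [|||i1] := hK m sg^-1 om z.
- move=> t; apply: (@rcont_line_comp (fun v => (root1e v)^-1) (fun u => CofR u + iC * CofR om)); last exact: lin.
  have tp : `|Im (CofR t + iC * CofR om : C)| < pi by rewrite Imw.
  exact: holo_rcont (@holo_inv R root1e _ _ (root1e_neq0 tp) (holo_root1e tp)).
- have -> : Im z + om = Im z / 3 by rewrite /om; field.
  rewrite normrM [`|3^-1|]ger0_norm //; lra.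
- move=> u; have tp : `|Im (CofR u + iC * CofR om : C)| < pi by rewrite Imw.
  apply: le_trans (root1e_sub1 tp) _; rewrite Rew mul1r ler_wpM2r ?expR_ge0 //.
  have hh : sg <= cmod (root1e (CofR u + iC * CofR om)) by apply: hs; rewrite Imw.
  by rewrite lef_pV2 ?posrE //; exact: lt_le_trans hh.
have -> : cintegral setT (fun u => cexp (1 / 2 * (CofR u + iC * CofR om) - cexp (z + (CofR u + iC * CofR om))) * m u) = vint z.
  have [||_ eP] := @cintegrable_translate R (vker z) (2 / 3 * Re z).
  - by move=> u; exact: rcont_vker.
  - by apply: (eq_cintegrable measurableT _ i1) => u _; rewrite vker_shift.
  by rewrite /vint eP; apply: eq_cintegral => u _; rewrite vker_shift.
by rewrite [1 * Re z]mul1r.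
Qed.

(** e^(z / 2) K_0(z / 2) as a function of log z, that is sqrt pi U(1/2, 1, z).
    *)
Definition bessel_entire z : C := cexp (cexp z / 2) * bK (z - CofR (ln 4)).

Lemma bessel_entire_holo : exists W1, forall z, holo_at bessel_entire W1 z.
Proof.
have [A1 hA] := bA_holo; have [B1 hB] := bB_holo.
pose K1 z := A1 z - (1 * bB z + z * B1 z).
have hK z : holo_at bK K1 z by exact: holo_sub (hA z) (holo_mul (holo_id z) (hB z)).
exists (fun z => cexp (2^-1 * cexp z) * (2^-1 * (cexp z * 1)) * bK (z - CofR (ln 4)) + cexp (2^-1 * cexp z) * (K1 (z - CofR (ln 4)) * (1 - 0))) => z.
have h1 := holo_cexp (holo_scale (2^-1) (holo_cexp (holo_id z))).
have h2 := @holo_comp R (fun z => z - CofR (ln 4)) _ bK K1 z (hK _) (holo_sub (holo_id z) (holo_cst (CofR (ln 4)) z)).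
by apply: (holo_ext _ (holo_mul h1 h2)) => v; rewrite /bessel_entire mulrC [_ / 2]mulrC mulrC.
Qed.

Lemma bessel_entire_real t : ln 4 < t -> bessel_entire (CofR t) = tint (1 / 2) (- (1 / 2)) (cexp (CofR t)).
Proof. by move=> t4; have := bessel_tint t4; rewrite CofRB. Qed.

Lemma rderiv_CofR_uniq (f : R -> C) t (d d' : C) : rderiv CofR f t d -> rderiv CofR f t d' -> d = d'.
Proof.
move=> h h'; apply: cplx_ext.
  by have [_ <-] := rderiv_Re h; have [_ <-] := rderiv_Re h'.
by have [_ <-] := rderiv_Im h; have [_ <-] := rderiv_Im h'.
Qed.

Lemma rderiv_local (f g : R -> C) t d (x0 : R) : x0 < t -> (forall s, x0 < s -> f s = g s) -> rderiv CofR f t d -> rderiv CofR g t d.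
Proof.
move=> xt fg h e0 e00; have [r r0 hr] := h e0 e00.
exists (Num.min r (t - x0)); first by rewrite lt_min r0 subr_gt0.
move=> y; rewrite lt_min => /andP[yr yt0].
have yt : `|y - t| < t - x0 by rewrite -cmod_CofR CofRB.
have xy : x0 < y by move: yt; rewrite ltr_norml; lra.
by rewrite -(fg y xy) -(fg t xt); exact: hr.
Qed.

(** On the real axis the function is a confluent integral, which gives the
    differential equation there and, by the identity theorem, everywhere. The
    asymptotics hold for vint, with which it agrees on the strip. *)
Lemma tricomi_half : is_tricomi (1 / 2) 1 (fun z => (CofR (Num.sqrt pi))^-1 * bessel_entire z).
Proof.
have [W1 hW] := bessel_entire_holo; have [W2 hW1] := entire_derivative hW; have [W3 hW2] := entire_derivative hW1.
have p0 := @pi_gt0 R; set k := (CofR (Num.sqrt pi))^-1.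
have h0 : 0 < Re (1 / 2 : C) by rewrite CofR_half Re_CofR; lra.
have h0' : Re (- (1 / 2) : C) <= 0 by rewrite ReN CofR_half Re_CofR; lra.
have [F1 [F2 [dF dF1 odeF]]] : exists F1 F2, real_solution (1 / 2) 1 (fun t => tint (1 / 2) (- (1 / 2)) (cexp (CofR t))) F1 F2.
  by apply: tint_solution => //; rewrite CofR1 subrr add0r.
have E0 t : ln 4 < t -> bessel_entire (CofR t) = tint (1 / 2) (- (1 / 2)) (cexp (CofR t)) := @bessel_entire_real t.
have E1 t : ln 4 < t -> W1 (CofR t) = F1 t.
  move=> t4; apply: rderiv_CofR_uniq (dF t).
  by apply: (rderiv_local t4 E0); apply: rderiv_real; exact: (hW _).1.
have E2 t : ln 4 < t -> W2 (CofR t) = F2 t.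
  move=> t4; apply: rderiv_CofR_uniq (dF1 t).
  by apply: (rderiv_local t4 E1); apply: rderiv_real; exact: (hW1 _).1.
have ode z : W2 z + (1 - 1 - cexp z) * W1 z = 1 / 2 * cexp z * bessel_entire z.
  have he := holo_cexp (holo_id z).
  suff : (fun z => W2 z + (1 - 1 - cexp z) * W1 z) = (fun z => 1 / 2 * (cexp z * bessel_entire z)).
    by move/(congr1 (fun f => f z)) => /= ->; rewrite mulrA.
  apply: (@entire_eq R _ (fun z => W3 z + ((0 - 0 - cexp z * 1) * W1 z + (1 - 1 - cexp z) * W2 z)) _
    (fun z => 1 / 2 * (cexp z * 1 * bessel_entire z + cexp z * W1 z)) (ln 4 + 1)).
  - move=> v; have hev := holo_cexp (holo_id v).
    exact: holo_add (hW2 v) (holo_mul (holo_sub (holo_sub (holo_cst 1 v) (holo_cst 1 v)) hev) (hW1 v)).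
  - move=> v; have hev := holo_cexp (holo_id v); exact: (@holo_scale R (1 / 2) (fun w => cexp w * bessel_entire w) _ v (holo_mul hev (hW v))).
  - move=> t t4; have {}t4 : ln 4 < t by lra.
    by rewrite E0 // E1 // E2 // -CofR1 (odeF t) CofR1 mulrA.
apply: (@is_tricomiI R (1 / 2) 1 _ (fun z => k * W1 z) (fun z => k * W2 z)).
- by move=> z; exact: holo_scale.
- by move=> z; exact: holo_scale.
- move=> z; have := ode z; move: (cexp z) (W1 z) (W2 z) (bessel_entire z) => e' w1 w2 w h.
  have -> : 1 / 2 * e' * (k * w) = k * (1 / 2 * e' * w) by ring.
  by rewrite -h; ring.
move=> d d0; have [K K0 hK] := vint_asymp d0.
exists (cmod k * K); first by rewrite mulr_ge0 // cmod_ge0.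
exists 1 => //; exists (ln 4 + 1) => z zr zd.
have [V1 hV] := vint_holo.
have VW : bessel_entire z = vint z.
  apply/eqP; rewrite -subr_eq0; apply/eqP.
  apply: (@identity_strip R (fun z => bessel_entire z - vint z) (fun z => W1 z - V1 z) (3 / 2 * pi) (ln 4 + 1)) => //.
  - by move=> v vt; apply: holo_sub; [exact: hW|exact: hV].
  - by move=> t t4; rewrite E0 ?vint_real ?subrr //; lra.
  - lra.
have k0 : k != 0 by rewrite invr_eq0 CofR_eq0 gt_eqF // sqrtr_gt0.
have -> : k * bessel_entire z * cexp (1 / 2 * z) - 1 = k * (vint z * cexp (1 / 2 * z) - Gam (1 / 2)).
  by rewrite VW Gam_half mulrBr /k mulVf ?mulrA // CofR_eq0 gt_eqF // sqrtr_gt0.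
by have := ler_wpM2l (cmod_ge0 k) (hK z zd); rewrite cmodM [1 * Re z]mul1r mulrA.
Qed.

End BesselWitness.

(** * Fourier inversion *)

Section FourierInversion.
Context {R : realType}.
Local Notation C := (Cplx R).
Local Notation mu := (@lebesgue_measure R).
Local Notation mR := (measurableTypeR R).

(** Abel summation of the Fourier integral gives the Poisson kernel. *)
Lemma poisson_kernel (e x : R) : 0 < e ->
  cintegral setT (fun y => CofR (expabs e y) * cis (y * x)) = CofR (2 * e / (e ^+ 2 + x ^+ 2)).
Proof.
move=> e0.
pose E (d : C) (y : R) : C := cexp (CofR y * d).
have cE d t : rcont CofR (E d) t by exact: rderiv_cont (rderiv_cexp_line d t).
pose dp : C := - CofR e + iC * CofR x. pose dn : C := CofR e + iC * CofR x.
have Rp : Re dp = - e by rewrite !ReImE !(mul0r, mulr0, subr0, addr0).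
have Rn : Re dn = e by rewrite !ReImE !(mul0r, mulr0, subr0, addr0).
have n0 (d : C) : Re d != 0 -> d != 0 by apply: contraNneq => ->; rewrite Re0.
have dp0 : dp != 0 by apply: n0; rewrite Rp oppr_eq0 gt_eqF.
have dn0 : dn != 0 by apply: n0; rewrite Rn gt_eqF.
have ReE d (y : R) : cmod (E d y) = expR (y * Re d).
  by rewrite cmod_cexp ReM Re_CofR Im_CofR mul0r subr0.
have EP y : 0 <= y -> CofR (expabs e y) * cis (y * x) = E dp y.
  move=> y0; rewrite /expabs ger0_norm // -cexp_CofR /cis -cexpD; congr cexp.
  by rewrite /dp CofRN !CofRM; ring.
have EN y : y <= 0 -> CofR (expabs e y) * cis (y * x) = E dn y.
  move=> y0; rewrite /expabs ler0_norm // -cexp_CofR /cis -cexpD; congr cexp.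
  by rewrite /dn CofRN CofRM CofRN CofRM; ring.
have cc t : rcont CofR (fun y => CofR (expabs e y) * cis (y * x)) t.
  apply: rcont_mul.
    by apply: rcontP; [exact: continuous_expabs|exact: cvg_cst].
  have h := rderiv_cont (rderiv_cexp_line (iC * CofR x) t).
  have -> : (fun y => cis (y * x)) = (fun y => cexp (CofR y * (iC * CofR x))) :> (R -> C).
    by apply/funext => y; rewrite /cis; congr cexp; rewrite CofRM; ring.
  exact: h.
have ci : cintegrable setT (fun y => CofR (expabs e y) * cis (y * x)).
  apply: (@cint_expabs R setT 1 e _ measurableT e0); first by apply: cmeas_rcont.
  by move=> y _; rewrite cmodM cmod_cis mulr1 mul1r cmod_CofR ger0_norm ?expabs_ge0.
rewrite (cintegral_split 0 ci).
have dE d t : rderiv CofR (fun s => E d s * d^-1) t (E d t * d * d^-1).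
  by apply: (rderiv_eq (rderiv_mul (rderiv_cexp_line d t) (rderiv_cst CofR d^-1 t))); rewrite mulr0 addr0.
have DE d t : d != 0 -> rderiv CofR (fun s => E d s * d^-1) t (E d t).
  by move=> d0; apply: (rderiv_eq (dE d t)); rewrite mulfK.
have -> : cintegral `]-oo, 0] (fun y => CofR (expabs e y) * cis (y * x)) = dn^-1.
  rewrite (@eq_cintegral _ _ _ (E dn)); last by move=> y; rewrite /= in_itv/= => y0; exact: EN.
  rewrite (@cintegral_FTC_ninfty R (fun y => E dn y * dn^-1) (E dn) 0 (fun t => DE dn t dn0) (cE dn)).
  - by rewrite /E CofR0 mul0r cexp0 mul1r.
  - have h : cintegrable `]-oo, 0] (fun y => CofR (expabs e y) * cis (y * x)) by apply: cintegrableS ci.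
    by apply: (eq_cintegrable (measurable_itv _) _ h) => y; rewrite /= in_itv/= => y0; exact: EN.
  - apply: (@vanish_ninfty_half R _ (cmod dn)^-1 e e0) => t t0.
    by rewrite cmodM cmodV ReE Rn mulrC /expabs ler0_norm // mulrN opprK [t * e]mulrC.
have -> : cintegral `[0, +oo[ (fun y => CofR (expabs e y) * cis (y * x)) = - dp^-1.
  rewrite (@eq_cintegral _ _ _ (E dp)); last by move=> y; rewrite /= in_itv/= andbT => y0; exact: EP.
  rewrite (@cintegral_FTC_pinfty R (fun y => E dp y * dp^-1) (E dp) 0 (fun t => DE dp t dp0) (cE dp)).
  - by rewrite /E CofR0 mul0r cexp0 mul1r.
  - have h : cintegrable `[0, +oo[ (fun y => CofR (expabs e y) * cis (y * x)) by apply: cintegrableS ci.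
    by apply: (eq_cintegrable (measurable_itv _) _ h) => y; rewrite /= in_itv/= andbT => y0; exact: EP.
  - apply: (@vanish_pinfty_half R _ (cmod dp)^-1 e e0) => t t0.
    by rewrite cmodM cmodV ReE Rp mulrC /expabs ger0_norm // mulrN [t * e]mulrC.
have q : CofR e * CofR e + CofR x * CofR x = - (dp * dn).
  rewrite /dp /dn; have -> : - ((- CofR e + iC * CofR x) * (CofR e + iC * CofR x)) = CofR e * CofR e - (iC * iC) * (CofR x * CofR x) :> C by ring.
  by rewrite iC2 mulN1r opprK.
have -> : CofR (2 * e / (e ^+ 2 + x ^+ 2)) = (dn - dp) / (- (dp * dn)).
  rewrite -q CofRM CofRV CofRD !expr2 !CofRM; congr (_ / _).
  by rewrite CofR_nat /dn /dp; ring.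
by field; rewrite dp0 dn0.
Qed.

Lemma cintegral_open (u : R) (f : R -> C) : cintegrable setT f ->
  cintegral `]-oo, u[ f = cintegral `]-oo, u] f /\ cintegral `]u, +oo[ f = cintegral `[u, +oo[ f.
Proof.
move=> [i1 i2].
have s (D : set R) g : measurable (D : set mR) -> mu.-integrable setT (EFin \o g) -> mu.-integrable D (EFin \o g).
  by move=> mD ig; apply: integrableS ig => //.
split; apply: cplx_ext; rewrite ?Re_cintegral ?Im_cintegral.
- by apply: Rintegral_itv_bndo_bndc; apply: s i1; exact: measurable_itv.
- by apply: Rintegral_itv_bndo_bndc; apply: s i2; exact: measurable_itv.
- by apply: Rintegral_itv_obnd_cbnd; apply: s i1; exact: measurable_itv.
- by apply: Rintegral_itv_obnd_cbnd; apply: s i2; exact: measurable_itv.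
Qed.

Lemma atan_scaled_cvg (x : R) : 0 < x -> forall e : R, 0 < e -> \forall n \near \oo, `|atan (x * n.+1%:R) - pi / 2| <= e.
Proof.
move=> x0 e e0; have /cvgrPdist_le /(_ e e0) [B [_ hB]] := @cvgy_atan R.
have [N _ hN] := nat_gt ((`|B| + 1) / x).
exists N => // n /= Nn; have := hN n Nn; rewrite ler_pdivrMr // => h.
rewrite distrC; apply: hB; have := ler_norm B; have : (n%:R : R) <= n.+1%:R by rewrite ler_nat.
nra.
Qed.

Lemma rcont_cis_comp t (f : R -> R) : rcont CofR (fun u => CofR (f u)) t -> rcont CofR (fun u => cis (f u)) t.
Proof.
move=> hf; apply: (rcont_line_comp (rcont_cexp _)); apply: rcont_mul; [exact: rcont_cst|exact: hf].
Qed.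

Lemma cmeas_fst (f : R -> C) : cmeas (setT : set mR) f -> cmeas (setT : set (mR * mR)) (fun xy : mR * mR => f xy.1).
Proof.
by move=> [f1 f2]; split; [exact: (measurableT_comp f1 (@measurable_fst _ _ mR mR))|exact: (measurableT_comp f2 (@measurable_fst _ _ mR mR))].
Qed.

Lemma cmeas_snd (f : R -> C) : cmeas (setT : set mR) f -> cmeas (setT : set (mR * mR)) (fun xy : mR * mR => f xy.2).
Proof.
by move=> [f1 f2]; split; [exact: (measurableT_comp f1 (@measurable_snd _ _ mR mR))|exact: (measurableT_comp f2 (@measurable_snd _ _ mR mR))].
Qed.

Lemma cmeas_line (f : R -> C) : (forall t, rcont CofR f t) -> cmeas (setT : set mR) f.
Proof. by move=> cf; exact: cmeas_rcont cf measurableT. Qed.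

Lemma cmeas_integrable (f : R -> C) : cintegrable setT f -> cmeas (setT : set mR) f.
Proof.
move=> [m1 m2]; have /measurable_EFinP h1 := measurable_int _ m1.
have /measurable_EFinP h2 := measurable_int _ m2.
by split; [exact: h1|exact: h2].
Qed.

Section Parseval.
Variables (g h r r1 : R -> C) (lam lam1 : R -> R) (k K : R).
Hypothesis k0 : 0 < k.
Hypothesis cg : forall t, rcont CofR g t.
Hypothesis ch : forall t, rcont CofR h t.
Hypothesis cr1 : forall t, rcont CofR r1 t.
Hypothesis dr : forall t, rderiv CofR r t (r1 t).
Hypothesis dlam : forall t : R, is_derive t 1 lam (lam1 t).
Hypothesis lam10 : forall t, 0 < lam1 t.
Hypothesis hr : forall t, h t = r t * CofR (lam1 t).
Hypothesis gK : forall t, cmod (g t) <= K * expabs k t.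
Hypothesis hK : forall t, cmod (h t) <= K * expabs k t.
Hypothesis rK : forall t, cmod (r t) <= K * expabs k t.
Hypothesis r1K : forall t, cmod (r1 t) <= K * expabs k t.

Let G y := cintegral setT (fun u => g u * cis (- (y * lam u))).
Let H y := cintegral setT (fun u => h u * cis (y * lam u)).

Let K0 : 0 <= K.
Proof. by have := le_trans (cmod_ge0 _) (gK 0); rewrite pmulr_lge0 ?expR_gt0. Qed.

Let clam t : rcont CofR (fun u => CofR (lam u)) t.
Proof. exact: rderiv_cont (is_derive_rderiv (dlam t)). Qed.

Let lam_incr u v : u < v -> lam u < lam v.
Proof.
move=> uv; have [c _ E] := @MVT _ lam lam1 u v uv (fun x _ => dlam x)
  (continuous_subspaceT (is_derive_continuous dlam)).
by rewrite -subr_gt0 E mulr_gt0 // subr_gt0.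
Qed.

Let angle (e u v : R) : C := CofR (2 * atan ((lam v - lam u) / e)).

Let angle_le e u v : cmod (angle e u v) <= pi.
Proof.
rewrite /angle cmod_CofR; have := atan_gtNpi2 ((lam v - lam u) / e); have := atan_ltpi2 ((lam v - lam u) / e).
by rewrite ler_norml; lra.
Qed.

Let rderiv_angle e u v : 0 < e ->
  rderiv CofR (angle e u) v (CofR (2 * e / (e ^+ 2 + (lam v - lam u) ^+ 2) * lam1 v)).
Proof.
move=> e0.
have h1 : is_derive v 1 (fun v => (lam v - lam u) / e) (lam1 v / e).
  have h1 := is_deriveZ (e^-1) (is_deriveB (dlam v) (is_derive_cst (lam u) v (1 : R))).
  have -> : (fun v => (lam v - lam u) / e) = e^-1 \*: (lam - cst (lam u)) by apply/funext => t /=; rewrite mulrC.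
  by apply: (is_derive_eq h1); rewrite subr0 /GRing.scale /= mulrC.
have h2 := @is_derive1_comp R (@atan R) (fun v => (lam v - lam u) / e) v _ _ (is_derive1_atan _) h1.
have h3 := is_deriveZ (2 : R) h2.
have h4 := is_derive_rderiv h3; apply: (rderiv_eq h4).
congr CofR; rewrite /GRing.scale /=.
have p : 0 < e ^+ 2 + (lam v - lam u) ^+ 2 by rewrite ltr_wpDr ?sqr_ge0 // exprn_gt0.
have -> : 1 + ((lam v - lam u) / e) ^+ 2 = (e ^+ 2 + (lam v - lam u) ^+ 2) / e ^+ 2 by field; exact: lt0r_neq0.
by field; rewrite !lt0r_neq0.
Qed.

(** The Poisson integral of h = r lam', integrated by parts: the primitive of
    the kernel is an arctangent, which is bounded and tends to a step function
    as e -> 0. *)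
Let smoothed e u : 0 < e ->
  cintegral setT (fun v => h v * CofR (2 * e / (e ^+ 2 + (lam v - lam u) ^+ 2))) =
  - cintegral setT (fun v => r1 v * angle e u v).
Proof.
move=> e0.
have cang t : rcont CofR (angle e u) t by exact: rderiv_cont (rderiv_angle u t e0).
have p v : 0 < e ^+ 2 + (lam v - lam u) ^+ 2 by rewrite ltr_wpDr ?sqr_ge0 // exprn_gt0.
have ck t : rcont CofR (fun v => CofR (2 * e / (e ^+ 2 + (lam v - lam u) ^+ 2))) t.
  have E v : CofR (2 * e / (e ^+ 2 + (lam v - lam u) ^+ 2)) = CofR (2 * e) * (CofR (e ^+ 2) + (CofR (lam v) - CofR (lam u)) * (CofR (lam v) - CofR (lam u)))^-1.
    by rewrite CofRM CofRV CofRD [(lam v - lam u) ^+ 2]expr2 CofRM CofRB.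
  rewrite (funext E); apply: rcont_mul; first exact: rcont_cst.
  have cd : rcont CofR (fun v => CofR (lam v) - CofR (lam u)) t by apply: rcont_sub; [exact: clam|exact: rcont_cst].
  apply: (rcont_line_comp (f := fun w => w^-1)); last by apply: rcont_add; [exact: rcont_cst|exact: rcont_mul].
  apply: rderiv_cont; apply: rderiv_inv.
  by rewrite -CofRB -CofRM -CofRD CofR_eq0 -expr2 gt_eqF.
have i1 : cintegrable setT (fun v => r1 v * angle e u v).
  apply: (@cint_expabs R setT (K * pi) k _ measurableT k0); first by apply: cmeas_rcont => // t; apply: rcont_mul; [exact: cr1|exact: cang].
  by move=> v _; rewrite cmodM mulrAC ler_pM ?cmod_ge0.
have i2 : cintegrable setT (fun v => h v * CofR (2 * e / (e ^+ 2 + (lam v - lam u) ^+ 2))).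
  apply: (@cint_expabs R setT (K * (2 / e)) k _ measurableT k0); first by apply: cmeas_rcont => // t; apply: rcont_mul; [exact: ch|exact: ck].
  move=> v _; have q : cmod (CofR (2 * e / (e ^+ 2 + (lam v - lam u) ^+ 2)) : C) <= 2 / e.
    rewrite cmod_CofR ger0_norm; last by rewrite divr_ge0 ?mulr_ge0 ?(ltW e0) ?(ltW (p v)).
    rewrite ler_pdivrMr // mulrAC ler_pdivlMr // -mulrA ler_pM2l // -expr2 lerDl sqr_ge0 //.
  by rewrite cmodM [leRHS]mulrAC; exact: (ler_pM (cmod_ge0 _) (cmod_ge0 _) (hK v) q).
apply/eqP; rewrite -subr_eq0 opprK addrC -cintegral_add //; apply/eqP.
have [v1 v2] : vanish_pinfty (fun v => r v * angle e u v) /\ vanish_ninfty (fun v => r v * angle e u v).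
  apply: (@expabs_vanish R _ (K * pi) k k0) => v; by rewrite cmodM mulrAC ler_pM ?cmod_ge0.
apply: (@cintegral_FTC_line R (fun v => r v * angle e u v)) => //.
- move=> t; apply: (rderiv_eq (rderiv_mul (dr t) (rderiv_angle u t e0))).
  by rewrite CofRM hr; ring.
- by move=> t; apply: rcont_add; apply: rcont_mul; [exact: cr1|exact: cang|exact: ch|exact: ck].
- exact: cintegrable_add.
Qed.

Let smoothed_le : exists2 B : R, 0 <= B & forall e u, 0 < e -> cmod (cintegral setT (fun v => r1 v * angle e u v)) <= B.
Proof.
have [B B0 hB] := @cintegral_expabs_le R setT k measurableT k0.
exists (K * pi * B) => [|e u e0]; first by rewrite !mulr_ge0 ?pi_ge0.
apply: hB => [|v _]; last by rewrite cmodM mulrAC ler_pM ?cmod_ge0.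
apply: cmeas_rcont => // t; apply: rcont_mul; first exact: cr1.
exact: rderiv_cont (rderiv_angle u t e0).
Qed.

Let smoothed_cvg u : ccvg (fun n => - cintegral setT (fun v => r1 v * angle (n.+1%:R)^-1 u v)) (2 * CofR pi * r u).
Proof.
have en n : 0 < (n.+1%:R : R)^-1 by rewrite invr_gt0 ltr0n.
pose L v : C := if v < u then - CofR pi * r1 v else if u < v then CofR pi * r1 v else 0.
have ir1 : cintegrable setT r1 by apply: (@cint_expabs R setT K k _ measurableT k0) => //; apply: cmeas_rcont.
pose U n v : C := - (r1 v * angle (n.+1%:R)^-1 u v).
have cang n t : rcont CofR (angle (n.+1%:R)^-1 u) t by exact: rderiv_cont (rderiv_angle u t (en n)).
have iU n : cintegrable setT (fun v => r1 v * angle (n.+1%:R)^-1 u v).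
  apply: (@cint_expabs R setT (K * pi) k _ measurableT k0); first by apply: cmeas_rcont => // t; apply: rcont_mul; [exact: cr1|exact: cang].
  by move=> v _; rewrite cmodM mulrAC ler_pM ?cmod_ge0.
have lim v : ccvg (U ^~ v) (- L v).
  apply: ccvgP => e0 e00; have q0 : 0 < e0 / 2 / (cmod (r1 v) + 1) by rewrite !divr_gt0 // ltr_wpDl ?cmod_ge0.
  have fin (x : R) (n : nat) : `|x - atan ((lam v - lam u) * n.+1%:R)| <= e0 / 2 / (cmod (r1 v) + 1) ->
      L v = CofR (2 * x) * r1 v -> cmod (U n v - - L v) <= e0.
    move=> xn ->; rewrite /U /angle invrK opprK.
    have -> : - (r1 v * CofR (2 * atan ((lam v - lam u) * n.+1%:R))) + CofR (2 * x) * r1 v = r1 v * CofR (2 * (x - atan ((lam v - lam u) * n.+1%:R))).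
      by rewrite mulrBr CofRB; ring.
    rewrite cmodM cmod_CofR normrM ger0_norm //.
    rewrite ler_pdivlMr ?ltr_wpDl ?cmod_ge0 // in xn.
    have := cmod_ge0 (r1 v); have := normr_ge0 (x - atan ((lam v - lam u) * n.+1%:R)); nra.
  have [vu|uv|vu] := ltgtP v u.
  - have x0 : 0 < lam u - lam v by rewrite subr_gt0 lam_incr.
    have [N _ hN] := atan_scaled_cvg x0 q0; exists N => // n /hN /= hn.
    apply: (fin (- (pi / 2))); last first.
      rewrite /L vu; have -> : 2 * - (pi / 2) = - pi :> R by field.
      by rewrite CofRN.
    by rewrite -(opprB (lam u)) mulNr atanN opprK addrC.
  - have x0 : 0 < lam v - lam u by rewrite subr_gt0 lam_incr.
    have [N _ hN] := atan_scaled_cvg x0 q0; exists N => // n /hN /= hn.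
    apply: (fin (pi / 2)); last first.
      by rewrite /L uv ltNge (ltW uv) /=; have -> : 2 * (pi / 2) = pi :> R by field.
    by rewrite distrC.
  - rewrite vu in fin q0 *; exists 0%N => // n _; apply: (fin 0); last by rewrite /L ltxx mulr0 CofR0 mul0r.
    by rewrite subrr mul0r atan0 subrr normr0 ltW.
have mU n : cmeas (setT : set mR) (U n).
  apply: cmeas_opp; apply: cmeas_rcont => // t; apply: rcont_mul; [exact: cr1|exact: cang].
have mL : cmeas (setT : set mR) (fun v => - L v).
  split.
    by apply: (@measurable_fun_cvg _ mR R setT (fun n v => Re (U n v))) => [n|v _]; [exact: (mU n).1|exact: (lim v).1].
  by apply: (@measurable_fun_cvg _ mR R setT (fun n v => Im (U n v))) => [n|v _]; [exact: (mU n).2|exact: (lim v).2].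
have UK n v : cmod (U n v) <= K * pi * expabs k v by rewrite /U cmodN cmodM mulrAC ler_pM ?cmod_ge0.
have Lle v : cmod (- L v) <= K * pi * expabs k v.
  have pc : cmod (CofR pi : C) = pi by rewrite cmod_CofR ger0_norm // pi_ge0.
  have q : cmod (CofR pi * r1 v) <= K * pi * expabs k v.
    by rewrite cmodM pc mulrAC [leRHS]mulrC ler_wpM2l ?pi_ge0.
  rewrite cmodN /L; case: ifP => _; first by rewrite mulNr cmodN.
  by case: ifP => _ //; rewrite cmod0 !mulr_ge0 ?pi_ge0 ?expabs_ge0.
have iM : mu.-integrable setT (EFin \o (fun v => K * pi * expabs k v)).
  by apply: integrable_scale => //; exact: integrable_expabs.
have := @ccvg_dom R setT (fun v => K * pi * expabs k v) U (fun v => - L v) measurableT mU mL iM (fun n v _ => UK n v) (fun v _ => lim v).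
have iL : cintegrable setT (fun v => - L v) by apply: (@cint_expabs R setT (K * pi) k _ measurableT k0).
have -> : cintegral setT (fun v => - L v) = 2 * CofR pi * r u.
  have [oL oR] := cintegral_open u iL.
  rewrite (cintegral_split u iL) -oL -oR.
  have ip := cintegrable_scale (CofR pi) measurableT ir1.
  have ip' := cintegrable_scale (- CofR pi) measurableT ir1.
  have [p1 _] := cintegral_open u ip; have [_ p2] := cintegral_open u ip'.
  rewrite (@eq_cintegral _ `]-oo, u[ _ (fun v => CofR pi * r1 v)); last first.
    by move=> v; rewrite /= in_itv/= /L => ->; rewrite mulNr opprK.
  rewrite (@eq_cintegral _ `]u, +oo[ _ (fun v => - CofR pi * r1 v)); last first.
    by move=> v; rewrite /= in_itv/= andbT /L => uv; rewrite uv ltNge (ltW uv) /= mulNr.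
  rewrite p1 p2.
  have m1 : measurable (`]-oo, u]%classic : set mR) by exact: measurable_itv.
  have m2 : measurable (`[u, +oo[%classic : set mR) by exact: measurable_itv.
  have j1 : cintegrable `]-oo, u] r1 by apply: cintegrableS ir1.
  have j2 : cintegrable `[u, +oo[ r1 by apply: cintegrableS ir1.
  have [v1 v2] := expabs_vanish k0 rK.
  rewrite (cintegral_scale _ m1 j1) (cintegral_scale _ m2 j2) (cintegral_FTC_ninfty dr cr1 j1 v2) (cintegral_FTC_pinfty dr cr1 j2 v1).
  ring.
congr ccvg; apply/funext => n; rewrite -cintegral_opp //.
Qed.

Variable M : R -> R.
Hypothesis iM : mu.-integrable setT (EFin \o M).
Hypothesis GHM : forall y, cmod (G y * H y) <= M y.

Let mcis (s : R) : cmeas (setT : set (mR * mR)) (fun xy : mR * mR => cis (s * (xy.1 * lam xy.2))).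
Proof.
apply: cmeas_cexp; apply: cmeas_mul; first exact: cmeas_cst.
apply: cmeas_real; apply: measurable_funM => //; apply: measurable_funM; first exact: measurable_fst.
by apply: measurableT_comp => //; apply: continuous_measurable_fun; exact: is_derive_continuous dlam.
Qed.

(** A damping factor e^(- e |y|) allows the integrals to be exchanged. The
    y-integral is then the Poisson kernel in lam v - lam u, which concentrates
    on the diagonal as e -> 0; smoothed_cvg is this limit, and smoothed_le the
    bound that allows it under the integral over u. *)
Theorem parseval : cintegral setT (fun y => G y * H y) = 2 * CofR pi * cintegral setT (fun u => g u * r u).
Proof.
have rlam (y t : R) : rcont CofR (fun u => CofR (y * lam u)) t.
  have E u : CofR (y * lam u) = CofR y * CofR (lam u) by rewrite CofRM.
  by rewrite (funext E); apply: rcont_mul; [exact: rcont_cst|exact: clam].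
have rlamN (y t : R) : rcont CofR (fun u => CofR (- (y * lam u))) t.
  have E u : CofR (- (y * lam u)) = CofR (- y) * CofR (lam u) by rewrite -CofRM mulNr.
  by rewrite (funext E); apply: rcont_mul; [exact: rcont_cst|exact: clam].
have iK : mu.-integrable setT (EFin \o (fun u => K * expabs k u)) by apply: integrable_scale => //; exact: integrable_expabs.
have mh : cmeas (setT : set mR) h by exact: cmeas_line.
have mg : cmeas (setT : set mR) g by exact: cmeas_line.
have w1 (e y : R) : cmod (CofR (expabs e y) : C) = expabs e y by rewrite cmod_CofR ger0_norm ?expabs_ge0.
have mw e : cmeas (setT : set mR) (fun y => CofR (expabs e y)).
  by apply: cmeas_real; apply: continuous_measurable_fun; exact: continuous_expabs.
have inner (e s : R) : 0 < e -> 
  cintegrable setT (fun y => CofR (expabs e y) * cis (- (y * s)) * H y) /\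
  cintegral setT (fun y => CofR (expabs e y) * cis (- (y * s)) * H y) =
  cintegral setT (fun v => h v * CofR (2 * e / (e ^+ 2 + (lam v - s) ^+ 2))).
  move=> e0; pose F (y v : R) : C := CofR (expabs e y) * cis (- (y * s)) * (h v * cis (y * lam v)).
  have mF : cmeas (setT : set (mR * mR)) (fun xy : mR * mR => F xy.1 xy.2).
    apply: cmeas_mul.
      refine (@cmeas_fst (fun y => CofR (expabs e y) * cis (- (y * s))) _); apply: cmeas_mul; first exact: mw.
      apply: cmeas_cexp; apply: cmeas_mul; first exact: cmeas_cst.
      by apply: cmeas_real; apply: measurable_funN; apply: measurable_funM.
    apply: cmeas_mul; first by refine (@cmeas_snd h _).
    apply: (cmeas_ext _ (mcis 1)) => xy; by rewrite mul1r.
  have FM y v : cmod (F y v) <= expabs e y * (K * expabs k v).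
    by rewrite /F !cmodM !cmod_cis !mulr1 w1 ler_wpM2l ?expabs_ge0.
  have [iF eF] := cFubini mF (integrable_expabs e0) iK FM.
  have hy y : cintegrable setT (fun v => h v * cis (y * lam v)).
    apply: (@cint_expabs R setT K k _ measurableT k0).
      by apply: cmeas_line => t; apply: rcont_mul; [exact: ch|apply: rcont_cis_comp; exact: rlam].
    by move=> v _; rewrite cmodM cmod_cis mulr1.
  have E1 y : cintegral setT (F y) = CofR (expabs e y) * cis (- (y * s)) * H y.
    by rewrite /F (cintegral_scale _ measurableT (hy y)).
  have ip (x : R) : cintegrable setT (fun y => CofR (expabs e y) * cis (y * x)).
    apply: (@cint_expabs R setT 1 e _ measurableT e0) => [|y _]; last by rewrite cmodM cmod_cis mulr1 w1 mul1r.
    apply: cmeas_mul; first exact: mw.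
    apply: cmeas_cexp; apply: cmeas_mul; first exact: cmeas_cst.
    by apply: cmeas_real; apply: measurable_funM.
  have E2 v : cintegral setT (F ^~ v) = h v * CofR (2 * e / (e ^+ 2 + (lam v - s) ^+ 2)).
    rewrite -(poisson_kernel (lam v - s) e0) -(cintegral_scale (h v) measurableT (ip (lam v - s))).
    apply: eq_cintegral => y _; rewrite /F.
    have -> : cis (y * (lam v - s)) = cis (y * lam v) * cis (- (y * s)) :> C by rewrite -cisD; congr cis; ring.
    ring.
  split; first by apply: (eq_cintegrable measurableT _ iF) => y _; exact: E1.
  by rewrite -(eq_cintegral (fun y _ => E1 y)) eF; apply: eq_cintegral => v _; exact: E2.
have mWH e : 0 < e -> cmeas (setT : set mR) (fun y => CofR (expabs e y) * H y).
  move=> e0; have [h1 _] := inner e 0 e0.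
  by apply: cmeas_ext (cmeas_integrable h1) => y; rewrite mulr0 oppr0 cis0 mulr1.
have [BH BH0 hBH] := @cintegral_expabs_le R setT k measurableT k0.
have Hle y : cmod (H y) <= K * BH.
  apply: hBH => [|v _]; last by rewrite cmodM cmod_cis mulr1.
  by apply: cmeas_line => t; apply: rcont_mul; [exact: ch|apply: rcont_cis_comp; exact: rlam].
have outer (e : R) : 0 < e ->
  [/\ cintegrable setT (fun u => g u * - cintegral setT (fun v => r1 v * angle e u v)),
   cintegrable setT (fun y => CofR (expabs e y) * (G y * H y)) &
   cintegral setT (fun u => g u * - cintegral setT (fun v => r1 v * angle e u v)) =
   cintegral setT (fun y => CofR (expabs e y) * (G y * H y))].
  move=> e0; pose F (y u : R) : C := g u * cis (- (y * lam u)) * (CofR (expabs e y) * H y).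
  have mF : cmeas (setT : set (mR * mR)) (fun xy : mR * mR => F xy.1 xy.2).
    apply: cmeas_mul; last by refine (@cmeas_fst (fun y => CofR (expabs e y) * H y) _); exact: mWH.
    apply: cmeas_mul; first by refine (@cmeas_snd g _).
    by apply: (cmeas_ext _ (mcis (-1))) => xy; rewrite mulN1r.
  have mF' : cmeas (setT : set (mR * mR)) (fun xy : mR * mR => F xy.2 xy.1).
    apply: cmeas_mul; last by refine (@cmeas_snd (fun y => CofR (expabs e y) * H y) _); exact: mWH.
    apply: cmeas_mul; first by refine (@cmeas_fst g _).
    apply: cmeas_cexp; apply: cmeas_mul; first exact: cmeas_cst.
    apply: cmeas_real; apply: measurable_funN; apply: measurable_funM; first exact: measurable_snd.
    by apply: measurableT_comp => //; apply: continuous_measurable_fun; exact: is_derive_continuous dlam.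
  have FM y u : cmod (F y u) <= (K * BH * expabs e y) * (K * expabs k u).
    rewrite /F !cmodM cmod_cis mulr1 w1 mulrC ler_pM ?mulr_ge0 ?cmod_ge0 ?expabs_ge0 //.
    by rewrite mulrC ler_wpM2r ?expabs_ge0.
  have iE : mu.-integrable setT (EFin \o (fun y => K * BH * expabs e y)) by apply: integrable_scale => //; exact: integrable_expabs.
  have [iF eF] := cFubini mF iE iK FM.
  have FM' u y : cmod (F y u) <= (K * expabs k u) * (K * BH * expabs e y) by rewrite mulrC; exact: FM.
  have [iF' _] := @cFubini R (fun u y => F y u) _ _ mF' iK iE FM'.
  have gy y : cintegrable setT (fun u => g u * cis (- (y * lam u))).
    apply: (@cint_expabs R setT K k _ measurableT k0).
      by apply: cmeas_line => t; apply: rcont_mul; [exact: cg|apply: rcont_cis_comp; exact: rlamN].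
    by move=> v _; rewrite cmodM cmod_cis mulr1.
  have E1 y : cintegral setT (F y) = CofR (expabs e y) * (G y * H y).
    transitivity (cintegral setT (fun u => (CofR (expabs e y) * H y) * (g u * cis (- (y * lam u))))).
      by apply: eq_cintegral => u _; rewrite /F mulrC.
    by rewrite (cintegral_scale _ measurableT (gy y)) -/(G y); ring.
  have E2 u : cintegral setT (F ^~ u) = g u * - cintegral setT (fun v => r1 v * angle e u v).
    have [i3 e3] := inner e (lam u) e0.
    transitivity (cintegral setT (fun y => g u * (CofR (expabs e y) * cis (- (y * lam u)) * H y))).
      by apply: eq_cintegral => y _; rewrite /F; ring.
    by rewrite (cintegral_scale _ measurableT i3) e3 smoothed.
  split.
  - by apply: (eq_cintegrable measurableT _ iF') => u _; exact: E2.
  - by apply: (eq_cintegrable measurableT _ iF) => y _; exact: E1.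
  - transitivity (cintegral setT (fun u => cintegral setT (F ^~ u))); first by apply: eq_cintegral => u _; exact: esym (E2 u).
    transitivity (cintegral setT (fun y => cintegral setT (F y))); first exact: esym eF.
    by apply: eq_cintegral => y _; exact: E1.
have en n : 0 < (n.+1%:R : R)^-1 by rewrite invr_gt0 ltr0n.
have wcvg y : ccvg (fun n => CofR (expabs (n.+1%:R)^-1 y) * (G y * H y)) (G y * H y).
  apply: ccvgP => e e0; have c0 : 0 < cmod (G y * H y) + 1 by rewrite ltr_wpDl ?cmod_ge0.
  have [N _ hN] := nat_gt (`|y| * (cmod (G y * H y) + 1) / e); exists N => // n /= Nn.
  have {hN} := hN n Nn; rewrite ler_pdivrMr // => hn.
  have -> : CofR (expabs (n.+1%:R)^-1 y) * (G y * H y) - G y * H y = CofR (expabs (n.+1%:R)^-1 y - 1) * (G y * H y).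
    by rewrite CofRB CofR1; ring.
  rewrite cmodM cmod_CofR distrC ger0_norm; last first.
    by rewrite subr_ge0 /expabs -[leRHS]expR0 ler_expR oppr_le0 mulr_ge0 ?invr_ge0.
  have h1 : 1 - expabs (n.+1%:R)^-1 y <= n.+1%:R^-1 * `|y|.
    rewrite /expabs; move: (n.+1%:R^-1 * `|y|) => X; have := expR_ge1Dx (- X); lra.
  apply: le_trans (ler_wpM2r (cmod_ge0 _) h1) _.
  have n1 : 0 < n.+1%:R :> R by rewrite ltr0n.
  rewrite -mulrA mulrC ler_pdivrMr // .
  have : `|y| * cmod (G y * H y) <= `|y| * (cmod (G y * H y) + 1) by rewrite ler_wpM2l // lerDl.
  have : n%:R <= n.+1%:R :> R by rewrite ler_nat.
  nra.
have mGH : cmeas (setT : set mR) (fun y => G y * H y).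
  have mn n : cmeas (setT : set mR) (fun y => CofR (expabs (n.+1%:R)^-1 y) * (G y * H y)).
    by apply: cmeas_integrable; have [] := outer _ (en n).
  split.
    by apply: (@measurable_fun_cvg _ mR R setT (fun n y => Re (CofR (expabs (n.+1%:R)^-1 y) * (G y * H y)))) => [n|v _]; [exact: (mn n).1|exact: (wcvg v).1].
  by apply: (@measurable_fun_cvg _ mR R setT (fun n y => Im (CofR (expabs (n.+1%:R)^-1 y) * (G y * H y)))) => [n|v _]; [exact: (mn n).2|exact: (wcvg v).2].
have lim1 : ccvg (fun n => cintegral setT (fun y => CofR (expabs (n.+1%:R)^-1 y) * (G y * H y))) (cintegral setT (fun y => G y * H y)).
  apply: (@ccvg_dom R setT M _ _ measurableT _ mGH iM _ (fun y _ => wcvg y)).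
  - by move=> n; apply: cmeas_integrable; have [] := outer _ (en n).
  - move=> n y _; rewrite cmodM w1; apply: le_trans (GHM y); rewrite ler_piMl ?cmod_ge0 //.
    by rewrite /expabs -[leRHS]expR0 ler_expR oppr_le0 mulr_ge0 ?invr_ge0.
have [B B0 hB] := smoothed_le.
have ir : cintegrable setT (fun u => g u * r u).
  apply: (@cint_expabs R setT (K * K) k _ measurableT k0).
    by apply: cmeas_line => t; apply: rcont_mul; [exact: cg|exact: rderiv_cont (dr t)].
  move=> u _; rewrite cmodM mulrAC; apply: ler_pM; [exact: cmod_ge0|exact: cmod_ge0|exact: gK|].
  have el : expabs k u <= 1 by rewrite /expabs -[leRHS]expR0 ler_expR oppr_le0 mulr_ge0 // ltW.
  exact: le_trans (rK u) (ler_piMr K0 el).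
have lim2 : ccvg (fun n => cintegral setT (fun u => g u * - cintegral setT (fun v => r1 v * angle (n.+1%:R)^-1 u v)))
   (cintegral setT (fun u => 2 * CofR pi * (g u * r u))).
  apply: (@ccvg_dom R setT (fun u => B * (K * expabs k u)) _ _ measurableT).
  - by move=> n; apply: cmeas_integrable; have [] := outer _ (en n).
  - by apply: cmeas_mul; [exact: cmeas_cst|exact: cmeas_integrable].
  - by apply: integrable_scale.
  - by move=> n u _; rewrite cmodM cmodN mulrC ler_pM ?cmod_ge0 // hB.
  - move=> u _; apply: ccvgP => e e0; have c0 : 0 < cmod (g u) + 1 by rewrite ltr_wpDl ?cmod_ge0.
    have e1 : 0 < e / (cmod (g u) + 1) by rewrite divr_gt0.
    have [N _ hN] := ccvg_ge (smoothed_cvg u) e1; exists N => // n /hN /= hn.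
    have -> : 2 * CofR pi * (g u * r u) = g u * (2 * CofR pi * r u) by ring.
    rewrite -mulrBr cmodM; rewrite ler_pdivlMr // in hn; apply: le_trans hn.
    by rewrite mulrC ler_wpM2l ?cmod_ge0 // lerDl.
rewrite -(cintegral_scale _ measurableT ir); apply: (ccvg_uniq lim1).
move: lim2; congr ccvg; apply/funext => n; by have [] := outer _ (en n).
Qed.

End Parseval.

End FourierInversion.

(** * The product of two confluent integrals *)

Section ProductBound.
Context {R : realType}.
Local Notation C := (Cplx R).
Local Notation mu := (@lebesgue_measure R).
Local Notation mR := (measurableTypeR R).
Implicit Types (a p q w z : C) (t u y T : R).

(** Analytic continuation along a segment that issues from the real axis; m
    measures the distance to the boundary of the domain. *)
Lemma identity_region (f f1 : C -> C) (m : C -> R) (x0 : R) (z : C) :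
  (forall v w, m v - 2 * cmod (w - v) <= m w) ->
  (forall x t, 0 <= t <= 1 -> 0 < m (CofR x) -> Num.min (m (CofR x)) (m z) <= m (CofR x + CofR t * (z - CofR x))) ->
  (forall v, 0 < m v -> holo_at f f1 v) ->
  (forall x, x0 <= x -> 0 < m (CofR x) /\ f (CofR x) = 0) ->
  0 < m z -> f z = 0.
Proof.
move=> lip conc hf f0 mz; have [mx _] := f0 _ (lexx x0).
pose d := Num.min (m (CofR x0)) (m z); have d0 : 0 < d by rewrite lt_min mx mz.
pose r := d / 24; have r0 : 0 < r by rewrite divr_gt0.
have near t w : 0 <= t <= 1 -> cmod (w - (CofR x0 + CofR t * (z - CofR x0))) < 6 * r -> holo_at f f1 w.
  move=> t01 h; apply: hf; apply: lt_le_trans (lip (CofR x0 + CofR t * (z - CofR x0)) w).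
  have := conc x0 t t01 mx; rewrite -/d; rewrite /r in h; lra.
have disc w : cmod (w - CofR x0) <= r / 2 -> f w = 0.
  apply: (@identity_disc R f f1 (CofR x0) r r0 _ 1 1) => //.
  - by move=> v hv; apply: (near 0); rewrite ?lexx ?ler01 // CofR0 mul0r addr0.
  - by move=> t /andP[t0 _]; rewrite mulr1 -CofRD; apply: (f0 _ _).2; lra.
pose h := r / 2 / (cmod (z - CofR x0) + 1).
have c1 : 0 < cmod (z - CofR x0) + 1 by rewrite ltr_wpDl ?cmod_ge0.
have h0 : 0 < h by rewrite /h; apply: divr_gt0; [exact: divr_gt0|exact: c1].
have := @identity_segment R f f1 (CofR x0) (z - CofR x0) r h r0 h0 _ _ 1.
have ez : CofR x0 + (z - CofR x0) = z by ring.
rewrite CofR1 mul1r ez; apply; last by rewrite ltr01 lexx.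
- by move=> t t01 v hv; exact: near hv.
- move=> t /andP[t0 th]; apply: disc.
  rewrite addrAC subrr add0r cmodM cmod_CofR (gtr0_norm t0).
  have : t * (cmod (z - CofR x0) + 1) <= r / 2 by rewrite -ler_pdivlMr // ltW.
  by have := cmod_ge0 (z - CofR x0); nra.
Qed.

Lemma Lip_Im (v w : C) : `|Im w| <= `|Im v| + cmod (w - v).
Proof.
have := Im_le_cmod (w - v); rewrite ImD ImN => h.
by have := ler_normD (Im w - Im v) (Im v); rewrite subrK; lra.
Qed.

(** e^(p^2 / 4) Gamma (a) D_(- 2 a)(p), which is 2^(- a) Gamma (a) U(a, 1/2,
    p^2 / 2). *)
Definition Phi a p : C := Gam a / Gam (2 * a) * pint (2 * a) p.

Lemma Re_dbl a : Re (2 * a) = 2 * Re a.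
Proof. by rewrite -CofR_nat ReM Re_CofR Im_CofR mul0r subr0. Qed.
Lemma Im_dbl a : Im (2 * a) = 2 * Im a.
Proof. by rewrite -CofR_nat ImM Re_CofR Im_CofR mul0r addr0. Qed.

(** Both sides are multiples of U(a, 1/2, p^2 / 2): uniqueness of the
    recessive solution identifies them for large real p, and analytic
    continuation in the whole wedge. *)
Lemma tint_Phi a p : 0 < Re a < 1 / 2 -> `|Im p| < Re p ->
  tint a (- a - 1 / 2) (p * p / 2) = cexp (a * CofR (ln 2)) * Phi a p.
Proof.
move=> a01 wp; have a0 : 0 < Re a by case/andP: a01.
have c0 : Re (- a - 1 / 2 : C) <= 0 by rewrite ReD ReN ReN CofR_half Re_CofR; lra.
have abc : a + (- a - 1 / 2) + 1 = CofR (1 / 2) by (have two0 : (2 : C) != 0 by rewrite -CofR_nat CofR_eq0 pnatr_eq0); rewrite -CofR_half; field.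
have [F1 [F2 sF]] := tint_solution a0 c0 abc.
have half1 : 1 / 2 <= 1 :> R by lra.
have tw := parabolic_is_tricomi a01; rewrite CofR_half in tw.
have [x0 hx] := tricomi_proportional half1 tw sF (tint_asymp a0 c0).
have r2 : 0 < Re (2 * a) by rewrite Re_dbl; lra.
have sq p' : Re (p' * p' / 2) = (Re p' ^+ 2 - Im p' ^+ 2) / 2.
  by rewrite -CofR_nat -CofRV mulrC ReM Re_CofR Im_CofR mul0r subr0 ReM; field.
pose f p := tint a (- a - 1 / 2) (p * p / 2) - cexp (a * CofR (ln 2)) * Phi a p.
pose f1 p := - tint (a + 1) (- a - 1 / 2) (p * p / 2) * (2^-1 * (1 * p + p * 1)) - cexp (a * CofR (ln 2)) * (Gam a / Gam (2 * a) * - pint (2 * a + 1) p).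
apply/eqP; rewrite -subr_eq0; apply/eqP.
pose x1 := expR ((ln 2 + `|x0|) / 2).
apply: (@identity_region f f1 (fun p => Re p - `|Im p|) x1 p).
- move=> v w; have h1 := Lip_Im v w; have := Re_le_cmod (w - v); rewrite ReD ReN ler_norml; lra.
- move=> x t /andP[t0 t1]; rewrite Re_CofR Im_CofR normr0 subr0 => xx.
  have -> : Re (CofR x + CofR t * (p - CofR x)) = x + t * (Re p - x) by rewrite !ReImE; ring.
  have -> : Im (CofR x + CofR t * (p - CofR x)) = t * Im p by rewrite !ReImE; ring.
  rewrite normrM (ger0_norm t0) ge_min.
  have [h|h] := leP x (Re p - `|Im p|); apply/orP; [left|right].
    have := ler_wpM2l t0 h; nra.
  have t1' : 0 <= 1 - t by rewrite subr_ge0.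
  have := ler_wpM2l t1' (ltW h); nra.
- move=> v hv; have pv : 0 < Re (v * v / 2).
    rewrite sq divr_gt0 // subr_gt0 -[Im v ^+ 2]real_normK ?num_real //.
    rewrite ltr_sqr ?nnegrE //; [lra|have := normr_ge0 (Im v); lra].
  have hq := holo_scale (2^-1) (holo_mul (holo_id v) (holo_id v)).
  have h1 : holo_at (fun p => tint a (- a - 1 / 2) (p * p / 2)) (fun p => - tint (a + 1) (- a - 1 / 2) (p * p / 2) * (2^-1 * (1 * p + p * 1))) v.
    have hq' : holo_at (fun p => p * p / 2) (fun p => 2^-1 * (1 * p + p * 1)) v.
      by apply: holo_ext hq => w; rewrite mulrC.
    exact: (@holo_comp R (fun p => p * p / 2) _ (tint a (- a - 1 / 2)) _ v (tint_holo a0 c0 pv) hq').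
  exact: holo_sub h1 (holo_scale _ (holo_scale _ (pint_holo v r2))).
- move=> x x1x; have xp : 0 < x by apply: lt_le_trans x1x; exact: expR_gt0.
  rewrite Re_CofR Im_CofR normr0 subr0; split => //.
  pose t := 2 * ln x - ln 2.
  have tx : x0 <= t.
    have : (ln 2 + `|x0|) / 2 <= ln x by rewrite -[leLHS]expRK ler_ln ?posrE ?expR_gt0.
    rewrite /t; have := ler_norm x0; lra.
  have et : cexp (CofR t) = CofR x * CofR x / 2.
    rewrite cexp_CofR /t; have -> : 2 * ln x - ln 2 = ln x + ln x - ln 2 by ring.
    by rewrite expRD expRN expRD !lnK ?posrE // CofRM CofRM CofRV CofR_nat.
  rewrite /f -et hx // /parabolic_tricomi /Phi.
  have -> : cexp ((CofR (ln 2) + CofR t) / 2) = CofR x.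
    rewrite -CofRD half_CofR cexp_CofR /t; have -> : (ln 2 + (2 * ln x - ln 2)) / 2 = ln x by field.
    by rewrite lnK ?posrE.
  ring.
- by rewrite subr_gt0.
Qed.

Lemma Phi_prefactor (al : R) : 0 < al < 1 / 2 -> exists2 K : R, 0 <= K &
  forall a T, Re a = al -> `|Im a| = T ^+ 2 / 2 -> 0 <= T ->
  cmod (Gam a / Gam (2 * a)) <= K * (1 + T) ^+ 8 * expR (T ^+ 2 * (pi / 4)).
Proof.
move=> al01; have [|K1 K10 h1] := @Gam_le R al; first lra.
have [|K2 K20 h2] := @Gam_inv_le R (2 * al); first lra.
exists (K1 * K2) => [|a T Ra Ia T0]; first exact: mulr_ge0.
have {}h1 := h1 a Ra; have {}h2 := h2 (2 * a); rewrite Re_dbl Ra in h2; have {}h2 := h2 erefl.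
rewrite cmodM; have := ler_pM (cmod_ge0 _) (cmod_ge0 _) h1 h2 => /le_trans; apply.
rewrite Im_dbl normrM ger0_norm // Ia.
have t0 : 0 <= T ^+ 2 by exact: sqr_ge0.
have q1 : (1 + T ^+ 2 / 2) ^+ 2 <= (1 + T) ^+ 4.
  have -> : (1 + T) ^+ 4 = ((1 + T) ^+ 2) ^+ 2 by rewrite -exprM.
  rewrite ler_sqr ?nnegrE ?sqr_ge0 ?addr_ge0 ?divr_ge0 //; nra.
have q2 : (1 + 2 * (T ^+ 2 / 2)) ^+ 2 <= (1 + T) ^+ 4.
  have -> : (1 + T) ^+ 4 = ((1 + T) ^+ 2) ^+ 2 by rewrite -exprM.
  rewrite ler_sqr ?nnegrE ?sqr_ge0 ?addr_ge0 ?mulr_ge0 ?divr_ge0 //; nra.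
have q3 := ler_pM (sqr_ge0 _) (sqr_ge0 _) q1 q2.
have -> : expR (T ^+ 2 * (pi / 4)) = expR (- (pi / 2 * (T ^+ 2 / 2))) * expR (pi / 2 * (2 * (T ^+ 2 / 2))) :> R.
  by rewrite -expRD; congr expR; field.
have -> : (1 + T) ^+ 8 = (1 + T) ^+ 4 * (1 + T) ^+ 4 by rewrite -exprD.
set e1 := expR (- _); set e2 := expR _.
have e0 : 0 <= K1 * K2 * (e1 * e2) by rewrite !mulr_ge0 ?expR_ge0.
have := ler_wpM2l e0 q3; move: ((1 + T ^+ 2 / 2) ^+ 2) ((1 + 2 * (T ^+ 2 / 2)) ^+ 2) ((1 + T) ^+ 4) => x y z; lra.
Qed.

(** The factors e^(T^2 pi / 4) of the Gamma quotient and e^(- T^2 pi / 4) of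
    the parabolic integral cancel, which leaves the decay in T, of rate tilt
    p. *)
Lemma Phi_le (al M : R) : 0 < al < 1 / 2 -> 0 <= M -> exists2 K : R, 0 <= K &
  forall a p T, Re a = al -> 0 <= T -> cmod p <= M ->
  (Im a = - (T ^+ 2 / 2) -> cmod (Phi a p) <= K * (1 + T) ^+ 10 * expR (- (T * tilt p))) /\
  (Im a = T ^+ 2 / 2 -> cmod (Phi a p) <= K * (1 + T) ^+ 10 * expR (- (T * tilt (conjc p)))).
Proof.
move=> al01 M0; have [K1 K10 h1] := Phi_prefactor al01.
have [|K2 K20 h2] := @pint_bound_neg R (2 * al) M _ M0; first lra.
have fin (a p : C) T (x : R) : 0 <= T -> Re a = al -> `|Im a| = T ^+ 2 / 2 ->
    cmod (pint (2 * a) p) <= K2 * (1 + T) ^+ 2 * expR (- (T ^+ 2 * (pi / 4)) - T * x) ->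
    cmod (Phi a p) <= K1 * K2 * (1 + T) ^+ 10 * expR (- (T * x)).
  move=> T0 Ra Ia hp; rewrite cmodM; have {}h1 := h1 a T Ra Ia T0.
  have := ler_pM (cmod_ge0 _) (cmod_ge0 _) h1 hp => /le_trans; apply.
  have -> : (1 + T) ^+ 10 = (1 + T) ^+ 8 * (1 + T) ^+ 2 by rewrite -exprD.
  have -> : expR (- (T * x)) = expR (T ^+ 2 * (pi / 4)) * expR (- (T ^+ 2 * (pi / 4)) - T * x) by rewrite -expRD; congr expR; ring.
  by apply: eq_leR; ring.
exists (K1 * K2) => [|a p T Ra T0 pM]; first exact: mulr_ge0.
have tq : 0 <= T ^+ 2 / 2 by rewrite divr_ge0 ?sqr_ge0.
split=> Ia; apply: fin => //.
- by rewrite Ia normrN ger0_norm.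
- by apply: h2 => //; rewrite ?Re_dbl ?Im_dbl ?Ra // Ia; field.
- by rewrite Ia ger0_norm.
- have r0 : 0 < Re (2 * a) by rewrite Re_dbl Ra; lra.
  rewrite -(cmod_pint_conj p r0); apply: h2 => //.
  + by rewrite -Ra -Re_dbl; case: (2 * a).
  + have -> : Im (conjc (2 * a)) = - Im (2 * a) by case: (2 * a).
    by rewrite Im_dbl Ia; field.
  + by rewrite cmod_conj.
Qed.

(** The exponent 24 serves Phi_product_le: 10 for each factor, and 4 to gain 1
    / (1 + (Im a)^2). *)
Lemma poly_exp_decay (m : R) : 0 < m -> exists2 K : R, 0 <= K &
  forall T, 0 <= T -> (1 + T) ^+ 24 * expR (- (m * T)) <= K.
Proof.
move=> m0; exists ((1 + 24 / m) ^+ 24) => [|T T0]; first by rewrite exprn_ge0 // addr_ge0 // divr_ge0 // ltW.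
rewrite expRN ler_pdivrMr ?expR_gt0 //.
have -> : expR (m * T) = expR (m * T / 24) ^+ 24 by rewrite -expRM_natl; congr expR; field.
rewrite -exprMn lerXn2r ?nnegrE ?mulr_ge0 ?addr_ge0 ?expR_ge0 ?divr_ge0 ?(ltW m0) //.
have d0 : 0 <= 24 / m by rewrite divr_ge0 // ltW.
have h := expR_ge1Dx (m * T / 24).
apply: (@le_trans _ _ ((1 + 24 / m) * (1 + m * T / 24))); last by rewrite ler_wpM2l // addr_ge0.
have -> : (1 + 24 / m) * (1 + m * T / 24) = 1 + T + 24 / m + m * T / 24 by field; exact: lt0r_neq0.
have : 0 <= m * T / 24 by rewrite divr_ge0 ?mulr_ge0 ?(ltW m0).
lra.
Qed.

(** The imaginary parts of the two parameters are opposite, so only the sums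
    of a tilt and a conjugate tilt matter, one for each half of the line. *)
Lemma Phi_product_le (al M m : R) : 0 < al < 1 / 2 -> 0 <= M -> 0 < m -> exists2 K : R, 0 <= K &
  forall a a' p q, Re a = al -> Re a' = 1 / 2 - al -> Im a' = - Im a -> cmod p <= M -> cmod q <= M ->
  m <= tilt p + tilt (conjc q) -> m <= tilt (conjc p) + tilt q ->
  cmod (Phi a p * Phi a' q) <= K / (1 + Im a ^+ 2).
Proof.
move=> al01 M0 m0; have al01' : 0 < 1 / 2 - al < 1 / 2 by lra.
have [K1 K10 h1] := Phi_le al01 M0; have [K2 K20 h2] := Phi_le al01' M0.
have [K3 K30 h3] := poly_exp_decay m0.
have fin (x y T s1 s2 t : R) : 0 <= T -> 0 <= x -> 0 <= y -> x <= K1 * (1 + T) ^+ 10 * expR (- (T * s1)) -> y <= K2 * (1 + T) ^+ 10 * expR (- (T * s2)) ->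
    m <= s1 + s2 -> t ^+ 2 = (T ^+ 2 / 2) ^+ 2 -> x * y <= K1 * K2 * K3 / (1 + t ^+ 2).
  move=> T0 x0 y0 hx hy ms ->; rewrite ler_pdivlMr ?ltr_pwDl ?sqr_ge0 //.
  have q1 : 1 + (T ^+ 2 / 2) ^+ 2 <= (1 + T) ^+ 4.
    have -> : (1 + T) ^+ 4 = ((1 + T) ^+ 2) ^+ 2 by rewrite -exprM.
    have : 0 <= T ^+ 2 by exact: sqr_ge0.
    have -> : (1 + T) ^+ 2 = 1 + 2 * T + T ^+ 2 by ring.
    move: (T ^+ 2) => X X0; nra.
  have q2 := ler_pM x0 y0 hx hy.
  have q3 : expR (- (T * s1)) * expR (- (T * s2)) <= expR (- (m * T)) by rewrite -expRD ler_expR; nra.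
  have xy0 : 0 <= x * y by rewrite mulr_ge0.
  have o0 : 0 <= 1 + (T ^+ 2 / 2) ^+ 2 by rewrite addr_ge0 ?sqr_ge0.
  have := ler_pM xy0 o0 q2 q1 => /le_trans; apply.
  have -> : K1 * (1 + T) ^+ 10 * expR (- (T * s1)) * (K2 * (1 + T) ^+ 10 * expR (- (T * s2))) * (1 + T) ^+ 4 =
     K1 * K2 * ((1 + T) ^+ 24 * (expR (- (T * s1)) * expR (- (T * s2)))).
    by (have -> : (1 + T) ^+ 24 = (1 + T) ^+ 10 * (1 + T) ^+ 10 * (1 + T) ^+ 4 by rewrite -!exprD); ring.
  apply: ler_wpM2l; first by rewrite mulr_ge0.
  apply: le_trans (h3 T T0); apply: ler_wpM2l => //; first by rewrite exprn_ge0 // addr_ge0.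
exists (K1 * K2 * K3) => [|a a' p q Ra Ra' Iaa pM qM m1 m2]; first by rewrite !mulr_ge0.
pose T := Num.sqrt (2 * `|Im a|).
have T0 : 0 <= T by exact: sqrtr_ge0.
have T2 : T ^+ 2 / 2 = `|Im a| by rewrite /T sqr_sqrtr ?mulr_ge0 //; field.
have [f1 f2] := h1 a p T Ra T0 pM; have [g1 g2] := h2 a' q T Ra' T0 qM.
rewrite cmodM; have tt : Im a ^+ 2 = (T ^+ 2 / 2) ^+ 2 by rewrite T2 real_normK ?num_real.
have [i0|i0] := leP 0 (Im a).
  have e1 : Im a = T ^+ 2 / 2 by rewrite T2 ger0_norm.
  have e2 : Im a' = - (T ^+ 2 / 2) by rewrite Iaa e1.
  exact: (fin _ _ T (tilt (conjc p)) (tilt q) (Im a) T0 (cmod_ge0 _) (cmod_ge0 _) (f2 e1) (g1 e2) m2 tt).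
have e1 : Im a = - (T ^+ 2 / 2) by rewrite T2 ltr0_norm // opprK.
have e2 : Im a' = T ^+ 2 / 2 by rewrite Iaa e1 opprK.
exact: (fin _ _ T (tilt p) (tilt (conjc q)) (Im a) T0 (cmod_ge0 _) (cmod_ge0 _) (f1 e1) (g2 e2) m1 tt).
Qed.


Lemma integrable_lorentz : mu.-integrable setT (EFin \o (fun y => (1 + y ^+ 2)^-1)).
Proof.
have cf : continuous (fun y : R => (1 + y ^+ 2)^-1) := continuous_oneDsqrV.
have p y : 0 <= (1 + y ^+ 2)^-1 :> R by rewrite invr_ge0 addr_ge0 ?sqr_ge0.
apply/integrableP; split; first by apply/measurable_EFinP; exact: continuous_measurable_fun.
under eq_integral do rewrite /= ger0_norm ?p //.
rewrite ge0_symfun_integralT.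
- by rewrite -set_itvcy integral0y_oneDsqr ltry.
- by move=> y; exact: p.
- exact: cf.
- by move=> y /=; rewrite sqrrN.
Qed.

(** Fourier transforms of integrable families are measurable in the
    frequency: damp them and use Fubini. *)
Lemma cmeas_fourier (g : R -> C) (s k K : R) : 0 < k -> (forall t, rcont CofR g t) ->
  (forall t, cmod (g t) <= K * expabs k t) ->
  cmeas (setT : set mR) (fun y => cintegral setT (fun u => g u * cis (s * (y * u)))).
Proof.
move=> k0 cg gK; pose F (y u : R) : C := CofR (expabs 1 y) * (g u * cis (s * (y * u))).
have mw : cmeas (setT : set mR) (fun y => CofR (expabs 1 y)).
  by apply: cmeas_real; apply: continuous_measurable_fun; exact: continuous_expabs.
have mF : cmeas (setT : set (mR * mR)) (fun xy : mR * mR => F xy.1 xy.2).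
  apply: cmeas_mul; first by refine (@cmeas_fst _ _ mw).
  apply: cmeas_mul; first by refine (@cmeas_snd _ g _); exact: cmeas_line.
  apply: cmeas_cexp; apply: cmeas_mul; first exact: cmeas_cst.
  apply: cmeas_real; apply: measurable_funM => //; apply: measurable_funM; first exact: measurable_fst.
  exact: measurable_snd.
have FM y u : cmod (F y u) <= expabs 1 y * (K * expabs k u).
  by rewrite /F !cmodM cmod_cis mulr1 cmod_CofR ger0_norm ?expabs_ge0 // ler_wpM2l ?expabs_ge0.
have iK : mu.-integrable setT (EFin \o (fun u => K * expabs k u)) by apply: integrable_scale => //; exact: integrable_expabs.
have [iF _] := cFubini mF (integrable_expabs ltr01) iK FM.
have gi y : cintegrable setT (fun u => g u * cis (s * (y * u))).
  apply: (@cint_expabs R setT K k _ measurableT k0) => [|u _]; last by rewrite cmodM cmod_cis mulr1.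
  apply: cmeas_line => t; apply: rcont_mul; first exact: cg.
  apply: rcont_cis_comp; have E u : CofR (s * (y * u)) = CofR (s * y) * CofR u :> C by rewrite -CofRM mulrA.
  by rewrite (funext E); apply: rcont_mul; [exact: rcont_cst|exact: rcont_id].
have mp : cmeas (setT : set mR) (fun y => CofR (expR `|y|)).
  by apply: cmeas_real; apply: measurableT_comp => //; exact: measurable_normr.
apply: cmeas_ext (cmeas_mul mp (cmeas_integrable iF)) => y.
rewrite /F (cintegral_scale _ measurableT (gi y)) mulrA -CofRM /expabs mul1r -expRD subrr expR0.
by rewrite CofR1 mul1r.
Qed.

Lemma cmeas_Gam a0 (s : R) : 0 < Re a0 -> cmeas (setT : set mR) (fun y => Gam (a0 + iC * CofR (s * y))).
Proof.
move=> a00; have p0 : (0 : R) < pi / 2 by rewrite divr_gt0 // pi_gt0.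
have n0 : `|(0 : R)| <= 0 by rewrite normr0.
have := @cmeas_fourier (fun u => gamma_kernel a0 (CofR u)) s (Num.min (Re a0) 1) _ (minr_gt0 a00) _ (fun u => _).
move=> h; apply: cmeas_ext (h (expR (- (Im a0 * 0)) * exp_const (Re a0) (cos 0)) _ _).
- move=> y; apply: eq_cintegral => u _; rewrite /gamma_kernel /cis -cexpD; congr cexp.
  by rewrite CofRM CofRM CofRM; ring.
- move=> t; apply: (rcont_line_comp (holo_rcont (holo_gamma_kernel a0 (CofR t)))); exact: rcont_id.
- by move=> t; have := gamma_kernel_le t a00 n0 p0; rewrite iC0.
Qed.

Lemma cmeas_pint a0 p (s : R) : 0 < Re a0 -> cmeas (setT : set mR) (fun y => pint (a0 + iC * CofR (s * y)) p).
Proof.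
move=> a00.
have h := @cmeas_fourier (fun u => pker a0 p (CofR u)) s (Num.min (Re a0) 1) _ (minr_gt0 a00) (rcont_pker a0 p) (fun u => pker_le_real u a00 (lexx (cmod p))).
apply: cmeas_ext h => y; apply: eq_cintegral => u _; rewrite /pker /cis -cexpD; congr cexp.
by rewrite CofRM CofRM CofRM; ring.
Qed.

Lemma Gam_inv (b : C) : 0 < Re b < 1 -> (Gam b)^-1 = Gam (1 - b) * (epi b - epi (- b)) / (2 * iC * CofR pi).
Proof.
move=> b01; have g0 := Gam_neq0 b01; have tp0 : (2 * iC * CofR pi : C) != 0.
  by rewrite !mulf_neq0 ?iC_neq0 // -?CofR_nat CofR_eq0 ?pnatr_eq0 // gt_eqF // pi_gt0.
by apply: (mulfI g0); rewrite mulfV // !mulrA reflection // mulfV.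
Qed.

(** The reflection formula moves the Gamma function out of the denominator, so
    that cmeas_Gam applies. *)
Lemma cmeas_prefactor a0 (s : R) : 0 < Re a0 < 1 / 2 ->
  cmeas (setT : set mR) (fun y => Gam (a0 + iC * CofR (s * y)) / Gam (2 * (a0 + iC * CofR (s * y)))).
Proof.
move=> a01; apply: cmeas_mul; first by apply: cmeas_Gam; case/andP: a01.
have E y : (Gam (2 * (a0 + iC * CofR (s * y))))^-1 =
    Gam (1 - 2 * a0 + iC * CofR ((-2 * s) * y)) * (epi (2 * (a0 + iC * CofR (s * y))) - epi (- (2 * (a0 + iC * CofR (s * y))))) * (2 * iC * CofR pi)^-1.
  have r0 : Re (a0 + iC * CofR (s * y)) = Re a0 by rewrite ReD !ReImE; ring.
  rewrite Gam_inv; last by rewrite Re_dbl r0; lra.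
  have e : CofR (-2 * s * y) = - (2 * CofR (s * y)) :> C by rewrite -CofR_nat -CofRM -CofRN; congr CofR; ring.
  by congr (Gam _ * _ / _); rewrite e; ring.
have mlin : cmeas (setT : set mR) (fun y => 2 * (a0 + iC * CofR (s * y))).
  apply: cmeas_mul; first exact: cmeas_cst.
  apply: cmeas_add; first exact: cmeas_cst.
  apply: cmeas_mul; first exact: cmeas_cst.
  by apply: cmeas_real; apply: measurable_funM.
apply: cmeas_ext (fun y => esym (E y)) _; apply: cmeas_mul; last exact: cmeas_cst.
apply: cmeas_mul.
  apply: cmeas_Gam; rewrite ReD ReN Re1 Re_dbl; lra.
apply: cmeas_add.
  by apply: cmeas_cexp; apply: cmeas_mul; [exact: cmeas_cst|exact: mlin].
apply: cmeas_opp; apply: cmeas_cexp; apply: cmeas_mul; first exact: cmeas_cst.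
exact: cmeas_opp.
Qed.

Lemma cmeas_pint_dbl a0 p (s : R) n : 0 < Re a0 ->
  cmeas (setT : set mR) (fun y => pint (2 * (a0 + iC * CofR (s * y)) + n%:R) p).
Proof.
move=> a00; have r : 0 < Re (2 * a0 + n%:R) by rewrite ReS Re_dbl ltr_wpDr // mulr_gt0.
apply: cmeas_ext (cmeas_pint p (2 * s) r) => y; congr (pint _ p).
by rewrite -(mulrA 2) (CofRM 2) CofR_nat; ring.
Qed.

Lemma cmeas_Phi a0 p (s : R) : 0 < Re a0 < 1 / 2 ->
  cmeas (setT : set mR) (fun y => Phi (a0 + iC * CofR (s * y)) p).
Proof.
move=> a01; apply: cmeas_mul; first exact: cmeas_prefactor.
have a00 : 0 < Re a0 by case/andP: a01.
by apply: cmeas_ext (cmeas_pint_dbl p s 0 a00) => y; rewrite addr0.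
Qed.

(** On the wedges both factors are Laplace integrals. There y enters through
    e^(- i y lam u) and e^(i y lam u) with lam u = u - ln (1 + e^u), so
    parseval applies; on the diagonal the exponents of e^u and of 1 + e^u add
    up to 1/2 and - 1/2, and P and Q enter through P + Q. *)
Lemma Phi_integral (al : C) p q (M : R -> R) : 0 < Re al < 1 / 2 -> `|Im p| < Re p -> `|Im q| < Re q ->
  mu.-integrable setT (EFin \o M) ->
  (forall y, cmod (Phi (al + iC * CofR (-1 * y)) p * Phi (1 / 2 - al + iC * CofR (1 * y)) q) <= M y) ->
  CofR (Num.sqrt 2) * cintegral setT (fun y => Phi (al + iC * CofR (-1 * y)) p * Phi (1 / 2 - al + iC * CofR (1 * y)) q) =
  2 * CofR pi * tint (1 / 2) (- (1 / 2)) ((p * p + q * q) / 2).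
Proof.
move=> al01 wp wq iM hM.
have wedge (v : C) : `|Im v| < Re v -> 0 < Re (v * v / 2).
  move=> hv; have -> : Re (v * v / 2) = (Re v ^+ 2 - Im v ^+ 2) / 2.
    by rewrite -CofR_nat -CofRV mulrC ReM Re_CofR Im_CofR mul0r subr0 ReM; field.
  rewrite divr_gt0 // subr_gt0 -[Im v ^+ 2]real_normK ?num_real //.
  rewrite ltr_sqr ?nnegrE //; have := normr_ge0 (Im v); lra.
pose P : C := p * p / 2; pose Q : C := q * q / 2; pose al' : C := 1 / 2 - al.
have P0 : 0 < Re P := wedge _ wp; have Q0 : 0 < Re Q := wedge _ wq.
have Ral' : Re al' = 1 / 2 - Re al by rewrite /al' ReD ReN CofR_half Re_CofR.
have al0 : 0 < Re al by lra.
have al'0 : 0 < Re al' by rewrite Ral'; lra.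
pose c : C := - al - 1 / 2; pose c' : C := - al' - 1 / 2.
have c0 : Re c <= 0 by rewrite /c ReD ReN ReN CofR_half Re_CofR; lra.
have c'0 : Re c' <= 0 by rewrite /c' ReD ReN ReN CofR_half Re_CofR Ral'; lra.
(* h = r lam', where lam' = 1 / (1 + e^u). *)
pose g u := tker al c P u; pose h u := tker al' c' Q u.
pose r u := tker al' c' Q u + tker (al' + 1) c' Q u.
pose d (a : C) u : C := a + c' * CofR (expR u / (1 + expR u)) - Q * cexp (CofR u).
pose r1 u := tker al' c' Q u * d al' u + tker (al' + 1) c' Q u * d (al' + 1) u.
pose lam u : R := u - ln1e u; pose lam1 u : R := 1 - expR u / (1 + expR u).
have al'1 : 0 < Re (al' + 1) by rewrite ReD Re1 addr_gt0.
have al'2 : 0 < Re (al' + 1 + 1) by rewrite ReD Re1 addr_gt0.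
pose k := Num.min (Re al) (Re al'); have k0 : 0 < k by rewrite lt_min al0.
have mono (x : R) u : k <= x -> expabs (Num.min x 1) u <= expabs k u.
  move=> kx; rewrite /expabs ler_expR lerN2 ler_wpM2r // le_min kx /=.
  by rewrite /k ge_min; apply/orP; left; lra.
have kal : k <= Re al by rewrite /k ge_min lexx.
have kal' : k <= Re al' by rewrite /k ge_min lexx orbT.
have b (a2 c2 z2 : C) u : 0 < Re a2 -> Re c2 <= 0 -> 0 < Re z2 -> k <= Re a2 ->
    cmod (tker a2 c2 z2 u) <= exp_const (Re a2) (Re z2) * expabs k u.
  move=> h1 h2 h3 h4; apply: le_trans (tker_le u h1 h2 h3 (lexx _)) _.
  by rewrite ler_wpM2l ?expR_ge0 // mono.
pose K0 := exp_const (Re al) (Re P); pose K1 := exp_const (Re al') (Re Q).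
pose K2 := exp_const (Re (al' + 1)) (Re Q); pose K3 := exp_const (Re (al' + 1 + 1)) (Re Q).
pose D := cmod al' + 1 + cmod c'.
pose K := K0 + K1 + K2 + D * (K1 + K2) + cmod Q * (K2 + K3).
have e0 (x y : R) : 0 <= exp_const x y by exact: expR_ge0.
have D0 : 0 <= D by rewrite /D !addr_ge0 ?cmod_ge0.
have k1 : k <= Re (al' + 1) by rewrite ReD Re1; lra.
have k2 : k <= Re (al' + 1 + 1) by rewrite ReD Re1; lra.
have b0 u : cmod (g u) <= K0 * expabs k u := b _ _ _ u al0 c0 P0 kal.
have b1 u : cmod (h u) <= K1 * expabs k u := b _ _ _ u al'0 c'0 Q0 kal'.
have b2 u : cmod (tker (al' + 1) c' Q u) <= K2 * expabs k u := b _ _ _ u al'1 c'0 Q0 k1.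
have b3 u : cmod (tker (al' + 1 + 1) c' Q u) <= K3 * expabs k u := b _ _ _ u al'2 c'0 Q0 k2.
have Q00 := cmod_ge0 Q.
have pos : [/\ 0 <= K0, 0 <= K1, 0 <= K2 & 0 <= K3] by split; exact: e0.
have [p0 p1 p2 p3] := pos.
have KK : [/\ K0 <= K, K1 <= K, K1 + K2 <= K & D * (K1 + K2) + cmod Q * (K2 + K3) <= K].
  have q1 : 0 <= D * (K1 + K2) := mulr_ge0 D0 (addr_ge0 p1 p2).
  have q2 : 0 <= cmod Q * (K2 + K3) := mulr_ge0 Q00 (addr_ge0 p2 p3).
  by rewrite /K; split; lra.
have [KK0 KK1 KK2 KK3] := KK.
have up (x L : R) u : x <= L * expabs k u -> L <= K -> x <= K * expabs k u.
  by move=> h1 h2; apply: le_trans h1 _; rewrite ler_wpM2r ?expabs_ge0.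
have frac u : 0 <= expR u / (1 + expR u) <= 1.
  have := one_expR_gt0 u; have := expR_ge0 u => h1 h2.
  by rewrite divr_ge0 ?(ltW h2) //= ler_pdivrMr //; lra.
have bd (a : C) u : cmod a <= cmod al' + 1 -> cmod (a + c' * CofR (expR u / (1 + expR u))) <= D.
  move=> ha; apply: le_trans (cmodD _ _) _; rewrite /D lerD // cmodM cmod_CofR.
  by have /andP[f1 f2] := frac u; rewrite ger0_norm // ler_piMr ?cmod_ge0.
have br1 u : cmod (r1 u) <= K * expabs k u.
  apply: up KK3; rewrite /r1.
  have -> : tker al' c' Q u * d al' u + tker (al' + 1) c' Q u * d (al' + 1) u =
    (h u * (al' + c' * CofR (expR u / (1 + expR u))) + tker (al' + 1) c' Q u * (al' + 1 + c' * CofR (expR u / (1 + expR u)))) -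
    Q * (tker (al' + 1) c' Q u + tker (al' + 1 + 1) c' Q u).
    by rewrite [tker (al' + 1 + 1) _ _ _]tkerS {2}[tker (al' + 1) _ _ _]tkerS /d /h tkerS; ring.
  have a1 : cmod al' <= cmod al' + 1 by rewrite lerDl.
  have a2 : cmod (al' + 1) <= cmod al' + 1 by have := cmodD al' 1; rewrite cmod1.
  have m1 := ler_pM (cmod_ge0 _) (cmod_ge0 _) (b1 u) (bd _ u a1).
  have m2 := ler_pM (cmod_ge0 _) (cmod_ge0 _) (b2 u) (bd _ u a2).
  have m3 := ler_wpM2l Q00 (lerD (b2 u) (b3 u)).
  apply: le_trans (cmodB _ _) _; rewrite [cmod (Q * _)]cmodM.
  have n1 := cmodD (h u * (al' + c' * CofR (expR u / (1 + expR u)))) (tker (al' + 1) c' Q u * (al' + 1 + c' * CofR (expR u / (1 + expR u)))).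
  rewrite !cmodM in n1.
  have n3 := ler_wpM2l Q00 (cmodD (tker (al' + 1) c' Q u) (tker (al' + 1 + 1) c' Q u)).
  lra.
have dr t : rderiv CofR r t (r1 t) by apply: rderiv_add; exact: rderiv_tker.
have cd (a : C) t : rcont CofR (d a) t.
  apply: rcont_sub; last by apply: rcont_mul; [exact: rcont_cst|exact: rderiv_cont (rderiv_cexp_real t)].
  apply: rcont_add; first exact: rcont_cst.
  apply: rcont_mul; first exact: rcont_cst.
  have E v : CofR (expR v / (1 + expR v)) = (fun w => cexp w * (1 + cexp w)^-1) (CofR v) :> C.
    by rewrite CofRM CofRV CofRD CofR1 cexp_CofR.
  rewrite (funext E); apply: (rcont_line_comp (f := fun w => cexp w * (1 + cexp w)^-1)); last exact: rcont_id.
  have one0 : 1 + cexp (CofR t) != 0 :> C by apply: one_plus_cexp_neq0; rewrite Im_CofR normr0 pi_gt0.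
  have hh := holo_add (holo_cst 1 (CofR t)) (holo_cexp (holo_id (CofR t))).
  exact: holo_rcont (holo_mul (holo_cexp (holo_id _)) (@holo_inv R (fun w => 1 + cexp w) _ (CofR t) one0 hh)).
have cr1 t : rcont CofR r1 t.
  by apply: rcont_add; apply: rcont_mul; [exact: rcont_tker|exact: cd|exact: rcont_tker|exact: cd].
have dlam (t : R) : is_derive t 1 lam (lam1 t) := is_deriveB (is_derive_id t (1 : R)) (is_derive_ln1e t).
have lam1E t : lam1 t = (1 + expR t)^-1.
  by rewrite /lam1; have := one_expR_gt0 t => h1; field; exact: lt0r_neq0.
have lam10 t : 0 < lam1 t by rewrite lam1E invr_gt0 one_expR_gt0.
have hr t : h t = r t * CofR (lam1 t).
  rewrite /r /h tkerS lam1E CofRV CofRD CofR1 cexp_CofR.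
  have n0 : 1 + CofR (expR t) != 0 :> C by rewrite -CofR1 -CofRD CofR_eq0 gt_eqF // one_expR_gt0.
  by move: (tker al' c' Q t) (CofR (expR t)) n0 => x e n0; field.
pose a y : C := al + iC * CofR (-1 * y); pose a' y : C := al' + iC * CofR (1 * y).
have Ra y : Re (a y) = Re al by rewrite /a ReD !ReImE; ring.
have Ra' y : Re (a' y) = Re al' by rewrite /a' ReD !ReImE; ring.
have GE y : cintegral setT (fun u => g u * cis (- (y * lam u))) = cexp (a y * CofR (ln 2)) * Phi (a y) p.
  rewrite -tint_Phi ?Ra //; apply: eq_cintegral => u _; rewrite /g /tker /cis -cexpD; congr cexp.
  by rewrite /a /c /lam -/P CofRN mulN1r CofRN CofRM CofRB; ring.
have HE y : cintegral setT (fun u => h u * cis (y * lam u)) = cexp (a' y * CofR (ln 2)) * Phi (a' y) q.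
  rewrite -tint_Phi ?Ra' ?Ral' //; last by apply/andP; split; lra.
  apply: eq_cintegral => u _; rewrite /h /tker /cis -cexpD; congr cexp.
  by rewrite /a' /c' /lam -/Q mul1r CofRM CofRB; ring.
have s2 y : cexp (a y * CofR (ln 2)) * cexp (a' y * CofR (ln 2)) = CofR (Num.sqrt 2).
  rewrite -cexpD; have -> : a y * CofR (ln 2) + a' y * CofR (ln 2) = CofR (1 / 2 * ln 2).
    by rewrite /a /a' /al' (CofRM (1 / 2)) -CofR_half mulN1r mul1r CofRN; ring.
  rewrite cexp_CofR; congr CofR.
  have l2 : ln 2 = ln (Num.sqrt 2 ^+ 2) :> R by rewrite sqr_sqrtr.
  have q0 : 0 < Num.sqrt 2 :> R by rewrite sqrtr_gt0.
  rewrite {1}l2 lnXn // mulrnAr -mulrnAl; have -> : (1 / 2) *+ 2 = 1 :> R by rewrite -mulr_natl; field.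
  by rewrite mul1r lnK.
pose F y := Phi (a y) p * Phi (a' y) q.
have GH y : cintegral setT (fun u => g u * cis (- (y * lam u))) * cintegral setT (fun u => h u * cis (y * lam u)) = CofR (Num.sqrt 2) * F y.
  by rewrite GE HE -(s2 y) /F; ring.
have q2 : 0 <= Num.sqrt 2 :> R by exact: sqrtr_ge0.
have iM2 : mu.-integrable setT (EFin \o (fun y => Num.sqrt 2 * M y)) by exact: integrable_scale.
have GHM y : cmod (cintegral setT (fun u => g u * cis (- (y * lam u))) * cintegral setT (fun u => h u * cis (y * lam u))) <= Num.sqrt 2 * M y.
  by rewrite GH cmodM cmod_CofR ger0_norm // ler_wpM2l // hM.
have mF : cmeas (setT : set mR) F.
  by apply: cmeas_mul; apply: cmeas_Phi => //; rewrite Ral'; lra.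
have iF : cintegrable setT F by apply: (cint_dom measurableT mF iM) => y _; exact: hM.
have cg t : rcont CofR g t by exact: rcont_tker.
have ch t : rcont CofR h t by exact: rcont_tker.
have gK t : cmod (g t) <= K * expabs k t by exact: up (b0 t) KK0.
have hK t : cmod (h t) <= K * expabs k t by exact: up (b1 t) KK1.
have rK t : cmod (r t) <= K * expabs k t.
  by apply: up KK2; have := cmodD (h t) (tker (al' + 1) c' Q t); have := b1 t; have := b2 t; rewrite -/(r t); lra.
have := parseval k0 cg ch cr1 dr dlam lam10 hr gK hK rK br1 iM2 GHM.
rewrite (eq_cintegral (fun y _ => GH y)) (cintegral_scale _ measurableT iF) => ->.
congr (_ * _); apply: eq_cintegral => u _.
rewrite /g /r tkerS; have -> : tker al' c' Q u + tker al' c' Q u * cexp (CofR u) = tker al' c' Q u * cexp (CofR (ln1e u)).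
  by rewrite -{1}[tker al' c' Q u]mulr1 -mulrDr; congr (_ * _); rewrite !cexp_CofR expR_ln1e CofRD CofR1.
rewrite /tker -!cexpD; congr cexp; rewrite /c /c' /al' /P /Q.
have two0 : (2 : C) != 0 by rewrite -CofR_nat CofR_eq0 pnatr_eq0.
by field.
Qed.

End ProductBound.

(** * Continuation to the right half-planes *)

Section Continuation.
Context {R : realType}.
Local Notation C := (Cplx R).
Local Notation mu := (@lebesgue_measure R).
Local Notation mR := (measurableTypeR R).
Implicit Types (A B a p q v w z : C) (t u y : R).

Lemma bessel_entire_strip w : `|Im w| < pi / 2 ->
  bessel_entire w = tint (1 / 2) (- (1 / 2)) (cexp w).
Proof.
move=> hw; have [W1 hW] := @bessel_entire_holo R.
have h0 : 0 < Re (1 / 2 : C) by rewrite CofR_half Re_CofR; lra.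
have h1 : Re (- (1 / 2) : C) <= 0 by rewrite ReN CofR_half Re_CofR; lra.
apply/eqP; rewrite -subr_eq0; apply/eqP.
apply: (@identity_region R (fun w => bessel_entire w - tint (1 / 2) (- (1 / 2)) (cexp w))
  (fun w => W1 w - - tint (1 / 2 + 1) (- (1 / 2)) (cexp w) * (cexp w * 1)) (fun w => pi / 2 - `|Im w|) (ln 4 + 1) w).
- by move=> v v'; have := Lip_Im v v'; have := cmod_ge0 (v' - v); lra.
- move=> x t /andP[t0 t1] _; rewrite Im_CofR normr0 subr0.
  have -> : Im (CofR x + CofR t * (w - CofR x)) = t * Im w by rewrite !ReImE; ring.
  rewrite normrM (ger0_norm t0) ge_min; apply/orP; right.
  by have := ler_wpM2r (normr_ge0 (Im w)) t1; lra.
- move=> v; rewrite subr_gt0 ltr_norml => hv.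
  have v0 : 0 < Re (cexp v) by rewrite Re_cexp mulr_gt0 ?expR_gt0 // cos_gt0_pihalf.
  apply: holo_sub (hW v) _.
  exact: (@holo_comp R cexp _ (tint (1 / 2) (- (1 / 2))) _ v (tint_holo h0 h1 v0) (holo_cexp (holo_id v))).
- move=> x hx; rewrite Im_CofR normr0 subr0 bessel_entire_real ?subrr; last lra.
  by split=> //; rewrite divr_gt0 // pi_gt0.
- by rewrite subr_gt0.
Qed.

Lemma sin_eq0_small t : `|t| < pi -> sin t = 0 -> t = 0.
Proof.
rewrite ltr_norml => /andP[h1 h2] s0.
case: (ltrgtP t 0) => // t0.
- have h3 : 0 < - t < pi by lra.
  by have := sin_gt0_pi h3; rewrite sinN s0 oppr0 ltxx.
- have h3 : 0 < t < pi by lra.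
  by have := sin_gt0_pi h3; rewrite s0 ltxx.
Qed.

Lemma cexp_eq1_small w : cexp w = 1 -> `|Im w| < 2 * pi -> w = 0.
Proof.
move=> w1 hw.
have r0 : Re w = 0.
  by apply: (@expR_inj R); rewrite -cmod_cexp w1 cmod1 expR0.
have c1 : cos (Im w) = 1 by have := congr1 (@complex.Re R) w1; rewrite Re_cexp r0 expR0 mul1r.
have h : `|Im w / 2| < pi by rewrite normrM [`|2^-1|]ger0_norm ?invr_ge0 //; lra.
have s0 : sin (Im w / 2) = 0.
  have e : Im w = Im w / 2 + Im w / 2 by field.
  rewrite e cosD in c1; have := cos2Dsin2 (Im w / 2) => c2.
  have : sin (Im w / 2) ^+ 2 = 0 by move: c1 c2; rewrite !expr2; lra.
  by move/eqP; rewrite sqrf_eq0 => /eqP.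
have i0 := sin_eq0_small h s0.
by apply: cplx_ext; rewrite ?r0 // Im0; lra.
Qed.

Lemma Im_clog_lt z : 0 < Re z -> `|Im (clog z)| < pi / 2.
Proof.
move=> z0; have c0 : 0 < cmod z.
  by apply: lt_le_trans z0 _; have := Re_le_cmod z; have := ler_norm (Re z); lra.
have bd : -1 <= Re z / cmod z <= 1.
  have := Re_le_cmod z; rewrite ler_norml => /andP[h1 h2].
  by rewrite ler_pdivlMr // ler_pdivrMr // mulN1r mul1r h1 h2.
have a0 : 0 <= acos (Re z / cmod z) by exact: acos_ge0.
have a1 : acos (Re z / cmod z) <= pi by exact: acos_lepi.
have lt : acos (Re z / cmod z) < pi / 2.
  rewrite ltNge; apply/negP => h; have p0 : 0 <= pi / 2 :> R by rewrite divr_ge0 // pi_ge0.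
  have := le_cos p0 h a1; rewrite cos_pihalf acosK // leNgt divr_gt0 //.
by rewrite /clog /= /carg; case: ifP => _; rewrite ?normrN ger0_norm.
Qed.

(** With A = eta + i xi and B = xi + i eta these are (1 + i) xi and (1 + i)
    eta. *)
Definition arg1 A B : C := ((1 - iC) * A + (1 + iC) * B) / 2.
Definition arg2 A B : C := ((1 + iC) * A + (1 - iC) * B) / 2.

Lemma arg_prod A B : (arg1 A B * arg1 A B + arg2 A B * arg2 A B) / 2 = A * B.
Proof.
have i2 := @iC2 R; have two0 : (2 : C) != 0 by rewrite -CofR_nat CofR_eq0 pnatr_eq0.
have e : (arg1 A B * arg1 A B + arg2 A B * arg2 A B) / 2 = ((1 - iC * iC) * (A * B) * 2 + (1 + iC * iC) * (A * A + B * B)) / 4.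
  by rewrite /arg1 /arg2; field.
by rewrite e i2; field.
Qed.

Lemma tiltE p : tilt p = cos (pi / 4) * (Re p + Im p).
Proof.
have c0 : cos (pi / 4) != 0 :> R.
  by rewrite gt_eqF // cos_gt0_pihalf //; have := pi_gt0 R; lra.
have sc : sin (pi / 4) = cos (pi / 4) :> R.
  by have := @tan_piquarter R; rewrite /tan => /(congr1 (fun x => x * cos (pi / 4))); rewrite divfK // mul1r.
rewrite /tilt /cis ReM Re_cexp Im_cexp.
have -> : Re (iC * CofR (- (pi / 4)) : C) = 0 by rewrite !ReImE; ring.
have -> : Im (iC * CofR (- (pi / 4)) : C) = - (pi / 4) by rewrite !ReImE; ring.
by rewrite expR0 cosN sinN sc; ring.
Qed.

Lemma Re_half z : Re (z / 2) = Re z / 2.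
Proof. by rewrite -CofR_nat -CofRV mulrC ReM Re_CofR Im_CofR; ring. Qed.
Lemma Im_half z : Im (z / 2) = Im z / 2.
Proof. by rewrite -CofR_nat -CofRV mulrC ImM Re_CofR Im_CofR; ring. Qed.

(** The decay rates of the integrand at the two ends of the line are the real
    parts of B and A up to a factor: this is the origin of the two half-plane
    conditions. *)
Lemma tilt_arg A B : tilt (arg1 A B) + tilt (conjc (arg2 A B)) = 2 * cos (pi / 4) * Re B /\
  tilt (conjc (arg1 A B)) + tilt (arg2 A B) = 2 * cos (pi / 4) * Re A.
Proof.
have rc z : Re (conjc z) = Re z by case: z.
have ic z : Im (conjc z) = - Im z by case: z.
by rewrite !tiltE !rc !ic /arg1 /arg2 !Re_half !Im_half !ReImE; split; field.
Qed.

Lemma cmod_arg A B (N : R) : cmod A <= N -> cmod B <= N -> cmod (arg1 A B) <= 2 * N /\ cmod (arg2 A B) <= 2 * N.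
Proof.
move=> AN BN.
have m1 : cmod (1 + iC : C) <= 2 by have := cmodD (1 : C) iC; rewrite cmod1 cmod_iC; lra.
have m2 : cmod (1 - iC : C) <= 2 by have := cmodB (1 : C) iC; rewrite cmod1 cmod_iC; lra.
have fin (c d x y : C) : cmod c <= 2 -> cmod d <= 2 -> cmod x <= N -> cmod y <= N -> cmod ((c * x + d * y) / 2) <= 2 * N.
  move=> c2 d2 xN yN; rewrite cmodM cmodV cmod_nat ler_pdivrMr //.
  have := cmodD (c * x) (d * y); rewrite !cmodM.
  have := ler_pM (cmod_ge0 _) (cmod_ge0 _) c2 xN; have := ler_pM (cmod_ge0 _) (cmod_ge0 _) d2 yN; lra.
by split; apply: fin.
Qed.

Lemma holo_Phi a p : 0 < Re a -> holo_at (Phi a) (fun p => Gam a / Gam (2 * a) * - pint (2 * a + 1) p) p.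
Proof. by move=> a0; apply: holo_scale; apply: pint_holo; rewrite Re_dbl mulr_gt0. Qed.

Definition Phi_line (al : C) A B y : C :=
  Phi (al + iC * CofR (-1 * y)) (arg1 A B) * Phi (1 / 2 - al + iC * CofR (1 * y)) (arg2 A B).

Lemma cmeas_Phi_line (al : C) A B : 0 < Re al < 1 / 2 -> cmeas (setT : set mR) (Phi_line al A B).
Proof.
move=> al01; apply: cmeas_mul; first exact: cmeas_Phi.
by apply: cmeas_Phi; rewrite ReD ReN CofR_half Re_CofR; lra.
Qed.

(** As long as A and B stay in a compact part of the right half-plane, the
    decay of Phi_product_le is uniform. *)
Lemma Phi_line_le (al : C) (N m : R) : 0 < Re al < 1 / 2 -> 0 <= N -> 0 < m -> exists M : R -> R,
  mu.-integrable setT (EFin \o M) /\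
  forall A B y, cmod A <= N -> cmod B <= N -> m <= Re A -> m <= Re B -> cmod (Phi_line al A B y) <= M y.
Proof.
move=> al01 N0 m0.
have c0 : 0 < cos (pi / 4) :> R by rewrite cos_gt0_pihalf //; have := pi_gt0 R; lra.
have M0 : 0 <= 2 * N by rewrite mulr_ge0.
have m1 : 0 < 2 * cos (pi / 4) * m by rewrite !mulr_gt0.
have [K K0 hK] := Phi_product_le al01 M0 m1.
(* 1 + y^2 <= 2 (1 + b^2) (1 + (b - y)^2) allows the shift by b = Im al. *)
pose b := Im al; exists (fun y => K * (2 * (1 + b ^+ 2)) * (1 + y ^+ 2)^-1); split.
  by apply: integrable_scale => //; exact: integrable_lorentz.
move=> A B y AN BN mA mB; have [aN bN] := cmod_arg AN BN; have [t1 t2] := tilt_arg A B.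
have c2 : 0 <= 2 * cos (pi / 4) :> R by rewrite mulr_ge0 // ltW.
apply: le_trans (hK _ _ _ _ _ _ _ aN bN _ _) _.
- by rewrite ReD !ReImE; ring.
- by rewrite ReD ReD ReN CofR_half !ReImE; ring.
- by rewrite CofR_half !ReImE; ring.
- by rewrite t1 ler_wpM2l.
- by rewrite t2 ler_wpM2l.
have -> : Im (al + iC * CofR (-1 * y)) = b - y by rewrite ImD !ReImE /b; ring.
have y1 : 0 < 1 + y ^+ 2 by rewrite ltr_pwDl ?sqr_ge0.
have y2 : 0 < 1 + (b - y) ^+ 2 by rewrite ltr_pwDl ?sqr_ge0.
rewrite -mulrA ler_wpM2l // ler_pdivlMr // mulrC ler_pdivrMr //.
have := sqr_ge0 (2 * b - y); have := sqr_ge0 (b * (b - y)); nra.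
Qed.

(** Where arg1 and arg2 lie in the wedge and the strip contains w,
    bessel_entire is the confluent integral and Phi_integral applies. *)
Lemma product_formula_near1 (al A B w : C) : 0 < Re al < 1 / 2 -> 0 < Re A -> 0 < Re B ->
  `|Im (arg1 A B)| < Re (arg1 A B) -> `|Im (arg2 A B)| < Re (arg2 A B) ->
  `|Im w| < pi / 2 -> cexp w = A * B ->
  CofR (Num.sqrt 2) * cintegral setT (Phi_line al A B) = 2 * CofR pi * bessel_entire w.
Proof.
move=> al01 A0 B0 w1 w2 hw wE.
have N0 : 0 <= cmod A + cmod B by rewrite addr_ge0 ?cmod_ge0.
have m0 : 0 < Num.min (Re A) (Re B) by rewrite lt_min A0 B0.
have [M [iM hM]] := Phi_line_le al01 N0 m0.
rewrite bessel_entire_strip // wE -(arg_prod A B).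
have hh y : cmod (Phi_line al A B y) <= M y; last first.
  exact: (@Phi_integral R al _ _ M al01 w1 w2 iM hh).
apply: hM.
- by rewrite lerDl cmod_ge0.
- by rewrite lerDr cmod_ge0.
- by rewrite ge_min lexx.
- by rewrite ge_min lexx orbT.
Qed.

(** The formula spreads from A = B = 1 along the curve (A^w, B^w), 0 <= w <=
    1. Both sides are holomorphic in w near this segment: on the left the
    powers stay in a compact part of the right half-plane, and on the right
    bessel_entire is an entire function of the logarithm. *)
Theorem product_formula (al A B : C) : 0 < Re al < 1 / 2 -> 0 < Re A -> 0 < Re B ->
  CofR (Num.sqrt 2) * cintegral setT (Phi_line al A B) = 2 * CofR pi * bessel_entire (clog A + clog B).
Proof.
move=> al01 A0 B0; pose la := clog A; pose lb := clog B.
have nz (x : C) : 0 < Re x -> x != 0 by apply: contraTneq => ->; rewrite Re0 ltxx.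
have ia : `|Im la| < pi / 2 := Im_clog_lt A0; have ib : `|Im lb| < pi / 2 := Im_clog_lt B0.
(* Half of the angle that is left between the curves and the imaginary axis.
   *)
pose th := (pi / 2 - Num.max `|Im la| `|Im lb|) / 2.
have th0 : 0 < th by rewrite divr_gt0 // subr_gt0 gt_max ia ib.
have tha : `|Im la| <= pi / 2 - 2 * th.
  have q : `|Im la| <= Num.max `|Im la| `|Im lb| by rewrite le_max lexx.
  by move: q; rewrite /th; lra.
have thb : `|Im lb| <= pi / 2 - 2 * th.
  have q : `|Im lb| <= Num.max `|Im la| `|Im lb| by rewrite le_max lexx orbT.
  by move: q; rewrite /th; lra.
have th1 : th <= 1 by have := normr_ge0 (Im la); have := pihalf_lt2 R; lra.
pose N := cmod la + cmod lb + 1.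
have ga := cmod_ge0 la; have gb := cmod_ge0 lb.
have N1 : 1 <= N by rewrite /N; lra.
have Na : cmod la <= N by rewrite /N; lra.
have Nb : cmod lb <= N by rewrite /N; lra.
have N0 : 0 < N by lra.
(* identity_segment asks for discs of radius 6 r around the segment, and
   param_holo for radius 7 r around their points. *)
pose r := th / (13 * N); have r0 : 0 < r by rewrite divr_gt0 // mulr_gt0.
have rN : 13 * r * N = th by rewrite /r; field; exact: lt0r_neq0.
have r1 : 13 * r <= 1 by move: rN N1 th1 r0; nra.
pose L := expR (2 * N); pose m := expR (- (2 * N)) * cos (pi / 2 - th).
have m0 : 0 < m by rewrite mulr_gt0 ?expR_gt0 // cos_gt0_pihalf //; have := pi_ge2 R; lra.
have L0 : 0 <= L by exact: expR_ge0.
have reg (x w : C) t : `|Im x| <= pi / 2 - 2 * th -> cmod x <= N -> 0 <= t <= 1 -> cmod (w - CofR t) < 13 * r ->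
    m <= Re (cexp (w * x)) /\ cmod (cexp (w * x)) <= L.
  move=> hx xN /andP[t0 t1] hw; have x0 := cmod_ge0 x; have w0 := cmod_ge0 (w - CofR t).
  have e : w * x = CofR t * x + (w - CofR t) * x by ring.
  have dx : cmod ((w - CofR t) * x) <= th.
    by rewrite cmodM -rN; apply: ler_pM => //; exact: ltW.
  have hI : `|Im (w * x)| <= pi / 2 - th.
    rewrite e ImD; apply: le_trans (ler_normD _ _) _.
    have h1 := le_trans (Im_le_cmod _) dx.
    have h2 : `|Im (CofR t * x)| <= `|Im x|.
      rewrite ImM Re_CofR Im_CofR mul0r addr0 normrM (ger0_norm t0).
      by have := ler_wpM2r (normr_ge0 (Im x)) t1; rewrite mul1r.
    by move: h1 h2 hx; lra.
  have hc : cmod (w * x) <= 2 * N.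
    rewrite e; apply: le_trans (cmodD _ _) _.
    have h2 : cmod (CofR t * x) <= N.
      by rewrite cmodM cmod_CofR (ger0_norm t0); have := ler_wpM2r x0 t1; rewrite mul1r; lra.
    by move: h2 dx; lra.
  have := le_trans (Re_le_cmod _) hc; rewrite ler_norml => /andP[q1 q2].
  rewrite cmod_cexp /L ler_expR Re_cexp; split=> //.
  apply: ler_pM; rewrite ?expR_ge0 ?ler_expR //.
    by apply/ltW; rewrite cos_gt0_pihalf //; have := pi_ge2 R; lra.
  by apply: cos_lb => //; have := pi_gt0 R; lra.
have [M [iM hM]] := Phi_line_le al01 L0 m0.
pose EA w := cexp (w * la); pose EB w := cexp (w * lb).
pose EA1 w := cexp (w * la) * la; pose EB1 w := cexp (w * lb) * lb.
have hlin (c w : C) : holo_at (fun w => w * c) (fun=> c) w.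
  by apply: holo_eq (holo_mul (holo_id w) (holo_cst c w)) _ => v; rewrite mul1r mulr0 addr0.
have hA w : holo_at EA EA1 w := holo_cexp (hlin la w).
have hB w : holo_at EB EB1 w := holo_cexp (hlin lb w).
have hlc (c d w : C) : holo_at (fun w => (c * EA w + d * EB w) / 2) (fun w => (c * EA1 w + d * EB1 w) / 2) w.
  have h := holo_scale (2^-1) (holo_add (holo_scale c (hA w)) (holo_scale d (hB w))).
  by apply: (holo_eq (holo_ext _ h)) => v; rewrite mulrC.
pose P w := arg1 (EA w) (EB w); pose P1 w := arg1 (EA1 w) (EB1 w).
pose Q w := arg2 (EA w) (EB w); pose Q1 w := arg2 (EA1 w) (EB1 w).
have hP w : holo_at P P1 w := hlc _ _ w.
have hQ w : holo_at Q Q1 w := hlc _ _ w.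
pose a y : C := al + iC * CofR (-1 * y); pose a' y : C := 1 / 2 - al + iC * CofR (1 * y).
have Ra y : 0 < Re (a y).
  have -> : Re (a y) = Re al by rewrite /a ReD !ReImE; ring.
  by case/andP: al01.
have al01' : 0 < Re (1 / 2 - al) < 1 / 2 by rewrite ReD ReN CofR_half Re_CofR; lra.
have Ra' y : 0 < Re (a' y).
  have -> : Re (a' y) = Re (1 / 2 - al) by rewrite /a' [LHS]ReD !ReImE; ring.
  by case/andP: al01'.
pose dPhi b p : C := Gam b / Gam (2 * b) * - pint (2 * b + 1) p.
pose F1 w y := dPhi (a y) (P w) * P1 w * Phi (a' y) (Q w) + Phi (a y) (P w) * (dPhi (a' y) (Q w) * Q1 w).
have hF y w : holo_at (fun w => Phi_line al (EA w) (EB w) y) (fun w => F1 w y) w.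
  exact: holo_mul (@holo_comp R P P1 (Phi (a y)) (dPhi (a y)) w (holo_Phi (P w) (Ra y)) (hP w))
    (@holo_comp R Q Q1 (Phi (a' y)) (dPhi (a' y)) w (holo_Phi (Q w) (Ra' y)) (hQ w)).
have mdPhi (b p : C) (s : R) : 0 < Re b < 1 / 2 -> cmeas (setT : set mR) (fun y => dPhi (b + iC * CofR (s * y)) p).
  move=> b01; apply: cmeas_mul; first exact: cmeas_prefactor.
  by apply: cmeas_opp; apply: (cmeas_pint_dbl p s 1); case/andP: b01.
have mF1 w : cmeas (setT : set mR) (F1 w).
  apply: cmeas_add; apply: cmeas_mul.
  - by apply: cmeas_mul; [exact: mdPhi|exact: cmeas_cst].
  - exact: cmeas_Phi.
  - exact: cmeas_Phi.
  - by apply: cmeas_mul; [exact: mdPhi|exact: cmeas_cst].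
have [W1 hW] := @bessel_entire_holo R.
pose f w := CofR (Num.sqrt 2) * cintegral setT (Phi_line al (EA w) (EB w)) - 2 * CofR pi * bessel_entire (w * (la + lb)).
pose f1 w := CofR (Num.sqrt 2) * cintegral setT (F1 w) - 2 * CofR pi * (W1 (w * (la + lb)) * (la + lb)).
have hf t : 0 <= t <= 1 -> forall z, cmod (z - (0 + CofR t * 1)) < 6 * r -> holo_at f f1 z.
  move=> t01 z; rewrite add0r mulr1 => hz; apply: holo_sub.
    apply: holo_scale; apply: (@param_holo R setT (fun w => Phi_line al (EA w) (EB w)) F1 M z r) => //.
    - by move=> w _; exact: cmeas_Phi_line.
    - move=> y _ w hw; have hwt : cmod (w - CofR t) < 13 * r.
        by have := cmodBD z w (CofR t); move: hz hw; lra.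
      have [A1 A2] := reg la w t tha Na t01 hwt; have [B1 B2] := reg lb w t thb Nb t01 hwt.
      exact: hM.
  apply: holo_scale.
  exact: (@holo_comp R (fun w => w * (la + lb)) _ bessel_entire W1 z (hW _) (hlin _ z)).
have P0 : P 0 = 1 /\ Q 0 = 1.
  have two0 : (2 : C) != 0 by rewrite -CofR_nat CofR_eq0 pnatr_eq0.
  by rewrite /P /Q /EA /EB !mul0r cexp0 /arg1 /arg2; split; field.
have [P01 Q01] := P0; have e3 : 0 < 1 / 3 :> R by lra.
have [r2 r20 h2] := holo_rcont (hP 0) e3; have [r3 r30 h3] := holo_rcont (hQ 0) e3.
pose h := Num.min r2 (Num.min r3 (1 / 2)).
have h0 : 0 < h by rewrite !lt_min r20 r30; lra.
have wedge (p : C) : cmod (p - 1) <= 1 / 3 -> `|Im p| < Re p.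
  move=> hp; have q1 := le_trans (Re_le_cmod _) hp; have q2 := le_trans (Im_le_cmod _) hp.
  rewrite ReD ReN Re1 in q1; rewrite ImD ImN Im1 subr0 in q2.
  by move: q1; rewrite ler_norml => /andP[q3 q4]; lra.
have fh t : 0 < t < h -> f (0 + CofR t * 1) = 0.
  rewrite add0r mulr1 => /andP[t0]; rewrite !lt_min => /and3P[t2 t3 t4].
  have ct : cmod (CofR t - 0) = t by rewrite subr0 cmod_CofR gtr0_norm.
  have p1 : cmod (P (CofR t) - 1) <= 1 / 3 by rewrite -P01; apply: h2; rewrite ct.
  have q1 : cmod (Q (CofR t) - 1) <= 1 / 3 by rewrite -Q01; apply: h3; rewrite ct.
  have t01 : 0 <= t <= 1 by lra.
  have tt : cmod (CofR t - CofR t) < 13 * r by rewrite subrr cmod0 mulr_gt0.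
  have [A1 _] := reg la (CofR t) t tha Na t01 tt; have [B1 _] := reg lb (CofR t) t thb Nb t01 tt.
  have ar : `|Im (CofR t * (la + lb))| < pi / 2.
    rewrite ImM Re_CofR Im_CofR mul0r addr0 normrM (gtr0_norm t0) ImD.
    have := ler_normD (Im la) (Im lb); have := normr_ge0 (Im la + Im lb).
    by move: (`|Im la + Im lb|) ia ib => X; nra.
  apply/eqP; rewrite subr_eq0; apply/eqP.
  apply: product_formula_near1 => //; rewrite ?(lt_le_trans m0) //.
  - exact: wedge p1.
  - exact: wedge q1.
  - by rewrite /EA /EB -cexpD mulrDr.
have := @identity_segment R f f1 0 1 r h r0 h0 hf fh 1.
rewrite ltr01 lexx CofR1 mul1r add0r => /(_ isT) /eqP.
rewrite /f /EA /EB !mul1r !cexp_clog ?nz // subr_eq0 => /eqP.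
exact.
Qed.

End Continuation.

Theorem corollary3 (R : realType) (xi eta sigma : Cplx R)
  (h1 : 0 < Re (eta + iC * xi)) (h2 : 0 < Re (xi + iC * eta))
  (hsigma : `|Re sigma| < 1 / 4) :
  let integrand (s : Cplx R) : Cplx R :=
    cGamma (1 / 4 - s) * cGamma (1 / 4 + s)
    * parcyl (2 * s - 1 / 2) ((1 + iC) * xi)
    * parcyl (- (2 * s) - 1 / 2) ((1 + iC) * eta) in
  [/\ ~ (exists2 x : R, x <= 0 & iC * (xi ^+ 2 + eta ^+ 2) = CofR x),
      vintegrable sigma integrand
    & forall zeta : Cplx R,
        cexp zeta = 1 / 2 * (xi ^+ 2 + eta ^+ 2) ->
        - (3 / 2 * pi) < Im zeta < 1 / 2 * pi ->
        hankel2 0 zeta =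
          CofR (Num.sqrt 2) / CofR pi ^+ 2 * vintegral sigma integrand].
Proof.
move=> integrand.
have nz (n : nat) : (n.+1%:R : Cplx R) != 0 by rewrite -CofR_nat CofR_eq0 pnatr_eq0.
have two0 := nz 1; have four0 := nz 3.
pose A : Cplx R := eta + iC * xi; pose B : Cplx R := xi + iC * eta.
have A0 : 0 < Re A := h1; have B0 : 0 < Re B := h2.
have nzRe (x : Cplx R) : 0 < Re x -> x != 0 by apply: contraTneq => ->; rewrite Re0 ltxx.
have i2 := @iC2 R.
have AB : A * B = iC * (xi ^+ 2 + eta ^+ 2).
  have -> : A * B = iC * (xi ^+ 2 + eta ^+ 2) + (1 + iC * iC) * (xi * eta) by rewrite /A /B; ring.
  by rewrite i2 subrr mul0r addr0.
have pE : (1 + iC) * xi = arg1 A B.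
  have -> : arg1 A B = ((1 - iC * iC + 2 * iC) * xi + (1 + iC * iC) * eta) / 2 by rewrite /arg1 /A /B; ring.
  by rewrite i2; field.
have qE : (1 + iC) * eta = arg2 A B.
  have -> : arg2 A B = ((1 - iC * iC + 2 * iC) * eta + (1 + iC * iC) * xi) / 2 by rewrite /arg2 /A /B; ring.
  by rewrite i2; field.
pose al : Cplx R := 1 / 4 - sigma.
have quarter : (1 / 4 : Cplx R) = CofR (1 / 4) by rewrite CofRM CofRV CofR_nat CofR1.
have al01 : 0 < Re al < 1 / 2.
  by move: hsigma; rewrite /al ReD ReN quarter Re_CofR ltr_norml; lra.
have al01' : 0 < Re (1 / 2 - al) < 1 / 2 by rewrite ReD ReN CofR_half Re_CofR; lra.
(* The exponent that the two parabolic cylinder functions together and the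
   Hankel function have in common. *)
pose E : Cplx R := - (A * B / 2).
pose F := Phi_line al A B.
have intE y : integrand (sigma + iC * CofR y) = cexp E * F y.
  rewrite /integrand pE qE.
  pose a : Cplx R := al + iC * CofR (-1 * y); pose a' : Cplx R := 1 / 2 - al + iC * CofR (1 * y).
  have aE : 1 / 4 - (sigma + iC * CofR y) = a by rewrite /a /al mulN1r CofRN; ring.
  have a'E : 1 / 4 + (sigma + iC * CofR y) = a' by rewrite /a' /al mul1r; field.
  have ra : 0 < Re a < 1 / 2.
    by have -> : Re a = Re al by rewrite /a ReD !ReImE; ring.
  have ra' : 0 < Re a' < 1 / 2.
    by have -> : Re a' = Re (1 / 2 - al) by rewrite /a' [LHS]ReD !ReImE; ring.
  have n1 : - ((2 * (sigma + iC * CofR y) - 1 / 2) / 2) = a by rewrite -aE; field.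
  have n2 : - ((- (2 * (sigma + iC * CofR y)) - 1 / 2) / 2) = a' by rewrite -a'E; field.
  rewrite (parcylE ra _ n1) (parcylE ra' _ n2) aE a'E.
  rewrite !cGammaE; [|by case/andP: ra'|by case/andP: ra].
  have -> : cexp E = cexp (- (arg1 A B ^+ 2 / 4)) * cexp (- (arg2 A B ^+ 2 / 4)).
    by rewrite -cexpD; congr cexp; rewrite /E -(arg_prod A B); field.
  by rewrite /F /Phi_line -/a -/a' /Phi; ring.
have iF : cintegrable setT F.
  have N0 : 0 <= cmod A + cmod B by rewrite addr_ge0 ?cmod_ge0.
  have m0 : 0 < Num.min (Re A) (Re B) by rewrite lt_min A0 B0.
  have [M [iM hM]] := Phi_line_le al01 N0 m0.
  apply: (cint_dom measurableT (cmeas_Phi_line A B al01) iM) => y _; apply: hM.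
  - by rewrite lerDl cmod_ge0.
  - by rewrite lerDr cmod_ge0.
  - by rewrite ge_min lexx.
  - by rewrite ge_min lexx orbT.
have ABc : A * B = cexp (clog A + clog B) by rewrite cexpD !cexp_clog ?nzRe.
have hIm : `|Im (clog A + clog B)| < pi.
  have := Im_clog_lt A0; have := Im_clog_lt B0; rewrite ImD.
  by have := ler_normD (Im (clog A)) (Im (clog B)); lra.
split.
- case=> x x0; rewrite -AB ABc => e.
  have := congr1 (@complex.Im R) e; rewrite Im_CofR Im_cexp => /eqP.
  rewrite mulf_eq0 gt_eqF ?expR_gt0 //= => /eqP /(sin_eq0_small hIm) t0.
  have ex : Re (cexp (clog A + clog B)) = x by rewrite e Re_CofR.
  rewrite Re_cexp t0 cos0 mulr1 in ex.
  by move: x0; rewrite -ex leNgt expR_gt0.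
- refine (@eq_cintegrable R setT (fun y => cexp E * F y) _ measurableT _ _); last exact: cintegrable_scale.
  by move=> y _; rewrite intE.
- move=> zeta ze hz.
  rewrite /vintegral (eq_cintegral (fun y _ => intE y)) (cintegral_scale _ measurableT iF).
  pose zeta' : Cplx R := CofR (ln 2) + zeta + iC * CofR (pi / 2).
  have zE : zeta' = clog A + clog B.
    (* Both are logarithms of A B with imaginary part in ]- pi, pi[. *)
    apply/eqP; rewrite -subr_eq0; apply/eqP; apply: cexp_eq1_small.
      rewrite cexpB -ABc AB /zeta' !cexpD ze cexp_CofR lnK ?posrE // CofR_nat -/(cis _) cis_pihalf.
      have -> : 2 * (1 / 2 * (xi ^+ 2 + eta ^+ 2)) * iC = iC * (xi ^+ 2 + eta ^+ 2) by field.
      by rewrite divff // -AB ABc cexp_neq0.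
    have i1 : Im zeta' = Im zeta + pi / 2 by rewrite /zeta' !ImD !ReImE; ring.
    move: hIm; rewrite [Im (zeta' - _)]ImD ImN i1 !ltr_norml; have := pi_gt0 R; lra.
  have b1 : 1 <= 1 :> R by [].
  have U := tricomiU_eq b1 (@tricomi_half R).
  rewrite /hankel2 -/zeta' mulr0 !addr0 !mul0r subr0 cexp0 mulr1 U zE ze.
  have eE : cexp (- iC * (1 / 2 * (xi ^+ 2 + eta ^+ 2))) = cexp E by rewrite /E AB; congr cexp; field.
  have main := product_formula al01 A0 B0.
  have p0 : 0 < pi :> R := pi_gt0 R.
  have s0 : CofR (Num.sqrt pi) != 0 :> Cplx R by rewrite CofR_eq0 gt_eqF // sqrtr_gt0.
  have sp : CofR (Num.sqrt pi) * CofR (Num.sqrt pi) = CofR pi :> Cplx R.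
    by rewrite -CofRM -expr2 sqr_sqrtr // ltW.
  have pi0 : CofR pi != 0 :> Cplx R by rewrite CofR_eq0 gt_eqF.
  rewrite eE; set W := bessel_entire _ in main *.
  have -> : CofR (Num.sqrt 2) / CofR pi ^+ 2 * (iC * (cexp E * cintegral setT F)) =
    iC * cexp E / CofR pi ^+ 2 * (CofR (Num.sqrt 2) * cintegral setT F) by ring.
  rewrite main; clear main; move: s0 pi0; rewrite -sp; move: (CofR (Num.sqrt pi)) (cexp E) W => x y W' x0 _.
  by field.
Qed.
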